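(* For any character $\lambda$ of $T^\tau$ (with the added center acting by scalar multiplication) one can define an $LT^\tau$-equivariant line bundle $\mathcal L_\lambda$ on the flag manifold $\Omega T=LT^\tau/T^\tau$ by $$\mathcal L_\lambda:=LT^\tau\times_{T^\tau}\mathbb C_\lambda,$$ and a Dirac operator $\mathcal D_\lambda$ acting on $L^2(\Omega T,\mathcal L_\lambda\otimes\mathcal S)$. Moreover, the index of $\mathcal D_\lambda$ in $R^\tau(LT)$ is the irreducible positive energy representation of $LT$ at level $\tau$ corresponding to $[\lambda]\in\Lambda_T/\kappa^\tau(\Pi_T)$.
   Context: $T$ is a circle group, $\mathfrak t\cong\mathbb R$, $\Pi_T=\ker(\exp:\mathfrak t\to T)$, $\Lambda_T=\mathrm{Hom}(\Pi_T,\mathbb Z)$, identified with the character group of $T$. $LT=C^\infty(S^1,T)=T\times\Pi_T\times\Omega T_0$, where $\Omega T_0$, the identity component of the based loop group $\Omega T=\Pi_T\times\Omega T_0$, is identified with $U=\{f\in C^\infty(S^1,\mathfrak t):\int f\,d\theta=0\}$. Fix a homomorphism $\kappa^\tau:\Pi_T\to\Lambda_T$ with $\langle v,w\rangle_\tau=\kappa^\tau(v)(w)$ positive definite on $\mathfrak t$; $\omega(f,g)=\int_{S^1}\langle f,dg/d\theta\rangle_\tau\,d\theta$; $\tau\bigl((t_1,n_1,l_1),(t_2,n_2,l_2)\bigr)=\kappa^\tau(n_1)(t_2)\,e^{i\omega(l_1,l_2)}$. $LT^\tau=LT\times U(1)$ with $(a,z)(b,w)=(ab,zw\tau(a,b))$;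 $T^\tau=T\times U(1)$ and $(T\times\Pi_T)^\tau$ are the preimages of $T$ and $T\times\Pi_T$. $\tau$-twisted means $\rho(a)\rho(b)=\tau(a,b)\rho(ab)$. $LT$ acts on $\Omega T=LT/T$ by left translation, and $\Omega T=\widetilde M\times\Omega T_0$ with $\widetilde M=\Pi_T$ (0-dimensional). Fock space: identify $\mathfrak t=\mathbb R$ by a unit vector for $\langle,\rangle_\tau$; $z_k=\frac1{\sqrt2}\bigl(\frac{\cos k\theta}{\sqrt{k\pi}}+i\frac{\sin k\theta}{\sqrt{k\pi}}\bigr)$, $\overline{z_k}$ its conjugate. $L^2(\mathbb R^\infty)$ is the completion of $\mathbb C[z_1,z_2,\dots]$ with orthogonal monomials of squared norm $n_1!n_2!\cdots$; $d\rho(z_k)=-\sqrt2M_{z_k}$, $d\rho(\overline{z_k})=\sqrt2\,\partial/\partial z_k$, $\rho=\exp d\rho$ is a $\tau$-twisted representation of $\Omega T_0$; $\rho^*$ is the dual representation, $\langle\rho^*_g\phi,\psi\rangle=\langle\phi,\rho_{-g}\psi\rangle$. $\mathcal H_{WZW}=L^2(\mathbb R^\infty)^*\otimes L^2(\mathbb R^\infty)$. $S=S^0\oplus S^1$ is the completion of $\bigwedge^*_{alg}\bigoplus_{k>0}\mathbb C\overline{z_k}$, $\gamma(\overline{z_k})=\sqrt2\,\overline{z_k}\wedge$, $\gamma(z_k)=\sqrt2\,\overline{z_k}\rfloor$ (adjoint contraction). By definition $L^2(\Omega T,\mathcal L_\lambda\otimes\mathcal S)=L^2(\Pi_T,\mathcal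 L_\lambda|_{\Pi_T})\otimes\mathcal H_{WZW}\otimes S$ and $\mathcal D_\lambda=D_{\widetilde M}\otimes\mathrm{id}+\mathrm{id}\otimes\partial$ with $D_{\widetilde M}=0$ and $\partial=i\sum_k\sqrt k\,d\rho^*(z_k)\otimes\mathrm{id}\otimes\gamma(\overline{z_k})+i\sum_k\sqrt k\,d\rho^*(\overline{z_k})\otimes\mathrm{id}\otimes\gamma(z_k)$. Index: a positive energy representation (P.E.R.) of $LT$ at level $\tau$ is a strongly continuous $\tau$-twisted unitary representation extending to the semidirect product with the rotation circle, with finite dimensional rotation weight spaces vanishing for sufficiently small weights; $R^\tau(LT)$ is the free abelian group on the irreducible ones. The irreducible P.E.R. corresponding to $[\lambda]$ is $\bigoplus_{n\in\Pi_T}\mathbb C_{\lambda+\kappa^\tau(n)}\otimes L^2(\mathbb R^\infty)$, with $T$ acting by the indicated weights, $\Pi_T$ permuting the summands and $\Omega T_0$ acting by $\rho$. The index is $\mathrm{ind}(\mathcal D_\lambda)=\mathrm{ind}(D_{\widetilde M})\otimes\mathrm{ind}(\partial)$, where $\mathrm{ind}(D_{\widetilde M})$ is the Kasparov $(T\times\Pi_T)^\tau$-equivariant index, viewed as a formal difference of $\tau$-twisted representations of $T\times\Pi_T$ (via $K_0(C^*(T\times\Pi_T,\tau))\cong R^\tau(T\times\Pi_T)$, where $C^*(T\times\Pi_T,\tau)$ is the twisted group $C^*$-algebra and $R^\tau(T\times\Pi_T)$ is the free abelian group on the irreducible $\tau$-twisted unitary representations), and $\mathrm{ind}(\partial)=[\ker\partial|_{\mathcal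 H_{WZW}\otimes S^0}]-[\ker\partial|_{\mathcal H_{WZW}\otimes S^1}]$ as representations of $\Omega T_0$. *)

(* Defs.v *)
From HB Require Import structures.
From mathcomp Require Import all_boot all_order all_algebra finmap.
From mathcomp Require Import generic_quotient complex.
From mathcomp Require Import all_classical all_reals all_analysis.
From mathcomp Require Import ring lra.

(* MathComp-Analysis, over an arbitrary [R : realType]; complex numbers are [R[i]]. *)

Set Implicit Arguments.
Unset Strict Implicit.
Unset Printing Implicit Defensive.
Import Order.TTheory GRing.Theory Num.Theory numFieldNormedType.Exports.
Local Open Scope classical_set_scope.
Local Open Scope ring_scope.
Local Open Scope complex_scope.

Section hilbert.
Variable R : realType.
Local Notation C := R[i].
Local Notation "z ^*" := (conjc z).

Section dotnorm.
Variables (V : Type) (dot : V -> V -> C).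
Definition dnorm (v : V) : R := Num.sqrt (complex.Re (dot v v)).
End dotnorm.

(* [hdot] is antilinear in its first argument. *)
Record hilbert := Hilbert {
  hsort :> lmodType C;
  hdot : hsort -> hsort -> C;
  hdotDr : forall u v w, hdot u (v + w) = hdot u v + hdot u w;
  hdotZr : forall a u v, hdot u (a *: v) = a * hdot u v;
  hdotC : forall u v, hdot v u = (hdot u v)^*;
  hdot_ge0 : forall u, 0 <= hdot u u;
  hdot_eq0 : forall u, hdot u u = 0 -> u = 0;
  hcomplete : forall x : nat -> hsort,
    (forall e : R, 0 < e -> exists N, forall m n, (N <= m)%N -> (N <= n)%N ->
       dnorm hdot (x m - x n) < e) ->
    exists l, forall e : R, 0 < e -> exists N, forall n, (N <= n)%N ->
       dnorm hdot (x n - l) < e }.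

Definition hnorm (H : hilbert) (v : H) : R := dnorm (@hdot H) v.


Definition cabs (z : C) : R := complex.Re `|z|.
Definition sqc (z : C) : R := complex.Re z ^+ 2 + complex.Im z ^+ 2.

Lemma cabsE z : `|z| = (cabs z)%:C.
Proof. by rewrite /cabs normc_def. Qed.

Lemma cabs_ge0 z : 0 <= cabs z.
Proof. by rewrite -ler0c -cabsE normr_ge0. Qed.

Lemma cabsD z t : cabs (z + t) <= cabs z + cabs t.
Proof. by rewrite -lecR rmorphD /= -!cabsE ler_normD. Qed.

Lemma cabsM z t : cabs (z * t) = cabs z * cabs t.
Proof.
by apply: (@complexI R); rewrite rmorphM /= -!cabsE normrM.
Qed.

Lemma cabsJ z : cabs (z^*) = cabs z.
Proof. by rewrite /cabs normcJ. Qed.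

Lemma cabs_sqc z : cabs z ^+ 2 = sqc z.
Proof. by apply: (@complexI R); rewrite rmorphXn /= -cabsE -add_Re2_Im2. Qed.

Lemma cabs_eq0 z : cabs z = 0 -> z = 0.
Proof. by move=> h; apply/eqP; rewrite -normr_eq0 cabsE h. Qed.

Lemma cabs_ReIm z : `|complex.Re z| <= cabs z /\ `|complex.Im z| <= cabs z.
Proof.
split; rewrite -(@ler_pXn2r _ 2%N) ?nnegrE ?cabs_ge0 // cabs_sqc real_normK ?num_real //.
  by rewrite lerDl sqr_ge0.
by rewrite lerDr sqr_ge0.
Qed.

Section usum.
Variable I : choiceType.
Implicit Types (F G : I -> C) (u : I -> R) (A B : {fset I}).

Definition is_usum F (s : C) := forall e : R, 0 < e ->
  exists A, forall B, (A `<=` B)%fset -> `| \sum_(i <- B) F i - s | < e%:C.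

Definition usum F : C := xget 0 [set s | is_usum F s].

Lemma is_usum_uniq F s t : is_usum F s -> is_usum F t -> s = t.
Proof.
move=> hs ht; apply/eqP; rewrite -subr_eq0; apply/eqP; apply: cabs_eq0.
apply/eqP; rewrite eq_le cabs_ge0 andbT; apply/ler_addgt0Pr => e e0; rewrite add0r.
have e2 : 0 < e / 2 by rewrite divr_gt0.
have [A hA] := hs _ e2; have [B hB] := ht _ e2.
have := hA (A `|` B)%fset (fsubsetUl _ _); have := hB (A `|` B)%fset (fsubsetUr _ _).
rewrite !cabsE !ltcR; set S := \sum_(i <- _) _ => h1 h2.
have -> : s - t = (S - t) + - (S - s) by ring.
apply: (le_trans (cabsD _ _)); rewrite (splitr e) lerD //; apply/ltW => //.
by rewrite /cabs normrN.
Qed.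

Lemma usumE F s : is_usum F s -> usum F = s.
Proof.
by move=> h; apply: (is_usum_uniq _ h); rewrite /usum; case: xgetP => [x -> //|/(_ s)].
Qed.

Lemma is_usumD F G s t :
  is_usum F s -> is_usum G t -> is_usum (fun i => F i + G i) (s + t).
Proof.
move=> hs ht e e0; have e2 : 0 < e / 2 by rewrite divr_gt0.
have [A hA] := hs _ e2; have [B hB] := ht _ e2.
exists (A `|` B)%fset => D hD; rewrite big_split /= opprD addrACA.
apply: (le_lt_trans (ler_normD _ _)); rewrite (splitr e) rmorphD /=.
by rewrite ltrD // ?hA ?hB // (fsubset_trans _ hD) // ?fsubsetUl ?fsubsetUr.
Qed.

Lemma is_usumZ a F s : is_usum F s -> is_usum (fun i => a * F i) (a * s).
Proof.
move=> hs e e0; have d0 : 0 < e / (cabs a + 1).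
  by rewrite divr_gt0 // ltr_wpDl ?cabs_ge0.
have [A hA] := hs _ d0; exists A => B /hA.
rewrite -mulr_sumr -mulrBr !cabsE !ltcR cabsM ltr_pdivlMr ?ltr_wpDl ?cabs_ge0 // => h.
apply: le_lt_trans h; rewrite mulrC ler_wpM2l ?cabs_ge0 // lerDl //.
Qed.

Lemma is_usumJ F s : is_usum F s -> is_usum (fun i => (F i)^*) (s^*).
Proof.
move=> hs e e0; have [A hA] := hs _ e0; exists A => B /hA.
by rewrite -rmorph_sum -rmorphB /= normcJ.
Qed.

Lemma fsum_le (u : I -> R) A B : (forall i, 0 <= u i) -> (A `<=` B)%fset ->
  \sum_(i <- A) u i <= \sum_(i <- B) u i.
Proof.
move=> u0 AB; rewrite (big_fsetID _ (mem A) B) /=.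
have -> : [fset x in B | x \in A]%fset = A.
  apply/fsetP => x; rewrite !inE /= andbC; case: (boolP (x \in A)) => //= xA.
  by rewrite (fsubsetP AB).
by rewrite lerDl sumr_ge0.
Qed.

Lemma usum_ex_ge0 u M : (forall i, 0 <= u i) -> (forall A, \sum_(i <- A) u i <= M) ->
  exists s : R, [/\ is_usum (fun i => (u i)%:C) s%:C, 0 <= s, s <= M &
                 forall A, \sum_(i <- A) u i <= s].
Proof.
move=> u0 uM; pose E := [set x | exists A, x = \sum_(i <- A) u i].
have E0 : E 0 by exists fset0; rewrite big_seq_fset0.
have hE : has_sup E by split; [exists 0 | exists M => x [A ->]].
have ub A : \sum_(i <- A) u i <= sup E.
  by apply: sup_upper_bound => //; exists A.
exists (sup E); split => //.
- move=> e e0; have [x [A ->] hA] := sup_adherent e0 hE; exists A => B AB.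
  rewrite -rmorph_sum -rmorphB /= cabsE ltcR /cabs normc_def /= expr0n addr0 sqrtr_sqr.
  rewrite distrC ger0_norm ?subr_ge0 //.
  by have := fsum_le u0 AB; lra.
- exact: (sup_upper_bound hE).
- by apply: ge_sup; [exists 0 | move=> x [A ->]].
Qed.

Definition asummable F := exists M : R, forall A, \sum_(i <- A) cabs (F i) <= M.

Lemma usum_ex F : asummable F -> is_usum F (usum F).
Proof.
move=> [M hM].
suff [s hs] : exists s, is_usum F s by rewrite (usumE hs).
pose a i := cabs (F i).
have a0 i : 0 <= a i by exact: cabs_ge0.
have key (v : I -> R) : (forall i, `|v i| <= a i) -> exists s, is_usum (fun i => (v i)%:C) s.
  move=> va; have [s [hs _ _ _]] := usum_ex_ge0 a0 hM.
  have [t [ht _ _ _]] : exists t : R, [/\ is_usum (fun i => (a i + v i)%:C) t%:C, 0 <= t,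
      t <= M + M & forall A, \sum_(i <- A) (a i + v i) <= t].
    apply: usum_ex_ge0 => [i|A].
      by have := va i; rewrite ler_norml; lra.
    rewrite big_split /= lerD // (le_trans _ (hM A)) //.
    by apply: ler_sum => i _; apply: le_trans (va i); exact: ler_norm.
  exists (t%:C + -1 * s%:C).
  have := is_usumD ht (is_usumZ (-1) hs).
  by congr is_usum; apply/funext => i; rewrite rmorphD /=; ring.
have [s hs] := key (fun i => complex.Re (F i)) (fun i => (cabs_ReIm (F i)).1).
have [t ht] := key (fun i => complex.Im (F i)) (fun i => (cabs_ReIm (F i)).2).
exists (s + 'i * t).
have := is_usumD hs (is_usumZ 'i ht).
by congr is_usum; apply/funext => i; rewrite [RHS]complexE.
Qed.

End usum.
End hilbert.

Section l2.
Variables (R : realType) (I : choiceType) (w : I -> R).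
Hypothesis w0 : forall i, 0 < w i.
Local Notation C := R[i].
Local Notation "z ^*" := (conjc z).
Implicit Types (A B : {fset I}).

(* l2 w: the completion of the finitely supported functions on I, for the inner
   product in which the delta functions are orthogonal with squared norms w i. *)
Definition l2pred : {pred I -> C} :=
  fun f => `[< exists M : R, forall A, \sum_(i <- A) w i * sqc (f i) <= M >].

Lemma sqc_ge0 (z : C) : 0 <= sqc z.
Proof. by rewrite addr_ge0 ?sqr_ge0. Qed.

Lemma wsqc_ge0 (f : I -> C) i : 0 <= w i * sqc (f i).
Proof. by rewrite mulr_ge0 ?sqc_ge0 ?ltW. Qed.

Lemma sqcM (a z : C) : sqc (a * z) = sqc a * sqc z.
Proof. by rewrite -!cabs_sqc cabsM exprMn. Qed.

Lemma sqcD (y z : C) : sqc (y + z) <= 2 * sqc y + 2 * sqc z.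
Proof.
case: y z => [a b] [c d]; rewrite /sqc /=.
by have := sqr_ge0 (a - c); have := sqr_ge0 (b - d); nra.
Qed.

Lemma l2pred_submod : submod_closed l2pred.
Proof.
split.
  apply/asboolP; exists 0 => A; rewrite big1 // => i _.
  by rewrite /sqc /= expr0n addr0 mulr0.
move=> a f g /asboolP[M hM] /asboolP[N hN]; apply/asboolP.
exists (2 * sqc a * M + 2 * N) => A.
apply: (@le_trans _ _ (\sum_(i <- A) (2 * sqc a * (w i * sqc (f i)) + 2 * (w i * sqc (g i))))).
  apply: ler_sum => i _; have := sqcD (a * f i) (g i); rewrite sqcM => h.
  have := ler_wpM2l (ltW (w0 i)) h; move=> h'.
  apply: (le_trans h'); rewrite le_eqVlt; apply/orP; left; apply/eqP; rewrite /=; ring.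
rewrite big_split /= -!mulr_sumr lerD // ler_wpM2l //.
by rewrite mulr_ge0 ?sqc_ge0.
Qed.


HB.instance Definition _ := GRing.isSubmodClosed.Build C (I -> C) l2pred l2pred_submod.

Record l2 := L2 { l2fun :> I -> C; l2P : l2fun \in l2pred }.

HB.instance Definition _ := [isSub for l2fun].
HB.instance Definition _ := [Choice of l2 by <:].
HB.instance Definition _ := [SubChoice_isSubLmodule of l2 by <:].

Definition l2dot (f g : I -> C) : C := usum (fun i => (w i)%:C * ((f i)^* * g i)).

Lemma l2dot_asummable (f g : l2) : asummable (fun i => (w i)%:C * ((f i)^* * g i)).
Proof.
have /asboolP[M hM] := l2P f; have /asboolP[N hN] := l2P g.
exists (M + N) => A; apply: (le_trans _ (lerD (hM A) (hN A))).
rewrite -big_split /=; apply: ler_sum => i _.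
rewrite !cabsM cabsJ -mulrDr; have -> : cabs (w i)%:C = w i.
  by apply: (@complexI R); rewrite -cabsE ger0_norm // ler0c ltW.
rewrite ler_wpM2l ?(ltW (w0 i)) // -!cabs_sqc.
have := cabs_ge0 (f i); have := cabs_ge0 (g i).
have := sqr_ge0 (cabs (f i) - cabs (g i)); nra.
Qed.

Lemma l2dotP (f g : l2) : is_usum (fun i => (w i)%:C * ((f i)^* * g i)) (l2dot f g).
Proof. exact/usum_ex/l2dot_asummable. Qed.

Lemma l2dotDr (f g h : l2) : l2dot f (g + h) = l2dot f g + l2dot f h.
Proof.
apply: usumE; have := is_usumD (l2dotP f g) (l2dotP f h).
by congr is_usum; apply/funext => i /=; rewrite !mulrDr.
Qed.

Lemma l2dotZr a (f g : l2) : l2dot f (a *: g) = a * l2dot f g.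
Proof.
apply: usumE; have := is_usumZ a (l2dotP f g).
congr is_usum; apply/funext => i.
rewrite (_ : (a *: g) i = a * g i) //.
by rewrite mulrCA; congr (_ * _); rewrite mulrCA.
Qed.

Lemma l2dotC (f g : l2) : l2dot g f = (l2dot f g)^*.
Proof.
apply: usumE; have := is_usumJ (l2dotP f g).
congr is_usum; apply/funext => i /=.
rewrite rmorphM /= rmorphM /= oppr0 conjcK. by congr (_ * _); rewrite mulrC.
Qed.

Lemma l2dot_self (f : l2) : exists s : R,
  [/\ l2dot f f = s%:C, 0 <= s, forall A, \sum_(i <- A) w i * sqc (f i) <= s &
   forall M, (forall A, \sum_(i <- A) w i * sqc (f i) <= M) -> s <= M].
Proof.
have /asboolP[M hM] := l2P f.
have [s [hs s0 sM hA]] := usum_ex_ge0 (wsqc_ge0 f) hM.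
exists s; split => //.
  apply: usumE; move: hs; congr is_usum; apply/funext => i.
  by rewrite rmorphM /= /sqc add_Re2_Im2 sqr_normc; congr (_ * _); rewrite mulrC.
move=> N hN; have [t [ht _ tN _]] := usum_ex_ge0 (wsqc_ge0 f) hN.
by have /complexI -> := is_usum_uniq hs ht.
Qed.

Lemma l2dot_ge0 (f : l2) : 0 <= l2dot f f.
Proof. by have [s [-> s0 _ _]] := l2dot_self f; rewrite ler0c. Qed.

Lemma l2_coord_le (f : l2) i : w i * sqc (f i) <= complex.Re (l2dot f f).
Proof.
have [s [-> _ h _]] := l2dot_self f.
by have := h [fset i]%fset; rewrite big_seq_fset1.
Qed.

Lemma l2dot_eq0 (f : l2) : l2dot f f = 0 -> f = 0.
Proof.
move=> h; apply/val_inj/funext => i /=.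
have := l2_coord_le f i; rewrite h /= pmulr_rle0 // => h2.
apply: cabs_eq0; apply/eqP; rewrite -sqrf_eq0 cabs_sqc eq_le h2 /=.
exact: sqc_ge0.
Qed.


Lemma real_cauchy (u : nat -> R) :
  (forall e : R, 0 < e -> exists N, forall m n, (N <= m)%N -> (N <= n)%N ->
     `|u m - u n| < e) -> exists l : R, u n @[n --> \oo] --> l.
Proof.
move=> h; suff : cvgn u by move=> /cvg_ex[l hl]; exists l.
apply/cauchy_cvgP/cauchy_ballP => e e0; have [N hN] := h _ e0.
pose S := [set y : R | exists2 n, (N <= n)%N & y = u n].
exists (S, S) => /=.
  by split; exists N => // n /= hn; exists n.
by move=> [_ _] /= [[m hm ->] [n hn ->]]; rewrite /ball /=; exact: hN.
Qed.

Lemma l2_diff_le (x y : l2) e : dnorm l2dot (x - y) < e ->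
  forall A, \sum_(i <- A) w i * sqc (x i - y i) <= e ^+ 2.
Proof.
move=> h A; have [s [hs s0 hA _]] := l2dot_self (x - y).
move: h; rewrite /dnorm hs /= => h; apply: (le_trans (hA A)).
rewrite -(sqr_sqrtr s0) ler_pXn2r ?nnegrE ?sqrtr_ge0 //; first exact: ltW.
by apply: le_trans (ltW h); exact: sqrtr_ge0.
Qed.

Lemma l2complete (x : nat -> l2) :
    (forall e : R, 0 < e -> exists N, forall m n, (N <= m)%N -> (N <= n)%N ->
       dnorm l2dot (x m - x n) < e) ->
    exists l : l2, forall e : R, 0 < e -> exists N, forall n, (N <= n)%N ->
       dnorm l2dot (x n - l) < e.
Proof.
move=> hx.
have hsq i (e : R) : 0 < e -> exists N, forall m n, (N <= m)%N -> (N <= n)%N ->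
    cabs (x m i - x n i) < e.
  move=> e0; have d0 : 0 < e / 2 * Num.sqrt (w i) by rewrite mulr_gt0 ?sqrtr_gt0 ?divr_gt0.
  have [N hN] := hx _ d0; exists N => m n hm hn.
  have := l2_diff_le (hN _ _ hm hn) [fset i]%fset; rewrite big_seq_fset1 -cabs_sqc.
  rewrite exprMn sqr_sqrtr ?(ltW (w0 i)) // mulrC ler_pM2r // => h.
  apply: (@le_lt_trans _ _ (e / 2)); last by rewrite gtr_pMr // invf_lt1 ?ltr1n.
  by rewrite -(@ler_pXn2r _ 2%N) ?nnegrE ?cabs_ge0 // ltW ?divr_gt0.
have hlim i : exists l : C, (complex.Re (x n i) @[n --> \oo] --> complex.Re l) /\
                            (complex.Im (x n i) @[n --> \oo] --> complex.Im l).
  have [a ha] : exists a : R, complex.Re (x n i) @[n --> \oo] --> a.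
    apply: real_cauchy => e /(hsq i)[N hN]; exists N => m n hm hn.
    by rewrite -raddfB; apply: le_lt_trans (hN _ _ hm hn); exact: (cabs_ReIm _).1.
  have [b hb] : exists b : R, complex.Im (x n i) @[n --> \oo] --> b.
    apply: real_cauchy => e /(hsq i)[N hN]; exists N => m n hm hn.
    by rewrite -raddfB; apply: le_lt_trans (hN _ _ hm hn); exact: (cabs_ReIm _).2.
  by exists (a +i* b).
pose F i := xget 0 [set l : C | (complex.Re (x n i) @[n --> \oo] --> complex.Re l) /\
                       (complex.Im (x n i) @[n --> \oo] --> complex.Im l)].
have hF i : (complex.Re (x n i) @[n --> \oo] --> complex.Re (F i)) /\
            (complex.Im (x n i) @[n --> \oo] --> complex.Im (F i)).
  by rewrite /F; case: xgetP => [y -> //|h]; have [l hl] := hlim i; have := h l.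
have hA (e : R) : 0 < e -> exists N, forall n, (N <= n)%N ->
    forall A, \sum_(i <- A) w i * sqc (x n i - F i) <= e ^+ 2.
  move=> e0; have [N hN] := hx _ e0; exists N => n hn A.
  have hc : (\sum_(i <- A) w i * sqc (x n i - x m i)) @[m --> \oo] -->
            \sum_(i <- A) w i * sqc (x n i - F i).
    apply: cvg_big => [|i _]; first exact: add_continuous.
    apply: cvgM; first exact: cvg_cst.
    have hr : complex.Re (x n i - x m i) @[m --> \oo] --> complex.Re (x n i - F i).
      rewrite raddfB; under eq_fun do rewrite raddfB.
      by apply: cvgB; [exact: cvg_cst | exact: (hF i).1].
    have hi : complex.Im (x n i - x m i) @[m --> \oo] --> complex.Im (x n i - F i).
      rewrite raddfB; under eq_fun do rewrite raddfB.
      by apply: cvgB; [exact: cvg_cst | exact: (hF i).2].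
    rewrite /sqc; under eq_fun do rewrite !expr2; rewrite !expr2.
    by apply: cvgD; exact: cvgM.
  rewrite -(cvg_lim _ hc) //; apply: limr_le.
    by apply/cvg_ex; eexists; exact: hc.
  near=> m; apply: l2_diff_le; apply: hN => //; near: m; exact: nbhs_infty_ge.
have FP : F \in l2pred.
  have [N hN] := hA 1 ltr01.
  have hd : (x N : I -> C) - F \in l2pred.
    by apply/asboolP; exists (1 ^+ 2) => A; exact: (hN N).
  have -> : F = (x N : I -> C) - ((x N : I -> C) - F) by rewrite subKr.
  by rewrite rpredB // l2P.
exists (L2 FP) => e e0.
have e2 : 0 < e / 2 by rewrite divr_gt0.
have [N hN] := hA _ e2; exists N => n hn.
have [s [hs s0 _ hle]] := l2dot_self (x n - L2 FP).
rewrite /dnorm hs /=; apply: (@le_lt_trans _ _ (e / 2)); last first.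
  by rewrite gtr_pMr // invf_lt1 ?ltr1n.
rewrite -(ger0_norm (ltW e2)) -sqrtr_sqr ler_wsqrtr //.
by apply: hle => A; exact: (hN n hn).
Unshelve. all: by end_near.
Qed.


Definition l2hilbert : hilbert R :=
  Hilbert l2dotDr l2dotZr l2dotC l2dot_ge0 l2dot_eq0 l2complete.

End l2.

HB.instance Definition _ := Topological.copy int (discrete_topology int).

Section circle.
Variable R : realType.
Local Notation C := R[i].
Local Notation "z ^*" := (conjc z).

(* The circle group T is U(1), with Lie algebra R and exp x = expi (2 * pi * x), so
   that ker exp = int.  [circ] also serves as the centre of the extensions. *)
Record circ := Circ { cval :> C; cvalP : `|cval| == 1 }.
HB.instance Definition _ := [isSub for cval].
HB.instance Definition _ := [Choice of circ by <:].
HB.instance Definition _ :=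
  Topological.copy circ (initial_topology (cval : circ -> C^o)).

Lemma circ_neq0 (t : circ) : (t : C) != 0.
Proof. by rewrite -normr_eq0 (eqP (cvalP t)) oner_neq0. Qed.

Fact cone_subproof : `|1 : C| == 1. Proof. by rewrite normr1. Qed.
Definition cone := Circ cone_subproof.

Fact cmul_subproof (s t : circ) : `|(s : C) * t| == 1.
Proof. by rewrite normrM (eqP (cvalP s)) (eqP (cvalP t)) mulr1. Qed.
Definition cmul s t := Circ (cmul_subproof s t).

Fact cinv_subproof (s : circ) : `|(s : C)^-1| == 1.
Proof. by rewrite normfV (eqP (cvalP s)) invr1. Qed.
Definition cinv s := Circ (cinv_subproof s).

Fact cpow_subproof (s : circ) (m : int) : `|(s : C) ^ m| == 1.
Proof.
by case: m => n; rewrite ?NegzE -?exprnP ?exprnN ?normfV normrX (eqP (cvalP s)) expr1n ?invr1.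
Qed.
Definition cpow s m := Circ (cpow_subproof s m).

Fact expi_subproof (x : R) : `|cos x +i* sin x : C| == 1.
Proof. by rewrite normc_def /= cos2Dsin2 sqrtr1. Qed.
Definition expi x := Circ (expi_subproof x).

Lemma cmulA : associative cmul.
Proof. by move=> s t u; apply/val_inj; rewrite /= mulrA. Qed.
Lemma cmulC : commutative cmul.
Proof. by move=> s t; apply/val_inj; rewrite /= mulrC. Qed.
Lemma cmul1 : left_id cone cmul.
Proof. by move=> s; apply/val_inj; rewrite /= mul1r. Qed.
Lemma cmulV : left_inverse cone cinv cmul.
Proof. by move=> s; apply/val_inj; rewrite /= mulVf ?circ_neq0. Qed.
Lemma cpowD s m n : cpow s (m + n) = cmul (cpow s m) (cpow s n).
Proof. by apply/val_inj; rewrite /= expfzDr ?circ_neq0. Qed.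
Lemma cpowM s t m : cpow (cmul s t) m = cmul (cpow s m) (cpow t m).
Proof. by apply/val_inj; rewrite /= expfzMl. Qed.
Lemma cpow0 s : cpow s 0 = cone.
Proof. by apply/val_inj. Qed.
Lemma expi0 : expi 0 = cone.
Proof. by apply/val_inj; rewrite /= cos0 sin0. Qed.

(* The identity component of the based loop group: Lie-algebra-valued smooth loops on
   R / 2 pi Z of mean zero. *)
Record loopU := LoopU {
  ufun :> R -> R;
  usmooth : forall n x, derivable (derive1n n ufun) x 1;
  uper : forall x, ufun (x + 2 * pi) = ufun x;
  umean : Rintegral lebesgue_measure `[0, 2 * pi] ufun = 0 }.

HB.instance Definition _ := gen_eqMixin loopU.
HB.instance Definition _ := gen_choiceMixin loopU.

(* The C^oo topology: uniform convergence of all derivatives. *)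
Definition uderivs (f : loopU) : prod_topology (fun _ : nat => {uniform R -> R}) :=
  fun n => derive1n n (f : R -> R).
HB.instance Definition _ := Topological.copy loopU (initial_topology uderivs).

Lemma loopU_eq (f g : loopU) : (f : R -> R) = g -> f = g.
Proof.
case: f g => [f a b c] [g a' b' c'] /= e; subst g.
by congr LoopU; exact: Prop_irrelevance.
Qed.

Lemma derive1n_lin (a b : R) (f g : loopU) n :
  derive1n n (fun x => a * f x + b * g x) = (fun x => a * derive1n n f x + b * derive1n n g x).
Proof.
elim: n => [//|n IH]; rewrite !derive1nS IH; apply/funext => x.
rewrite !derive1E deriveD; last 2 first.
- by apply: derivableM => //; exact: usmooth.
- by apply: derivableM => //; exact: usmooth.
rewrite !deriveM //=; try exact: usmooth.
by rewrite !derive_cst !scaler0 !addr0.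
Qed.

Lemma loopU_cont (f : loopU) : continuous (f : R -> R).
Proof.
move=> x; have h : derivable (f : R -> R) x 1 := @usmooth f 0%N x.
by move/derivable1_diffP: h => /differentiable_continuous.
Qed.

Lemma loopU_int a (f : loopU) :
  lebesgue_measure.-integrable `[0, 2 * pi] (EFin \o (fun x => a * f x)).
Proof.
apply: continuous_compact_integrable; first exact: segment_compact.
apply: continuous_subspaceT => x; apply: cvgM; first exact: cvg_cst.
exact: loopU_cont.
Qed.

Fact ulin_subproof a b (f g : loopU) :
  [/\ forall n x, derivable (derive1n n (fun x => a * f x + b * g x)) x 1,
   forall x, a * f (x + 2 * pi) + b * g (x + 2 * pi) = a * f x + b * g x &
   Rintegral lebesgue_measure `[0, 2 * pi] (fun x => a * f x + b * g x) = 0].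
Proof.
split=> [n x|x|].
- rewrite derive1n_lin.
  by apply: derivableD; apply: derivableM => //; exact: usmooth.
- by rewrite !uper.
rewrite RintegralD //; try exact: loopU_int.
have hi (g' : loopU) : lebesgue_measure.-integrable `[0, 2 * pi] (EFin \o (g' : R -> R)).
  by have := loopU_int 1 g'; congr (_.-integrable _ _); apply/funext => x /=; rewrite mul1r.
by rewrite !RintegralZl // !umean !mulr0 addr0.
Qed.

Definition ulin a b f g : loopU :=
  let h := ulin_subproof a b f g in
  LoopU (let: And3 p _ _ := h in p) (let: And3 _ q _ := h in q)
        (let: And3 _ _ r := h in r).


Lemma derive1n_0 n : derive1n n (fun _ : R => 0 : R) = (fun _ => 0).
Proof.
elim: n => [//|n IH]; rewrite derive1nS IH; apply/funext => x.
by rewrite derive1E derive_cst.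
Qed.

Fact uzero_subproof1 n x : derivable (derive1n n (fun _ : R => 0 : R)) x 1.
Proof. by rewrite derive1n_0. Qed.
Fact uzero_subproof2 : Rintegral lebesgue_measure `[0, 2 * pi] (fun _ : R => 0 : R) = 0.
Proof. by rewrite Rintegral_cst // mul0r. Qed.
Definition uzero : loopU := LoopU uzero_subproof1 (fun _ => erefl) uzero_subproof2.

Definition uadd (f g : loopU) := ulin 1 1 f g.
Definition uscale (a : R) (f : loopU) := ulin a 0 f f.
Definition uopp (f : loopU) := uscale (-1) f.

Lemma uaddA : associative uadd.
Proof. by move=> f g h; apply/loopU_eq/funext => x /=; ring. Qed.
Lemma uaddf0 f : uadd f uzero = f.
Proof. by apply/loopU_eq/funext => x /=; ring. Qed.

End circle.
Arguments uzero {R}.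
Arguments cone {R}.

Definition Lambda := {additive int -> int}.
Definition chi (R : realType) (mu : Lambda) (t : circ R) : circ R := cpow t (mu 1).

Section groups.
Variable R : realType.
Local Notation C := R[i].
Local Notation "z ^*" := (conjc z).

(* The R-bilinear extension of (v, w) |-> kap v w from int to the Lie algebra R. *)
Definition tform (kap : int -> Lambda) (v w : R) : R := v * w * (kap 1 1)%:~R.

Record level := Level {
  kap :> int -> Lambda;
  kapD : forall m n v, kap (m + n) v = kap m v + kap n v;
  kap_pos : forall v : R, v != 0 -> 0 < tform kap v v }.

(* A group together with a U(1)-valued 2-cocycle; [ext] is the central extension. *)
Record twgroup := TwGroup {
  gsort :> topologicalType;
  gmul : gsort -> gsort -> gsort;
  gone : gsort;
  ginv : gsort -> gsort;
  gtau : gsort -> gsort -> circ R }.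

Definition ext (G : twgroup) : topologicalType := (G * circ R)%type.
Definition emul (G : twgroup) (x y : ext G) : ext G :=
  (gmul x.1 y.1, cmul (cmul x.2 y.2) (gtau x.1 y.1)).
Definition eone (G : twgroup) : ext G := (gone G, cone).
Definition einv (G : twgroup) (x : ext G) : ext G :=
  (ginv x.1, cinv (cmul x.2 (gtau x.1 (ginv x.1)))).

Variable K : level.

Definition omega (f g : loopU R) : R :=
  Rintegral lebesgue_measure `[0, 2 * pi] (fun x => tform K (f x) (derive1 g x)).

(* LT = T x Pi_T x U; see [loop_of] for the corresponding loops. *)
Definition LTsort : topologicalType := (circ R * int * loopU R)%type.
Definition LTmul (a b : LTsort) : LTsort :=
  (cmul a.1.1 b.1.1, a.1.2 + b.1.2, uadd a.2 b.2).
Definition LTtau (a b : LTsort) : circ R :=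
  cmul (chi (K a.1.2) b.1.1) (expi (omega a.2 b.2)).
Definition LT : twgroup :=
  TwGroup LTmul (cone, 0, uzero) (fun a => (cinv a.1.1, - a.1.2, uopp a.2)) LTtau.

Definition incT (t : circ R) : LT := (t, 0, uzero).
Definition incTP (a : circ R * int) : LT := (a, uzero).
Definition incU (f : loopU R) : LT := (cone, 0, f).

Definition Tgrp : twgroup := 
  @TwGroup (circ R) (@cmul R) cone (@cinv R) (fun s t => gtau (incT s) (incT t)).
Definition TPgrp : twgroup :=
  @TwGroup (circ R * int)%type (fun a b => (cmul a.1 b.1, a.2 + b.2)) (cone, 0)
    (fun a => (cinv a.1, - a.2)) (fun a b => gtau (incTP a) (incTP b)).
Definition Ugrp : twgroup :=
  @TwGroup (loopU R) (@uadd R) uzero (@uopp R) (fun f g => gtau (incU f) (incU g)).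

Definition eincT (h : ext Tgrp) : ext LT := (incT h.1, h.2).

Lemma kap0 n : K 0 n = 0.
Proof.
by have := @kapD K 0 0 n; rewrite addr0 => /eqP; rewrite -subr_eq0 opprD addNKr oppr_eq0 => /eqP.
Qed.

Lemma omegaf0 f : omega f uzero = 0.
Proof.
rewrite /omega (_ : (fun x => _) = fun=> 0); first by rewrite Rintegral_cst // mul0r.
by apply/funext => x; rewrite /tform derive1E derive_cst mulr0 mul0r.
Qed.

Lemma LTtauT (a : LT) s : LTtau a (incT s) = chi (K a.1.2) s.
Proof. by rewrite /LTtau omegaf0 expi0 cmulC cmul1. Qed.

Lemma chi0 (s : circ R) : chi (K 0) s = cone.
Proof. by rewrite /chi kap0 cpow0. Qed.

Lemma emul_incT (a : LT) z s y :
  emul ((a, z) : ext LT) (eincT (s, y)) =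
  ((cmul a.1.1 s, a.1.2, a.2), cmul (cmul z y) (chi (K a.1.2) s)).
Proof. by rewrite /emul /eincT [gtau _ _]LTtauT /= /LTmul /= addr0 uaddf0. Qed.

Lemma emul_T s y s' y' :
  emul ((s, y) : ext Tgrp) (s', y') = (cmul s s', cmul y y').
Proof.
by rewrite /emul [gtau _ _]LTtauT chi0 /=; congr (_, _); rewrite cmulC cmul1.
Qed.

Lemma emulT (g : ext LT) (h h' : ext Tgrp) :
  emul (emul g (eincT h)) (eincT h') = emul g (eincT (emul h h')).
Proof.
case: g => a z; case: h => s y; case: h' => s' y'.
apply: (eq_trans (congr1 (fun g => emul g (eincT (s', y'))) (emul_incT a z s y))).
apply: (eq_trans (emul_incT _ _ _ _)).
apply: (eq_trans _ (esym (congr1 (fun h => emul (a, z) (eincT h)) (emul_T s y s' y')))).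
apply: (eq_trans _ (esym (emul_incT _ _ _ _))) => /=.
congr (_, _, _, _); first by rewrite cmulA.
by rewrite /chi cpowM; apply/val_inj => /=; ring.
Qed.

Lemma emulT1 (g : ext LT) : emul g (eincT (eone Tgrp)) = g.
Proof.
case: g => [[[t n] f] z]; apply: (eq_trans (emul_incT (t, n, f) z cone cone)) => /=.
congr (_, _, _, _); first by rewrite cmulC cmul1.
by rewrite /chi; apply/val_inj => /=; rewrite exp1rz !mulr1.
Qed.

Lemma einvT (h : ext Tgrp) : emul h (einv h) = eone Tgrp.
Proof.
case: h => s y; apply: (eq_trans (emul_T s y (cinv s) _)).
rewrite [gtau _ _]LTtauT chi0 /=.
congr (_, _); apply/val_inj => /=; first by rewrite divff ?circ_neq0.
by rewrite mulr1 divff ?circ_neq0.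
Qed.

Lemma emulTK (g : ext LT) (h : ext Tgrp) :
  emul (emul g (eincT h)) (eincT (einv h)) = g.
Proof.
exact: (etrans (emulT g h (einv h))
  (etrans (congr1 (fun x => emul g (eincT x)) (einvT h)) (emulT1 g))).
Qed.

(* Characters of the preimage of T in the extension whose restriction to the centre is
   scalar multiplication. *)
Record central_char := CentralChar {
  lamf :> ext Tgrp -> circ R;
  lam_cont : continuous lamf;
  lamM : forall x y, lamf (emul x y) = cmul (lamf x) (lamf y);
  lam_central : forall z, lamf (cone, z) = z }.

End groups.

Section bundle.
Local Open Scope quotient_scope.
Variables (R : realType) (K : level R).
Local Notation C := R[i].

Definition flag_rel : rel (ext (LT K)) :=
  fun g g' => `[< exists h, g' = emul g (eincT h) >].

Lemma flag_equiv_proof : equiv_class_of flag_rel.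
Proof.
split=> [g|g g'|g' g g''].
- by apply/asboolP; exists (eone _); exact: (esym (emulT1 g)).
- have key a b : (exists h, b = emul a (eincT h)) -> exists h, a = emul b (eincT h).
    move=> [h ->]; exists (einv h).
    exact: (esym (emulTK a h)).
  by apply/asboolP/asboolP; exact: key.
- move=> /asboolP[h ->] /asboolP[h' ->]; apply/asboolP. idtac. exists (emul h h').
  exact: (emulT g h h').
Qed.
Canonical flag_equiv := EquivRelPack flag_equiv_proof.

Definition flag : topologicalType := quotient_topology {eq_quot flag_equiv}.
Definition flag_pi (g : ext (LT K)) : flag := \pi_({eq_quot flag_equiv}) g.

Variable lam : central_char K.

(* (g h, v) ~ (g, lam h v) *)
Definition bundle_rel : rel (ext (LT K) * C^o) :=
  fun p q => `[< exists h, q.1 = emul p.1 (eincT h) /\ p.2 = (lam h : C) * q.2 :> C >].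

Lemma lam1 : lam (eone _) = cone.
Proof. exact: lam_central. Qed.

Lemma bundle_equiv_proof : equiv_class_of bundle_rel.
Proof.
have lamK h : (lam h : C) * lam (einv h) = 1.
  by have := congr1 (@cval R) (lamM lam h (einv h)); rewrite (einvT h) lam1.
split=> [p|p q|q p r].
- by apply/asboolP; exists (eone _); split; [exact: (esym (emulT1 p.1)) | rewrite lam1 mul1r].
- have key (a b : ext (LT K) * C^o) : (exists h, b.1 = emul a.1 (eincT h) /\ a.2 = (lam h : C) * b.2 :> C) ->
      exists h, a.1 = emul b.1 (eincT h) /\ b.2 = (lam h : C) * a.2 :> C.
    move=> [h [-> ->]]; exists (einv h).
    split; first exact: (esym (emulTK a.1 h)).
    by rewrite mulrA [_ * (lam h : C)]mulrC lamK mul1r.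
  by apply/asboolP/asboolP; exact: key.
- move=> /asboolP[h [e1 e2]] /asboolP[h' [e3 e4]]; apply/asboolP. idtac. exists (emul h h').
  split; last by rewrite e2 e4 (lamM lam h h') /= mulrA.
  exact: (etrans e3 (etrans (congr1 (fun x => emul x (eincT h')) e1) (emulT p.1 h h'))).
Qed.
Canonical bundle_equiv := EquivRelPack bundle_equiv_proof.

Definition bundle : topologicalType := quotient_topology {eq_quot bundle_equiv}.
Definition bundle_pi (g : ext (LT K)) (v : C) : bundle :=
  \pi_({eq_quot bundle_equiv}) (g, v : C^o).

Definition bundle_repr (e : bundle) : ext (LT K) * C^o :=
  repr (e : {eq_quot bundle_equiv}).
Definition flag_repr (b : flag) : ext (LT K) := repr (b : {eq_quot flag_equiv}).

(* The fibrewise operations [g, v] |-> [g, c v] and [g, v] + [g, w] = [g, v + w];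
   [bundle_add] is only meaningful on two points of the same fibre. *)
Definition bundle_proj (e : bundle) : flag := flag_pi (bundle_repr e).1.
Definition bundle_scale (c : C) (e : bundle) : bundle :=
  bundle_pi (bundle_repr e).1 (c * (bundle_repr e).2).
Definition bundle_add (e e' : bundle) : bundle :=
  bundle_pi (bundle_repr e).1
    ((bundle_repr e).2 + xget 0 [set w : C | bundle_pi (bundle_repr e).1 w = e']).
Definition flag_act (x : ext (LT K)) (b : flag) : flag := flag_pi (emul x (flag_repr b)).
Definition bundle_act (x : ext (LT K)) (e : bundle) : bundle :=
  bundle_pi (emul x (bundle_repr e).1) (bundle_repr e).2.

End bundle.

Section line_bundle.
Variables (R : realType).
Local Notation C := R[i].

(* A local trivialisation over O is phi, with phi (x, -) linear onto the fibre at x, and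
   psi is its fibre coordinate; this makes each fibre a line. *)
Record line_bundle (B E : topologicalType) (p : E -> B)
    (add : E -> E -> E) (scale : C -> E -> E) : Prop := {
  lb_cont : continuous p;
  lb_triv : forall b : B, exists (O : set B) (phi : B * C^o -> E) (psi : E -> C^o),
    [/\ open O /\ O b,
     forall x v, O x -> p (phi (x, v)) = x /\ psi (phi (x, v)) = v,
     forall e, O (p e) -> phi (p e, psi e) = e,
     forall x v w c, O x -> phi (x, v + w) = add (phi (x, v)) (phi (x, w)) /\
                            phi (x, c * v) = scale c (phi (x, v)) &
     (forall y, O y.1 -> {for y, continuous phi}) /\
     (forall e, O (p e) -> {for e, continuous psi})] }.

Record equivariant_line_bundle (G : twgroup R) (B E : topologicalType) (p : E -> B)
    (add : E -> E -> E) (scale : C -> E -> E)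
    (actB : ext G -> B -> B) (actE : ext G -> E -> E) : Prop := {
  elb_lb : line_bundle p add scale;
  elb_B1 : forall b, actB (eone G) b = b;
  elb_BM : forall x y b, actB (emul x y) b = actB x (actB y b);
  elb_Bcont : continuous (fun q : ext G * B => actB q.1 q.2);
  elb_E1 : forall e, actE (eone G) e = e;
  elb_EM : forall x y e, actE (emul x y) e = actE x (actE y e);
  elb_Econt : continuous (fun q : ext G * E => actE q.1 q.2);
  elb_proj : forall x e, p (actE x e) = actB x (p e);
  elb_add : forall x e e', p e = p e' -> actE x (add e e') = add (actE x e) (actE x e');
  elb_scale : forall x c e, actE x (scale c e) = scale c (actE x e) }.
End line_bundle.

Definition bundle_is_equivariant (R : realType) (K : level R) (lam : central_char K) :=
  @equivariant_line_bundle R (LT K) (flag K) (bundle lam) (@bundle_proj R K lam) 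
   (@bundle_add R K lam) (@bundle_scale R K lam) (@flag_act R K) (@bundle_act R K lam).

Section reps.
Variable R : realType.
Local Notation C := R[i].
Local Notation "z ^*" := (conjc z).

Definition hlinear (V W : lmodType C) (u : V -> W) : Prop :=
  forall (a : C) x y, u (a *: x + y) = a *: u x + u y.
Definition hisometric (V W : hilbert R) (u : V -> W) : Prop :=
  forall x y, hdot (u x) (u y) = hdot x y.

Section twrep.
Variable G : twgroup R.

Record twrep_on (V : hilbert R) := TwRepOn {
  ract :> G -> V -> V;
  ract_lin : forall g, hlinear (ract g);
  ract_iso : forall g, hisometric (ract g);
  ract_surj : forall g v, exists u, ract g u = v;
  ract_tw : forall g h v, ract g (ract h v) = (gtau g h : C) *: ract (gmul g h) v;
  ract_cont : forall v g (e : R), 0 < e ->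
    \forall h \near g, hnorm (ract h v - ract g v) < e }.

Record twrep := TwRep { rspace :> hilbert R; raction :> twrep_on rspace }.

Definition tw_iso (V W : twrep) : Prop := exists u : V -> W,
  [/\ hlinear u, hisometric u, forall w, exists v, u v = w &
      forall g v, u (raction V g v) = raction W g (u v)].

Definition closed_invariant (V : twrep) (P : V -> Prop) : Prop :=
  [/\ P 0, forall a x y, P x -> P y -> P (a *: x + y),
      forall g v, P v -> P (raction V g v) &
      forall v, (forall e : R, 0 < e -> exists2 u, P u & hnorm (u - v) < e) -> P v].

Definition irreducible (V : twrep) : Prop :=
  (exists v : V, v <> 0) /\
  forall P : V -> Prop, closed_invariant P ->
    (forall v, P v -> v = 0) \/ (forall v, P v).

(* A formal difference of isomorphism classes is given by its integer coefficients, and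
   [free_on P] singles out the free abelian group on the classes satisfying P. *)
Definition formal := twrep -> int.
Definition fclass (V : twrep) : formal := fun W => if `[< tw_iso V W >] then 1 else 0.
Definition free_on (P : twrep -> Prop) (x : formal) : Prop :=
  exists (n : nat) (c : 'I_n -> int) (V : 'I_n -> twrep),
    (forall i, P (V i)) /\ forall W, x W = \sum_(i < n) c i * fclass (V i) W.

Definition direct_sum (X : twrep) (n : nat) (W : 'I_n -> twrep) : Prop :=
  exists inc : forall i, W i -> X,
    [/\ forall i, hlinear (inc i), forall i, hisometric (inc i),
        forall i g w, inc i (raction (W i) g w) = raction X g (inc i w),
        forall i j w w', i != j -> hdot (inc i w) (inc j w') = 0 &
        forall x, exists w : forall i, W i, x = \sum_(i < n) inc i (w i)].

(* x is the class of X in the free abelian group on the representations satisfying P. *)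
Definition has_class (P : twrep -> Prop) (X : twrep) (x : formal) : Prop :=
  exists (n : nat) (W : 'I_n -> twrep),
    [/\ forall i, P (W i), direct_sum X W &
        forall Z, x Z = \sum_(i < n) fclass (W i) Z].
End twrep.
End reps.

Section loops.
Variables (R : realType) (K : level R).
Local Notation C := R[i].
Local Notation "z ^*" := (conjc z).

(* The loop of period 2 pi represented by (t, n, f).  The sign of the winding term is
   forced by the cocycle: on the sum over m of C_(lam + kap m) (x) L^2, the rotation
   x |-> x + phi acts on U with energies >= 0, and tau(n, t) = kap n t then makes the
   energy of the m-th summand (kap m m) / 2 + linear terms; with the winding term
   n * x it would be - (kap m m) / 2, and no representation would have energy bounded
   below with finite multiplicities. *)
Definition loop_of (a : LT K) (x : R) : circ R :=
  cmul (cmul a.1.1 (expi (- (a.1.2)%:~R * x))) (expi (2 * pi * (a.2 : loopU R) x)).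

Definition rotates (phi : R) (a b : LT K) : Prop :=
  forall x, loop_of b x = loop_of a (x + phi).

(* The rotation circle is lifted to automorphisms of the extension of LT by
   (a, z) |-> (rotated a, z e^(i q(n) phi)), n the winding number of a; a lift with q = 0
   does not exist as tau is not rotation invariant on T x Pi_T. *)
Definition rotation_lift (q : int -> int) : Prop :=
  forall phi (a b a' b' : LT K), rotates phi a a' -> rotates phi b b' ->
    cmul (cmul (expi ((q a.1.2)%:~R * phi)) (expi ((q b.1.2)%:~R * phi))) (gtau a' b') =
    cmul (gtau a b) (expi ((q (gmul a b).1.2)%:~R * phi)).

Definition positive_energy (V : twrep (LT K)) : Prop :=
  exists (q : int -> int) (Q : R -> V -> V),
    rotation_lift q /\
    [/\ forall phi, hlinear (Q phi), forall phi, hisometric (Q phi),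
        forall phi psi v, Q (phi + psi) v = Q phi (Q psi v),
        forall v, Q (2 * pi) v = v &
        forall v phi (e : R), 0 < e ->
          \forall psi \near phi, hnorm (Q psi v - Q phi v) < e] /\
    (forall phi a b v, rotates phi a b ->
       Q phi (raction V a v) = (expi ((q a.1.2)%:~R * phi) : C) *: raction V b (Q phi v)) /\
    (forall E : int, exists (n : nat) (b : 'I_n -> V), forall v,
       (forall phi, Q phi v = (expi (E%:~R * phi) : C) *: v) ->
       exists c : 'I_n -> C, v = \sum_(i < n) c i *: b i) /\
    (exists E0 : int, forall E : int, E < E0 -> forall v,
       (forall phi, Q phi v = (expi (E%:~R * phi) : C) *: v) -> v = 0).

Definition irrPER (V : twrep (LT K)) : Prop := irreducible V /\ positive_energy V.

Definition tensor_rep (V : twrep (TPgrp K)) (W : twrep (Ugrp K)) (X : twrep (LT K)) : Prop :=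
  exists b : V -> W -> X,
    [/\ forall w, hlinear (fun v => b v w), forall v, hlinear (b v),
        forall v w v' w', hdot (b v w) (b v' w') = hdot v v' * hdot w w',
        forall x, (forall v w, hdot (b v w) x = 0) -> x = 0 &
        forall a v w, raction X a (b v w) = b (raction V a.1 v) (raction W a.2 w)].

End loops.

Section fock.
Variables (R : realType) (K : level R).
Local Notation C := R[i].
Local Notation "z ^*" := (conjc z).

(* Multi-indices.  The index k : nat stands throughout for the mode k.+1, i.e. for the
   variable z_(k+1); a function midx -> C lists the coefficients of a power series. *)
Definition midx := {fsfun nat -> nat with 0%N}.
Definition incr (k : nat) (al : midx) : midx := [fsfun al with k |-> (al k).+1].
Definition decr (k : nat) (al : midx) : midx := [fsfun al with k |-> (al k).-1].

Definition mfact (al : midx) : R := \prod_(k <- finsupp al) ((al k)`!)%:R.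
Fact mfact_gt0 al : 0 < mfact al.
Proof. by apply: prodr_gt0 => k _; rewrite ltr0n fact_gt0. Qed.

Definition Fock : hilbert R := l2hilbert mfact_gt0.
Definition fock_fun (v : Fock) : midx -> C := l2fun v.

Definition sqrt2 : C := (Num.sqrt 2)%:C.

Definition drho_z (k : nat) (p : midx -> C) : midx -> C :=
  fun al => if al k == 0%N then 0 else - sqrt2 * p (decr k al).
Definition drho_zb (k : nat) (p : midx -> C) : midx -> C :=
  fun al => sqrt2 * (((al k).+1)%:R * p (incr k al)).

Definition zmode (k : nat) (x : R) : C :=
  let d := Num.sqrt (k.+1%:R * pi) in
  (Num.sqrt 2)^-1%:C * ((cos (k.+1%:R * x) / d)%:C + 'i%C * (sin (k.+1%:R * x) / d)%:C).

Definition cintegral (a b : R) (F : R -> C) : C :=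
  (Rintegral lebesgue_measure `[a, b] (fun x => complex.Re (F x))) +i*
  (Rintegral lebesgue_measure `[a, b] (fun x => complex.Im (F x))).

(* f in the coordinate of the Lie algebra given by a unit vector for [tform]. *)
Definition ucoord (f : loopU R) (x : R) : R := Num.sqrt (tform K 1 1) * f x.

(* ucoord f = \sum_k (zcoef f k * zmode k + its conjugate), as the integral of
   zmode j * conj (zmode k) over a period is (j == k) / (k + 1). *)
Definition zcoef (f : loopU R) (k : nat) : C :=
  k.+1%:R * cintegral 0 (2 * pi) (fun x => (ucoord f x)%:C * (zmode k x)^*).

Definition drho (f : loopU R) (p : midx -> C) : midx -> C := fun al =>
  \sum_(k \in [set: nat]) (zcoef f k * drho_z k p al + (zcoef f k)^* * drho_zb k p al).

Definition finsup (I : choiceType) (u : I -> C) : Prop := finite_set [set x | u x != 0].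

(* rho = exp (drho): as tau (s f, t f) = 1, t |-> rho (t f) is a unitary one-parameter
   group, and its generator is required to be drho f on polynomials, a domain of
   essential skew-adjointness. *)
Record fock_rep := FockRep {
  frep :> twrep_on (Ugrp K) Fock;
  frep_gen : forall (f : loopU R) (p : Fock), finsup (fock_fun p) ->
    exists2 D : Fock, (forall al, fock_fun D al = drho f (fock_fun p) al) &
      forall e : R, 0 < e -> exists2 d : R, 0 < d & forall t : R, t != 0 -> `|t| < d ->
        hnorm (t^-1%:C *: (frep (uscale t f) p - p) - D) < e }.

Variable rho : fock_rep.

(* An element phi of the dual of L^2(R^oo) is given by its values phi al on monomials,
   and drho* X phi = - phi \o drho X. *)
Definition mono (al : midx) : midx -> C := fun be => (be == al)%:R.
Definition pairing (phi p : midx -> C) : C := \sum_(al \in [set: midx]) phi al * p al.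
Definition drhoD_z (k : nat) (phi : midx -> C) : midx -> C :=
  fun al => - pairing phi (drho_z k (mono al)).
Definition drhoD_zb (k : nat) (phi : midx -> C) : midx -> C :=
  fun al => - pairing phi (drho_zb k (mono al)).

(* The spinor space: a finite set s = {k1 < .. < kr} stands for the orthonormal basis
   vector zb_k1 /\ .. /\ zb_kr, and a function on these sets lists coefficients. *)
Definition fsign (k : nat) (s : {fset nat}) : C := (-1) ^+ #|` [fset j in s | (j < k)%N]%fset|.
Definition wedge (k : nat) (h : {fset nat} -> C) : {fset nat} -> C :=
  fun s => if k \in s then fsign k s * h (s `\ k)%fset else 0.
Definition contract (k : nat) (h : {fset nat} -> C) : {fset nat} -> C :=
  fun s => if k \in s then 0 else fsign k s * h (k |` s)%fset.
Definition gam_zb (k : nat) (h : {fset nat} -> C) : {fset nat} -> C :=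
  fun s => sqrt2 * wedge k h s.
Definition gam_z (k : nat) (h : {fset nat} -> C) : {fset nat} -> C :=
  fun s => sqrt2 * contract k h s.

(* Basis of L^2(R^oo)* (x) L^2(R^oo) (x) S. *)
Definition idx : choiceType := (midx * midx * {fset nat})%type.

Definition on_dual (A : (midx -> C) -> midx -> C) (u : idx -> C) : idx -> C :=
  fun x => A (fun al => u (al, x.1.2, x.2)) x.1.1.
Definition on_spinor (B : ({fset nat} -> C) -> {fset nat} -> C) (u : idx -> C) : idx -> C :=
  fun x => B (fun s => u (x.1, s)) x.2.

Definition partial (u : idx -> C) : idx -> C := fun x =>
  'i%C * (\sum_(k \in [set: nat]) (Num.sqrt k.+1%:R)%:C * on_dual (drhoD_z k) (on_spinor (gam_zb k) u) x)
  + 'i%C * (\sum_(k \in [set: nat]) (Num.sqrt k.+1%:R)%:C * on_dual (drhoD_zb k) (on_spinor (gam_z k) u) x).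

Definition idxw (x : idx) : R := (mfact x.1.1)^-1 * mfact x.1.2.
Fact idxw_gt0 x : 0 < idxw x.
Proof. by rewrite mulr_gt0 ?invr_gt0 ?mfact_gt0. Qed.

Definition WZWS : hilbert R := l2hilbert idxw_gt0.
Definition wfun (u : WZWS) : idx -> C := l2fun u.

(* The kernel, in even or odd spinor degree, of the closure of [partial] from its
   algebraic domain. *)
Definition ker_partial (odd_part : bool) (u : WZWS) : Prop :=
  (forall e : R, 0 < e -> exists u' v' : WZWS,
     [/\ finsup (wfun u'), wfun v' =1 partial (wfun u'), hnorm (u - u') < e & hnorm v' < e]) /\
  (forall x, wfun u x != 0 -> odd #|` x.2| = odd_part).

(* u' = (id (x) rho_f (x) id) u *)
Definition acts_by_rho (f : loopU R) (u u' : idx -> C) : Prop := forall al s,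
  exists2 v : Fock, (forall be, fock_fun v be = u (al, be, s)) &
                    (forall be, u' (al, be, s) = fock_fun (rho f v) be).

Definition subrep_on (P : WZWS -> Prop) (W : twrep (Ugrp K)) : Prop :=
  exists j : W -> WZWS,
    [/\ hlinear j, hisometric j, forall u, P u <-> exists w, j w = u &
        forall f w, acts_by_rho f (wfun (j w)) (wfun (j (raction W f w)))].

Variable lam : central_char K.

Definition eincTP (h : ext (Tgrp K)) : ext (TPgrp K) := ((h.1, 0), h.2).
Definition basept (n : int) : ext (TPgrp K) := ((cone, n), cone).

(* Sections over Pi_T of the line bundle of lam (tensored with functions of j) as
   equivariant functions on the preimage of T x Pi_T; an element of I is a further
   coordinate. *)
Definition equivariant (I : Type) (s : ext (TPgrp K) -> I -> C) : Prop :=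
  forall g h j, s (emul g (eincTP h)) j = (lam h : C)^-1 * s g j.

Definition translate (I : Type) (g : TPgrp K) (s : ext (TPgrp K) -> I -> C) :=
  fun x => s (emul (einv (g, cone)) x).

Definition secw (x : int * idx) : R := idxw x.2.
Definition coords (s : ext (TPgrp K) -> idx -> C) : int * idx -> C :=
  fun x => s (basept x.1) x.2.
Definition sec_dot (s t : ext (TPgrp K) -> idx -> C) : C := l2dot secw (coords s) (coords t).
Definition sec_norm := dnorm sec_dot.
Definition sec_sub (s t : ext (TPgrp K) -> idx -> C) : ext (TPgrp K) -> idx -> C :=
  fun x j => s x j - t x j.

Definition L2sec (s : ext (TPgrp K) -> idx -> C) : Prop :=
  equivariant s /\ coords s \in l2pred secw.
Definition core (s : ext (TPgrp K) -> idx -> C) : Prop :=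
  equivariant s /\ finsup (coords s).

Definition dirac_M (s : ext (TPgrp K) -> idx -> C) : ext (TPgrp K) -> idx -> C :=
  fun _ _ => 0.
Definition dirac (s : ext (TPgrp K) -> idx -> C) : ext (TPgrp K) -> idx -> C :=
  fun x j => dirac_M s x j + partial (s x) j.
Definition dirac_closure (s t : ext (TPgrp K) -> idx -> C) : Prop :=
  [/\ L2sec s, L2sec t & forall e : R, 0 < e -> exists s',
     [/\ core s', sec_norm (sec_sub s s') < e & sec_norm (sec_sub t (dirac s')) < e]].

Definition sec_act (a : LT K) (s s' : ext (TPgrp K) -> idx -> C) : Prop :=
  forall x, acts_by_rho a.2 (translate (a.1 : TPgrp K) s x) (s' x).

Record dirac_operator : Prop := {
  do_dom : forall s, core s -> L2sec s;
  do_stable : forall s, core s -> core (dirac s);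
  do_dense : forall s, L2sec s -> forall e : R, 0 < e ->
    exists2 s', core s' & sec_norm (sec_sub s s') < e;
  do_sym : forall s t, core s -> core t -> sec_dot (dirac s) t = sec_dot s (dirac t);
  do_act : forall a s, L2sec s -> exists2 s', L2sec s' & sec_act a s s';
  do_equiv : forall a s t s' t', dirac_closure s t -> sec_act a s s' -> sec_act a t t' ->
    dirac_closure s' t' }.

End fock.

Section kasparov.
Variables (R : realType) (K : level R).
Local Notation C := R[i].
Local Notation "z ^*" := (conjc z).
Local Notation TP := (TPgrp K).

(* Haar measure on T x Pi_T: normalised on T, counting on Pi_T. *)
Definition haar (b : TP -> C) : C :=
  \sum_(n \in [set: int]) cintegral 0 1 (fun x => b (expi (2 * pi * x), n)).

Definition Cc (b : TP -> C) : Prop :=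
  (forall n, continuous (fun t : circ R => b (t, n) : C^o)) /\
  finite_set [set n : int | exists t : circ R, b (t, n) != 0].

(* Twisted convolution and involution; [integrated] is a *-representation for these. *)
Definition conv (b c : TP -> C) : TP -> C := fun g =>
  haar (fun h => b h * c (gmul (ginv h) g) * (gtau h (gmul (ginv h) g) : C)).
Definition star (b : TP -> C) : TP -> C := fun g =>
  (b (ginv g) * (gtau (ginv g) g : C))^*.

Definition integrated (V : twrep TP) (b : TP -> C) (v w : V) : C :=
  haar (fun g => b g * hdot v (raction V g w)).

Record cstar := CStar {
  csort :> lmodType C;
  cprod : csort -> csort -> csort;
  cadj : csort -> csort;
  cnorm : csort -> R;
  cprodDl : forall (a : C) x y z, cprod (a *: x + y) z = a *: cprod x z + cprod y z;
  cprodDr : forall (a : C) x y z, cprod z (a *: x + y) = a *: cprod z x + cprod z y;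
  cprodA : forall x y z, cprod x (cprod y z) = cprod (cprod x y) z;
  cadjD : forall (a : C) x y, cadj (a *: x + y) = a^* *: cadj x + cadj y;
  cadjK : forall x, cadj (cadj x) = x;
  cadjM : forall x y, cadj (cprod x y) = cprod (cadj y) (cadj x);
  cnormD : forall x y, cnorm (x + y) <= cnorm x + cnorm y;
  cnormZ : forall a x, cnorm (a *: x) = cabs a * cnorm x;
  cnorm0 : forall x, cnorm x = 0 -> x = 0;
  cnormM : forall x y, cnorm (cprod x y) <= cnorm x * cnorm y;
  cnorm_star : forall x, cnorm (cprod (cadj x) x) = cnorm x ^+ 2;
  ccomplete : forall x : nat -> csort,
    (forall e : R, 0 < e -> exists N, forall m n, (N <= m)%N -> (N <= n)%N ->
       cnorm (x m - x n) < e) ->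
    exists l, forall e : R, 0 < e -> exists N, forall n, (N <= n)%N -> cnorm (x n - l) < e }.

(* Left Hilbert A-modules; [mip] is A-linear in its first argument. *)
Record hmodule (A : cstar) := HModule {
  msort :> lmodType C;
  mact : A -> msort -> msort;
  mip : msort -> msort -> A;
  mactDl : forall (a : C) x y u, mact (a *: x + y) u = a *: mact x u + mact y u;
  mactDr : forall (a : C) x u v, mact x (a *: u + v) = a *: mact x u + mact x v;
  mactM : forall x y u, mact (cprod x y) u = mact x (mact y u);
  mipDl : forall (a : C) u v w, mip (a *: u + v) w = a *: mip u w + mip v w;
  mipM : forall x u v, mip (mact x u) v = cprod x (mip u v);
  mipJ : forall u v, cadj (mip u v) = mip v u;
  mip_ge0 : forall u, exists x, mip u u = cprod (cadj x) x;
  mip_eq0 : forall u, mip u u = 0 -> u = 0;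
  mcomplete : forall x : nat -> msort,
    (forall e : R, 0 < e -> exists N, forall m n, (N <= m)%N -> (N <= n)%N ->
       Num.sqrt (cnorm (mip (x m - x n) (x m - x n))) < e) ->
    exists l, forall e : R, 0 < e -> exists N, forall n, (N <= n)%N ->
      Num.sqrt (cnorm (mip (x n - l) (x n - l))) < e }.

Definition mnorm (A : cstar) (E : hmodule A) (u : E) : R := Num.sqrt (cnorm (mip u u)).

(* The twisted group C*-algebra: the completion of C_c (T x Pi_T) for the largest norm
   coming from tau-twisted unitary representations. *)
Record group_cstar := GroupCstar {
  gcA :> cstar;
  gcj : (TP -> C) -> gcA;
  gcj_lin : forall a b c, Cc b -> Cc c ->
    gcj (fun g => a * b g + c g) = a *: gcj b + gcj c;
  gcj_mul : forall b c, Cc b -> Cc c -> gcj (conv b c) = cprod (gcj b) (gcj c);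
  gcj_star : forall b, Cc b -> gcj (star b) = cadj (gcj b);
  gcj_norm : forall b, Cc b -> cnorm (gcj b) =
    sup [set r : R | exists (V : twrep TP) (v w : V),
           [/\ hnorm v <= 1, hnorm w <= 1 & r = cabs (integrated b v w)]];
  gcj_dense : forall x (e : R), 0 < e -> exists2 b, Cc b & cnorm (x - gcj b) < e }.

Variable lam : central_char K.

(* Compactly supported sections of the bundle of lam over Pi_T, with Kasparov's
   C_c-valued inner product <s, t> g = (g t, s).  Left modules are used, so that the
   algebra acting is C* (T x Pi_T, tau) itself and not that of the conjugate twist. *)
Definition sect := ext TP -> unit -> C.
Definition Csec (s : sect) : Prop :=
  equivariant lam s /\ finite_set [set n : int | s (basept K n) tt != 0].
Definition sect_ip (s t : sect) : TP -> C := fun g =>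
  \sum_(n \in [set: int]) (translate g t (basept K n) tt)^* * s (basept K n) tt.
Definition sect_act (b : TP -> C) (s : sect) : sect := fun x i =>
  haar (fun g => b g * translate g s x i).

Record kasparov_module (A : group_cstar) := KasparovModule {
  kmE :> hmodule A;
  kmi : sect -> kmE;
  kmi_lin : forall a s t, Csec s -> Csec t ->
    kmi (fun x i => a * s x i + t x i) = a *: kmi s + kmi t;
  kmi_act : forall b s, Cc b -> Csec s -> kmi (sect_act b s) = mact (gcj A b) (kmi s);
  kmi_ip : forall s t, Csec s -> Csec t -> mip (kmi s) (kmi t) = gcj A (sect_ip s t);
  kmi_dense : forall x (e : R), 0 < e -> exists2 s, Csec s & mnorm (x - kmi s) < e }.

(* Kasparov's cycle of a first order operator D is (E, D (1 + D^2)^(-1/2)).  Over the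
   0-dimensional Pi_T, D = 0 and E is purely even, so the cycle is (E, 0), Fredholm as
   id_E is compact, and the index is the class of the module E in K_0. *)
Definition compact_id (A : cstar) (E : hmodule A) : Prop :=
  forall e : R, 0 < e -> exists (n : nat) (y z : 'I_n -> E), forall x : E,
    mnorm (x - \sum_(i < n) mact (mip x (y i)) (z i)) <= e * mnorm x.

Definition extends_rep (A : group_cstar) (V : twrep TP) (pi : A -> V -> V) : Prop :=
  [/\ forall v (a : C) x y, pi (a *: x + y) v = a *: pi x v + pi y v,
      forall x, hlinear (pi x),
      forall x y v, pi (cprod x y) v = pi x (pi y v),
      forall x v w, hdot (pi (cadj x) v) w = hdot v (pi x w) &
      forall b, Cc b -> forall v w, hdot v (pi (gcj A b) w) = integrated b v w].

(* A representation pi of A on V induces K_0(A) -> K_0(compact operators) = Z, sending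
   the class of E to the dimension of conj(E) (x)_A V, the Hausdorff completion of
   the algebraic tensor product for the semi-inner product
   (e (x) v, e' (x) v') = (v, pi <e, e'> v').  [loc_dim d] says this dimension is d, by
   an orthonormal family satisfying Parseval's identity. *)
Section localization.
Variables (A : cstar) (E : hmodule A) (V : hilbert R) (pi : A -> V -> V).
Definition loc_form (x y : seq (E * V)) : C :=
  \sum_(p <- x) \sum_(q <- y) hdot p.2 (pi (mip p.1 q.1) q.2).
Definition loc_dim (d : nat) : Prop := exists x : 'I_d -> seq (E * V),
  (forall i j, loc_form (x i) (x j) = (i == j)%:R) /\
  forall y, loc_form y y = \sum_(i < d) `|loc_form (x i) y| ^+ 2.
End localization.

(* The identification of K_0(C* (T x Pi_T, tau)) with the free abelian group on the
   irreducible representations V sends a class to its images under these maps. *)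
Definition index_M (A : group_cstar) (E : kasparov_module A) (m : formal TP) : Prop :=
  [/\ compact_id E, free_on (@irreducible R TP) m &
      forall V : twrep TP, irreducible V -> exists (pi : A -> V -> V) (d : nat),
        [/\ extends_rep pi, @loc_dim A E V pi d & m V = d]].

(* x = m (x) ([W0] - [W1]), from the expansion m = \sum_i c i [V i]. *)
Definition product_class (m : formal TP) (W0 W1 : twrep (Ugrp K)) (x : formal (LT K)) : Prop :=
  exists (n : nat) (c : 'I_n -> int) (V : 'I_n -> twrep TP)
         (X0 X1 : 'I_n -> twrep (LT K)) (y0 y1 : 'I_n -> formal (LT K)),
    [/\ forall i, irreducible (V i) /\ c i != 0,
        forall i j, tw_iso (V i) (V j) -> i = j,
        forall Z, m Z = \sum_(i < n) c i * fclass (V i) Z,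
        forall i, [/\ tensor_rep (V i) W0 (X0 i), has_class (@irrPER R K) (X0 i) (y0 i),
                      tensor_rep (V i) W1 (X1 i) & has_class (@irrPER R K) (X1 i) (y1 i)] &
        forall Z, x Z = \sum_(i < n) c i * (y0 i Z - y1 i Z)].

Definition dirac_index (rho : fock_rep K) (A : group_cstar) (E : kasparov_module A)
    (x : formal (LT K)) : Prop :=
  exists (m : formal TP) (W0 W1 : twrep (Ugrp K)),
    [/\ index_M E m, subrep_on rho (@ker_partial R false) W0,
        subrep_on rho (@ker_partial R true) W1 & product_class m W0 W1 x].

(* mu is in the class of lam in Lambda / kap (int). *)
Definition in_coset (mu : Lambda) : Prop :=
  exists n, forall t, lam (t, cone) = cmul (chi mu t) (chi (K n) t).

(* V is the Hilbert sum over n of C_(mu + kap n) (x) L^2(R^oo). *)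
Definition standard_PER (rho : fock_rep K) (mu : Lambda) (V : twrep (LT K)) : Prop :=
  exists inc : int -> Fock R -> V,
    [/\ forall n, hlinear (inc n), forall n, hisometric (inc n),
        forall n m u v, n != m -> hdot (inc n u) (inc m v) = 0,
        forall v, (forall n u, hdot (inc n u) v = 0) -> v = 0 &
        forall (t : circ R) (n m : int) (f : loopU R) u,
          raction V (t, n, f) (inc m u) =
          (cmul (chi mu t) (chi (K (m - n)) t) : C) *: inc (m - n) (rho f u)].

Definition corresponds_to (rho : fock_rep K) (V : twrep (LT K)) : Prop :=
  (exists mu, in_coset mu) /\ forall mu, in_coset mu -> standard_PER rho mu V.

End kasparov.

(* Main.v *)
(* Two total families with the same Gram matrix, permuted in the same way up to scalars by
   the group, define isomorphic representations; all isomorphisms below arise like this.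

   The map (t, n, f) |-> (1, n, f) gives a continuous global section of LT^tau over the
   flag manifold, which trivialises the bundle.  The square of the fibre operator on
   H_WZW (x) S is diagonal on monomials, a positive multiple of the total energy of the
   dual bosonic and of the fermionic variables; hence its kernel is the vacuum line of
   these variables tensored with L^2(R^oo), which is even and carries rho.

   Kasparov's module is generated by the section d supported at 0: x = <x, d> d holds on
   sections, and extends by continuity because the norm of the twisted group algebra is
   computed in unitary representations, so that c^* c <= c^* c + e^* e in norm.  For a
   representation V, e (x) v |-> <d, e> v identifies the localisation of the module at V
   with the range of the projection <d, d>, which is the space of vectors of weight lam
   for the torus.  When V is irreducible and has such a vector, the translates of this
   vector under Pi_T have the distinct weights lam + kap n, so they form an orthonormal
   basis and determine V.  Thus the index is the class of the sum of the lines
   C_(lam + kap n), whose product with L^2(R^oo) is the standard representation. *)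
Require Import Defs.
From HB Require Import structures.
From mathcomp Require Import all_boot all_order all_algebra finmap.
From mathcomp Require Import generic_quotient complex.
From mathcomp Require Import all_classical all_reals all_analysis.
From mathcomp Require Import ring lra zify.

Set Implicit Arguments.
Unset Strict Implicit.
Unset Printing Implicit Defensive.
Import Order.TTheory GRing.Theory Num.Theory numFieldNormedType.Exports.
Local Open Scope classical_set_scope.
Local Open Scope ring_scope.
Local Open Scope complex_scope.
Local Notation "z ^*" := (conjc z) : ring_scope.

(** * Hilbert spaces and unitaries *)

(** Nothing is known of [rho] beyond unitarity, twist, continuity and the generator on polynomials,
    so its irreducibility and its covariance under rotation have to be derived. Both rest on one
    uniqueness principle: a bounded operator that commutes with the one-parameter groups of the
    Fourier modes up to phases has a matrix in the monomials that obeys a two-sided recursion and is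
    determined by its vacuum entry. Hence the commutant is scalar, and the rotated operators agree
    with the expected ones up to a phase, which a first order expansion at the vacuum removes. The
    tensor products that are constructed are l2 spaces over product index sets, cut into fibres on
    which operators are defined and compared. The index is a relation, so the final equivalence
    needs a witness and also the uniqueness of each choice: the localised dimension, the kernels,
    the tensor products, the decompositions into irreducibles. The core of the Dirac operator need
    not be stable under [rho]; equivariance is therefore proved for the closure, by truncations that
    commute with [partial]. *)

Section complex_facts.
Variable R : realType.
Local Notation C := R[i].
Implicit Types (z t : C).

Lemma NconjE (z : C) : Num.conj z = z^*. Proof. by []. Qed.
Lemma cabs0 : cabs (0 : C) = 0.
Proof. by apply: (@complexI R); rewrite -cabsE normr0. Qed.
Lemma cabs1 : cabs (1 : C) = 1.
Proof. by apply: (@complexI R); rewrite -cabsE normr1. Qed.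
Lemma cabsN z : cabs (- z) = cabs z.
Proof. by rewrite /cabs normrN. Qed.
Lemma cabs_real (x : R) : cabs (x%:C) = `|x|.
Proof. by rewrite /cabs normc_def /= expr0n addr0 sqrtr_sqr. Qed.
Lemma cabsV z : cabs (z^-1) = (cabs z)^-1.
Proof. by apply: (@complexI R); rewrite fmorphV /= -!cabsE normfV. Qed.
Lemma cabs_circ (t : circ R) : cabs (t : C) = 1.
Proof. by apply: (@complexI R); rewrite -cabsE (eqP (cvalP t)). Qed.
Lemma cabs_gt0 z : z != 0 -> 0 < cabs z.
Proof. by move=> z0; rewrite lt_neqAle cabs_ge0 andbT eq_sym; apply: contra z0 => /eqP/cabs_eq0 ->. Qed.
Lemma cabs_sum (I : Type) (r : seq I) (P : pred I) (F : I -> C) :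
  cabs (\sum_(i <- r | P i) F i) <= \sum_(i <- r | P i) cabs (F i).
Proof.
elim/big_ind2: _ => [|x1 x2 y1 y2 h1 h2|//]; first by rewrite cabs0.
by apply: le_trans (cabsD _ _) _; rewrite lerD.
Qed.
Lemma conj_mul z : z^* * z = (cabs z ^+ 2)%:C.
Proof. by rewrite mulrC -sqr_normc cabsE rmorphXn. Qed.
Lemma circ_conj (t : circ R) : (t : C)^* = (t : C)^-1.
Proof.
apply: (mulIf (circ_neq0 t)); rewrite conj_mul cabs_circ expr1n.
by rewrite mulVf ?circ_neq0.
Qed.
Lemma cabs_le_eq0 z : (forall e : R, 0 < e -> cabs z < e) -> z = 0.
Proof.
move=> h; apply: cabs_eq0; apply/eqP; rewrite eq_le cabs_ge0 andbT.
by apply/ler_addgt0Pr => e e0; rewrite add0r ltW // h.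
Qed.
(** Closes most of the density arguments, which bound a norm by a fixed constant times an arbitrary
    error. As [c] may have any sign, the proof divides by [|c| + 1]. *)
Lemma le_small (a c : R) : (forall e : R, 0 < e -> a <= c * e) -> a <= 0.
Proof.
move=> h; apply/ler_addgt0Pr => e e0; rewrite add0r.
have c1 : 0 < `|c| + 1 by rewrite ltr_wpDl.
apply: (le_trans (h (e / (`|c| + 1)) (divr_gt0 e0 c1))).
rewrite mulrA ler_pdivrMr // mulrC ler_wpM2l ?(ltW e0) //.
by rewrite (le_trans (ler_norm c)) // lerDl.
Qed.
Lemma reC_eq (z : C) : (z \is Num.real) -> z = (complex.Re z)%:C.
Proof. by case: z => a b /complex_realP[x [-> ->]]. Qed.
Lemma ge0_ReE (z : C) : 0 <= z -> z = (complex.Re z)%:C.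
Proof. by move=> /ger0_real/reC_eq. Qed.
Lemma ReD (z t : C) : complex.Re (z + t) = complex.Re z + complex.Re t.
Proof. by case: z t => [a b] [c d]. Qed.
Lemma ReN (z : C) : complex.Re (- z) = - complex.Re z.
Proof. by case: z. Qed.
Lemma ReJ (z : C) : complex.Re (z^*) = complex.Re z.
Proof. by case: z. Qed.
Lemma ReZ (a : R) (z : C) : complex.Re (a%:C * z) = a * complex.Re z.
Proof. by case: z => x y /=; rewrite mul0r subr0. Qed.
Lemma Re_real (a : R) : complex.Re (a%:C) = a. Proof. by []. Qed.
Lemma Re_le_cabs z : complex.Re z <= cabs z.
Proof. by apply: le_trans (cabs_ReIm z).1; exact: ler_norm. Qed.
End complex_facts.

Section hilbert_facts.
Variables (R : realType) (H : hilbert R).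
Local Notation C := R[i].
Local Notation dot := (@hdot R H).
Implicit Types (u v w x y : H) (a b : C).

Lemma hdotDl u v w : dot (u + v) w = dot u w + dot v w.
Proof. by rewrite hdotC hdotDr rmorphD /= -!hdotC. Qed.
Lemma hdotZl a u v : dot (a *: u) v = a^* * dot u v.
Proof. by rewrite hdotC hdotZr rmorphM /= -hdotC. Qed.
Lemma hdot0r u : dot u 0 = 0.
Proof. by rewrite -(scale0r (0 : H)) hdotZr mul0r. Qed.
Lemma hdot0l u : dot 0 u = 0.
Proof. by rewrite hdotC hdot0r conjc0. Qed.
Lemma hdotNr u v : dot u (- v) = - dot u v.
Proof. by rewrite -scaleN1r hdotZr mulN1r. Qed.
Lemma hdotNl u v : dot (- u) v = - dot u v.
Proof. by rewrite hdotC hdotNr rmorphN /= -hdotC. Qed.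
Lemma hdotBr u v w : dot u (v - w) = dot u v - dot u w.
Proof. by rewrite hdotDr hdotNr. Qed.
Lemma hdotBl u v w : dot (u - v) w = dot u w - dot v w.
Proof. by rewrite hdotDl hdotNl. Qed.
Lemma hdot_sumr (I : Type) (r : seq I) (P : pred I) u (F : I -> H) :
  dot u (\sum_(i <- r | P i) F i) = \sum_(i <- r | P i) dot u (F i).
Proof. by apply: (big_morph (dot u)) => [x y|]; [exact: hdotDr | exact: hdot0r]. Qed.
Lemma hdot_suml (I : Type) (r : seq I) (P : pred I) u (F : I -> H) :
  dot (\sum_(i <- r | P i) F i) u = \sum_(i <- r | P i) dot (F i) u.
Proof.
by apply: (big_morph (fun x => dot x u)) => [x y|]; [exact: hdotDl | exact: hdot0l].
Qed.

Lemma hnorm_ge0 v : 0 <= hnorm v. Proof. exact: sqrtr_ge0. Qed.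
Lemma hdot_self_ge0 v : 0 <= complex.Re (dot v v).
Proof. by rewrite -ler0c -(ge0_ReE (hdot_ge0 v)) hdot_ge0. Qed.
Lemma hnorm_sqr v : hnorm v ^+ 2 = complex.Re (dot v v).
Proof. by rewrite sqr_sqrtr // hdot_self_ge0. Qed.
Lemma hdot_self v : dot v v = (hnorm v ^+ 2)%:C.
Proof. by rewrite hnorm_sqr -(ge0_ReE (hdot_ge0 v)). Qed.
Lemma hnorm0 : hnorm (0 : H) = 0.
Proof. by rewrite /hnorm /dnorm hdot0r sqrtr0. Qed.
Lemma hnorm_eq0 v : hnorm v = 0 -> v = 0.
Proof. by move=> h; apply: hdot_eq0; rewrite hdot_self h expr0n. Qed.
Lemma hnormZ a v : hnorm (a *: v) = cabs a * hnorm v.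
Proof.
apply/eqP; rewrite -(@eqrXn2 _ 2%N) ?mulr_ge0 ?hnorm_ge0 ?cabs_ge0 //.
rewrite exprMn; apply/eqP/(@complexI R); rewrite -hdot_self hdotZr hdotZl.
by rewrite mulrA [a * _]mulrC conj_mul hdot_self -rmorphM.
Qed.
Lemma hnormN v : hnorm (- v) = hnorm v.
Proof. by rewrite -scaleN1r hnormZ cabsN cabs1 mul1r. Qed.
Lemma hnormBC u v : hnorm (u - v) = hnorm (v - u).
Proof. by rewrite -hnormN opprB. Qed.

Lemma hnormD_sqr u v :
  hnorm (u + v) ^+ 2 = hnorm u ^+ 2 + hnorm v ^+ 2 + 2 * complex.Re (dot u v).
Proof.
rewrite !hnorm_sqr hdotDr !hdotDl !ReD (hdotC u v) ReJ; lra.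
Qed.
Lemma parallelogram u v :
  hnorm (u + v) ^+ 2 + hnorm (u - v) ^+ 2 = 2 * hnorm u ^+ 2 + 2 * hnorm v ^+ 2.
Proof. by rewrite !hnormD_sqr hdotNr ReN hnormN; lra. Qed.

Lemma cauchy_schwarz u v : cabs (dot u v) <= hnorm u * hnorm v.
Proof.
have [v0|v0] := eqVneq (hnorm v) 0.
  by rewrite (hnorm_eq0 v0) hdot0r cabs0 hnorm0 mulr0.
have vp : 0 < hnorm v ^+ 2 by rewrite exprn_even_gt0.
(* This scalar minimises the norm of [u + a v]; nonnegativity of the minimum is the inequality. *)
pose a : C := - ((hnorm v ^+ 2)^-1)%:C * dot v u.
have h : 0 <= hnorm (u + a *: v) ^+ 2 by rewrite sqr_ge0.
move: h; rewrite hnormD_sqr hnormZ hdotZr /a !cabsM cabsN cabs_real.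
have -> : - ((hnorm v ^+ 2)^-1)%:C * dot v u * dot u v =
    - (((hnorm v ^+ 2)^-1)%:C * (cabs (dot u v) ^+ 2)%:C).
  by rewrite (hdotC u v) -conj_mul !mulNr mulrA.
rewrite (hdotC u v) cabsJ ReN ReZ Re_real.
rewrite ger0_norm ?invr_ge0 ?sqr_ge0 //.
set x := cabs _; set n := hnorm v; set m := hnorm u => h.
rewrite -(@ler_pXn2r _ 2%N) ?nnegrE ?mulr_ge0 ?hnorm_ge0 ?cabs_ge0 // exprMn.
rewrite -ler_pdivrMr // -subr_ge0; apply: (le_trans h).
rewrite le_eqVlt; apply/orP; left; apply/eqP; field.
by rewrite v0.
Qed.

Lemma hnormD u v : hnorm (u + v) <= hnorm u + hnorm v.
Proof.
rewrite -(@ler_pXn2r _ 2%N) ?nnegrE ?addr_ge0 ?hnorm_ge0 // hnormD_sqr.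
have := le_trans (Re_le_cabs _) (cauchy_schwarz u v); nra.
Qed.
Lemma hnormB_le u v w : hnorm (u - w) <= hnorm (u - v) + hnorm (v - w).
Proof. by apply: le_trans (hnormD _ _); rewrite addrA subrK. Qed.
Lemma hnorm_le0 v : hnorm v <= 0 -> v = 0.
Proof. by move=> h; apply: hnorm_eq0; apply/eqP; rewrite eq_le hnorm_ge0 andbT. Qed.
Lemma hdot_inj u v : (forall w, dot w u = dot w v) -> u = v.
Proof.
move=> h; apply/eqP; rewrite -subr_eq0; apply/eqP/hdot_eq0.
by rewrite hdotBr h subrr.
Qed.

Definition closed_subspace (P : H -> Prop) :=
  [/\ P 0, forall a x y, P x -> P y -> P (a *: x + y) &
      forall v, (forall e : R, 0 < e -> exists2 u, P u & hnorm (u - v) < e) -> P v].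

(* A minimising sequence for the distance to P is Cauchy by the parallelogram law. *)
Lemma projection (P : H -> Prop) : closed_subspace P ->
  forall v, exists2 p, P p & forall u, P u -> dot u (v - p) = 0.
Proof.
move=> [P0 Pl Pc] v.
have Ph x y : P x -> P y -> P ((2^-1)%:C *: (x + y)).
  move=> Px Py; rewrite scalerDr -[(2^-1)%:C *: y]addr0; apply: (Pl _ _ _ Px); exact: Pl.
pose E := [set r | exists2 u, P u & r = hnorm (v - u) ^+ 2].
have hE : has_inf E.
  split; first by exists (hnorm (v - 0) ^+ 2), 0.
  by exists 0 => r [u _ ->]; exact: sqr_ge0.
pose d := inf E.
have dle u : P u -> d <= hnorm (v - u) ^+ 2.
  by move=> Pu; apply: (inf_lbound hE.2); exists u.
have dx (e : R) : 0 < e -> exists2 u, P u & hnorm (v - u) ^+ 2 < d + e.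
  by move=> e0; have [r [u Pu ->] h] := inf_adherent e0 hE; exists u.
have close u1 u2 (e : R) : P u1 -> P u2 -> hnorm (v - u1) ^+ 2 < d + e ->
    hnorm (v - u2) ^+ 2 < d + e -> hnorm (u1 - u2) ^+ 2 <= 4 * e.
  move=> P1 P2 h1 h2.
  have := parallelogram (v - u2) (v - u1).
  rewrite [_ - (v - u1)](_ : _ = u1 - u2); last first.
    by rewrite opprB addrC addrA subrK.
  have -> : v - u2 + (v - u1) = (2)%:C *: (v - (2^-1)%:C *: (u1 + u2)).
    rewrite scalerBr scalerA -rmorphM divff // rmorph1 scale1r.
    rewrite (_ : 2%:C = 1 + 1) ?rmorphD // scalerDl scale1r opprD.
    by rewrite addrACA [- u2 + _]addrC.
  rewrite hnormZ cabs_real exprMn (ger0_norm (ler0n _ 2)).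
  have := dle _ (Ph _ _ P1 P2); nra.
have [x hx] : {x : nat -> H | forall n, P (x n) /\ hnorm (v - x n) ^+ 2 < d + n.+1%:R^-1}.
  have : forall n, exists u, P u /\ hnorm (v - u) ^+ 2 < d + n.+1%:R^-1.
    by move=> n; have [|u] := dx n.+1%:R^-1; [rewrite invr_gt0 ltr0n | exists u].
  by move=> /choice[f hf]; exists f.
have cl (e : R) : 0 < e -> exists N, forall m n, (N <= m)%N -> (N <= n)%N ->
    hnorm (x m - x n) ^+ 2 < e.
  move=> e0; have [N _ hN] := near_infty_natSinv_lt (PosNum (divr_gt0 e0 (ltr0Sn R 4))).
  exists N => m n hm hn.
  have h k : (N <= k)%N -> hnorm (v - x k) ^+ 2 < d + e / 5.
    move=> hk; apply: (lt_trans (hx k).2); rewrite ltrD2l; exact: hN.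
  by have := close _ _ _ (hx m).1 (hx n).1 (h _ hm) (h _ hn); lra.
(* [cl] controls squared norms; used at [e ^+ 2], it gives the Cauchy condition because squaring is
   monotone on nonnegative reals. *)
have [p hp] := @hcomplete R H x (fun e e0 => match cl (e ^+ 2) (exprn_gt0 2 e0) with
   ex_intro N hN => ex_intro _ N (fun m n hm hn => etrans (esym (@ltr_pXn2r _ 2%N isT _ _
     (hnorm_ge0 _) (ltW e0))) (hN m n hm hn)) end).
have Pp : P p.
  by apply: Pc => e /hp[N hN]; exists (x N); [exact: (hx N).1 | exact: hN].
exists p => // u Pu.
have dp : hnorm (v - p) ^+ 2 <= d.
  apply/ler_addgt0Pr => e e0.
  pose c := 2 * hnorm (v - p) + 3.
  have c0 : 0 < c by rewrite ltr_wpDl ?mulr_ge0 ?hnorm_ge0.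
  (* With [A = |v - x k|], [B = |x k - p| < r <= 1] and [D = |v - p|], one has [A <= D + B], so the
     excess [2 A B + B^2] is at most [(2 D + 3) B = c B], hence at most [e / 2]. *)
  pose r := Num.min 1 (e / 2 / c).
  have r0 : 0 < r by rewrite lt_min ltr01 !divr_gt0.
  have rc : r * c <= e / 2 by rewrite -ler_pdivlMr // ge_min lexx orbT.
  have r1 : r <= 1 by rewrite ge_min lexx.
  have [N hN] := hp _ r0.
  have [M _ hM] := near_infty_natSinv_lt (PosNum (divr_gt0 e0 (ltr0Sn R 1))).
  pose k := maxn N M.
  have h1 : hnorm (x k - p) < r := hN k (leq_maxl _ _).
  have h2 := (hx k).2; have h3 := hM k (leq_maxr _ _).
  have h4 := hnormB_le v (x k) p; have h8 := hnormB_le v p (x k).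
  have h5 := hnorm_ge0 (v - x k); have h6 := hnorm_ge0 (x k - p).
  rewrite (hnormBC p) in h8; move: h3 h2 => /=; rewrite /c in rc.
  have D0 : 0 <= hnorm (v - p) by exact: hnorm_ge0.
  move: (hnorm (v - x k)) (hnorm (x k - p)) (hnorm (v - p)) k.+1%:R^-1
    h1 h4 h5 h6 h8 rc D0 => A B D s h1 h4 h5 h6 h8 rc D0 h3 h2.
  have h7 : D ^+ 2 <= (A + B) ^+ 2 by rewrite ler_pXn2r // nnegrE addr_ge0.
  have h9 : 2 * A * B + B ^+ 2 <= e / 2.
    have Br : B * (2 * D + 3) <= r * (2 * D + 3) by rewrite ler_wpM2r; lra.
    nra.
  nra.
set z := dot u (v - p).
(* Moving [p] by [t z u] inside [P] cannot shorten the distance to [v]. The choice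
   [t = 1 / (|u|^2 + 1)] below then forces [z = 0]. *)
have key (t : R) : t * (2 * cabs z ^+ 2) <= t ^+ 2 * (cabs z ^+ 2 * hnorm u ^+ 2).
  have Pq : P ((t%:C * z) *: u + p) by exact: Pl.
  have := le_trans dp (dle _ Pq).
  have -> : v - ((t%:C * z) *: u + p) = (v - p) + - ((t%:C * z) *: u).
    by rewrite opprD addrCA addrC.
  rewrite (hnormD_sqr (v - p)) hnormN hnormZ hdotNr ReN hdotZr (hdotC u (v - p)) -/z -mulrA.
  rewrite [z * _]mulrC conj_mul ReZ Re_real cabsM cabs_real !exprMn real_normK ?num_real //.
  nra.
have := key (hnorm u ^+ 2 + 1)^-1.
have n0 : 0 < hnorm u ^+ 2 + 1 by rewrite ltr_wpDl ?sqr_ge0.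
rewrite expr2 -[X in _ <= X]mulrA ler_pM2l ?invr_gt0 // [X in _ <= X]mulrC ler_pdivlMr //.
have := cabs_ge0 z; have := sqr_ge0 (cabs z); have := sqr_ge0 (hnorm u) => h1 h2 h3 h4.
apply: cabs_eq0; apply/eqP; rewrite -sqrf_eq0 eq_le h2 andbT; nra.
Qed.

End hilbert_facts.

Section span.
Variables (R : realType) (H : hilbert R).
Local Notation C := R[i].
Local Notation dot := (@hdot R H).

Definition lcomb (I : Type) (S : I -> H) (c : seq (C * I)) : H :=
  \sum_(p <- c) p.1 *: S p.2.

Definition total (I : Type) (S : I -> H) := forall x : H, (forall i, dot (S i) x = 0) -> x = 0.

Lemma lcomb_cat (I : Type) (S : I -> H) a c d :
  exists e, a *: lcomb S c + lcomb S d = lcomb S e.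
Proof.
exists ([seq (a * p.1, p.2) | p <- c] ++ d).
rewrite /lcomb big_cat big_map scaler_sumr; congr (_ + _).
by apply: eq_bigr => p _; rewrite scalerA.
Qed.

(** The limits of linear combinations form a closed subspace; the residual of the projection of [v]
    onto it is orthogonal to every [S i], hence zero by totality. *)
Lemma total_dense (I : Type) (S : I -> H) : total S ->
  forall v (e : R), 0 < e -> exists c, hnorm (lcomb S c - v) < e.
Proof.
move=> tS v.
pose P v := forall e : R, 0 < e -> exists c, hnorm (lcomb S c - v) < e.
suff : P v by [].
have cP : closed_subspace P.
  split.
  - by move=> e e0; exists [::]; rewrite /lcomb big_nil subr0 hnorm0.
  - move=> a x y hx hy e e0.
    have a1 : 0 < cabs a + 1 by rewrite ltr_wpDl ?cabs_ge0.
    have e2 : 0 < e / 2 by rewrite divr_gt0.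
    have [c hc] := hx _ (divr_gt0 e2 a1); have [d hd] := hy _ e2.
    have [f hf] := lcomb_cat S a c d; exists f; rewrite -hf.
    rewrite opprD addrACA -scalerBr; apply: (le_lt_trans (hnormD _ _)).
    rewrite hnormZ (splitr e) ler_ltD // ltW //.
    move: hc; rewrite ltr_pdivlMr // mulrDr mulr1 mulrC => hc.
    by apply: le_lt_trans hc; rewrite lerDl hnorm_ge0.
  - move=> x hx e e0; have e2 : 0 < e / 2 by rewrite divr_gt0.
    have [u hu hux] := hx _ e2; have [c hc] := hu _ e2; exists c.
    apply: (le_lt_trans (hnormB_le _ u _)); rewrite (splitr e); exact: ltrD.
have [p Pp hp] := projection cP v.
have -> : v = p; last by [].
apply/eqP; rewrite -subr_eq0; apply/eqP/tS => i; apply: hp => e e0.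
by exists [:: (1, i)]; rewrite /lcomb big_seq1 scale1r subrr hnorm0.
Qed.

Lemma hlinearD (V : lmodType C) (f : V -> H) : hlinear f -> forall x y, f (x + y) = f x + f y.
Proof. by move=> lf x y; have := lf 1 x y; rewrite !scale1r. Qed.
Lemma hlinear0 (V : lmodType C) (f : V -> H) : hlinear f -> f 0 = 0.
Proof.
by move=> lf; have := hlinearD lf 0 0; rewrite addr0 => /eqP; rewrite -subr_eq0 opprD addNKr oppr_eq0 => /eqP.
Qed.
Lemma hlinearZ (V : lmodType C) (f : V -> H) : hlinear f -> forall a x, f (a *: x) = a *: f x.
Proof. by move=> lf a x; have := lf a x 0; rewrite !addr0 hlinear0 // addr0. Qed.
Lemma hlinearB (V : lmodType C) (f : V -> H) : hlinear f -> forall x y, f (x - y) = f x - f y.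
Proof. by move=> lf x y; rewrite hlinearD // -scaleN1r hlinearZ // scaleN1r. Qed.
End span.

Section maps.
Variables (R : realType) (H1 H2 : hilbert R).
Local Notation C := R[i].

Lemma hlinear_lcomb (I : Type) (S : I -> H1) (f : H1 -> H2) c : hlinear f ->
  f (lcomb S c) = lcomb (f \o S) c.
Proof.
move=> lf; rewrite /lcomb; elim: c => [|p c IH]; first by rewrite !big_nil hlinear0.
by rewrite !big_cons lf IH.
Qed.

Lemma hiso_norm (f : H1 -> H2) v : hisometric f -> hnorm (f v) = hnorm v.
Proof. by move=> hf; rewrite /hnorm /dnorm hf. Qed.

(** Polarisation: norms determine the real part of the inner product, and replacing [u] by [i u]
    recovers the imaginary part. *)
Lemma hiso_polar (f : H1 -> H2) : hlinear f -> (forall v, hnorm (f v) = hnorm v) ->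
  hisometric f.
Proof.
move=> lf nf; have hre u v : complex.Re (hdot (f u) (f v)) = complex.Re (hdot u v).
  have := hnormD_sqr (f u) (f v); rewrite -hlinearD // !nf hnormD_sqr; lra.
move=> u v; apply/eqP; rewrite eq_complex hre eqxx /=.
have := hre ('i%C *: u) v; rewrite (hlinearZ lf) !hdotZl.
by case: (hdot _ _) => a b; case: (hdot _ _) => c d /=; rewrite !mul0r !sub0r !mulN1r !opprK => ->.
Qed.

Lemma hiso_inj (f : H1 -> H2) : hlinear f -> hisometric f -> injective f.
Proof.
move=> lf hf x y e; apply/eqP; rewrite -subr_eq0; apply/eqP/hnorm_eq0.
by rewrite -(hiso_norm _ hf) hlinearB // e subrr hnorm0.
Qed.

Lemma eq_on_total (I : Type) (S : I -> H1) (f g : H1 -> H2) (k : R) : total S -> 0 <= k ->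
  hlinear f -> hlinear g -> (forall v, hnorm (f v) <= k * hnorm v) ->
  (forall v, hnorm (g v) <= k * hnorm v) -> (forall i, f (S i) = g (S i)) -> f =1 g.
Proof.
move=> tS k0 lf lg bf bg fg v; apply/eqP; rewrite -subr_eq0; apply/eqP/hnorm_le0.
apply: (@le_small _ _ (k + k)) => e e0; have [c hc] := total_dense tS v e0.
have fgc : f (lcomb S c) = g (lcomb S c).
  by rewrite !hlinear_lcomb //; apply: eq_bigr => p _; rewrite /= fg.
apply: (le_trans (hnormB_le _ (f (lcomb S c)) _)); rewrite -hlinearB // fgc -hlinearB //.
rewrite mulrDl; apply: lerD.
  by apply: (le_trans (bf _)); rewrite ler_wpM2l // hnormBC ltW.
by apply: (le_trans (bg _)); rewrite ler_wpM2l // ltW.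
Qed.

Lemma eq_on_total_iso (I : Type) (S : I -> H1) (f g : H1 -> H2) : total S ->
  hlinear f -> hlinear g -> hisometric f -> hisometric g ->
  (forall i, f (S i) = g (S i)) -> f =1 g.
Proof.
move=> tS lf lg jf jg; apply: (@eq_on_total _ _ _ _ 1) => // v.
  by rewrite hiso_norm // mul1r.
by rewrite hiso_norm // mul1r.
Qed.
End maps.

Section gram.
Variables (R : realType) (I : Type).
Local Notation C := R[i].

Lemma gram_lcomb (H1 H2 : hilbert R) (S : I -> H1) (T : I -> H2) :
  (forall i j, hdot (S i) (S j) = hdot (T i) (T j)) ->
  forall c d, hdot (lcomb S c) (lcomb S d) = hdot (lcomb T c) (lcomb T d).
Proof.
move=> ST c d; rewrite /lcomb !hdot_suml; apply: eq_bigr => p _.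
rewrite !hdotZl !hdot_sumr; congr (_ * _).
by apply: eq_bigr => q _; rewrite !hdotZr ST.
Qed.

(** The vector [w] is the limit of the combinations of [T] with the coefficients of combinations of
    [S] that tend to [v]; equality of the Gram matrices transports the Cauchy property. *)
Lemma gram_match (H1 H2 : hilbert R) (S : I -> H1) (T : I -> H2) : total S ->
  (forall i j, hdot (S i) (S j) = hdot (T i) (T j)) ->
  forall v, exists w : H2, forall i, hdot (T i) w = hdot (S i) v.
Proof.
move=> tS ST v; have dotST := gram_lcomb ST.
have nST c d : hnorm (lcomb S c - lcomb S d) = hnorm (lcomb T c - lcomb T d).
  rewrite /hnorm /dnorm; congr (Num.sqrt (complex.Re _)).
  by rewrite !hdotBl !hdotBr !dotST.
have [c hc] : {c : nat -> seq (C * I) | forall n, hnorm (lcomb S (c n) - v) < n.+1%:R^-1}.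
  have : forall n, exists c, hnorm (lcomb S c - v) < n.+1%:R^-1.
    by move=> n; apply: total_dense => //; rewrite invr_gt0 ltr0n.
  by move=> /choice[f hf]; exists f.
have cau (e : R) : 0 < e -> exists N, forall m n, (N <= m)%N -> (N <= n)%N ->
    hnorm (lcomb T (c m) - lcomb T (c n)) < e.
  move=> e0; have [N _ hN] := near_infty_natSinv_lt (PosNum (divr_gt0 e0 (ltr0Sn R 1))).
  exists N => m n hm hn; rewrite -nST; apply: (le_lt_trans (hnormB_le _ v _)).
  rewrite (splitr e) [hnorm (v - _)]hnormBC ltrD // (lt_trans (hc _)) //; exact: hN.
have [w hw] := hcomplete cau; exists w => i.
apply/eqP; rewrite -subr_eq0; apply/eqP/cabs_eq0/eqP; rewrite eq_le cabs_ge0 andbT.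
apply: (@le_small _ _ (hnorm (S i) + hnorm (T i))) => e e0.
have [N hN] := hw _ e0; have [M _ hM] := near_infty_natSinv_lt (PosNum e0).
pose k := maxn N M.
have -> : hdot (T i) w - hdot (S i) v =
    hdot (T i) (w - lcomb T (c k)) + hdot (S i) (lcomb S (c k) - v).
  rewrite !hdotBr.
  have -> : hdot (T i) (lcomb T (c k)) = hdot (S i) (lcomb S (c k)).
    by rewrite !hdot_sumr; apply: eq_bigr => p _; rewrite !hdotZr ST.
  by rewrite addrA subrK.
apply: (le_trans (cabsD _ _)); rewrite addrC mulrDl; apply: lerD.
  apply: (le_trans (cauchy_schwarz _ _)); rewrite ler_wpM2l ?hnorm_ge0 // ltW //.
  apply: (lt_trans (hc _)); apply: hM; exact: leq_maxr.
apply: (le_trans (cauchy_schwarz _ _)); rewrite ler_wpM2l ?hnorm_ge0 // hnormBC ltW //.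
apply: hN; exact: leq_maxl.
Qed.

(** A combination of [T] close to [w] pairs with [w] as the same combination of [S] pairs with [v];
    in the limit [|w|^2 <= |w| |v|]. Used in both directions, this makes the matching of
    [gram_match] isometric. *)
Lemma gram_bound (H1 H2 : hilbert R) (S : I -> H1) (T : I -> H2) : total T ->
  (forall i j, hdot (S i) (S j) = hdot (T i) (T j)) ->
  forall v w, (forall i, hdot (T i) w = hdot (S i) v) -> hnorm w <= hnorm v.
Proof.
move=> tT ST v w vw.
have [->|w0] := eqVneq w 0; first by rewrite hnorm0 hnorm_ge0.
have wp : 0 < hnorm w.
  by rewrite lt_neqAle hnorm_ge0 andbT eq_sym; apply: contra w0 => /eqP/hnorm_eq0 ->.
rewrite -(ler_pM2l wp) -subr_le0; apply: (@le_small _ _ (hnorm v + hnorm w)) => e e0.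
have [d hd] := total_dense tT w e0.
have h1 : hdot (lcomb T d) w = hdot (lcomb S d) v.
  by rewrite !hdot_suml; apply: eq_bigr => p _; rewrite !hdotZl vw.
have h2 : hnorm (lcomb S d) = hnorm (lcomb T d).
  by rewrite /hnorm /dnorm (gram_lcomb ST).
have h3 := cauchy_schwarz (lcomb S d) v; rewrite -h1 h2 in h3.
have h4 := cauchy_schwarz (lcomb T d - w) w; rewrite hdotBl in h4.
have h5 := cabsD (hdot (lcomb T d) w) (- (hdot (lcomb T d) w - hdot w w)).
rewrite cabsN opprB addrC subrK hdot_self cabs_real ger0_norm ?sqr_ge0 // in h5.
rewrite hdot_self in h4.
have h6 := hnormB_le (lcomb T d) w 0; rewrite !subr0 in h6.
have a0 := hnorm_ge0 v; have b0 := hnorm_ge0 w; clear wp w0 h1 h2.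
move: (cabs _) (cabs _) h3 h4 h5 => p q h3 h4 h5.
move: (hnorm (lcomb T d)) (hnorm (lcomb T d - w)) (hnorm v) (hnorm w) a0 b0 h3 h4 h5 h6 hd.
move=> x y a b a0 b0 h3 h4 h5 h6 hd.
have h7 : x * a <= (y + b) * a by rewrite ler_wpM2r.
have h8 : y * (b + a) <= e * (b + a) by rewrite ler_wpM2r ?addr_ge0 // ltW.
lra.
Qed.

(* Two total families with equal Gram matrices are exchanged by a unitary. *)
Lemma gram_unitary (H1 H2 : hilbert R) (S : I -> H1) (T : I -> H2) : total S -> total T ->
  (forall i j, hdot (S i) (S j) = hdot (T i) (T j)) ->
  exists u : H1 -> H2, [/\ hlinear u, hisometric u, forall w, exists v, u v = w &
    forall i, u (S i) = T i].
Proof.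
move=> tS tT ST; have /choice[u hu] := gram_match tS ST.
have uu w w' : (forall i, hdot (T i) w = hdot (T i) w') -> w = w'.
  move=> h; apply/eqP; rewrite -subr_eq0; apply/eqP/tT => i.
  by rewrite hdotBr h subrr.
have lu : hlinear u.
  by move=> a x y; apply: uu => i; rewrite hdotDr hdotZr !hu hdotDr hdotZr.
exists u; split => //.
- apply: hiso_polar => // v; apply: le_anti.
  rewrite (gram_bound tT ST (hu v)) /=.
  exact: (gram_bound tS (fun i j => esym (ST i j)) (fun i => esym (hu v i))).
- move=> w; have [v hv] := gram_match tT (fun i j => esym (ST i j)) w.
  by exists v; apply: uu => i; rewrite hu hv.
- by move=> i; apply: uu => j; rewrite hu ST.
Qed.

End gram.

(** * Equivalence of twisted representations *)

Section twreps.
Variables (R : realType) (G : twgroup R).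
Local Notation C := R[i].

Lemma tw_iso_total (I : Type) (V W : twrep G) (S : I -> V) (T : I -> W) : total S -> total T ->
  (forall i j, hdot (S i) (S j) = hdot (T i) (T j)) ->
  (forall g i, exists (c : C) (j : I), raction V g (S i) = c *: S j /\
    raction W g (T i) = c *: T j) ->
  exists u : V -> W, [/\ hlinear u, hisometric u, forall w, exists v, u v = w,
    forall g v, u (raction V g v) = raction W g (u v) & forall i, u (S i) = T i].
Proof.
move=> tS tT ST gST; have [u [lu iu su uS]] := gram_unitary tS tT ST.
exists u; split => // g.
apply: (eq_on_total_iso tS).
- by move=> a x y; rewrite (ract_lin (raction V)) lu.
- by move=> a x y; rewrite lu (ract_lin (raction W)).
- by move=> x y; rewrite iu (ract_iso (raction V)).
- by move=> x y; rewrite (ract_iso (raction W)) iu.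
- by move=> i; have [c [j [eS eT]]] := gST g i; rewrite uS eS eT (hlinearZ lu) uS.
Qed.

Lemma tw_iso_refl (V : twrep G) : tw_iso V V.
Proof. by exists id; split=> // w; exists w. Qed.

Lemma tw_iso_sym (V W : twrep G) : tw_iso V W -> tw_iso W V.
Proof.
move=> [u [lu iu su gu]]; have /choice[v hv] := su; have uinj := hiso_inj lu iu.
exists v; split => [a x y|x y|w|g w].
- by apply: uinj; rewrite lu !hv.
- by rewrite -iu !hv.
- by exists (u w); apply: uinj; rewrite hv.
- by apply: uinj; rewrite gu !hv.
Qed.

Lemma tw_iso_trans (V W X : twrep G) : tw_iso V W -> tw_iso W X -> tw_iso V X.
Proof.
move=> [u [lu iu su gu]] [v [lv iv sv gv]]; exists (v \o u); split => [a x y|x y|w|g w] /=.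
- by rewrite lu lv.
- by rewrite iv iu.
- by have [y <-] := sv w; have [x <-] := su y; exists x.
- by rewrite gu gv.
Qed.

Lemma irreducible_iso (V W : twrep G) : tw_iso V W -> irreducible V -> irreducible W.
Proof.
move=> [u [lu iu su gu]] [[v v0] irr]; split.
  exists (u v) => uv0; apply: v0; apply: (hiso_inj lu iu); by rewrite uv0 hlinear0.
move=> P [P0 Pl Pg Pc]; have [|h|h] := irr (fun x => P (u x)).
- split; first by rewrite hlinear0.
  + by move=> a x y hx hy; rewrite lu; exact: Pl.
  + by move=> g x hx; rewrite gu; exact: Pg.
  + move=> x hx; apply: Pc => e /hx[y Py hy]; exists (u y) => //.
    by rewrite -hlinearB // hiso_norm.
- by left=> w Pw; have [x xw] := su w; rewrite -xw (h x) ?hlinear0 // xw.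
- by right=> w; have [x <-] := su w; exact: h.
Qed.

Lemma fclass_iso (V W : twrep G) : tw_iso V W -> forall Z, fclass V Z = fclass W Z.
Proof.
move=> h Z; rewrite /fclass; congr (if _ then _ else _); apply/asbool_equiv_eq.
split => k; last exact: tw_iso_trans k.
exact: tw_iso_trans (tw_iso_sym h) k.
Qed.

End twreps.

(** The three-term splitting of strong continuity estimates: with [c] and [d] the images of an
    approximating vector, the first two differences are small by isometry and the last by continuity
    on the approximation. *)
Lemma subr_decomp (V : zmodType) (a b c d : V) : a - b = (a - c) - (b - d) + (c - d).
Proof. by rewrite opprB addrACA subrK [d - b]addrC addrK. Qed.

Lemma eq_ler (R : numDomainType) (x y : R) : x = y -> x <= y.
Proof. by move=> ->. Qed.

(** * Weighted l2 spaces *)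

Section riesz.
Variables (R : realType) (H : hilbert R).
Local Notation C := R[i].

(** A nonzero functional is represented on the line orthogonal to its kernel, which is spanned by
    the residual [y] of any [v0] with [phi v0] nonzero. *)
Lemma riesz (phi : H -> C) (k : R) : (forall a x y, phi (a *: x + y) = a * phi x + phi y) ->
  (forall v, cabs (phi v) <= k * hnorm v) -> exists u, forall v, phi v = hdot u v.
Proof.
move=> lphi bphi.
have phi0 : phi 0 = 0.
  by have := lphi (-1) 0 0; rewrite scaler0 addr0 mulN1r addNr.
have [[v0 hv0]|h] := pselect (exists v, phi v <> 0); last first.
  exists 0 => v; rewrite hdot0l; apply: contrapT => hv; apply: h; by exists v.
pose P v := phi v = 0.
have cP : closed_subspace P.
  split=> // [a x y|v hv]; first by rewrite /P lphi => -> ->; rewrite mulr0 addr0.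
  apply: cabs_eq0; apply/eqP; rewrite eq_le cabs_ge0 andbT.
  apply: (@le_small _ _ `|k|) => e /hv[u Pu hu].
  have -> : phi v = phi (v - u).
    by rewrite -[in LHS](subrK u v) -[v - u + u]scale1r scalerDr lphi scale1r Pu addr0 mul1r.
  apply: (le_trans (bphi _)); apply: (@le_trans _ _ (`|k| * hnorm (v - u))).
    by rewrite ler_wpM2r ?hnorm_ge0 // ler_norm.
  by rewrite ler_wpM2l // hnormBC ltW.
have [p Pp hp] := projection cP v0.
pose y := v0 - p.
have py : phi y = phi v0.
  by rewrite /y -[in LHS]addrC -scaleN1r lphi Pp mulr0 add0r.
have pyN : phi y != 0 by rewrite py; apply/eqP.
have yN : hdot y y != 0.
  by apply/eqP => /hdot_eq0 y0; move/eqP: pyN; rewrite y0 phi0.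
(* The conjugate compensates for the antilinearity of [hdot] in its first argument. *)
exists (conjc (phi y / hdot y y) *: y) => v.
have Pv : P (- (phi v / phi y) *: y + v) by rewrite /P lphi mulNr divfK // addNr.
have := hp _ Pv; rewrite -/y hdotC => /(congr1 (@conjc R)); rewrite conjcK conjc0.
rewrite hdotDr hdotZr => e; rewrite (hdotZl (conjc _) y v) (conjcK (phi y / hdot y y)).
have -> : hdot y v = (phi v / phi y) * hdot y y.
  by apply/eqP; rewrite -subr_eq0 -e; apply/eqP; ring.
by field; rewrite pyN yN.
Qed.

(** Turns integrals of matrix coefficients into operators, so that no vector-valued function has to
    be integrated. *)
Lemma riesz_op (B : H -> H -> C) (k : R) :
  (forall a x y w, B (a *: x + y) w = a^* * B x w + B y w) ->
  (forall v w, cabs (B v w) <= k * (hnorm v * hnorm w)) ->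
  exists T : H -> H, forall v w, B v w = hdot v (T w).
Proof.
move=> lB bB.
have : forall w, exists u, forall v, B v w = hdot v u.
  move=> w; have [||u hu] := @riesz (fun v => (B v w)^*) (k * hnorm w).
  - by move=> a x y; rewrite lB rmorphD rmorphM /= conjcK.
  - by move=> v; rewrite cabsJ; apply: (le_trans (bB _ _)); rewrite -mulrA [hnorm w * _]mulrC.
  by exists u => v; rewrite hdotC -hu conjcK.
by move=> /choice[T hT]; exists T.
Qed.
End riesz.

Section l2_facts.
Variables (R : realType) (I : choiceType) (w : I -> R).
Hypothesis w0 : forall i, 0 < w i.
Local Notation C := R[i].
Local Notation L := (l2hilbert w0).
Implicit Types (A B : {fset I}) (f g : L).

Definition lfun (f : L) : I -> C := l2fun f.
Arguments lfun : simpl never.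

Lemma l2_eq f g : lfun f =1 lfun g -> f = g.
Proof. by move=> h; apply/val_inj/funext. Qed.
Lemma lfunD f g i : lfun (f + g) i = lfun f i + lfun g i. Proof. by []. Qed.
Lemma lfunZ a f i : lfun (a *: f) i = a * lfun f i. Proof. by []. Qed.
Lemma lfunB f g i : lfun (f - g) i = lfun f i - lfun g i. Proof. by []. Qed.
Lemma lfun0 i : lfun 0 i = 0. Proof. by []. Qed.
Lemma lfun_sum (J : Type) (r : seq J) (P : pred J) (F : J -> L) i :
  lfun (\sum_(j <- r | P j) F j) i = \sum_(j <- r | P j) lfun (F j) i.
Proof. exact: (big_morph (fun f => lfun f i) (fun x y => lfunD x y i) (lfun0 i)). Qed.

Lemma l2_norm_ge f A : \sum_(i <- A) w i * sqc (lfun f i) <= hnorm f ^+ 2.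
Proof. by rewrite hnorm_sqr; have [s [hs _ h _]] := l2dot_self w0 f; rewrite [hdot _ _]hs. Qed.
Lemma l2_norm_le f (M : R) : (forall A, \sum_(i <- A) w i * sqc (lfun f i) <= M) ->
  hnorm f ^+ 2 <= M.
Proof.
move=> hM; rewrite hnorm_sqr; have [s [hs _ _ h]] := l2dot_self w0 f.
by rewrite [hdot _ _]hs; apply: h.
Qed.
Lemma l2_ex (F : I -> C) (M : R) : (forall A, \sum_(i <- A) w i * sqc (F i) <= M) ->
  exists f : L, lfun f =1 F.
Proof.
move=> h; have hF : F \in l2pred w by apply/asboolP; exists M.
by exists (L2 hF).
Qed.
Lemma sqc0 : sqc (0 : C) = 0. Proof. by rewrite /sqc /= expr0n addr0. Qed.

Lemma l2_pred_dom (F G : I -> C) : (forall i, cabs (F i) <= cabs (G i)) ->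
  G \in l2pred w -> F \in l2pred w.
Proof.
move=> FG /asboolP[M hM]; apply/asboolP; exists M => A; apply: le_trans (hM A).
apply: ler_sum => i _; rewrite ler_wpM2l ?(ltW (w0 i)) // -!cabs_sqc.
by rewrite ler_pXn2r ?nnegrE ?cabs_ge0.
Qed.

Lemma l2_dom f g (c : R) : 0 <= c -> (forall i, cabs (lfun f i) <= c * cabs (lfun g i)) ->
  hnorm f <= c * hnorm g.
Proof.
move=> c0 h; rewrite -(@ler_pXn2r _ 2%N) ?nnegrE ?mulr_ge0 ?hnorm_ge0 //.
apply: l2_norm_le => A; rewrite exprMn; apply: le_trans (ler_wpM2l (sqr_ge0 c) (l2_norm_ge g A)).
rewrite mulr_sumr; apply: ler_sum => i _; rewrite mulrCA ler_wpM2l ?(ltW (w0 i)) //.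
rewrite -!cabs_sqc -exprMn ler_pXn2r ?nnegrE ?mulr_ge0 ?cabs_ge0 //.
Qed.

Lemma l2_coord f i : Num.sqrt (w i) * cabs (lfun f i) <= hnorm f.
Proof.
rewrite -(@ler_pXn2r _ 2%N) ?nnegrE ?mulr_ge0 ?hnorm_ge0 ?cabs_ge0 ?sqrtr_ge0 //.
rewrite exprMn sqr_sqrtr ?(ltW (w0 i)) // cabs_sqc.
by have := l2_norm_ge f [fset i]%fset; rewrite big_seq_fset1.
Qed.

Lemma fset_suppP (F : I -> C) : finsup F -> exists A, forall i, i \notin A -> F i = 0.
Proof.
move=> hF; exists (fset_set [set x | F x != 0]) => i.
rewrite in_fset_set // => /negP h; apply/eqP; apply/negPn/negP => h2; apply: h.
by rewrite inE.
Qed.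
Lemma finsupP (F : I -> C) A : (forall i, i \notin A -> F i = 0) -> finsup F.
Proof.
move=> h; apply: (@sub_finite_set _ _ [set` A]) => //.
move=> i /=; apply: contraNT => hi; by rewrite h.
Qed.
Lemma big_supp (F : I -> R) A B : (forall i, i \notin A -> F i = 0) -> (forall i, 0 <= F i) ->
  \sum_(i <- B) F i <= \sum_(i <- A) F i.
Proof.
move=> h F0; apply: (@le_trans _ _ (\sum_(i <- (A `|` B)%fset) F i)).
  by apply: fsum_le => //; exact: fsubsetUr.
rewrite le_eqVlt; apply/orP; left; apply/eqP/esym/big_fset_incl; first exact: fsubsetUl.
by move=> i _; exact: h.
Qed.
Lemma finsup_ex (F : I -> C) : finsup F -> exists f : L, lfun f =1 F.
Proof.
move=> /fset_suppP[A hA]; apply: (@l2_ex _ (\sum_(i <- A) w i * sqc (F i))) => B.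
by apply: big_supp => i; [move/hA => ->; rewrite sqc0 mulr0 | rewrite mulr_ge0 ?sqc_ge0 ?ltW].
Qed.

Lemma is_usum_fin (F : I -> C) A : (forall i, i \notin A -> F i = 0) ->
  is_usum F (\sum_(i <- A) F i).
Proof.
move=> hA e e0; exists A => B AB.
rewrite (_ : \sum_(i <- B) F i = \sum_(i <- A) F i) ?subrr ?normr0 ?ltcR //.
by apply/esym/big_fset_incl => // i _; exact: hA.
Qed.

Lemma hdot_supp f g A : (forall i, i \notin A -> lfun g i = 0) ->
  hdot f g = \sum_(i <- A) (w i)%:C * ((lfun f i)^* * lfun g i).
Proof.
by move=> hA; apply: usumE; apply: is_usum_fin => i /hA hi; rewrite -/(lfun g i) hi !mulr0.
Qed.

Fact delta_subproof i : exists f : L, lfun f =1 (fun j => (j == i)%:R).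
Proof.
apply: finsup_ex; apply: (@finsupP _ [fset i]%fset) => j; rewrite inE => /negPf ->.
by [].
Qed.
Definition delta i : L := sval (cid (delta_subproof i)).
Lemma deltaE i j : lfun (delta i) j = (j == i)%:R.
Proof. exact: (svalP (cid (delta_subproof i))). Qed.

Lemma hdot_deltar f i : hdot f (delta i) = (w i)%:C * (lfun f i)^*.
Proof.
rewrite (@hdot_supp _ _ [fset i]%fset) => [|j]; last by rewrite inE deltaE => /negPf ->.
by rewrite big_seq_fset1 deltaE eqxx mulr1.
Qed.
Lemma hdot_deltal f i : hdot (delta i) f = (w i)%:C * lfun f i.
Proof. by rewrite hdotC hdot_deltar rmorphM /= conjcK oppr0. Qed.
Lemma wC_neq0 i : (w i)%:C != 0 :> C.
Proof. by rewrite (inj_eq (@complexI R)) gt_eqF. Qed.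
Lemma delta_total : total delta.
Proof.
move=> f h; apply: l2_eq => i; have /eqP := h i.
by rewrite hdot_deltal mulf_eq0 (negPf (wC_neq0 i)) => /eqP ->.
Qed.
Lemma hdot_delta i j : hdot (delta i) (delta j) = if i == j then (w i)%:C else 0.
Proof. by rewrite hdot_deltal deltaE; case: eqP => _; rewrite ?mulr1 ?mulr0. Qed.

Fact trunc_subproof A f : exists g : L, lfun g =1 (fun i => if i \in A then lfun f i else 0).
Proof. by apply: finsup_ex; apply: (@finsupP _ A) => i /negPf ->. Qed.
Definition trunc A f : L := sval (cid (trunc_subproof A f)).
Lemma truncE A f i : lfun (trunc A f) i = if i \in A then lfun f i else 0.
Proof. exact: (svalP (cid (trunc_subproof A f))). Qed.
Lemma trunc_finsup A f : finsup (lfun (trunc A f)).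
Proof. by apply: (@finsupP _ A) => i /negPf hi; rewrite truncE hi. Qed.

(** The squared norm is the least upper bound of its finite partial sums, so some finite [A]
    captures all but [(e / 2)^2] of it; for larger [B] any finite sum of the remainder lives outside
    [B] and fits into what is left. *)
Lemma trunc_cvg f (e : R) : 0 < e ->
  exists A, forall B, (A `<=` B)%fset -> hnorm (f - trunc B f) < e.
Proof.
move=> e0; have e2 : 0 < (e / 2) ^+ 2 by rewrite exprn_gt0 // divr_gt0.
have [A hA] : exists A, hnorm f ^+ 2 - (e / 2) ^+ 2 < \sum_(i <- A) w i * sqc (lfun f i).
  apply: contrapT => h; have : hnorm f ^+ 2 <= hnorm f ^+ 2 - (e / 2) ^+ 2; last by lra.
  by apply: l2_norm_le => A; rewrite leNgt; apply/negP => hA; apply: h; exists A.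
exists A => B AB; apply: (@le_lt_trans _ _ (e / 2)); last by rewrite gtr_pMr // invf_lt1 ?ltr1n.
rewrite -(@ler_pXn2r _ 2%N) ?nnegrE ?hnorm_ge0 ?divr_ge0 ?(ltW e0) //.
apply: l2_norm_le => D.
pose F i := w i * sqc (lfun f i).
have F0 i : 0 <= F i by exact: wsqc_ge0.
have h1 := fsum_le F0 AB; have h2 := l2_norm_ge f (B `|` D)%fset.
suff : \sum_(i <- D) w i * sqc (lfun (f - trunc B f) i) + \sum_(i <- B) F i <=
       \sum_(i <- (B `|` D)%fset) F i.
  by move: h1 h2 hA; rewrite /F; lra.
rewrite [X in _ <= X](big_fsetID _ (mem B)) /= [X in _ <= X]addrC.
have -> : [fset x in (B `|` D)%fset | x \in B]%fset = B.
  by apply/fsetP => x; rewrite !inE /=; case: (x \in B); rewrite ?andbF ?andbT.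
rewrite lerD2r; set E := [fset x in _ | _]%fset.
rewrite (big_fsetID _ (mem B) D) /= [X in X + _]big1_fset ?add0r; last first.
  by move=> i; rewrite !inE /= => /andP[_ iB] _; rewrite (lfunB f (trunc B f)) truncE iB subrr sqc0 mulr0.
apply: (@le_trans _ _ (\sum_(i <- [fset x | x in D & x \notin B]%fset) F i)).
  rewrite [X in X <= _]big_seq [X in _ <= X]big_seq; apply: ler_sum => i.
  by rewrite !inE /= => /andP[_ /negPf iB]; rewrite (lfunB f (trunc B f)) truncE iB subr0.
apply: fsum_le => //; apply/fsubsetP => i; rewrite !inE /= => /andP[-> ->].
by rewrite orbT.
Qed.

Section mult.
Variable T : topologicalType.
Variable m : T -> I -> C.
Hypothesis m1 : forall t i, cabs (m t i) = 1.

Fact mult_subproof t f : exists g : L, lfun g =1 (fun i => m t i * lfun f i).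
Proof.
have h : (fun i => m t i * lfun f i) \in l2pred w.
  by apply: (@l2_pred_dom _ (lfun f)) (l2P f) => i; rewrite cabsM m1 mul1r.
by exists (L2 h).
Qed.
Definition mult t f : L := sval (cid (mult_subproof t f)).
Lemma multE t f i : lfun (mult t f) i = m t i * lfun f i.
Proof. exact: (svalP (cid (mult_subproof t f))). Qed.
Lemma mult_lin t : hlinear (mult t).
Proof. by move=> a f g; apply: l2_eq => i; rewrite lfunD lfunZ !multE lfunD lfunZ; ring. Qed.
Lemma mult_norm t f : hnorm (mult t f) = hnorm f.
Proof.
apply/eqP; rewrite eq_le -[X in _ <= X]mul1r l2_dom /= => [|//|i]; last first.
  by rewrite multE cabsM m1.
rewrite -[X in _ <= X]mul1r; apply: l2_dom => // i.
by rewrite multE cabsM m1 !mul1r.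
Qed.
Lemma mult_iso t : hisometric (mult t).
Proof. by apply: hiso_polar; [exact: mult_lin | exact: mult_norm]. Qed.

(** Multipliers of modulus one are isometric for every [t], so the tail of [f] is harmless and only
    the finitely many functions [m _ i] with [i] in a truncation have to be continuous together. *)
Lemma mult_cont f t0 (e : R) : (forall i, continuous (fun t => m t i : C^o)) -> 0 < e ->
  \forall t \near t0, hnorm (mult t f - mult t0 f) < e.
Proof.
move=> cm e0; have e4 : 0 < e / 4 by rewrite divr_gt0.
have [A /(_ A (fsubset_refl A)) hA] := trunc_cvg f e4.
have n1 : 0 < hnorm f + 1 by rewrite ltr_wpDl ?hnorm_ge0.
pose d := e / 4 / (hnorm f + 1); have d0 : 0 < d by rewrite !divr_gt0.
have : \forall t \near t0, forall i, i \in (A : seq I) -> cabs (m t i - m t0 i) < d.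
  elim: (A : seq I) => [|i s IH]; first by near=> t.
  have hi : \forall t \near t0, cabs (m t i - m t0 i) < d.
    have dC : 0 < d%:C :> C^o by rewrite ltcR.
    have /fcvgrPdist_lt/(_ _ dC) := cm i t0.
    by move=> h; near=> t; rewrite -ltcR -cabsE distrC; near: t; exact: h.
  near=> t; move=> j; rewrite inE => /orP[/eqP ->|]; first by near: t.
  by move: j; near: t.
apply: filterS => t ht.
have dl u v : mult t (u - v) = mult t u - mult t v by rewrite hlinearB //; exact: mult_lin.
have dl0 u v : mult t0 (u - v) = mult t0 u - mult t0 v by rewrite hlinearB //; exact: mult_lin.
have -> : mult t f - mult t0 f = mult t (f - trunc A f) - mult t0 (f - trunc A f)
     + (mult t (trunc A f) - mult t0 (trunc A f)).
  by rewrite dl dl0; exact: subr_decomp.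
apply: (le_lt_trans (hnormD _ _)).
have h1 : hnorm (mult t (f - trunc A f) - mult t0 (f - trunc A f)) <= e / 4 + e / 4.
  apply: (le_trans (hnormD _ _)); rewrite hnormN !mult_norm lerD // ltW //.
have h2 : hnorm (mult t (trunc A f) - mult t0 (trunc A f)) <= e / 4.
  apply: (@le_trans _ _ (d * hnorm f)); last first.
    by rewrite /d mulrAC ler_pdivrMr // ler_wpM2l ?(ltW e4) // lerDl.
  apply: l2_dom; first exact: ltW.
  move=> i; rewrite lfunB !multE -mulrBl cabsM truncE; case: ifP => iA.
    by rewrite ler_wpM2r ?cabs_ge0 // ltW // ht.
  by rewrite cabs0 mulr0 mulr_ge0 ?cabs_ge0 // ltW.
lra.
Unshelve. all: by end_near.
Qed.
End mult.
End l2_facts.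

(** * Slicing an l2 space over a product index set *)

Section fibres.
Variables (R : realType) (X I J : choiceType).
Variables (wX : X -> R) (wI : I -> R) (wJ : J -> R).
Hypotheses (X0 : forall x, 0 < wX x) (I0 : forall i, 0 < wI i) (J0 : forall j, 0 < wJ j).
Variables (e : I -> J -> X) (pI : X -> I) (pJ : X -> J).
Hypotheses (eK : forall x, e (pI x) (pJ x) = x) (eI : forall i j, pI (e i j) = i)
  (eJ : forall i j, pJ (e i j) = j) (we : forall i j, wX (e i j) = wI i * wJ j).
Local Notation C := R[i].
Local Notation LX := (l2hilbert X0).
Local Notation LJ := (l2hilbert J0).

Lemma e_inj i : injective (e i).
Proof. by move=> j j' /(congr1 pJ); rewrite !eJ. Qed.

Fact fib_subproof i (f : LX) : exists g : LJ, lfun g =1 (fun j => lfun f (e i j)).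
Proof.
apply: (@l2_ex _ _ _ _ _ (hnorm f ^+ 2 / wI i)) => A.
rewrite ler_pdivlMr // mulr_suml.
apply: le_trans (l2_norm_ge f (e i @` A)%fset).
rewrite big_imfset /=; last by move=> j j' _ _; exact: e_inj.
by apply: ler_sum => j _; rewrite we; apply: eq_ler; ring.
Qed.
(** The substitute for Hilbert tensor products: when [e] identifies [X] with [I x J] and weights
    multiply, a vector over [X] is a square summable family of vectors over [J]. *)
Definition fib i f : LJ := sval (cid (fib_subproof i f)).
Lemma fibE i f j : lfun (fib i f) j = lfun f (e i j).
Proof. exact: (svalP (cid (fib_subproof i f))). Qed.
Lemma fib_lin i : hlinear (fib i).
Proof. by move=> a f g; apply: l2_eq => j; rewrite lfunD lfunZ !fibE. Qed.
Lemma fib_inj f g : (forall i, fib i f = fib i g) -> f = g.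
Proof. by move=> h; apply: l2_eq => x; rewrite -(eK x) -!fibE h. Qed.

(** The points [D] outside the fibres over [F] make the induction go through: the norm of one fibre
    is a supremum of finite sums, and each such sum is moved into [D] before the induction
    hypothesis is applied. *)
Lemma fib_sum_aux (f : LX) (F : seq I) (D : {fset X}) : uniq F ->
  (forall x, x \in D -> pI x \notin F) ->
  \sum_(i <- F) wI i * hnorm (fib i f) ^+ 2 + \sum_(x <- D) wX x * sqc (lfun f x) <= hnorm f ^+ 2.
Proof.
elim: F D => [|i F IH] D; first by move=> _ _; rewrite big_nil add0r l2_norm_ge.
move=> /= /andP[iF uF] hD; rewrite big_cons -addrA [_ + (_ + _)]addrC -lerBrDl.
rewrite mulrC -ler_pdivlMr //; apply: l2_norm_le => A.
rewrite ler_pdivlMr // mulr_suml lerBrDl.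
pose D' := (D `|` (e i @` A))%fset.
have hD' x : x \in D' -> pI x \notin F.
  rewrite inE => /orP[/hD|/imfsetP[j /= _ ->]]; last by rewrite eI.
  by rewrite inE negb_or => /andP[].
apply: le_trans (IH D' uF hD'); rewrite -addrA lerD2l.
rewrite (big_fsetID _ (mem D) D') /=; apply: lerD.
  rewrite (_ : [fset x in D' | x \in D]%fset = D) //.
  by apply/fsetP => x; rewrite !inE /=; case: (x \in D); rewrite ?andbF.
rewrite (_ : [fset x in D' | x \notin D]%fset = (e i @` A)%fset); last first.
  apply/fsetP => x; rewrite !inE /=; apply/idP/idP => [/andP[/orP[->//|//]]|].
  move=> h; rewrite h orbT /=; apply/negP => /hD; move/imfsetP: h => [j /= _ ->].
  by rewrite eI inE eqxx.
rewrite big_imfset /=; last by move=> j j' _ _; exact: e_inj.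
by apply: ler_sum => j _; rewrite we fibE; apply: eq_ler; ring.
Qed.
Lemma fib_sum (f : LX) (F : {fset I}) :
  \sum_(i <- F) wI i * hnorm (fib i f) ^+ 2 <= hnorm f ^+ 2.
Proof.
have := @fib_sum_aux f F fset0 (fset_uniq F); rewrite big_seq_fset0 addr0.
by apply=> x; rewrite inE.
Qed.

Lemma fib_sum_le (G : X -> C) (g : I -> LJ) (A : {fset X}) :
  (forall i j, G (e i j) = lfun (g i) j) ->
  \sum_(x <- A) wX x * sqc (G x) <= \sum_(i <- (pI @` A)%fset) wI i * hnorm (g i) ^+ 2.
Proof.
move=> Gg; rewrite (@partition_big_imfset _ _ _ _ _ pI); apply: ler_sum => i _.
have [T hT] : exists T : {fset X}, forall x, (x \in T) = (x \in A) && (pI x == i).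
  by exists [fset x in A | pI x == i]%fset => x; rewrite !inE.
have -> : \sum_(x <- A | pI x == i) wX x * sqc (G x) = \sum_(x <- T) wX x * sqc (G x).
  rewrite -big_filter; apply: perm_big; apply: uniq_perm => [||x].
  - by rewrite filter_uniq // fset_uniq.
  - exact: fset_uniq.
  - by rewrite mem_filter hT andbC.
apply: (le_trans _ (ler_wpM2l (ltW (I0 i)) (l2_norm_ge (g i) (pJ @` T)%fset))).
rewrite big_imfset /=; last first.
  move=> x y; rewrite !hT => /andP[_ /eqP xi] /andP[_ /eqP yi] h.
  by rewrite -(eK x) -(eK y) h xi yi.
rewrite mulr_sumr [X in X <= _]big_seq [X in _ <= X]big_seq.
apply: ler_sum => x; rewrite hT => /andP[_ /eqP xi]; apply: eq_ler.
by rewrite -{1 2}(eK x) we Gg xi mulrA.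
Qed.

Lemma fib_le (f : LX) (M : R) :
  (forall F : {fset I}, \sum_(i <- F) wI i * hnorm (fib i f) ^+ 2 <= M) -> hnorm f ^+ 2 <= M.
Proof.
move=> hM; apply: l2_norm_le => A; apply: le_trans (hM (pI @` A)%fset).
by apply: (@fib_sum_le (lfun f) (fun i => fib i f)) => i j; rewrite fibE.
Qed.

Lemma fib_glue (g : I -> LJ) (M : R) :
  (forall F : {fset I}, \sum_(i <- F) wI i * hnorm (g i) ^+ 2 <= M) ->
  exists f : LX, forall i, fib i f = g i.
Proof.
move=> hM.
have [|f hf] := @l2_ex _ _ _ X0 (fun x => lfun (g (pI x)) (pJ x)) M.
  move=> A; apply: le_trans (hM (pI @` A)%fset).
  by apply: (@fib_sum_le _ g) => i j; rewrite eI eJ.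
by exists f => i; apply: l2_eq => j; rewrite fibE hf eI eJ.
Qed.

(** The source of the group actions on induced spaces and on sections: permute the fibres and act
    isometrically on each. The two norm inequalities compare finite families of fibres along [s] and
    along its inverse [t]. *)
Lemma fib_op (s t : I -> I) (A : I -> LJ -> LJ) (f : LX) :
  cancel s t -> cancel t s -> (forall i, wI (s i) = wI i) ->
  (forall i v, hnorm (A i v) = hnorm v) ->
  exists f' : LX, (forall i, fib i f' = A i (fib (s i) f)) /\ hnorm f' = hnorm f.
Proof.
move=> st ts ws nA.
have le1 (F : {fset I}) : \sum_(i <- F) wI i * hnorm (A i (fib (s i) f)) ^+ 2 <= hnorm f ^+ 2.
  apply: le_trans (fib_sum f (s @` F)%fset).
  rewrite big_imfset /=; last by move=> i j _ _; exact: (can_inj st).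
  by apply: ler_sum => i _; rewrite nA ws.
have [f' hf'] := fib_glue le1; exists f'; split=> //.
apply/eqP; rewrite -(@eqrXn2 _ 2%N) ?hnorm_ge0 // eq_le; apply/andP; split.
  by apply: fib_le => F; under eq_bigr do rewrite hf'; exact: le1.
apply: fib_le => F; apply: le_trans (fib_sum f' (t @` F)%fset).
rewrite big_imfset /=; last by move=> i j _ _; exact: (can_inj ts).
by apply: ler_sum => i _; rewrite hf' nA ts -(ws (t i)) ts.
Qed.
End fibres.

(** * Integrals of continuous functions of a real variable *)

Section integrals.
Variable R : realType.
Local Notation mu := (@lebesgue_measure R).
Implicit Types (F P : R -> R) (a b c x T : R).

Definition rint a b F : R := Rintegral mu `[a, b] F.

Lemma cont_integrable F a b : continuous F -> mu.-integrable `[a, b] (EFin \o F).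
Proof.
move=> cF; apply: continuous_compact_integrable; first exact: segment_compact.
exact: continuous_subspaceT.
Qed.

Lemma is_derive_cont F x d : is_derive x 1 F d -> {for x, continuous F}.
Proof. by move=> [h _]; apply: differentiable_continuous; apply/derivable1_diffP. Qed.

Lemma ftc F P a b : a <= b -> continuous F ->
  (forall x, a <= x <= b -> is_derive x 1 P (F x)) -> rint a b F = P b - P a.
Proof.
rewrite le_eqVlt => /predU1P[->|ab] cF dP; first by rewrite /rint set_itv1 Rintegral_set1 subrr.
rewrite /rint /Rintegral (@continuous_FTC2 _ F P a b ab) //.
- exact: continuous_subspaceT.
- split.
  + move=> x; rewrite in_itv /= => /andP[ax xb].
    by have [] := dP x; rewrite ?(ltW ax) ?(ltW xb).
  + apply: cvg_at_right_filter; apply: (@is_derive_cont P a (F a)); apply: dP.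
    by rewrite lexx ltW.
  + apply: cvg_at_left_filter; apply: (@is_derive_cont P b (F b)); apply: dP.
    by rewrite lexx ltW.
- move=> x; rewrite in_itv /= => /andP[ax xb].
  rewrite derive1E; have hx : a <= x <= b by rewrite !ltW.
  by have [_ ->] := dP x hx.
Qed.

(** The integral is based at [- M], so the primitive is good on a bounded interval only; [big_bound]
    supplies an [M] beyond the finitely many endpoints of each application. *)
Lemma primitive F (M : R) : continuous F ->
  exists P, forall x : R, `|x| < M -> is_derive x 1 P (F x).
Proof.
move=> cF; exists (fun x => rint (- M) x F) => x; rewrite ltr_norml => /andP[Mx xM].
have [d e] := @continuous_FTC1_closed R F (- M) x M xM (cont_integrable _ _ cF) Mx (cF x).
rewrite derive1E in e; exact: (DeriveDef d e).
Qed.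

Lemma mvt F P a b : a <= b -> (forall x, a <= x <= b -> is_derive x 1 P (F x)) ->
  exists2 c, a <= c <= b & P b - P a = F c * (b - a).
Proof.
move=> ab dP; have [||c] := @MVT_segment _ P F a b ab.
- by move=> x; rewrite in_itv /= => /andP[ax xb]; apply: dP; rewrite !ltW.
- have h x : x \in `[a, b] -> {for x, continuous P}.
    by rewrite in_itv /= => hx; exact: (is_derive_cont (dP x hx)).
  by apply: continuous_in_subspaceT => x /set_mem /= hx; apply: h.
by rewrite in_itv /= => h e; exists c.
Qed.

Lemma big_bound (s : seq R) : exists2 M : R, 0 < M & forall x, x \in s -> `|x| < M.
Proof.
elim: s => [|y s [M M0 hM]]; first by exists 1.
exists (M + `|y| + 1).
  by rewrite ltr_wpDl // addr_ge0 ?normr_ge0 // ltW.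
move=> x; rewrite inE => /orP[/eqP ->|/hM h]; first by have := M0; lra.
by have := normr_ge0 y; lra.
Qed.

Lemma rint_mvt F a b : a <= b -> continuous F ->
  exists2 c, a <= c <= b & rint a b F = F c * (b - a).
Proof.
move=> ab cF; have [M M0 hM] := big_bound [:: a; b].
have [P hP] := primitive M cF.
have dP x : a <= x <= b -> is_derive x 1 P (F x).
  move=> /andP[ax xb]; apply: hP.
  have := hM a; have := hM b; rewrite !inE !eqxx orbT /= => /(_ isT) + /(_ isT).
  by rewrite !ltr_norml; lra.
by rewrite (ftc ab cF dP); exact: mvt.
Qed.

Lemma rint_cat F a b c : a <= b -> b <= c -> continuous F ->
  rint a c F = rint a b F + rint b c F.
Proof.
move=> ab bc cF; have [M M0 hM] := big_bound [:: a; c].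
have [P hP] := primitive M cF.
have dP x : a <= x <= c -> is_derive x 1 P (F x).
  move=> /andP[ax xb]; apply: hP.
  have := hM a; have := hM c; rewrite !inE !eqxx orbT /= => /(_ isT) + /(_ isT).
  by rewrite !ltr_norml; lra.
have e1 : rint a c F = P c - P a by apply: ftc => //; exact: le_trans bc.
have e2 : rint a b F = P b - P a.
  by apply: ftc => // x /andP[h1 h2]; apply: dP; rewrite h1 (le_trans h2).
have e3 : rint b c F = P c - P b.
  by apply: ftc => // x /andP[h1 h2]; apply: dP; rewrite h2 (le_trans ab).
by rewrite e1 e2 e3 [RHS]addrC subrKA.
Qed.

Lemma rint_eq F G a b : (forall x, a <= x <= b -> F x = G x) -> rint a b F = rint a b G.
Proof. by move=> h; apply: eq_Rintegral => x; rewrite inE /= in_itv /= => /h. Qed.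

Lemma rintD F G a b : continuous F -> continuous G ->
  rint a b (fun x => F x + G x) = rint a b F + rint a b G.
Proof. by move=> cF cG; rewrite /rint RintegralD //; exact: cont_integrable. Qed.
Lemma rintZ F k a b : continuous F -> rint a b (fun x => k * F x) = k * rint a b F.
Proof. by move=> cF; rewrite /rint RintegralZl //; exact: cont_integrable. Qed.
Lemma rintN F a b : continuous F -> rint a b (fun x => - F x) = - rint a b F.
Proof.
move=> cF; rewrite -[RHS]mulN1r -rintZ //; apply: rint_eq => x _; exact/esym/mulN1r.
Qed.
Lemma rint_cst k a b : a <= b -> rint a b (fun=> k) = k * (b - a).
Proof.
move=> ab; have [|c _ ->//] := @rint_mvt (fun=> k) a b ab.
by move=> x; exact: cvg_cst.
Qed.

Lemma continuous_shift F c : continuous F -> continuous (fun x => F (x + c)).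
Proof.
by move=> cF x; apply: continuous_comp; [apply: cvgD; [exact: cvg_id | exact: cvg_cst] | exact: cF].
Qed.
Lemma is_derive_shift P x c d : is_derive (x + c) 1 P d -> is_derive x 1 (fun y => P (y + c)) d.
Proof.
move=> h; have g : is_derive x 1 (fun y : R => y + c) 1.
  by apply: is_derive_eq; rewrite addr0.
by rewrite -[d]mulr1; exact: (@is_derive1_comp _ P (fun y => y + c)).
Qed.

Lemma rint_shift F a b c : a <= b -> continuous F ->
  rint a b (fun x => F (x + c)) = rint (a + c) (b + c) F.
Proof.
move=> ab cF; have [M M0 hM] := big_bound [:: a + c; b + c].
have [P hP] := primitive M cF.
have dP x : a + c <= x <= b + c -> is_derive x 1 P (F x).
  move=> /andP[ax xb]; apply: hP.
  have := hM (a + c); have := hM (b + c); rewrite !inE !eqxx orbT /= => /(_ isT) + /(_ isT).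
  by rewrite !ltr_norml; lra.
rewrite (ftc _ cF dP) ?lerD2r //.
apply: (@ftc _ (fun y => P (y + c))) => //; first exact: continuous_shift.
by move=> x /andP[h1 h2]; apply: is_derive_shift; apply: dP; rewrite !lerD2r h1.
Qed.

(** For a primitive [P], the function [P (x + T) - P x] has derivative zero by periodicity, so it
    takes the same value at [a] and at [0]. *)
Lemma rint_periodic F a T : 0 <= T -> continuous F -> (forall x, F (x + T) = F x) ->
  rint a (a + T) F = rint 0 T F.
Proof.
move=> T0 cF pF; have [M M0 hM] := big_bound [:: a; 0; a + T; T].
have [P hP] := primitive M cF.
have h x : x \in [:: a; 0; a + T; T] -> - M < x < M by rewrite -ltr_norml; exact: hM.
have := h a; have := h 0; have := h (a + T); have := h T.
rewrite !inE !eqxx ?orbT => /(_ isT) ht /(_ isT) hat /(_ isT) h0 /(_ isT) ha.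
have dP x : - M < x < M -> is_derive x 1 P (F x) by rewrite -ltr_norml; exact: hP.
have -> : rint a (a + T) F = P (a + T) - P a.
  by apply: ftc; rewrite ?lerDl // => x hx; apply: dP; lra.
have -> : rint 0 T F = P T - P 0 by apply: ftc => // x hx; apply: dP; lra.
have key u v : u <= v -> - M < u -> - M < u + T -> v < M -> v + T < M ->
    P (v + T) - P v = P (u + T) - P u.
  move=> uv mu1 mu2 mv1 mv2.
  have [|c _] := @mvt (fun=> 0) (fun x => P (x + T) - P x) u v uv.
    move=> x hx; rewrite -(subrr (F x)) -{1}(pF x).
    apply: is_deriveB; last by apply: dP; lra.
    by apply: is_derive_shift; apply: dP; lra.
  by rewrite mul0r => /eqP; rewrite subr_eq0 => /eqP.
have [a0|a0] := leP a 0.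
  by have := key _ _ a0; rewrite add0r => -> //; lra.
by have := key _ _ (ltW a0); rewrite add0r => -> //; lra.
Qed.

Lemma rint_rot F c T : 0 <= T -> continuous F -> (forall x, F (x + T) = F x) ->
  rint 0 T (fun x => F (x + c)) = rint 0 T F.
Proof.
by move=> T0 cF pF; rewrite rint_shift // add0r [T + c]addrC rint_periodic.
Qed.

(** Periodicity moves the unreflected integral to [[- T, 0]]; then [x |-> - P (- x)] is a primitive
    of the reflected integrand. *)
Lemma rint_refl F T : 0 <= T -> continuous F -> (forall x, F (x + T) = F x) ->
  rint 0 T (fun x => F (- x)) = rint 0 T F.
Proof.
move=> T0 cF pF; rewrite -(@rint_periodic F (- T)) // addNr.
have [P hP] := primitive (T + 1) cF.
have -> : rint (- T) 0 F = P 0 - P (- T).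
  by apply: ftc; rewrite ?oppr_le0 // => x hx; apply: hP; rewrite ltr_norml; lra.
have -> : P 0 - P (- T) = (- P (- T)) - (- P (- 0)) by rewrite oppr0 opprK addrC.
apply: (@ftc _ (fun x => - P (- x))) => // [x|x hx].
  by apply: continuous_comp; [exact: opp_continuous | exact: cF].
have g : is_derive x 1 (-%R : R -> R) (- 1) by exact: is_deriveN.
have h : is_derive (- x) 1 P (F (- x)) by apply: hP; rewrite ltr_norml; lra.
rewrite -[F (- x)]opprK -[X in - X]mulrN1.
apply: is_deriveN; exact: (@is_derive1_comp _ P -%R).
Qed.

End integrals.

Section complex_continuity.
Variables (R : realType) (T : topologicalType).
Local Notation C := R[i].

Lemma ccontP (f : T -> C) (t : T) :
  (forall e : R, 0 < e -> \forall s \near t, cabs (f s - f t) < e) <->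
  {for t, continuous (f : T -> C^o)}.
Proof.
split=> [h|h e e0].
  apply/cvgrPdist_lt => e e0; have eR : e = (complex.Re e)%:C by exact/reC_eq/gtr0_real.
  have e1 : 0 < complex.Re e by rewrite -ltcR -eR.
  have := h _ e1; apply: filterS => s hs.
  by rewrite distrC cabsE eR ltcR.
have e1 : 0 < e%:C :> C^o by rewrite ltcR.
move/cvgrPdist_lt: h => /(_ _ e1) h.
by near=> s; rewrite -ltcR -cabsE distrC; near: s; exact: h.
Unshelve. all: by end_near. Qed.

Lemma ccont_ReIm (f : T -> C) : continuous (fun t => complex.Re (f t)) ->
  continuous (fun t => complex.Im (f t)) -> continuous (f : T -> C^o).
Proof.
move=> cr ci t; apply/ccontP => e e0; have e2 : 0 < e / 2 by rewrite divr_gt0.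
move/cvgrPdist_lt: (cr t) => /(_ _ e2) h1; move/cvgrPdist_lt: (ci t) => /(_ _ e2) h2.
near=> s.
have : `|complex.Re (f t) - complex.Re (f s)| < e / 2 by near: s; exact: h1.
have : `|complex.Im (f t) - complex.Im (f s)| < e / 2 by near: s; exact: h2.
case: (f t) (f s) => [a b] [c d] /= h3 h4.
have -> : (c +i* d) - (a +i* b) = (c - a)%:C + 'i%C * (d - b)%:C.
  by apply/eqP; rewrite eq_complex /=; apply/andP; split; apply/eqP; ring.
apply: (le_lt_trans (cabsD _ _)); rewrite cabsM !cabs_real.
have -> : cabs ('i%C : C) = 1 by rewrite /cabs normc_def /= expr0n add0r expr1n sqrtr1.
by rewrite mul1r distrC (distrC d); lra.
Unshelve. all: by end_near. Qed.

Lemma Re_cont (f : T -> C) : continuous (f : T -> C^o) -> continuous (fun t => complex.Re (f t)).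
Proof.
move=> cf t; apply/cvgrPdist_lt => e e0; have /ccontP/(_ _ e0) := cf t.
apply: filterS => s h; rewrite distrC -raddfB; apply: le_lt_trans h; exact: (cabs_ReIm _).1.
Qed.
Lemma Im_cont (f : T -> C) : continuous (f : T -> C^o) -> continuous (fun t => complex.Im (f t)).
Proof.
move=> cf t; apply/cvgrPdist_lt => e e0; have /ccontP/(_ _ e0) := cf t.
apply: filterS => s h; rewrite distrC -raddfB; apply: le_lt_trans h; exact: (cabs_ReIm _).2.
Qed.
Lemma conj_cont (f : T -> C) : continuous (f : T -> C^o) -> continuous (fun t => (f t)^* : C^o).
Proof.
move=> cf t; apply/ccontP => e e0; have /ccontP/(_ _ e0) := cf t.
by apply: filterS => s; rewrite -rmorphB cabsJ.
Qed.
End complex_continuity.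

(** * The circle, loops and the bundle *)

Section circle_facts.
Variable R : realType.
Local Notation C := R[i].
Implicit Types (s t : circ R) (x y : R).

Lemma circ_eq s t : (s : C) = t -> s = t. Proof. exact: val_inj. Qed.
Lemma cmul1r s : cmul s cone = s. Proof. by rewrite cmulC cmul1. Qed.
Lemma cmulVr s : cmul s (cinv s) = cone. Proof. by rewrite cmulC cmulV. Qed.
Lemma cmulAC s t u : cmul (cmul s t) u = cmul (cmul s u) t.
Proof. by rewrite -!cmulA (cmulC t). Qed.
Lemma cmulACA s t u v : cmul (cmul s t) (cmul u v) = cmul (cmul s u) (cmul t v).
Proof. by rewrite !cmulA [cmul (cmul s t) u]cmulAC. Qed.
Lemma cmul_inj s t u : cmul s t = cmul s u -> t = u.
Proof. by move=> h; rewrite -[t]cmul1 -[u]cmul1 -(cmulV s) -!cmulA h. Qed.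
Lemma cinvM s t : cinv (cmul s t) = cmul (cinv s) (cinv t).
Proof. by apply: circ_eq; rewrite /= invfM. Qed.
Lemma cinv1 : cinv (cone : circ R) = cone. Proof. by apply: circ_eq; rewrite /= invr1. Qed.

Lemma expiD x y : expi (x + y) = cmul (expi x) (expi y).
Proof.
apply: circ_eq => /=; rewrite cosD sinD; apply/eqP; rewrite eq_complex /=.
by rewrite eqxx addrC [cos x * _]mulrC eqxx.
Qed.
Lemma expiN x : expi (- x) = cinv (expi x).
Proof. by apply: (@cmul_inj (expi x)); rewrite cmulVr -expiD subrr expi0. Qed.
Lemma expi_conj x : (expi x : C)^* = (expi (- x) : C).
Proof. by rewrite expiN circ_conj. Qed.
Lemma expiMn x (n : nat) : expi (n%:R * x) = cpow (expi x) n.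
Proof.
elim: n => [|n IH]; first by rewrite mul0r expi0 cpow0.
rewrite -[n.+1]addn1 natrD mulrDl mul1r expiD IH PoszD cpowD.
by congr (cmul _ _); apply: circ_eq.
Qed.
Lemma cpowN t m : cpow t (- m) = cinv (cpow t m).
Proof. by apply: (@cmul_inj (cpow t m)); rewrite cmulVr -cpowD subrr cpow0. Qed.
Lemma expiM x (m : int) : expi (m%:~R * x) = cpow (expi x) m.
Proof.
case: m => n; first exact: expiMn.
by rewrite NegzE mulrNz mulNr expiN cpowN -expiMn.
Qed.
Lemma expi_2pi : expi (2 * pi : R) = cone.
Proof. by apply: circ_eq; rewrite /= mulr_natl cos2pi sin2pi. Qed.
Lemma cpow1 (m : int) : cpow cone m = (cone : circ R).
Proof. by apply: circ_eq; rewrite /= exp1rz. Qed.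
Lemma expi_2piM (m : int) : expi (m%:~R * (2 * pi)) = (cone : circ R).
Proof. by rewrite expiM expi_2pi cpow1. Qed.
Lemma cpowMz t m n : cpow t (m * n) = cpow (cpow t m) n.
Proof. by apply: circ_eq; rewrite /= exprz_exp. Qed.

Lemma expi_surj t : exists x, t = expi x.
Proof.
case: t => -[a b] h; have ab : a ^+ 2 + b ^+ 2 = 1.
  move: (h); rewrite normc_def /= => /eqP[] /(congr1 (fun z => z ^+ 2)).
  by rewrite sqr_sqrtr ?addr_ge0 ?sqr_ge0 // expr1n.
have a1 : -1 <= a <= 1.
  by rewrite -ler_norml -sqr_norm_le1 // || (have := sqr_ge0 b; nra).
have hc : cos (acos a) = a by rewrite acosK // in_itv.
have hs : sin (acos a) = `|b|.
  by rewrite sin_acos // -ab addrAC subrr add0r sqrtr_sqr.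
have [b0|b0] := leP 0 b.
  by exists (acos a); apply: circ_eq => /=; rewrite hc hs ger0_norm.
by exists (- acos a); apply: circ_eq => /=; rewrite cosN sinN hc hs ltr0_norm // opprK.
Qed.

(** Reduce [x] modulo [2 pi] to [r] in [[0, 2 pi)]. Since [cos r = 1 - 2 sin^2 (r / 2)] and the
    half-angle sine is positive inside the interval, [cos r = 1] leaves only [r = 0]. *)
Lemma expi_eq1 x : expi x = cone -> exists n : int, x = n%:~R * (2 * pi).
Proof.
move=> h; pose n := Num.floor (x / (2 * pi)).
have p0 : 0 < 2 * pi :> R by rewrite mulr_gt0 // pi_gt0.
exists n; pose r := x - n%:~R * (2 * pi).
have hr : expi r = cone by rewrite /r expiD expiN expi_2piM cinv1 cmul1r.
have r0 : 0 <= r.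
  by rewrite subr_ge0 -ler_pdivlMr // floor_le.
have r1 : r < 2 * pi.
  rewrite ltrBlDl -[X in _ + X]mul1r -mulrDl -ltr_pdivrMr //.
  by rewrite -[X in _ + X](rmorph1 (intr : int -> R)) -rmorphD /= floorD1_gt.
suff : r = 0 by move/eqP; rewrite subr_eq0 => /eqP.
have hcos : cos r = 1 by have := congr1 (fun t : circ R => complex.Re (t : C)) hr.
apply/eqP; rewrite eq_le r0 andbT leNgt; apply/negP => rp.
have : 0 < sin (r / 2) by apply: sin_gt0_pi; rewrite divr_gt0 //= ltr_pdivrMr // mulrC.
have : cos r = 1 - 2 * sin (r / 2) ^+ 2.
  have {1}-> : r = (r / 2) *+ 2 by rewrite -mulr_natr divfK.
  by rewrite cos_mulr2n cos2sin2; lra.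
by rewrite hcos; nra.
Qed.

Lemma expi_pi : (expi pi : C) = -1.
Proof. by rewrite /= cospi sinpi; apply/eqP; rewrite eq_complex /= oppr0 !eqxx. Qed.

Lemma cpow_inj (m n : int) : (forall t, cpow t m = cpow t n) -> m = n.
Proof.
move=> h; apply/eqP; rewrite -subr_eq0; apply/negPn/negP => d0.
(* A point whose power of exponent [m - n] is [-1]. *)
set t := expi (pi / (m - n)%:~R : R).
have ht : cpow t (m - n) = cone by rewrite cpowD cpowN h cmulVr.
move: ht; rewrite /t -expiM mulrCA divff ?intr_eq0 // mulr1 => /(congr1 (@cval R)).
by rewrite expi_pi /= => /eqP; rewrite eqNr oner_eq0.
Qed.

Lemma cval_cont : continuous (@cval R : circ R -> C^o).
Proof. exact: initial_continuous. Qed.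
Lemma circ_cont (T : topologicalType) (f : T -> circ R) :
  continuous (fun p => f p : C^o) -> continuous f.
Proof. exact: (@continuous_comp_initial (circ R : choiceType) T (C^o : topologicalType) (@cval R) f). Qed.
Lemma circ_cval_cont (T : topologicalType) (f : T -> circ R) :
  continuous f -> continuous (fun p => f p : C^o).
Proof. by move=> cf p; apply: continuous_comp; [exact: cf | exact: cval_cont]. Qed.
Lemma cmul_cont (T : topologicalType) (f g : T -> circ R) :
  continuous f -> continuous g -> continuous (fun p => cmul (f p) (g p)).
Proof.
by move=> cf cg; apply: circ_cont => p /=; apply: cvgM; exact: circ_cval_cont.
Qed.
Lemma cinv_cont (T : topologicalType) (f : T -> circ R) :
  continuous f -> continuous (fun p => cinv (f p)).
Proof.
move=> cf; apply: circ_cont => p /=.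
have -> : (fun p => (f p : C)^-1) = (fun p => (f p : C)^*).
  by apply/funext => q; rewrite circ_conj.
move: p; by apply: (@conj_cont _ _ (fun p => f p : C)); exact: circ_cval_cont.
Qed.
Lemma cpow_cont (T : topologicalType) (f : T -> circ R) m :
  continuous f -> continuous (fun p => cpow (f p) m).
Proof.
have pos (n : nat) : continuous f -> continuous (fun p => cpow (f p) n).
  move=> cf; elim: n => [|n IH]; first by under eq_fun do rewrite cpow0; move=> p; exact: cvg_cst.
  under eq_fun do rewrite -[n.+1]addn1 PoszD cpowD.
  apply: cmul_cont => //; have -> : (fun p => cpow (f p) 1) = f by apply/funext => p; exact: circ_eq.
  by [].
move=> cf; case: m => n; first exact: pos.
under eq_fun do rewrite NegzE cpowN; apply: cinv_cont; exact: pos.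
Qed.
Lemma expi_cont : continuous (@expi R).
Proof.
apply: circ_cont; apply: ccont_ReIm => /=; [exact: continuous_cos|exact: continuous_sin].
Qed.
Lemma expi_comp_cont (T : topologicalType) (f : T -> R) :
  continuous f -> continuous (fun p => expi (f p)).
Proof. by move=> cf p; apply: continuous_comp; [exact: cf | exact: expi_cont]. Qed.

Lemma expi_near0 (e : R) : 0 < e -> exists2 d : R, 0 < d & forall x, `|x| < d -> cabs ((expi x : C) - 1) < e.
Proof.
move=> e0; have : continuous (fun x => expi x : C^o) by apply: circ_cval_cont; exact: expi_cont.
move=> /(_ 0)/ccontP/(_ _ e0) /nbhs_ballP[d /= d0 hd]; exists d => // x xd.
have -> : (1 : C) = (expi 0 : C) by rewrite expi0.
apply: (hd x).
by rewrite /ball /= sub0r normrN.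
Qed.

(* A continuous homomorphism from the line agrees near 0 with some [expi (a x)] on the
   dyadic points, as square roots with positive real part are unique. *)
Lemma line_char (g : R -> circ R) : continuous g ->
  (forall x y, g (x + y) = cmul (g x) (g y)) -> exists a : R, forall x, g x = expi (a * x).
Proof.
move=> cg gD; have cgC := circ_cval_cont cg.
have g0 : g 0 = cone.
  by apply: (@cmul_inj (g 0)); rewrite -gD addr0 cmul1r.
have gN x : g (- x) = cinv (g x).
  by apply: (@cmul_inj (g x)); rewrite -gD subrr g0 cmulVr.
have near0 (h : R -> circ R) (e : R) : continuous (fun x => h x : C^o) -> h 0 = cone -> 0 < e ->
    exists2 d : R, 0 < d & forall x, `|x| < d -> cabs ((h x : C) - 1) < e.
  move=> ch h0 e0; move: ch => /(_ 0)/ccontP/(_ _ e0) /nbhs_ballP[d /= d0 hd].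
  exists d => // x xd; have := hd x; rewrite h0 /=; apply.
  by rewrite /ball /= sub0r normrN.
have [d d0 hd] := near0 g 1 cgC g0 ltr01.
(* A point of the circle within distance 1 of the identity has positive real part, which selects one
   of the two square roots. *)
have repos x : `|x| < d -> 0 < complex.Re (g x : C).
  move=> /hd h; have := (cabs_ReIm ((g x : C) - 1)).1.
  rewrite ReD ReN /= => h2; have := le_lt_trans h2 h.
  by rewrite ltr_norml; lra.
pose x0 := d / 2.
have x0p : 0 < x0 by rewrite divr_gt0.
have x0d : `|x0| < d by rewrite gtr0_norm // /x0 ltr_pdivrMr //; have := d0; lra.
have [th hth thp] : exists2 th, g x0 = expi th & `|th| < pi / 2.
  have := repos _ x0d; have [y hy] := expi_surj (g x0).
  move: (hy); case E : (g x0) => [[a b] h] _ /= a0.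
  have ab : a ^+ 2 + b ^+ 2 = 1.
    move: (h); rewrite normc_def /= => /eqP[] /(congr1 (fun z => z ^+ 2)).
    by rewrite sqr_sqrtr ?addr_ge0 ?sqr_ge0 // expr1n.
  have b1 : -1 < b < 1 by apply/andP; split; nra.
  have b2 : -1 <= b <= 1 by case/andP: b1 => h1 h2; rewrite !ltW.
  exists (asin b).
    apply: circ_eq => /=; rewrite cos_asin // asinK ?in_itv //.
    by rewrite -ab addrK sqrtr_sqr gtr0_norm.
  rewrite ltr_norml asin_ltpi2 ?asin_gtNpi2 //; case/andP: b1 => h1 h2.
  by rewrite h1 (ltW h2).
  by rewrite (ltW h1) h2.
have dy n : g (x0 / 2 ^+ n) = expi (th / 2 ^+ n).
  elim: n => [|n IH]; first by rewrite expr0 !divr1.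
  have half y : y / 2 ^+ n = y / 2 ^+ n.+1 + y / 2 ^+ n.+1.
    by rewrite exprS; field; rewrite expf_neq0 // pnatr_eq0.
  have hx : `|x0 / 2 ^+ n.+1| < d.
    apply: le_lt_trans x0d; rewrite normrM normfV normrX (ger0_norm (ler0n _ 2)).
    by rewrite ler_pdivrMr ?exprn_gt0 // ler_peMr // exprn_ege1 // ler1n.
  have ht : `|th / 2 ^+ n.+1| < pi / 2.
    apply: le_lt_trans thp; rewrite normrM normfV normrX (ger0_norm (ler0n _ 2)).
    by rewrite ler_pdivrMr ?exprn_gt0 // ler_peMr // exprn_ege1 // ler1n.
  have r1 := repos _ hx; have r2 : 0 < cos (th / 2 ^+ n.+1).
    by apply: cos_gt0_pihalf; rewrite -ltr_norml.
  move: IH; rewrite half gD [th / _]half expiD => /(congr1 (@cval R)) /= /eqP.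
  rewrite -!expr2 eqf_sqr => /orP[/eqP h|/eqP h]; first exact: circ_eq.
  by move: r1; rewrite h /= oppr_gt0 ltNge (ltW r2).
pose a := th / x0; exists a => x.
(* Dividing by the candidate leaves a continuous homomorphism that is trivial at every
   [x0 / 2 ^+ n], hence at points arbitrarily close to any [x]. *)
pose h x := cmul (g x) (expi (- (a * x))).
have hM u v : h (u + v) = cmul (h u) (h v).
  by rewrite /h gD mulrDr opprD expiD cmulACA.
have h0 : h 0 = cone by rewrite /h g0 mulr0 oppr0 expi0 cmul1.
have ch : continuous (fun x => h x : C^o).
  apply: circ_cval_cont; apply: cmul_cont => //; apply: expi_comp_cont => y.
  by apply: cvgN; apply: cvgM; [exact: cvg_cst | exact: cvg_id].
have hdy n : h (x0 / 2 ^+ n) = cone.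
  rewrite /h dy expiN /a mulrA divfK ?gt_eqF // cmulVr //.
have hN u : h (- u) = cinv (h u).
  by apply: (@cmul_inj (h u)); rewrite -hM subrr h0 cmulVr.
have hnat u (n : nat) : h u = cone -> h (n%:R * u) = cone.
  move=> hu; elim: n => [|n IH]; first by rewrite mul0r.
  by rewrite -addn1 natrD mulrDl mul1r hM IH hu cmul1.
have hint u (m : int) : h u = cone -> h (m%:~R * u) = cone.
  move=> hu; case: m => n; first exact: hnat.
  by rewrite NegzE mulrNz mulNr hN hnat // cinv1.
suff : h x = cone by rewrite /h expiN => /(congr1 (fun t : circ R => cmul t (expi (a * x)))); rewrite -cmulA cmulV cmul1r cmul1.
apply: circ_eq; apply/eqP; rewrite -subr_eq0; apply/eqP/cabs_le_eq0 => e e0.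
have [r r0 hr] := near0 h e ch h0 e0.
have [n hn] : exists n, x0 / 2 ^+ n < r.
  have [n _ hn] := near_infty_natSinv_lt (PosNum (divr_gt0 r0 x0p)); exists n.+1.
  have := hn n (leqnn n); rewrite /= ltr_pdivlMr // => h1; apply: le_lt_trans h1.
  rewrite mulrC ler_pM2r // lef_pV2 ?posrE ?exprn_gt0 ?ltr0n //.
  by rewrite -natrX ler_nat ltnW // ltn_expl.
pose u := x0 / 2 ^+ n; have u0 : 0 < u by rewrite divr_gt0 // exprn_gt0.
pose m := Num.floor (x / u).
have -> : h x = h (x - m%:~R * u).
  by rewrite hM hN hint ?cinv1 ?cmul1r //; exact: hdy.
apply: hr; rewrite ger0_norm ?subr_ge0 -?ler_pdivlMr ?floor_le //.
apply: lt_trans hn; rewrite ltrBlDl -[X in _ + X]mul1r -mulrDl -ltr_pdivrMr //.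
by rewrite -[X in _ + X](rmorph1 (intr : int -> R)) -rmorphD /= floorD1_gt.
Qed.

(** Pulled back to the line, the character is [expi (a x)] for a real [a]; its triviality at [2 pi]
    makes [a] an integer. *)
Lemma circ_char (g : circ R -> circ R) : continuous g ->
  (forall s t, g (cmul s t) = cmul (g s) (g t)) -> exists m : int, forall t, g t = cpow t m.
Proof.
move=> cg gM; have [||a ha] := @line_char (fun x => g (expi x)).
- by move=> x; apply: continuous_comp; [exact: expi_cont | exact: cg].
- by move=> x y; rewrite expiD gM.
have g1 : g cone = cone by apply: (@cmul_inj (g cone)); rewrite -gM cmul1 cmul1r.
have := ha (2 * pi); rewrite expi_2pi g1 => /esym/expi_eq1[m].
rewrite [a * _]mulrC [_ * (2 * pi)]mulrC => /mulfI am; exists m => t.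
have [x ->] := expi_surj t; rewrite ha am ?expiM //.
by rewrite mulf_neq0 ?pnatr_eq0 // gt_eqF // pi_gt0.
Qed.

End circle_facts.

(** * The C^oo topology on loops, and rotation *)

Section loop_topology.
Variable R : realType.
Implicit Types (f g : loopU R) (a b c x : R).

Lemma loop_deriv f n x : is_derive x 1 (derive1n n f) (derive1n n.+1 f x).
Proof. by apply: DeriveDef; [exact: usmooth | rewrite derive1nS derive1E]. Qed.
Lemma loop_dcont f n : continuous (derive1n n f).
Proof. by move=> x; exact: is_derive_cont (loop_deriv f n x). Qed.
Lemma loop_cont0 f : continuous f. Proof. exact: (@loop_dcont f 0%N). Qed.
Lemma loop_cont1 f : continuous (derive1 f). Proof. exact: (@loop_dcont f 1%N). Qed.

Lemma derive1n_shift f n c : derive1n n (fun x => f (x + c)) = (fun x => derive1n n f (x + c)).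
Proof.
elim: n => [//|n IH]; rewrite derive1nS IH; apply/funext => x; rewrite derive1E.
exact: (@derive_val _ _ _ _ _ _ _ (@is_derive_shift R (derive1n n f) x c _ (loop_deriv f n (x + c)))).
Qed.
Lemma loop_dper f n x : derive1n n f (x + 2 * pi) = derive1n n f x.
Proof.
have -> : derive1n n f (x + 2 * pi) = derive1n n (fun y => f (y + 2 * pi)) x by rewrite derive1n_shift.
by congr (derive1n n _ x); apply/funext => y; exact: uper.
Qed.

(** Together with [loop_cont] this replaces the initial topology of a product of uniform topologies
    by one uniform estimate for each derivative. *)
Lemma loop_near f n (e : R) : 0 < e ->
  \forall g \near f, forall x, `|derive1n n (g : loopU R) x - derive1n n f x| < e.
Proof.
move=> e0.
have h1 : continuous (fun g : loopU R => proj n (uderivs g) : {uniform R -> R}).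
  move=> g; apply: (@continuous_comp _ _ _ (@uderivs R) (proj n)).
    exact: initial_continuous.
  exact: proj_continuous.
apply: (h1 f [set h : {uniform R -> R} | forall x, `|h x - derive1n n f x| < e]).
apply/uniform_nbhs; exists [set xy : R * R | `|xy.2 - xy.1| < e]; split.
  rewrite -entourage_ballE; exists e => // -[y z] /=.
  by rewrite /ball /= distrC.
by move=> h /= hh x; exact: hh.
Qed.

Lemma loop_cont (T : topologicalType) (phi : T -> loopU R) :
  (forall t n (e : R), 0 < e ->
    \forall s \near t, forall x, `|derive1n n (phi s) x - derive1n n (phi t) x| < e) ->
  continuous phi.
Proof.
move=> h; apply: (@continuous_comp_initial (loopU R : choiceType) T _ (@uderivs R) phi).
move=> t; apply/cvg_sup => n U [? [[W oW <-]]] /= Wt /filterS; apply.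
have : nbhs (uderivs (phi t) n : {uniform R -> R}) W by apply: open_nbhs_nbhs.
move/uniform_nbhs => [E []]; rewrite -entourage_ballE => -[e /= e0 eE] EW.
have := h t n e e0; apply: filterS => s hs; apply: EW => x _; apply: eE => /=.
by rewrite /ball /= distrC; exact: hs.
Qed.

Lemma derive1n_ulin a b f g n x :
  derive1n n (ulin a b f g) x = a * derive1n n f x + b * derive1n n g x.
Proof. by rewrite /= derive1n_lin. Qed.

Lemma uadd_cont (T : topologicalType) (phi psi : T -> loopU R) :
  continuous phi -> continuous psi -> continuous (fun t => uadd (phi t) (psi t)).
Proof.
move=> c1 c2; apply: loop_cont => t n e e0; have e2 : 0 < e / 2 by rewrite divr_gt0.
have h1 : \forall s \near t, forall x, `|derive1n n (phi s) x - derive1n n (phi t) x| < e / 2.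
  by have := loop_near (phi t) n e2; exact: (c1 t).
have h2 : \forall s \near t, forall x, `|derive1n n (psi s) x - derive1n n (psi t) x| < e / 2.
  by have := loop_near (psi t) n e2; exact: (c2 t).
near=> s => x; rewrite !derive1n_ulin !mul1r opprD addrACA (splitr e).
apply: (le_lt_trans (ler_normD _ _)); apply: ltrD.
  by move: x; near: s.
by move: x; near: s.
Unshelve. all: by end_near. Qed.

Lemma bounded_itv (F : R -> R) a b : a <= b -> continuous F ->
  exists2 M : R, 0 < M & forall x, a <= x <= b -> `|F x| <= M.
Proof.
move=> ab cF; have [|c _ hc] := @EVT_max R (fun x => `|F x|) a b ab.
  by apply: continuous_subspaceT => x; apply: cvg_norm; exact: cF.
exists (`|F c| + 1) => [|x hx]; first by rewrite ltr_wpDl.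
by have := hc x; rewrite in_itv /= => /(_ hx) h; apply: (le_trans h); rewrite lerDl.
Qed.

Lemma twopi_ge0 : 0 <= 2 * (pi : R). Proof. by rewrite mulr_ge0 // pi_ge0. Qed.

Definition urot_sub1 c f : forall n x, derivable (derive1n n (fun x => f (x + c))) x 1.
Proof.
move=> n x; rewrite derive1n_shift; have h := loop_deriv f n (x + c).
by have [] := @is_derive_shift R (derive1n n f) x c _ h.
Qed.
Definition urot_sub2 c f : forall x, f (x + 2 * pi + c) = f (x + c).
Proof. by move=> x; rewrite addrAC uper. Qed.
Definition urot_sub3 c f : Rintegral lebesgue_measure `[0, 2 * pi] (fun x => f (x + c)) = 0.
Proof.
rewrite -[LHS]/(rint _ _ _) rint_rot ?twopi_ge0 //; last by move=> x; exact: uper.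
- exact: umean.
- exact: loop_cont0.
Qed.
Definition urot c f : loopU R := LoopU (@urot_sub1 c f) (@urot_sub2 c f) (@urot_sub3 c f).

Lemma urotD c f g : urot c (uadd f g) = uadd (urot c f) (urot c g).
Proof. by apply/loopU_eq. Qed.
Lemma urotZ c a f : urot c (uscale a f) = uscale a (urot c f).
Proof. by apply/loopU_eq. Qed.

End loop_topology.

(** * The symplectic form on loops *)

Section omega_facts.
Variables (R : realType) (K : level R).
Implicit Types (f g : loopU R) (a b c x : R).
Local Notation k1 := ((K 1 1)%:~R : R).

Lemma fg_cont f g : continuous (fun x => f x * derive1 g x).
Proof. by move=> x; apply: cvgM; [exact: loop_cont0 | exact: loop_cont1]. Qed.

Definition ip (F G : R -> R) : R := rint 0 (2 * pi) (fun x => F x * G x).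

Lemma mulF_cont (F G : R -> R) : continuous F -> continuous G -> continuous (fun x => F x * G x).
Proof. by move=> cF cG x; apply: cvgM; [exact: cF | exact: cG]. Qed.
Lemma ipDl a b F F' G : continuous F -> continuous F' -> continuous G ->
  ip (fun x => a * F x + b * F' x) G = a * ip F G + b * ip F' G.
Proof.
move=> cF cF' cG.
have cZ (k : R) (H : R -> R) : continuous H -> continuous (fun x => k * H x).
  by move=> cH x; apply: cvgM; [exact: cvg_cst | exact: cH].
rewrite /ip -!rintZ; [|exact: mulF_cont|exact: mulF_cont].
rewrite -rintD; [|by apply: cZ; exact: mulF_cont|by apply: cZ; exact: mulF_cont].
by apply: rint_eq => x _; ring.
Qed.
Lemma ipC F G : ip F G = ip G F.
Proof. by apply: rint_eq => x _; rewrite mulrC. Qed.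
Lemma ipDr a b F G G' : continuous F -> continuous G -> continuous G' ->
  ip F (fun x => a * G x + b * G' x) = a * ip F G + b * ip F G'.
Proof. by move=> cF cG cG'; rewrite ipC ipDl // !(ipC _ F). Qed.
Lemma ip_rot c F G : continuous F -> continuous G -> (forall x, F (x + 2 * pi) = F x) ->
  (forall x, G (x + 2 * pi) = G x) -> ip (fun x => F (x + c)) (fun x => G (x + c)) = ip F G.
Proof.
move=> cF cG pF pG; apply: (@rint_rot _ (fun x => F x * G x)); first exact: twopi_ge0.
  exact: mulF_cont.
by move=> x; rewrite pF pG.
Qed.
Lemma ip_self F G : continuous F -> continuous G -> (forall x, is_derive x 1 F (G x)) ->
  F (2 * pi) = F 0 -> ip F G = 0.
Proof.
move=> cF cG dF p0; have E : ip F G = 2^-1 * (F (2 * pi) * F (2 * pi)) - 2^-1 * (F 0 * F 0).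
  apply: (@ftc _ _ (fun x => 2^-1 * (F x * F x))); [exact: twopi_ge0 | exact: mulF_cont|].
  by move=> x _; have d := dF x; apply: is_derive_eq; rewrite /GRing.scale /=; field.
by rewrite E p0 subrr.
Qed.

Lemma omegaE f g : omega K f g = k1 * ip f (derive1 g).
Proof.
rewrite /ip -rintZ; last exact: fg_cont.
by apply: rint_eq => x _; rewrite /tform mulrC.
Qed.
Opaque ip.

Lemma omegaDl a b f f' g : omega K (ulin a b f f') g = a * omega K f g + b * omega K f' g.
Proof.
rewrite !omegaE; have -> := ipDl a b (@loop_cont0 R f) (@loop_cont0 R f') (@loop_cont1 R g).
by move: (ip _ _) (ip _ _) => u v; ring.
Qed.
Lemma derive1_ulin a b g g' :
  derive1 (ulin a b g g') = (fun x => a * derive1 g x + b * derive1 g' x).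
Proof. by apply/funext => x; have := derive1n_ulin a b g g' 1%N x; rewrite !derive1n1. Qed.
Lemma omegaDr a b f g g' : omega K f (ulin a b g g') = a * omega K f g + b * omega K f g'.
Proof.
rewrite !omegaE derive1_ulin.
have -> := ipDr a b (@loop_cont0 R f) (@loop_cont1 R g) (@loop_cont1 R g').
by move: (ip _ _) (ip _ _) => u v; ring.
Qed.
Lemma omega_scale a b f g : omega K (uscale a f) (uscale b g) = a * b * omega K f g.
Proof. by rewrite omegaDl !omegaDr; move: (omega _ _ _) => u; ring. Qed.
Lemma omega0l f : omega K uzero f = 0.
Proof.
have -> : uzero = uscale 0 f by apply/loopU_eq/funext => x /=; rewrite !mul0r addr0.
by rewrite omegaDl !mul0r addr0.
Qed.
Lemma omega_self f : omega K f f = 0.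
Proof.
rewrite omegaE (_ : ip _ _ = 0) ?mulr0 //.
apply: ip_self; [exact: loop_cont0 | exact: loop_cont1| |].
  by move=> x; have := loop_deriv f 0%N x; rewrite derive1n1.
by rewrite -[2 * pi]add0r uper.
Qed.

Lemma omega_rot c f g : omega K (urot c f) (urot c g) = omega K f g.
Proof.
have -> : omega K (urot c f) (urot c g) = k1 * ip (fun x => f (x + c)) (fun x => derive1 g (x + c)).
  rewrite omegaE; congr (_ * ip _ _).
  by have := derive1n_shift g 1%N c; rewrite !derive1n1.
rewrite omegaE ip_rot //; [exact: loop_cont0 | exact: loop_cont1 | exact: uper |].
by move=> x; have := loop_dper g 1%N x; rewrite derive1n1.
Qed.

Transparent ip.
Lemma omega_cont (T : topologicalType) (phi psi : T -> loopU R) :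
  continuous phi -> continuous psi -> continuous (fun t => omega K (phi t) (psi t)).
Proof.
move=> c1 c2 t; apply/cvgrPdist_lt => e e0.
set f := phi t; set g := psi t.
have [Mf Mf0 hMf] := bounded_itv (twopi_ge0 R) (@loop_cont0 R f).
have [Mg Mg0 hMg] := bounded_itv (twopi_ge0 R) (@loop_cont1 R g).
(* After the mean value theorem for integrals the difference is [|k1|] times the length [2 pi] times
   a variation of at most [(Mf + Mg + 1) d]. Enlarging each factor by one keeps [B] positive and the
   final inequality strict. *)
pose B := (`|k1| + 1) * (2 * pi + 1) * (Mf + Mg + 2).
have k0 : 0 < `|k1| + 1 by rewrite ltr_wpDl.
have p0 : 0 < 2 * pi + 1 :> R by have := twopi_ge0 R; lra.
have B0 : 0 < B by rewrite !mulr_gt0 //; lra.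
pose d := Num.min 1 (e / B); have d0 : 0 < d by rewrite lt_min ltr01 divr_gt0.
have d1 : d <= 1 by rewrite ge_min lexx.
have dB : d * B <= e by rewrite -ler_pdivlMr // ge_min lexx orbT.
have h1 : \forall s \near t, forall x, `|phi s x - f x| < d.
  by have := loop_near f 0%N d0; exact: (c1 t).
have h2 : \forall s \near t, forall x, `|derive1n 1 (psi s) x - derive1n 1 g x| < d.
  by have := loop_near g 1%N d0; exact: (c2 t).
near=> s.
have H1 : forall x, `|phi s x - f x| < d by near: s; exact: h1.
have H2 : forall x, `|derive1n 1 (psi s) x - derive1n 1 g x| < d by near: s; exact: h2.
have cF : continuous (fun x => f x * derive1 g x - phi s x * derive1 (psi s) x).
  by move=> x; apply: cvgB; [exact: (@fg_cont f g) | exact: (@fg_cont (phi s) (psi s))].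
have -> : omega K f g - omega K (phi s) (psi s) =
    k1 * rint 0 (2 * pi) (fun x => f x * derive1 g x - phi s x * derive1 (psi s) x).
  rewrite !omegaE /ip -mulrBr; congr (_ * _); rewrite -(rintN _ _ (@fg_cont (phi s) (psi s))).
  rewrite -(rintD _ _ (@fg_cont f g)) // => x.
  by apply: cvgN; exact: (@fg_cont (phi s) (psi s)).
have [c hc ->] := rint_mvt (twopi_ge0 R) cF; rewrite subr0 normrM [X in _ * X]normrM (ger0_norm (twopi_ge0 R)).
have := H1 c; have := H2 c; rewrite !derive1n1; have := hMf c hc; have := hMg c hc.
move: (f c) (derive1 g c) (phi s c) (derive1 (psi s) c) => u v u' v' h3 h4 h5 h6.
have h7 : `|u * v - u' * v'| <= (Mf + Mg + 1) * d.
  have -> : u * v - u' * v' = - (u * (v' - v) + (u' - u) * v + (u' - u) * (v' - v)) by ring.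
  rewrite normrN; apply: (le_trans (ler_normD _ _)); apply: (@le_trans _ _ (Mf * d + d * Mg + d * d)).
    apply: lerD; last by rewrite normrM ler_pM // ltW.
    apply: (le_trans (ler_normD _ _)); rewrite !normrM.
    by apply: lerD; rewrite ler_pM // ltW.
  by nra.
apply: (@le_lt_trans _ _ (`|k1| * ((Mf + Mg + 1) * d * (2 * pi)))).
  by rewrite ler_wpM2l // ler_wpM2r // twopi_ge0.
apply: (@lt_le_trans _ _ (d * B)) => //.
rewrite /B; have p1 := twopi_ge0 R; have q0 := normr_ge0 k1.
apply: (@le_lt_trans _ _ ((`|k1| + 1) * ((Mf + Mg + 1) * d * (2 * pi + 1)))).
  apply: ler_pM => //; first by rewrite !mulr_ge0 //; lra.
    by rewrite lerDl.
  by apply: ler_pM; rewrite ?lerDl ?mulr_ge0 //; lra.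
have -> : d * ((`|k1| + 1) * (2 * pi + 1) * (Mf + Mg + 2)) =
  (`|k1| + 1) * ((Mf + Mg + 2) * d * (2 * pi + 1)) by ring.
by rewrite ltr_pM2l // ltr_pM2r // ltr_pM2r //; lra.
Unshelve. all: by end_near. Qed.
End omega_facts.
Local Opaque omega.

Section discrete_continuity.
Variables (T : topologicalType).

Lemma int_contP (f : T -> int) : continuous f <-> forall t, \forall s \near t, f s = f t.
Proof.
split=> [cf t|h t].
  apply: (cf t [set n | n = f t]); exact: discrete_set1.
move=> U /nbhs_singleton Uf; have := h t; apply: filterS => s /= e.
by rewrite /= e.
Qed.

Lemma int_glue_cont (S : topologicalType) (f : T -> int) (g : int -> T -> S) :
  continuous f -> (forall n, continuous (g n)) -> continuous (fun t => g (f t) t).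
Proof.
move=> /int_contP cf cg t U hU; have h1 := cf t; have h2 := cg (f t) t _ hU.
have h3 : \forall s \near t, U (g (f t) s) := h2.
suff : \forall s \near t, U (g (f s) s) by [].
by apply: filterS2 h1 h3 => s ->.
Qed.

Lemma int_add_cont (f g : T -> int) : continuous f -> continuous g ->
  continuous (fun t => f t + g t).
Proof.
move=> /int_contP cf /int_contP cg; apply/int_contP => t.
have h1 := cf t; have h2 := cg t; near=> s; congr (_ + _); near: s; assumption.
Unshelve. all: by end_near. Qed.

Lemma pair_cont (S1 S2 : topologicalType) (f : T -> S1) (g : T -> S2) :
  continuous f -> continuous g -> continuous (fun t => (f t, g t)).
Proof. by move=> cf cg t; apply: cvg_pair; [exact: cf | exact: cg]. Qed.
Lemma fst_cont (S1 S2 : topologicalType) (f : T -> S1 * S2) :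
  continuous f -> continuous (fun t => (f t).1).
Proof. by move=> cf t; apply: continuous_comp; [exact: cf | exact: cvg_fst]. Qed.
Lemma snd_cont (S1 S2 : topologicalType) (f : T -> S1 * S2) :
  continuous f -> continuous (fun t => (f t).2).
Proof. by move=> cf t; apply: continuous_comp; [exact: cf | exact: cvg_snd]. Qed.
Lemma comp_cont (S1 S2 : topologicalType) (f : T -> S1) (g : S1 -> S2) :
  continuous f -> continuous g -> continuous (fun t => g (f t)).
Proof. by move=> cf cg t; apply: continuous_comp; [exact: cf | exact: cg]. Qed.
End discrete_continuity.

(** * The level, the extension of the loop group, and rotation of loops *)

Section level_facts.
Variables (R : realType) (K : level R).
Local Notation C := R[i].

Definition kappa : int := K 1 1.
Lemma kapE n : K n 1 = n * kappa.
Proof.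
have nat_case (m : nat) : K m 1 = m%:Z * kappa.
  elim: m => [|m IH]; first by rewrite kap0 mul0r.
  by rewrite -addn1 PoszD kapD IH mulrDl mul1r.
case: n => m; first exact: nat_case.
rewrite NegzE mulNr -nat_case; apply/eqP; rewrite -addr_eq0 -kapD addNr kap0 //.
Qed.
Lemma kappa_gt0 : 0 < kappa.
Proof.
by have := kap_pos K (oner_neq0 R); rewrite /tform !mul1r ltr0z.
Qed.
Lemma chiE n (t : circ R) : chi (K n) t = cpow t (n * kappa).
Proof. by rewrite /chi kapE. Qed.
Lemma chiD m n (t : circ R) : chi (K (m + n)) t = cmul (chi (K m) t) (chi (K n) t).
Proof. by rewrite !chiE mulrDl cpowD. Qed.
Lemma chiM (mu : Lambda) (s t : circ R) : chi mu (cmul s t) = cmul (chi mu s) (chi mu t).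
Proof. exact: cpowM. Qed.
Lemma chi1 (mu : Lambda) : chi mu (cone : circ R) = cone.
Proof. exact: cpow1. Qed.
Lemma chi_cont (T : topologicalType) (mu : Lambda) (f : T -> circ R) :
  continuous f -> continuous (fun t => chi mu (f t)).
Proof. exact: cpow_cont. Qed.
Lemma chiK_cont (T : topologicalType) (f : T -> circ R) (n : T -> int) :
  continuous f -> continuous n -> continuous (fun t => chi (K (n t)) (f t)).
Proof.
move=> cf cn; apply: (@int_glue_cont _ _ n (fun m t => chi (K m) (f t))) => // m.
exact: chi_cont.
Qed.

Lemma emulE (x y : ext (LT K)) :
  emul x y = ((cmul x.1.1.1 y.1.1.1, x.1.1.2 + y.1.1.2, uadd x.1.2 y.1.2),
   cmul (cmul x.2 y.2) (cmul (chi (K x.1.1.2) y.1.1.1) (expi (omega K x.1.2 y.1.2)))).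
Proof. by []. Qed.

Lemma pair_eq (S T : Type) (a a' : S) (b b' : T) : a = a' -> b = b' -> (a, b) = (a', b').
Proof. by move=> -> ->. Qed.

Lemma omega_uaddl f f' g : omega K (uadd f f') g = omega K f g + omega K f' g.
Proof. exact: (etrans (omegaDl K 1 1 f f' g) (congr2 +%R (mul1r _) (mul1r _))). Qed.
Lemma omega_uaddr f g g' : omega K f (uadd g g') = omega K f g + omega K f g'.
Proof. exact: (etrans (omegaDr K 1 1 f g g') (congr2 +%R (mul1r _) (mul1r _))). Qed.

Lemma LTmulA (a b c : LTsort R) : LTmul (LTmul a b) c = LTmul a (LTmul b c).
Proof. by rewrite /LTmul /= cmulA addrA uaddA. Qed.

Lemma LTtau_cocycle (a b c : LTsort R) :
  cmul (LTtau K a b) (LTtau K (LTmul a b) c) = cmul (LTtau K b c) (LTtau K a (LTmul b c)).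
Proof.
rewrite /LTtau /LTmul /= chiD chiM omega_uaddl omega_uaddr !expiD.
have alg (p x q r y z : circ R) : cmul (cmul p x) (cmul (cmul q r) (cmul y z)) =
    cmul (cmul r z) (cmul (cmul p q) (cmul x y)).
  by apply: circ_eq => /=; ring.
exact: alg.
Qed.

Lemma emulA (x y z : ext (LT K)) : emul (emul x y) z = emul x (emul y z).
Proof.
case: x y z => [a s] [b t] [c u]; apply: pair_eq; first exact: LTmulA.
have alg (p q r w s' t' u' : circ R) : cmul p q = cmul r w ->
    cmul (cmul (cmul (cmul s' t') p) u') q = cmul (cmul s' (cmul (cmul t' u') r)) w.
  move=> /(congr1 (@cval R)) /= h; apply: circ_eq => /=.
  transitivity ((s' : C) * t' * u' * ((p : C) * q)); first by ring.
  by rewrite h; ring.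
exact: alg (LTtau_cocycle a b c).
Qed.

(** The function [|h|] never equals [pi], where [expi] is [-1]; being zero at [0], it stays below
    [pi] by the intermediate value theorem, and the only multiple of [2 pi] of that size is zero. *)
Lemma constant_lift (h : R -> R) : continuous h -> h 0 = 0 -> (forall x, expi (h x) = cone) ->
  forall x, h x = 0.
Proof.
move=> ch h0 h1.
have npi x : `|h x| != pi.
  apply/eqP => hx; have : expi `|h x| = cone.
    have [p|n] := leP 0 (h x); first by rewrite ger0_norm.
    by rewrite ltr0_norm // expiN h1 cinv1.
  rewrite hx => /(congr1 (@cval R)); rewrite expi_pi /= => /eqP.
  by rewrite eqNr oner_eq0.
have key a b : a <= b -> `|h a| < pi -> `|h b| < pi.
  move=> ab ha; rewrite ltNge; apply/negP => hb.
  have [||c _ hc] := @IVT R (fun x => `|h x|) a b pi ab.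
  - by apply: continuous_subspaceT => y; apply: cvg_norm; exact: ch.
  - by rewrite ge_min (ltW ha) /= le_max hb orbT.
  by have := npi c; rewrite hc eqxx.
have key2 a b : a <= b -> `|h b| < pi -> `|h a| < pi.
  move=> ab ha; rewrite ltNge; apply/negP => hb.
  have [||c _ hc] := @IVT R (fun x => `|h x|) a b pi ab.
  - by apply: continuous_subspaceT => y; apply: cvg_norm; exact: ch.
  - by rewrite ge_min (ltW ha) orbT /= le_max hb.
  by have := npi c; rewrite hc eqxx.
move=> x; have small : `|h x| < pi.
  have z0 : `|h 0| < pi by rewrite h0 normr0 pi_gt0.
  by have [p|n] := leP 0 x; [exact: key z0 | apply: key2 z0; exact: ltW].
have [n hn] := expi_eq1 (h1 x); move: small; rewrite hn normrM.
rewrite (ger0_norm (twopi_ge0 R)) => small.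
have n1 : `|n| < 1.
  rewrite -(@ltr_int R) intr_norm -(@ltr_pM2r _ (pi : R)) ?pi_gt0 // mul1r.
  apply: le_lt_trans small; rewrite ler_wpM2l //.
  by rewrite ler_peMl ?pi_ge0 // ler1n.
have -> : n = 0 by lia.
by rewrite mul0r.
Qed.

(** The quotient of the two loops has a continuous logarithm [g], up to a fixed point of the circle,
    so [g] is constant by [constant_lift]. Comparing [0] with [2 pi] equates the winding numbers,
    and the mean zero condition removes the remaining constant. *)
Lemma loop_of_inj (a b : LT K) : (forall x, loop_of a x = loop_of b x) -> a = b.
Proof.
case: a b => [[t n] f] [[t' n'] f'] /= h.
pose g x := 2 * pi * (f x - f' x) - (n - n')%:~R * x.
have cg : continuous g.
  move=> x; apply: cvgB.
    apply: cvgM; first exact: cvg_cst.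
    by apply: cvgB; exact: loop_cont0.
  by apply: cvgM; [exact: cvg_cst | exact: cvg_id].
have eg x : expi (g x) = cmul t' (cinv t).
  have := h x; rewrite /loop_of /= => e.
  have -> : g x = 2 * pi * f x + - n%:~R * x + - (2 * pi * f' x + - n'%:~R * x).
    by rewrite /g rmorphB /=; ring.
  rewrite expiD expiN !expiD cinvM.
  move: e; rewrite -!mulrNz.
  move: (expi _) (expi _) (expi _) (expi _) => p q r s e.
  have /(congr1 (@cval R)) /= := e; move=> e'.
  apply: circ_eq => /=; have t0 := circ_neq0 t.
  have r0 := circ_neq0 r; have s0 := circ_neq0 s.
  have p0 := circ_neq0 p; have q0 := circ_neq0 q.
  apply: (mulIf t0); rewrite divfK //.
  transitivity ((t : C) * s * r / ((q : C) * p)); first by field; rewrite p0 q0.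
  by rewrite e'; field; rewrite p0 q0.
have gc x : g x = g 0.
  apply/eqP; rewrite -subr_eq0; apply/eqP.
  apply: (@constant_lift (fun y => g y - g 0)).
  - by move=> y; apply: cvgB; [exact: cg | exact: cvg_cst].
  - exact: subrr.
  - by move=> y; rewrite expiD expiN !eg cmulVr.
have nn : n = n'.
  have := gc (2 * pi); rewrite /g -[in f _](add0r (2 * pi)) -[in f' _](add0r (2 * pi)) !uper mulr0 subr0.
  move=> /eqP; rewrite subr_eq -subr_eq0 opprD addrA subrr add0r oppr_eq0 mulf_eq0 intr_eq0 subr_eq0.
  by rewrite mulf_eq0 pnatr_eq0 (gt_eqF (pi_gt0 R)) !orbF => /eqP.
subst n'.
have fk x : f x = f' x + (f 0 - f' 0).
  have := gc x; rewrite /g subrr !mul0r !subr0 => /mulfI h2.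
  rewrite -h2 ?mulf_neq0 ?pnatr_eq0 // ?gt_eqF ?pi_gt0 //; ring.
have ff : f = f'.
  have k0 : f 0 - f' 0 = 0.
    have := umean f; rewrite -[LHS]/(rint _ _ _) (rint_eq (G := fun x => f' x + (f 0 - f' 0))) => [|x _]; last exact: fk.
    rewrite rintD; last 2 first.
    - exact: loop_cont0.
    - by move=> x; exact: cvg_cst.
    rewrite [X in X + _](_ : _ = 0) ?add0r; last exact: umean.
    rewrite rint_cst ?twopi_ge0 // subr0 => /eqP.
    by rewrite mulf_eq0 mulf_eq0 pnatr_eq0 (gt_eqF (pi_gt0 R)) !orbF => /eqP.
  by apply/loopU_eq/funext => x; rewrite fk k0 addr0.
subst f'; have := h 0; rewrite /loop_of /= => e; congr (_, _, _).
have := e; rewrite -!cmulA ![cmul t _]cmulC ![cmul t' _]cmulC; exact: cmul_inj.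
Qed.

(** The argument of the winding term is linear, so a rotation splits off a constant torus factor and
    translates only the mean zero part; injectivity of [loop_of] makes the rotated element
    unique. *)
Lemma rotatesP phi (a b : LT K) : rotates phi a b <->
  b = (cmul a.1.1 (expi (- (a.1.2)%:~R * phi)), a.1.2, urot phi a.2).
Proof.
have h : rotates phi a (cmul a.1.1 (expi (- (a.1.2)%:~R * phi)), a.1.2, urot phi a.2).
  case: a => [[t n] f] x; rewrite /loop_of.
  change (cmul (cmul (cmul t (expi (- n%:~R * phi))) (expi (- n%:~R * x))) (expi (2 * pi * f (x + phi))) =
    cmul (cmul t (expi (- n%:~R * (x + phi)))) (expi (2 * pi * f (x + phi)))).
  have -> : - n%:~R * (x + phi) = - n%:~R * phi + - n%:~R * x by ring.
  by rewrite expiD !cmulA.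
split=> [hb|-> //]; apply: loop_of_inj => x; by rewrite hb h.
Qed.

End level_facts.

(** * The line bundle in the coordinates of a global section *)

Section bundle_facts.
Local Open Scope quotient_scope.
Variables (R : realType) (K : level R) (lam : central_char K).
Local Notation C := R[i].
Local Notation G := (ext (LT K)).
Local Notation P := (int * loopU R)%type.

Definition gbase (g : G) : P := (g.1.1.2, g.1.2).
Definition gsec (p : P) : G := (((cone, p.1), p.2), cone).
(** The torus component of [g] relative to [gsec]. The inverse character cancels the cocycle value
    kap n t that arises when the section over winding number n is multiplied by t. *)
Definition gtor (g : G) : ext (Tgrp K) := (g.1.1.1, cmul g.2 (cinv (chi (K g.1.1.2) g.1.1.1))).

Lemma gsec_tor g : emul (gsec (gbase g)) (eincT (gtor g)) = g.
Proof.
case: g => [[[t n] f] z]; rewrite emul_incT; apply: pair_eq => /=; first by rewrite cmul1.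
by rewrite cmul1 -cmulA cmulV cmul1r.
Qed.
Lemma gbase_sec p : gbase (gsec p) = p. Proof. by case: p. Qed.
Lemma gtor_sec p : gtor (gsec p) = eone (Tgrp K).
Proof. by rewrite /gtor /= chi1 cinv1 cmul1r. Qed.
Lemma gbase_incT g h : gbase (emul g (eincT h)) = gbase g.
Proof. by case: g => [[[t n] f] z]; case: h => s y; rewrite emul_incT. Qed.
Lemma gtor_incT g h : gtor (emul g (eincT h)) = emul (gtor g) h.
Proof.
case: g => [[[t n] f] z]; case: h => s y.
apply: (etrans (congr1 gtor (emul_incT (t, n, f) z s y))).
apply: (etrans _ (esym (@emul_T R K t (cmul z (cinv (chi (K n) t))) s y))).
apply: pair_eq => //=; rewrite chiM; apply: circ_eq => /=; rewrite invfM.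
have := circ_neq0 (chi (K n) s); set w := cval (chi (K n) s) => w0; field.
by apply/andP; split; [exact: (circ_neq0 (chi (K n) t)) | exact: w0].
Qed.

Lemma lam_mul x y : (lam (emul x y) : C) = (lam x : C) * lam y.
Proof. by rewrite lamM. Qed.

Definition fcoord (b : flag K) : P := gbase (flag_repr b).
Definition fpt (p : P) : flag K := flag_pi (gsec p).
(** As [g h, v] = [g, lam h v], the class of (g, v) equals that of [gsec] at the base point of g
    with fibre coordinate [lam (gtor g) v]. *)
Definition bfib (x : G * C^o) : P * C^o := (gbase x.1, (lam (gtor x.1) : C) * x.2).
Definition bcoord (e : bundle lam) : P * C^o := bfib (bundle_repr e).
Definition bpt (x : P * C^o) : bundle lam := bundle_pi lam (gsec x.1) x.2.

Lemma flag_pi_eq g g' : gbase g = gbase g' -> flag_pi g = flag_pi g' :> flag K.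
Proof.
move=> h; apply/eqmodP; apply/asboolP.
exists (emul (einv (gtor g)) (gtor g')); rewrite -emulT.
by rewrite -{1}(gsec_tor g) emulTK h gsec_tor.
Qed.
Lemma fcoord_pi g : fcoord (flag_pi g) = gbase g.
Proof.
have : flag_rel g (flag_repr (flag_pi g)) by rewrite -[flag_rel _ _]eqmodE reprK.
by move=> /asboolP[h e]; rewrite /fcoord e gbase_incT.
Qed.
Lemma fcoordK b : fpt (fcoord b) = b.
Proof. by rewrite -[RHS]reprK; apply: flag_pi_eq; rewrite gbase_sec. Qed.
Lemma fptK p : fcoord (fpt p) = p. Proof. by rewrite fcoord_pi gbase_sec. Qed.

Lemma bcoord_pi g v : bcoord (bundle_pi lam g v) = bfib (g, v).
Proof.
have : bundle_rel lam (g, v : C^o) (bundle_repr (bundle_pi lam g v)).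
  by rewrite -[bundle_rel _ _ _]eqmodE reprK.
move=> /asboolP[h [/= e1 e2]]; rewrite /bcoord /bfib e1 gbase_incT gtor_incT lam_mul.
by rewrite -mulrA -e2.
Qed.
Lemma bundle_pi_sec g v : bundle_pi lam g v = bpt (bfib (g, v)).
Proof.
apply/esym/eqmodP; apply/asboolP.
by exists (gtor g) => /=; split => //; rewrite gsec_tor.
Qed.
Lemma bcoordK e : bpt (bcoord e) = e.
Proof.
rewrite /bcoord; case E : (bundle_repr e) => [g v]; rewrite -bundle_pi_sec.
by rewrite -[RHS]reprK /bundle_pi -E.
Qed.
Lemma lam1C : (lam (eone (Tgrp K)) : C) = 1. Proof. by rewrite lam1. Qed.
Lemma bptK x : bcoord (bpt x) = x.
Proof. by rewrite bcoord_pi /bfib gbase_sec gtor_sec lam1C mul1r; case: x. Qed.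

Definition bmove (x : G) (p : P) : P := (x.1.1.2 + p.1, uadd x.1.2 p.2).
Lemma gbase_mul x g : gbase (emul x g) = bmove x (gbase g).
Proof. by []. Qed.
Lemma bmoveA x y p : bmove (emul x y) p = bmove x (bmove y p).
Proof. by rewrite -(gbase_sec p) -!gbase_mul emulA. Qed.
(** The multiplier by which [x] acts on the fibre coordinate over [p]; [bmultM] is its cocycle
    identity. *)
Definition bmult (x : G) (p : P) : C := lam (gtor (emul x (gsec p))).
Lemma lam_gtor_mul x g : (lam (gtor (emul x g)) : C) = bmult x (gbase g) * lam (gtor g).
Proof. by rewrite -{1}(gsec_tor g) -emulA gtor_incT lam_mul. Qed.

Lemma uadd0f (f : loopU R) : uadd uzero f = f.
Proof. by apply/loopU_eq/funext => x /=; ring. Qed.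
Lemma emul1g (g : G) : emul (eone (LT K)) g = g.
Proof.
case: g => [[[t n] f] z]; rewrite emulE.
change ((cmul cone t, 0 + n, uadd uzero f, cmul (cmul cone z) (cmul (chi (K 0) t) (expi (omega K uzero f)))) =
  (t, n, f, z)).
by rewrite cmul1 add0r uadd0f cmul1 chi0 cmul1 omega0l expi0 cmul1r.
Qed.
Lemma bmove1 p : bmove (eone (LT K)) p = p.
Proof. by rewrite -{2}(gbase_sec p) -[in RHS](emul1g (gsec p)) gbase_mul gbase_sec. Qed.
Lemma bmult1 p : bmult (eone (LT K)) p = 1.
Proof. by rewrite /bmult emul1g gtor_sec lam1C. Qed.
Lemma fcoord_act x b : fcoord (flag_act x b) = bmove x (fcoord b).
Proof. by rewrite fcoord_pi gbase_mul. Qed.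
Lemma fcoord_inj (b b' : flag K) : fcoord b = fcoord b' -> b = b'.
Proof. by move=> h; rewrite -(fcoordK b) h fcoordK. Qed.
Lemma flag_actM (x y : G) (b : flag K) : flag_act (emul x y) b = flag_act x (flag_act y b).
Proof.
have h1 := fcoord_act (emul x y) b; have h2 := fcoord_act x (flag_act y b).
have h3 := fcoord_act y b; have h4 := bmoveA x y (fcoord b).
apply: fcoord_inj; exact: (etrans h1 (etrans h4 (esym (etrans h2 (congr1 (bmove x) h3))))).
Qed.
Lemma bcoord_act x e : bcoord (bundle_act x e) = (bmove x (bcoord e).1, bmult x (bcoord e).1 * (bcoord e).2).
Proof. by rewrite bcoord_pi /bfib gbase_mul /= lam_gtor_mul mulrA. Qed.
Lemma bcoord_proj e : fcoord (bundle_proj e) = (bcoord e).1.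
Proof. by rewrite fcoord_pi. Qed.
Lemma bcoord_scale c e : bcoord (bundle_scale c e) = ((bcoord e).1, c * (bcoord e).2).
Proof. by rewrite bcoord_pi /bfib /= mulrCA. Qed.
Lemma bcoord_add e e' : (bcoord e).1 = (bcoord e').1 ->
  bcoord (bundle_add e e') = ((bcoord e).1, (bcoord e).2 + (bcoord e').2).
Proof.
move=> h; rewrite bcoord_pi /bfib /=; congr (_, _).
set r := bundle_repr e; have l0 : (lam (gtor r.1) : C) != 0 by exact: circ_neq0.
(* The default value of [xget] cannot occur: over equal base points, dividing the fibre coordinate
   of [e'] by [lam (gtor r.1)] gives a representative of [e'] over the group element [r.1]. *)
case: xgetP => [w _ /= hw|/(_ ((lam (gtor r.1) : C)^-1 * (bcoord e').2))]; last first.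
  case; rewrite /= bundle_pi_sec /bfib /= mulrA divff // mul1r -[RHS]bcoordK; congr bpt.
  have h' : gbase r.1 = gbase (bundle_repr e').1 := h.
  by rewrite h'.
have h2 : (lam (gtor r.1) : C) * w = (bcoord e').2 by rewrite -hw bcoord_pi.
by rewrite mulrDr; congr (_ + _).
Qed.

Lemma bcoord_inj (e e' : bundle lam) : bcoord e = bcoord e' -> e = e'.
Proof. by move=> h; rewrite -(bcoordK e) h bcoordK. Qed.
Lemma bmultM x y p : bmult (emul x y) p = bmult x (bmove y p) * bmult y p.
Proof.
have h1 : bmult (emul x y) p = lam (gtor (emul x (emul y (gsec p)))).
  by rewrite -emulA.
have h2 : gbase (emul y (gsec p)) = bmove y p by rewrite gbase_mul gbase_sec.
have h3 := lam_gtor_mul x (emul y (gsec p)).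
exact: (etrans h1 (etrans h3 (congr1 (fun q => bmult x q * bmult y p) h2))).
Qed.
Lemma bundle_actM (x y : G) (e : bundle lam) :
  bundle_act (emul x y) e = bundle_act x (bundle_act y e).
Proof.
apply: bcoord_inj.
have h1 := bcoord_act (emul x y) e; have h2 := bcoord_act x (bundle_act y e).
have h3 := bcoord_act y e; move: (bundle_act y e) (bundle_act (emul x y) e) h1 h2 h3 => e1 e2.
move: (bcoord e) => [p v] h1 h2 h3; rewrite h3 in h2.
have h4 : bmult (emul x y) p * v = bmult x (bmove y p) * (bmult y p * v).
  by rewrite bmultM mulrA.
exact: (etrans h1 (etrans (pair_eq (bmoveA x y p) h4) (esym h2))).
Qed.

Lemma gbase_cont (T : topologicalType) (f : T -> G) : continuous f -> continuous (fun t => gbase (f t)).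
Proof.
move=> cf; apply: pair_cont; first by apply: snd_cont; apply: fst_cont; exact: fst_cont.
by apply: snd_cont; exact: fst_cont.
Qed.
Lemma gsec_cont : continuous gsec.
Proof.
apply: pair_cont; last by move=> t; exact: cvg_cst.
apply: pair_cont; last by apply: snd_cont => t; exact: cvg_id.
apply: pair_cont; first by move=> t; exact: cvg_cst.
by apply: fst_cont => t; exact: cvg_id.
Qed.
Lemma gtor_cont (T : topologicalType) (f : T -> G) : continuous f -> continuous (fun t => gtor (f t)).
Proof.
move=> cf; have c1 := fst_cont cf; have c11 := fst_cont c1.
apply: pair_cont; first exact: fst_cont.
apply: cmul_cont; first exact: snd_cont.
by apply: cinv_cont; apply: chiK_cont; [exact: fst_cont | exact: snd_cont].
Qed.
Lemma emul_cont (T : topologicalType) (f g : T -> G) : continuous f -> continuous g ->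
  continuous (fun t => emul (f t) (g t) : G).
Proof.
move=> cf cg; have f1 := fst_cont cf; have f11 := fst_cont f1.
have g1 := fst_cont cg; have g11 := fst_cont g1.
apply: pair_cont; last first.
  apply: cmul_cont; first by apply: cmul_cont; exact: snd_cont.
  apply: cmul_cont; first by apply: chiK_cont; [exact: fst_cont | exact: snd_cont].
  by apply: expi_comp_cont; apply: omega_cont; exact: snd_cont.
apply: pair_cont; last by apply: uadd_cont; exact: snd_cont.
apply: pair_cont; first by apply: cmul_cont; exact: fst_cont.
by apply: int_add_cont; exact: snd_cont.
Qed.
Lemma bfib_cont : continuous bfib.
Proof.
apply: pair_cont; first by apply: gbase_cont; apply: fst_cont => t; exact: cvg_id.
have h : continuous (fun x : G * C^o => lam (gtor x.1) : C^o).
  apply: circ_cval_cont; apply: comp_cont; last exact: lam_cont.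
  by apply: gtor_cont; apply: fst_cont => t; exact: cvg_id.
by move=> x; apply: cvgM; [exact: h | exact: cvg_snd].
Qed.
Lemma fcoord_cont : continuous fcoord.
Proof.
apply/quotient_continuous.
have -> : fcoord \o \pi_({eq_quot (flag_equiv K)}) = gbase.
  by apply/funext => g; exact: fcoord_pi.
by apply: gbase_cont => t; exact: cvg_id.
Qed.
Lemma fpt_cont : continuous fpt.
Proof. by apply: comp_cont; [exact: gsec_cont | exact: pi_continuous]. Qed.
Lemma bcoord_cont : continuous bcoord.
Proof.
apply/quotient_continuous.
have -> : bcoord \o \pi_({eq_quot (bundle_equiv lam)}) = bfib.
  by apply/funext => -[g v]; exact: bcoord_pi.
exact: bfib_cont.
Qed.
Lemma bpt_cont : continuous bpt.
Proof.
apply: (@comp_cont _ _ _ (fun x : P * C^o => (gsec x.1, x.2))); last exact: pi_continuous.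
apply: pair_cont; last by apply: snd_cont => t; exact: cvg_id.
by apply: comp_cont; [apply: fst_cont => t; exact: cvg_id | exact: gsec_cont].
Qed.
Lemma bmove_cont (T : topologicalType) (f : T -> G) (p : T -> P) :
  continuous f -> continuous p -> continuous (fun t => bmove (f t) (p t)).
Proof.
move=> cf cp; have f1 := fst_cont cf; have f11 := fst_cont f1.
apply: pair_cont; first by apply: int_add_cont; [exact: snd_cont | exact: fst_cont].
by apply: uadd_cont; exact: snd_cont.
Qed.

Lemma bundle_equivariant : bundle_is_equivariant lam.
Proof.
have cproj : continuous (@bundle_proj R K lam).
  have -> : @bundle_proj R K lam = (fun e => fpt (bcoord e).1).
    by apply/funext => e; apply: fcoord_inj; rewrite bcoord_proj fptK.
  by apply: comp_cont; [apply: fst_cont; exact: bcoord_cont | exact: fpt_cont].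
split.
- split => // b; exists setT, (fun x => bpt (fcoord x.1, x.2)), (fun e => (bcoord e).2).
  split.
  + by split; [exact: openT |].
  + move=> x v _; rewrite bptK; split=> //.
    by apply: fcoord_inj; rewrite bcoord_proj bptK.
  + by move=> e _; rewrite bcoord_proj -[RHS]bcoordK; congr bpt; case: (bcoord e).
  + move=> x v w c _; split; apply: bcoord_inj.
      by rewrite bcoord_add !bptK.
    by rewrite bcoord_scale !bptK.
  + split=> [y _|e _]; last by apply: snd_cont; exact: bcoord_cont.
    apply: (@comp_cont _ _ _ (fun x : flag K * C^o => (fcoord x.1, x.2))); last exact: bpt_cont.
    apply: pair_cont; last by apply: snd_cont => t; exact: cvg_id.
    by apply: comp_cont; [apply: fst_cont => t; exact: cvg_id | exact: fcoord_cont].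
- by move=> b; apply: fcoord_inj; rewrite fcoord_act bmove1.
- exact: flag_actM.
- have -> : (fun q : ext (LT K) * flag K => flag_act q.1 q.2) =
            (fun q => fpt (bmove q.1 (fcoord q.2))).
    by apply/funext => q; apply: fcoord_inj; rewrite fptK fcoord_act.
  apply: comp_cont; last exact: fpt_cont.
  apply: bmove_cont; first by apply: fst_cont => t; exact: cvg_id.
  by apply: comp_cont; [apply: snd_cont => t; exact: cvg_id | exact: fcoord_cont].
- move=> e; apply: bcoord_inj; rewrite bcoord_act bmove1 bmult1 mul1r.
  by case: (bcoord e).
- exact: bundle_actM.
- have -> : (fun q : ext (LT K) * bundle lam => bundle_act q.1 q.2) =
            (fun q => bpt (bmove q.1 (bcoord q.2).1, bmult q.1 (bcoord q.2).1 * (bcoord q.2).2)).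
    by apply/funext => q; apply: bcoord_inj; rewrite bptK bcoord_act.
  have c2 : continuous (fun q : ext (LT K) * bundle lam => bcoord q.2).
    by apply: comp_cont; [apply: snd_cont => t; exact: cvg_id | exact: bcoord_cont].
  have c1 : continuous (fun q : ext (LT K) * bundle lam => q.1) by apply: fst_cont => t; exact: cvg_id.
  apply: (@comp_cont _ _ _ (fun q : ext (LT K) * bundle lam =>
    (bmove q.1 (bcoord q.2).1, bmult q.1 (bcoord q.2).1 * (bcoord q.2).2) : P * C^o) bpt);
    last exact: bpt_cont.
  apply: pair_cont; first by apply: bmove_cont => //; exact: fst_cont.
  have h : continuous (fun q : ext (LT K) * bundle lam => bmult q.1 (bcoord q.2).1 : C^o).
    apply: circ_cval_cont; apply: comp_cont; last exact: lam_cont.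
    apply: gtor_cont; apply: emul_cont => //; apply: comp_cont; last exact: gsec_cont.
    exact: fst_cont.
  have c22 := snd_cont c2.
  by move=> q; apply: cvgM; [exact: (h q) | exact: (c22 q)].
- by move=> x e; apply: fcoord_inj; rewrite bcoord_proj bcoord_act fcoord_act bcoord_proj.
- move=> x e e' h; have h' : (bcoord e).1 = (bcoord e').1 by rewrite -!bcoord_proj h.
  apply: bcoord_inj; rewrite bcoord_act bcoord_add // bcoord_add !bcoord_act h' //=.
  by rewrite mulrDr.
- by move=> x c e; apply: bcoord_inj; rewrite bcoord_act !bcoord_scale bcoord_act /= mulrCA.
Qed.
End bundle_facts.

(** * The Fock representation *)

Section finite_support_sums.
Variables (R : realType) (T : choiceType).
Local Notation C := R[i].
Implicit Types (F G : T -> C).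

Lemma fsum_fset F (A : {fset T}) : (forall i, i \notin A -> F i = 0) ->
  \sum_(i \in [set: T]) F i = \sum_(i <- A) F i.
Proof.
exact: fsbigTE.
Qed.
Lemma fsum1 F k : (forall i, i != k -> F i = 0) -> \sum_(i \in [set: T]) F i = F k.
Proof.
move=> h; rewrite (@fsum_fset _ [fset k]%fset) ?big_seq_fset1 // => i.
by rewrite inE => /h.
Qed.
Lemma fsum0 F : (forall i, F i = 0) -> \sum_(i \in [set: T]) F i = 0.
Proof. by move=> h; rewrite (@fsum_fset _ fset0) ?big_seq_fset0. Qed.
End finite_support_sums.

Section multi_indices.
Implicit Types (al be : midx) (j k : nat).

Lemma incrE k al j : incr k al j = if j == k then (al k).+1 else al j.
Proof. by rewrite /incr fsfun_withE. Qed.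
Lemma decrE k al j : decr k al j = if j == k then (al k).-1 else al j.
Proof. by rewrite /decr fsfun_withE. Qed.
Lemma incrK k al : decr k (incr k al) = al.
Proof. by apply/fsfunP => j; rewrite decrE !incrE eqxx; case: eqP => [->|]. Qed.
Lemma decrK k al : al k != 0%N -> incr k (decr k al) = al.
Proof.
move=> h; apply/fsfunP => j; rewrite incrE !decrE eqxx; case: eqP => [->|//].
by rewrite prednK // lt0n.
Qed.
Lemma incr_k k al : incr k al k = (al k).+1. Proof. by rewrite incrE eqxx. Qed.
Lemma incrC j k al : incr j (incr k al) = incr k (incr j al).
Proof.
apply/fsfunP => i; rewrite !incrE; have [->//|jk] := eqVneq j k.
by have [->|ij] := eqVneq i j; rewrite ?(negPf jk).
Qed.

Definition midx0 : midx := [fsfun].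
Lemma midx0E j : midx0 j = 0%N. Proof. exact: fsfun0E. Qed.
Lemma midx_eq0 al : (forall j, al j = 0%N) -> al = midx0.
Proof. by move=> h; apply/fsfunP => j; rewrite h midx0E. Qed.
Lemma midx_neq0 al : al != midx0 -> exists k, al k != 0%N.
Proof.
move=> al0; apply: contrapT => h; move/eqP: al0; apply; apply: midx_eq0 => j.
by apply/eqP; apply/negPn/negP => hj; apply: h; exists j.
Qed.
Lemma incr_neq0 k al : incr k al != midx0.
Proof. by apply/eqP => /(congr1 (fun a : midx => a k)); rewrite incr_k midx0E. Qed.

(** A weighted degree: constant weight 1 drives the induction [midx_ind], and weight [S] gives the
    energy, as index k stands for mode k + 1. *)
Definition msum (w : nat -> nat) al : nat := (\sum_(k <- finsupp al) w k * al k)%N.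
Lemma msum_fset w al (A : {fset nat}) : (finsupp al `<=` A)%fset ->
  msum w al = (\sum_(k <- A) w k * al k)%N.
Proof.
move=> sA; apply: big_fset_incl => // k _; rewrite memNfinsupp => /eqP ->.
exact: muln0.
Qed.
Lemma msum_incr w k al : msum w (incr k al) = (msum w al + w k)%N.
Proof.
pose A := (k |` finsupp al)%fset.
rewrite (@msum_fset w (incr k al) A); last first.
  by apply/fsubsetP => j; rewrite mem_finsupp incrE !inE mem_finsupp; case: (j == k).
rewrite (@msum_fset w al A); last exact: fsubsetU1.
rewrite (big_fsetD1 k (fset1U1 _ _)) [in RHS](big_fsetD1 k (fset1U1 _ _)) /= incr_k mulnS.
have -> : (\sum_(j <- (A `\ k)%fset) w j * incr k al j = \sum_(j <- (A `\ k)%fset) w j * al j)%N.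
  rewrite big_seq [RHS]big_seq; apply: eq_bigr => j; rewrite !inE => /andP[jk _].
  by rewrite incrE (negPf jk).
by move: (\sum_(j <- _) _)%N (w k * al k)%N => u v; lia.
Qed.
Lemma msum0 w : msum w midx0 = 0%N.
Proof. by rewrite /msum finsupp0 big_seq_fset0. Qed.
Lemma msum_ge w k al : (w k * al k <= msum w al)%N.
Proof.
have [h|] := boolP (k \in finsupp al); last by rewrite memNfinsupp => /eqP ->; rewrite muln0.
by rewrite /msum (big_fsetD1 k) //= leq_addr.
Qed.

Lemma midx_ind (P : midx -> Prop) : P midx0 -> (forall k al, P al -> P (incr k al)) ->
  forall al, P al.
Proof.
move=> P0 PS al; have [n] := ubnP (msum (fun=> 1%N) al); elim: n al => // n IH al.
have [->|/midx_neq0[k hk]] := eqVneq al midx0; first by [].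
rewrite -(decrK hk) msum_incr addn1 ltnS => h; exact/PS/IH.
Qed.

End multi_indices.

Section mfact_facts.
Variable R : realType.

Lemma mfact_incr k al : mfact R (incr k al) = (al k).+1%:R * mfact R al.
Proof.
have mf (be : midx) (A : {fset nat}) : (finsupp be `<=` A)%fset ->
    mfact R be = \prod_(j <- A) ((be j)`!)%:R.
  move=> sA; apply: big_fset_incl => // j _; rewrite memNfinsupp => /eqP ->.
  by rewrite fact0.
pose A := (k |` finsupp al)%fset.
rewrite (mf _ A); last first.
  by apply/fsubsetP => j; rewrite mem_finsupp incrE !inE mem_finsupp; case: (j == k).
rewrite (mf al A); last exact: fsubsetU1.
rewrite (big_fsetD1 k (fset1U1 _ _)) [in RHS](big_fsetD1 k (fset1U1 _ _)) /= incr_k factS natrM -mulrA.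
congr (_ * (_ * _)).
rewrite big_seq [RHS]big_seq; apply: eq_bigr => j; rewrite !inE => /andP[jk _].
by rewrite incrE (negPf jk).
Qed.
Lemma mfact0 : mfact R midx0 = 1.
Proof. by rewrite /mfact finsupp0 big_seq_fset0. Qed.
End mfact_facts.

(** * Fourier modes and the generators attached to them *)

Section modes.
Variables (R : realType) (K : level R).
Local Notation C := R[i].

(** A phase parameter covers sine and cosine at once: differentiation adds [pi / 2] to it up to a
    scalar, and rotation is a translation of it. *)
Definition gcos (a th x : R) : R := cos (a * x + th).
Lemma gcos_derive (a th x : R) : is_derive x 1 (gcos a th) (a * gcos a (th + pi / 2) x).
Proof.
have h : is_derive x 1 (fun y : R => a * y + th) a.
  by apply: is_derive_eq; rewrite /GRing.scale /=; ring.
have := @is_derive1_comp R cos (fun y : R => a * y + th) x _ _ (is_derive_cos _) h.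
by rewrite /gcos addrA cosDpihalf mulrC.
Qed.
Lemma gcos_cont (a th : R) : continuous (gcos a th).
Proof. by move=> x; exact: is_derive_cont (gcos_derive a th x). Qed.
Lemma gcos_deriven a th n :
  derive1n n (gcos a th) = (fun x => a ^+ n * gcos a (th + pi / 2 *+ n) x).
Proof.
elim: n => [|n IH]; first by apply/funext => x; rewrite mulr0n addr0 expr0 mul1r.
rewrite derive1nS IH; apply/funext => x; rewrite derive1E.
have h := gcos_derive a (th + pi / 2 *+ n) x.
have h2 : is_derive x 1 (fun x => a ^+ n * gcos a (th + pi / 2 *+ n) x)
    (a ^+ n * (a * gcos a (th + pi / 2 *+ n + pi / 2) x)).
  by apply: is_derive_eq; rewrite /GRing.scale /=; ring.
by rewrite (@derive_val _ _ _ _ _ _ _ h2) mulrA -exprSr [in RHS](mulrSr (pi / 2) n) addrA.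
Qed.
Lemma gcos_per (n : int) th x : gcos n%:~R th (x + 2 * pi) = gcos n%:~R th x.
Proof.
have h : expi (n%:~R * (x + 2 * pi) + th) = expi (n%:~R * x + th).
  rewrite mulrDr addrAC expiD expi_2piM.
  exact: cmul1r.
by have := congr1 (fun t : circ R => complex.Re (t : C)) h.
Qed.
Lemma gcos_int (n : int) th : rint 0 (2 * pi) (gcos n%:~R th) = if n == 0 then 2 * pi * cos th else 0.
Proof.
case: eqP => [->|/eqP n0].
  rewrite (rint_eq (G := fun=> cos th)) => [|x _]; last by rewrite /gcos mul0r add0r.
  by rewrite rint_cst ?twopi_ge0 // subr0 mulrC.
have nR : n%:~R != 0 :> R by rewrite intr_eq0.
pose P x := n%:~R^-1 * gcos n%:~R (th - pi / 2) x.
have -> : rint 0 (2 * pi) (gcos n%:~R th) = P (2 * pi) - P 0.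
  apply: (@ftc _ _ P); [exact: twopi_ge0 | exact: gcos_cont|] => x _.
  have h := gcos_derive n%:~R (th - pi / 2) x.
  rewrite /P; apply: is_derive_eq; rewrite /GRing.scale /= subrK mulrA mulVf // mul1r; lra.
by rewrite /P -[2 * pi]add0r gcos_per subrr.
Qed.
Lemma gcos_mul (a b th ph x : R) :
  gcos a th x * gcos b ph x = 2^-1 * (gcos (a + b) (th + ph) x + gcos (a - b) (th - ph) x).
Proof.
rewrite /gcos.
have -> : (a + b) * x + (th + ph) = (a * x + th) + (b * x + ph) by ring.
have -> : (a - b) * x + (th - ph) = (a * x + th) - (b * x + ph) by ring.
by move: (a * x + th) (b * x + ph) => u v; rewrite cosD cosB; field.
Qed.
Lemma gcos_mul_int (m n : int) th ph : 0 < m -> 0 < n ->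
  rint 0 (2 * pi) (fun x => gcos m%:~R th x * gcos n%:~R ph x) =
  if m == n then pi * cos (th - ph) else 0.
Proof.
move=> m0 n0.
have E : rint 0 (2 * pi) (fun x => gcos m%:~R th x * gcos n%:~R ph x) =
    2^-1 * (rint 0 (2 * pi) (gcos (m + n)%:~R (th + ph)) + rint 0 (2 * pi) (gcos (m - n)%:~R (th - ph))).
  have c (k : int) (t : R) : continuous (gcos k%:~R t) by exact: gcos_cont.
  rewrite -rintD // -rintZ; last by move=> x; apply: cvgD; exact: c.
  by apply: rint_eq => x _; rewrite gcos_mul rmorphD rmorphB.
rewrite E !gcos_int subr_eq0; have -> : (m + n == 0) = false by lia.
rewrite add0r; case: eqP => _; last by rewrite mulr0.
by rewrite !mulrA mulVf ?pnatr_eq0 // mul1r.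
Qed.

Definition mode_sub1 k th : forall n x, derivable (derive1n n (gcos k.+1%:~R th)) x 1.
Proof.
move=> n x; rewrite gcos_deriven; have h := gcos_derive k.+1%:~R (th + pi / 2 *+ n) x.
have h2 : is_derive x 1 (fun x => (k.+1%:~R : R) ^+ n * gcos k.+1%:~R (th + pi / 2 *+ n) x)
   ((k.+1%:~R : R) ^+ n * (k.+1%:~R * gcos k.+1%:~R (th + pi / 2 *+ n + pi / 2) x)).
  by apply: is_derive_eq; rewrite /GRing.scale /=; ring.
by case: h2.
Qed.
Definition mode_sub3 k th : Rintegral lebesgue_measure `[0, 2 * pi] (gcos k.+1%:~R th) = 0.
Proof. exact: (gcos_int k.+1%:Z th). Qed.
Definition mode (k : nat) (th : R) : loopU R :=
  LoopU (@mode_sub1 k th) (gcos_per k.+1%:Z th) (@mode_sub3 k th).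

Lemma mode_rot k th c : urot c (mode k th) = mode k (th + k.+1%:R * c).
Proof.
apply/loopU_eq/funext => x /=; rewrite /gcos -pmulrn; congr cos; ring.
Qed.
Lemma mode_lin k th : mode k th = ulin (cos th) (sin th) (mode k 0) (mode k (pi / 2)).
Proof.
apply/loopU_eq/funext => x /=; rewrite /gcos addr0 cosDpihalf cosD; ring.
Qed.

(** The factors are the [k + 1] of [zcoef], the length of the unit vector of the form, the
    normalisation of [zmode], and the integral [pi] of a squared cosine over a period. *)
Definition mode_scale (k : nat) : R :=
  k.+1%:R * (Num.sqrt (tform K 1 1) * ((Num.sqrt 2)^-1 * (Num.sqrt (k.+1%:R * pi))^-1) * pi).
Lemma mode_scale_gt0 k : 0 < mode_scale k.
Proof.
rewrite /mode_scale !mulr_gt0 ?invr_gt0 ?sqrtr_gt0 ?pi_gt0 ?ltr0n //.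
  exact: (kap_pos K (oner_neq0 R)).
by rewrite mulr_gt0 ?pi_gt0 ?ltr0n.
Qed.

Lemma zcoef_mode k th j : zcoef K (mode k th) j =
  if j == k then (mode_scale k)%:C * (expi th : C) else 0.
Proof.
pose q : R := Num.sqrt (tform K 1 1) * ((Num.sqrt 2)^-1 * (Num.sqrt (j.+1%:R * pi))^-1).
have h1 : cintegral 0 (2 * pi) (fun x => (ucoord K (mode k th) x)%:C * (zmode j x)^*) =
    (q * rint 0 (2 * pi) (fun x => gcos k.+1%:~R th x * gcos j.+1%:~R 0 x)) +i*
    (q * rint 0 (2 * pi) (fun x => gcos k.+1%:~R th x * gcos j.+1%:~R (pi / 2) x)).
  have cc (t : R) : continuous (fun x => gcos k.+1%:~R th x * gcos j.+1%:~R t x).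
    by move=> x; apply: cvgM; exact: gcos_cont.
  rewrite -!rintZ //; congr (_ +i* _); apply: rint_eq => x _.
    by rewrite /ucoord /zmode /q /= /gcos -!pmulrn addr0; ring.
  by rewrite /ucoord /zmode /q /= /gcos -!pmulrn cosDpihalf; ring.
rewrite /zcoef h1 !gcos_mul_int ?ltz_nat // subr0 cosBpihalf.
rewrite eqz_nat eqSS eq_sym; case: eqP => [jk|_]; last first.
  have -> : (q * 0 +i* (q * 0) : C) = 0 by rewrite !mulr0.
  by rewrite mulr0.
have E : (j.+1%:R : C) = (j.+1%:R : R)%:C by rewrite rmorph_nat.
have -> : mode_scale k = j.+1%:R * (q * pi) by rewrite -jk.
rewrite E; move: (j.+1%:R : R) => a.
by apply/eqP; rewrite eq_complex /=; apply/andP; split; apply/eqP; ring.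
Qed.

Lemma conjM_real (a : R) (z : C) : (a%:C * z)^* = a%:C * z^*.
Proof.
by case: z => u v; apply/eqP; rewrite eq_complex /=; apply/andP; split; apply/eqP; ring.
Qed.

Lemma drho_mode k th (p : midx -> C) al : drho K (mode k th) p al =
  (mode_scale k)%:C * ((expi th : C) * drho_z k p al + (expi (- th) : C) * drho_zb k p al).
Proof.
rewrite /drho (@fsum1 _ _ _ k) => [|j /negPf jk]; last first.
  by rewrite NconjE zcoef_mode jk conjc0 !mul0r addr0.
rewrite NconjE zcoef_mode eqxx conjM_real expi_conj.
by move: ((mode_scale k)%:C) (expi th : C) (expi (- th) : C) => a b c; ring.
Qed.

End modes.

Section commuting_projection.
Variables (R : realType) (G : twgroup R) (V : twrep G).
Local Notation C := R[i].

Lemma projection_op (P : V -> Prop) : closed_subspace P ->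
  exists T : V -> V, [/\ hlinear T, forall v, hnorm (T v) <= hnorm v, forall v, P (T v),
    forall u v, P u -> hdot u (v - T v) = 0 & forall v, P v -> T v = v].
Proof.
move=> cP; have [P0 Pl _] := cP.
have /choice[T hT] : forall v, exists p, P p /\ forall u, P u -> hdot u (v - p) = 0.
  by move=> v; have [p] := projection cP v; exists p.
have Tuniq v p : P p -> (forall u, P u -> hdot u (v - p) = 0) -> T v = p.
  move=> Pp hp; have [PT oT] := hT v.
  have Pd : P (T v - p) by rewrite -scaleN1r addrC; exact: Pl.
  apply/eqP; rewrite -subr_eq0; apply/eqP/hdot_eq0.
  rewrite [X in hdot _ X](_ : _ = (v - p) - (v - T v)); last by rewrite opprB [RHS]addrC addrA subrK.
  by rewrite hdotBr hp // oT // subrr.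
exists T; split.
- move=> a x y; have [Px ox] := hT x; have [Py oy] := hT y.
  apply: Tuniq; first exact: Pl.
  move=> u Pu; rewrite opprD addrACA -scalerBr hdotDr hdotZr ox // oy //.
  by rewrite mulr0 addr0.
- move=> v; have [Pp op] := hT v.
  rewrite -(@ler_pXn2r _ 2%N) ?nnegrE ?hnorm_ge0 //.
  rewrite -{2}(subrK (T v) v) addrC hnormD_sqr op // mulr0 addr0 lerDl; exact: sqr_ge0.
- by move=> v; case: (hT v).
- by move=> u v Pu; case: (hT v) => _; apply.
- by move=> v Pv; apply: Tuniq => // u _; rewrite subrr hdot0r.
Qed.

(* The orthogonal projection onto an invariant subspace commutes with the action, as the
   subspace is also invariant under the inverse operators. *)
Lemma schur_irreducible :
  (forall g, exists (c : C) (h : G), forall v, raction V g (c *: raction V h v) = v) ->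
  (exists v : V, v <> 0) ->
  (forall T : V -> V, hlinear T -> (forall v, hnorm (T v) <= hnorm v) ->
     (forall g v, T (raction V g v) = raction V g (T v)) -> exists c : C, forall v, T v = c *: v) ->
  irreducible V.
Proof.
move=> inv v0 sch; split => // P iP; have [P0 Pl Pg Pc] := iP.
have [T [lT nT PT oT fT]] := projection_op (And3 P0 Pl Pc).
have [|c hc] := sch T lT nT.
  move=> g v; set p := raction V g (T v).
  have Pp : P p by apply: Pg.
  apply/eqP; rewrite -subr_eq0; apply/eqP/hdot_eq0.
  have Pd : P (T (raction V g v) - p) by rewrite -scaleN1r addrC; apply: Pl => //; exact: PT.
  rewrite [X in hdot _ X](_ : _ = (raction V g v - p) - (raction V g v - T (raction V g v))); last first.
    by rewrite opprB [RHS]addrC addrA subrK.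
  rewrite hdotBr (oT _ _ Pd) subr0 /p -(hlinearB (ract_lin (raction V) g)).
  have [k [h hv]] := inv g; rewrite -[X in hdot X _]hv (ract_iso (raction V)).
  by apply: oT; rewrite -[_ *: _]addr0; apply: Pl => //; exact: Pg.
have [c0|c0] := eqVneq c 0; [left|right] => v.
  by move=> Pv; rewrite -(fT v Pv) hc c0 scale0r.
have -> : v = c^-1 *: T v + 0 by rewrite hc scalerA mulVf // scale1r addr0.
by apply: Pl.
Qed.
End commuting_projection.

(** * Operators determined by their vacuum expectation *)

Section weyl_relations.
Variable R : realType.
Local Notation C := R[i].
Implicit Types (a b : nat -> C) (m : midx -> midx -> C).

(** For [m] the matrix of [T] in the monomials, these are [T z_k = z_k T + a_k T] and
    [(d/dz_k) T = T (d/dz_k) + b_k T], the commutation relations of a Weyl operator with creation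
    and annihilation. *)
Definition weylrel a b m :=
  (forall k be al, m be (incr k al) = (be k)%:R * m (decr k be) al + a k * m be al) /\
  (forall k be al, m (incr k be) al = (al k)%:R * m be (decr k al) + b k * m be al).

Lemma weylrel0 a b m : weylrel a b m -> m midx0 midx0 = 0 -> forall be al, m be al = 0.
Proof.
move=> [h1 h2] m0 be al; elim/midx_ind: al be => [|k al IH] be.
  elim/midx_ind: be => [//|k be IH].
  by rewrite h2 midx0E mul0r IH mulr0 addr0.
by rewrite h1 !IH !mulr0 addr0.
Qed.

(** Each relation lowers one multi-index, so a solution with zero vacuum entry vanishes; this is
    applied to the combination of [m] and [m'] whose vacuum entry cancels. *)
Lemma weylrel_prop a b m m' : weylrel a b m -> weylrel a b m' ->
  forall be al, m' midx0 midx0 * m be al = m midx0 midx0 * m' be al.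
Proof.
move=> [h1 h2] [h1' h2'] be al; apply/eqP; rewrite -subr_eq0; apply/eqP.
apply: (@weylrel0 a b (fun be al => m' midx0 midx0 * m be al - m midx0 midx0 * m' be al)).
  by split=> k {}be {}al; rewrite ?h1 ?h1' ?h2 ?h2'; ring.
by rewrite mulrC subrr.
Qed.
End weyl_relations.

Section fock_basis.
Variable R : realType.
Local Notation C := R[i].

Definition bv (al : midx) : Fock R := delta (@mfact_gt0 R) al.
Lemma bvE al be : lfun (bv al) be = (be == al)%:R. Proof. exact: deltaE. Qed.
Lemma bv_total : total bv. Proof. exact: delta_total. Qed.
Lemma bv_finsup al : finsup (fock_fun (bv al)).
Proof.
apply: (@finsupP R _ _ [fset al]%fset) => be; rewrite inE => /negPf h.
by rewrite -[fock_fun _ _]/(lfun _ _) bvE h.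
Qed.
Lemma hdot_bv al be : hdot (bv al) (bv be) = if al == be then (mfact R al)%:C else 0.
Proof. exact: hdot_delta. Qed.
Lemma bv0_neq : hdot (bv midx0) (bv midx0) = 1.
Proof. by rewrite hdot_bv eqxx mfact0. Qed.

Lemma drho_z_bv k al be : drho_z k (lfun (bv al)) be = (- sqrt2 R * (be == incr k al)%:R).
Proof.
rewrite /drho_z; case: eqP => [h|/eqP h].
  rewrite (_ : (be == _) = false) ?mulr0 //; apply/eqP => e.
  by move: h; rewrite e incr_k.
rewrite bvE; congr (_ * (nat_of_bool _)%:R); apply/eqP/eqP => [<-|->]; first by rewrite decrK.
by rewrite incrK.
Qed.
Lemma drho_zb_bv k al be :
  drho_zb k (lfun (bv al)) be = sqrt2 R * ((al k)%:R * (be == decr k al)%:R).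
Proof.
rewrite /drho_zb bvE; congr (_ * _); have [e|ne] := eqVneq (incr k be) al.
  by rewrite -e incrK eqxx incr_k.
rewrite mulr0; have [e|] := eqVneq be (decr k al); last by rewrite mulr0.
have [->|h] := eqVneq (al k) 0%N; first by rewrite mul0r.
by move: ne; rewrite e decrK // eqxx.
Qed.
End fock_basis.

(** * From the group representation to its generators *)

Section fock_representation.
Variables (R : realType) (K : level R) (rho : fock_rep K).
Local Notation C := R[i].
Implicit Types (f g : loopU R) (u v : Fock R).

Lemma expiCD (x y : R) : (expi x : C) * (expi y : C) = (expi (x + y) : C).
Proof. by rewrite expiD. Qed.
Lemma rhoM f g v : rho f (rho g v) = (expi (omega K f g) : C) *: rho (uadd f g) v.
Proof.
rewrite (ract_tw (frep rho)); congr ((_ : C) *: _).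
change ((cmul (chi (K 0) cone) (expi (omega K f g)) : C) = (expi (omega K f g) : C)).
by rewrite chi1 cmul1.
Qed.
Lemma rho_inj f : injective (rho f).
Proof. exact: hiso_inj (ract_lin (frep rho) f) (ract_iso (frep rho) f). Qed.
Lemma rho_norm f v : hnorm (rho f v) = hnorm v.
Proof. exact: hiso_norm (ract_iso (frep rho) f). Qed.
Lemma rho0 v : rho uzero v = v.
Proof.
apply: (@rho_inj uzero); rewrite rhoM omega_self expi0 scale1r.
by congr (rho _ v); exact: uaddf0.
Qed.
Lemma rhoV f v : rho f (rho (uopp f) v) = v.
Proof.
rewrite rhoM (_ : omega K f (uopp f) = 0); last first.
  have -> : f = uscale 1 f by apply/loopU_eq/funext => x /=; ring.
  by rewrite /uopp omega_scale (_ : uscale 1 f = f) ?omega_self ?mulr0 //; apply/loopU_eq/funext => x /=; ring.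
rewrite expi0 scale1r (_ : uadd _ _ = uzero) ?rho0 //.
by apply/loopU_eq/funext => x /=; ring.
Qed.
Lemma rho_adj f u v : hdot (rho f u) v = hdot u (rho (uopp f) v).
Proof. by rewrite -{1}(rhoV f v) (ract_iso (frep rho)). Qed.
Lemma rho_comm f g v :
  rho g (rho f v) = (expi (omega K g f - omega K f g) : C) *: rho f (rho g v).
Proof.
rewrite !rhoM scalerA expiCD subrK.
by congr (_ *: rho _ v); apply/loopU_eq/funext => x /=; ring.
Qed.
Definition fock_twrep : twrep (Ugrp K) := TwRep (frep rho).

Lemma expi_deriv0 (ga e : R) : 0 < e -> exists2 d : R, 0 < d & forall t : R, t != 0 -> `|t| < d ->
  cabs (t^-1%:C * ((expi (t * ga) : C) - 1) - 'i * ga%:C) < e.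
Proof.
move=> e0; have e2 : 0 < e / 2 by rewrite divr_gt0.
have lin : is_derive (0 : R) 1 (fun t : R => t * ga) ga.
  by apply: is_derive_eq; rewrite /GRing.scale /=; ring.
have dc : is_derive (0 : R) 1 (fun t : R => cos (t * ga)) 0.
  have := @is_derive1_comp R cos (fun t : R => t * ga) 0 _ _ (is_derive_cos _) lin.
  by rewrite mul0r sin0 oppr0 mul0r.
have ds : is_derive (0 : R) 1 (fun t : R => sin (t * ga)) ga.
  have := @is_derive1_comp R sin (fun t : R => t * ga) 0 _ _ (is_derive_sin _) lin.
  by rewrite mul0r cos0 mul1r.
have quot (F : R -> R) (D : R) : is_derive (0 : R) 1 F D ->
    exists2 d : R, 0 < d & forall t : R, t != 0 -> `|t| < d -> `|t^-1 * (F t - F 0) - D| < e / 2.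
  move=> [dF vF]; have := dF; rewrite /derivable => /cvg_ex[l hl].
  have : (fun h : R => h^-1 *: (F (h *: 1 + 0) - F 0)) @ 0^' --> D.
    by rewrite -vF; exact: dF.
  move=> /cvgrPdist_lt/(_ _ e2); rewrite near_withinE => /nbhs_ballP[d /= d0 hd].
  exists d => // t t0 td; rewrite distrC.
  have := hd t; rewrite /ball /= sub0r normrN => /(_ td t0).
  by rewrite /GRing.scale /= mulr1 addr0.
have [d1 d10 h1] := quot _ _ dc; have [d2 d20 h2] := quot _ _ ds.
exists (Num.min d1 d2); first by rewrite lt_min d10.
move=> t t0; rewrite lt_min => /andP[t1 t2].
have := h1 t t0 t1; have := h2 t t0 t2; rewrite mul0r sin0 cos0.
set x := _ - ga; set y := _ - 0 => hx hy.
have -> : t^-1%:C * ((expi (t * ga) : C) - 1) - 'i * ga%:C = y%:C + 'i * x%:C.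
  by apply/eqP; rewrite eq_complex /= /x /y; apply/andP; split; apply/eqP; ring.
apply: (le_lt_trans (cabsD _ _)); rewrite (splitr e) ltrD // ?cabs_real // cabsM cabs_real.
by rewrite (_ : cabs 'i = 1) ?mul1r // /cabs normc_def /= expr0n expr1n add0r sqrtr1.
Qed.

Lemma uscaleN (t : R) f : uopp (uscale t f) = uscale (- t) f.
Proof. by apply/loopU_eq/funext => x /=; ring. Qed.

Lemma small_bound (z A B D E : C) (r : R) : 0 <= r ->
  z = - A - D * E + B -> cabs A <= r -> cabs D <= 1 -> cabs E <= r -> cabs B <= r -> cabs z <= 3 * r.
Proof.
move=> r0 -> hA hD hE hB; have h := cabsD (- A - D * E) B; have h2 := cabsD (- A) (- (D * E)).
rewrite !cabsN cabsM in h2.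
have h3 : cabs D * cabs E <= r.
  by rewrite -[r]mul1r; apply: ler_pM => //; exact: cabs_ge0.
lra.
Qed.

(* Differentiating <q, T rho(t g) p> = exp (- i t ga) <rho(- t g) q, T p> at t = 0. *)
Lemma comm_rel (T : Fock R -> Fock R) g (ga k : R) (p q Dp Dq : Fock R) :
  hlinear T -> 0 <= k -> (forall v, hnorm (T v) <= k * hnorm v) ->
  (forall (t : R) u, rho (uscale t g) (T u) = (expi (t * ga) : C) *: T (rho (uscale t g) u)) ->
  finsup (fock_fun p) -> finsup (fock_fun q) ->
  (forall al, lfun Dp al = drho K g (lfun p) al) ->
  (forall al, lfun Dq al = drho K g (lfun q) al) ->
  hdot q (T Dp) + hdot Dq (T p) + 'i * ga%:C * hdot q (T p) = 0.
Proof.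
move=> lT k0 bT cT fp fq eDp eDq.
have [Dp' eDp' limp] := frep_gen rho g fp; have [Dq' eDq' limq] := frep_gen rho g fq.
have {eDp eDp'} eP : Dp' = Dp by apply: l2_eq => al; exact: etrans (eDp' al) (esym (eDp al)).
have {eDq eDq'} eQ : Dq' = Dq by apply: l2_eq => al; exact: etrans (eDq' al) (esym (eDq al)).
subst Dp' Dq'; apply: cabs_le_eq0.
pose M := hnorm q * k + hnorm (T p) + cabs (hdot q (T p)) + cabs (hdot Dq (T p)) + 1.
have M1 : 1 <= M.
  by rewrite lerDr !addr_ge0 ?mulr_ge0 ?hnorm_ge0 ?cabs_ge0.
have M0 : 0 < M by apply: lt_le_trans M1.
(* [M] dominates the coefficients of all the error terms, and the estimate at the end is
   [6 M r = 3 e / 4]. *)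
move=> e e0; pose r := e / (8 * M); have r0 : 0 < r by rewrite divr_gt0 // mulr_gt0.
have [d1 d10 h1] := limp _ r0; have [d2 d20 h2] := limq _ r0.
have [d3 d30 h3] := expi_deriv0 (- ga) r0.
have [d4 d40 h4] := expi_near0 r0.
pose d5 := d4 / (`|ga| + 1); have d50 : 0 < d5 by rewrite divr_gt0 // ltr_wpDl.
pose t := Num.min (Num.min d1 d2) (Num.min d3 d5) / 2.
have m0 : 0 < Num.min (Num.min d1 d2) (Num.min d3 d5) by rewrite !lt_min d10 d20 d30 d50.
have t0 : 0 < t by rewrite divr_gt0.
have tn : t != 0 by rewrite gt_eqF.
have tm : `|t| < Num.min (Num.min d1 d2) (Num.min d3 d5).
  by rewrite ger0_norm ?(ltW t0) // /t gtr_pMr // invf_lt1 ?ltr1n.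
move: tm; rewrite !lt_min -!andbA => /and4P[td1 td2 td3 td5].
have tC : t%:C != 0 :> C by rewrite (inj_eq (@complexI R)).
have hP := h1 t tn td1; set P := _ - Dp in hP.
have hQ : hnorm ((- t)^-1%:C *: (rho (uscale (- t) g) q - q) - Dq) < r.
  by apply: h2; rewrite ?oppr_eq0 ?normrN.
set Q := _ - Dq in hQ.
have hE := h3 t tn td3.
have hE2 : cabs ((expi (t * - ga) : C) - 1) < r.
  apply: h4; rewrite mulrN normrN normrM.
  have g1 : 0 < `|ga| + 1 by rewrite ltr_wpDl.
  move: td5; rewrite /d5 ltr_pdivlMr // mulrDr mulr1 => h; apply: le_lt_trans h.
  by rewrite lerDl.
(* Unitarity moves the group element to the left factor with the sign of [t] reversed, and the phase
   with it. *)
have key1 : hdot q (T (rho (uscale t g) p)) =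
    (expi (t * - ga) : C) * hdot (rho (uscale (- t) g) q) (T p).
  rewrite rho_adj uscaleN opprK cT hdotZr mulrA expiCD.
  by rewrite -mulrDr addNr mulr0 expi0 mul1r.
have eP' : rho (uscale t g) p = p + t%:C *: (Dp + P).
  rewrite /P [X in _ *: X]addrC subrK scalerA -rmorphM /= mulfV // scale1r.
  by rewrite addrC subrK.
have eQ' : rho (uscale (- t) g) q = q + (- t)%:C *: (Dq + Q).
  rewrite /Q [X in _ *: X]addrC subrK scalerA -rmorphM /= mulfV ?oppr_eq0 // scale1r.
  by rewrite addrC subrK.
have nTP : cabs (hdot q (T P)) <= M * r.
  apply: (le_trans (cauchy_schwarz _ _)); apply: (@le_trans _ _ (hnorm q * (k * hnorm P))).
    by rewrite ler_wpM2l ?hnorm_ge0.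
  rewrite mulrA; apply: ler_pM; rewrite ?mulr_ge0 ?hnorm_ge0 // ?(ltW hP) //.
  by rewrite /M -!addrA lerDl !addr_ge0 ?hnorm_ge0 ?cabs_ge0.
have nQT : cabs (hdot Q (T p)) <= M * r.
  apply: (le_trans (cauchy_schwarz _ _)); rewrite mulrC; apply: ler_pM; rewrite ?hnorm_ge0 ?(ltW hQ) //.
  rewrite /M; have := hnorm_ge0 q; have := cabs_ge0 (hdot q (T p)); have := cabs_ge0 (hdot Dq (T p)).
  by move=> x0 y0 z0; have := mulr_ge0 z0 k0; lra.
move: key1; rewrite eP' eQ' (hlinearD lT) (hlinearZ lT) hdotDr hdotZr (hlinearD lT) hdotDr hdotDl hdotZl conjc_real hdotDl.
move=> key1.
pose E0 : C := t^-1%:C * ((expi (t * - ga) : C) - 1) - 'i * (- ga)%:C.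
have nE0 : cabs (E0 * hdot q (T p)) <= M * r.
  rewrite cabsM mulrC; apply: ler_pM; rewrite ?cabs_ge0 ?(ltW hE) //.
  rewrite /M; have := hnorm_ge0 q; have := hnorm_ge0 (T p); have := cabs_ge0 (hdot Dq (T p)).
  by move=> x0 y0 z0; have := mulr_ge0 z0 k0; lra.
have nE1 : cabs (((expi (t * - ga) : C) - 1) * hdot Dq (T p)) <= M * r.
  rewrite cabsM mulrC; apply: ler_pM; rewrite ?cabs_ge0 ?(ltW hE2) //.
  rewrite /M; have := hnorm_ge0 q; have := hnorm_ge0 (T p); have := cabs_ge0 (hdot q (T p)).
  by move=> x0 y0 z0; have := mulr_ge0 z0 k0; lra.
(* The first order expansions of both sides of [key1], divided by [t]: the wanted expression equals
   error terms only. *)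
have alg : hdot q (T Dp) + hdot Dq (T p) + 'i * ga%:C * hdot q (T p) =
    - hdot q (T P) - (expi (t * - ga) : C) * hdot Q (T p) +
    (E0 * hdot q (T p) - ((expi (t * - ga) : C) - 1) * hdot Dq (T p)).
  have eV : (t^-1)%:C = (t%:C)^-1 :> C by exact: fmorphV.
  have eN (y : R) : (- y)%:C = - y%:C :> C by exact: rmorphN.
  move: key1; rewrite /E0 eV !eN.
  move: (hdot q (T p)) (hdot q (T Dp)) (hdot q (T P)) (hdot Dq (T p)) (hdot Q (T p)) (expi _ : C).
  move=> a b c d f w key1; apply: (mulfI tC).
  move: key1; move: (t%:C) (ga%:C) tC => s y s0 key1.
  have : s * (b + c) = w * (a + - s * (d + f)) - a by rewrite -key1; ring.
  move=> key2; rewrite mulrDr [s * (_ + _ + _)]mulrDr.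
  have -> : s * (b + d) = (s * (b + c)) + s * d - s * c by ring.
  by rewrite key2; field.
apply: (@le_lt_trans _ _ (3 * (2 * (M * r)))); last first.
  rewrite /r; have -> : 3 * (2 * (M * (e / (8 * M)))) = e * (3 / 4) by field; rewrite gt_eqF.
  lra.
have Mr : 0 <= M * r by rewrite mulr_ge0 // ltW.
have w1 : cabs (expi (t * - ga) : C) <= 1 by rewrite cabs_circ.
have Mr2 : 0 <= 2 * (M * r) by rewrite mulr_ge0.
apply: (small_bound Mr2 alg) => //.
- by apply: (le_trans nTP); rewrite ler_peMl // ler1n.
- by apply: (le_trans nQT); rewrite ler_peMl // ler1n.
apply: (le_trans (cabsD _ _)); rewrite cabsN; lra.
Qed.

End fock_representation.
Local Opaque mode bv incr decr.

(** * Bounded operators that commute with the Fock representation up to phases *)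

Section fock_intertwiners.
Variables (R : realType) (K : level R) (rho : fock_rep K).
Local Notation C := R[i].
Implicit Types (f g : loopU R) (u v : Fock R).

Definition fmat (T : Fock R -> Fock R) : midx -> midx -> C :=
  fun be al => hdot (bv R be) (T (bv R al)).

Definition svec (H : hilbert R) (s a b : C) (x y : H) : H := s *: (a *: x - b *: y).
Lemma svecr (H : hilbert R) s a b (x y u : H) (T : H -> H) : hlinear T ->
  hdot u (T (svec s a b x y)) = s * (a * hdot u (T x) - b * hdot u (T y)).
Proof. by move=> lT; rewrite /svec (hlinearZ lT) (hlinearB lT) !(hlinearZ lT) hdotZr hdotBr !hdotZr. Qed.
Lemma svecl (H : hilbert R) s a b (x y u : H) :
  hdot (svec s a b x y) u = s^* * (a^* * hdot x u - b^* * hdot y u).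
Proof. by rewrite /svec hdotZl hdotBl !hdotZl. Qed.
Lemma svecE s a b (x y : Fock R) al : lfun (svec s a b x y) al = s * (a * lfun x al - b * lfun y al).
Proof. by []. Qed.

Definition mode_vec k th (al : midx) : Fock R :=
  svec ((mode_scale K k)%:C * sqrt2 R) ((al k)%:R * (expi (- th) : C)) (expi th : C)
    (bv R (decr k al)) (bv R (incr k al)).

Lemma mode_vecE k th al be : lfun (mode_vec k th al) be = drho K (mode k th) (lfun (bv R al)) be.
Proof.
have -> := @drho_mode R K k th (lfun (bv R al)) be.
rewrite drho_z_bv drho_zb_bv /mode_vec.
have -> := svecE ((mode_scale K k)%:C * sqrt2 R) ((al k)%:R * (expi (- th) : C)) (expi th : C)
  (bv R (decr k al)) (bv R (incr k al)) be.
apply: (etrans (congr2 (fun P Q : C => (mode_scale K k)%:C * sqrt2 R *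
  ((al k)%:R * (expi (- th) : C) * P - (expi th : C) * Q)) (bvE R (decr k al) be) (bvE R (incr k al) be))).
move: ((mode_scale K k)%:C) (sqrt2 R) (expi th : C) (expi (- th) : C) => s r x y.
have alg (p q t : C) : s * r * (p * y * q - x * t) = s * (x * (- r * t) + y * (r * (p * q))) by ring.
exact: alg.
Qed.

Definition wcoef (k : nat) : C := 2 * ((mode_scale K k)%:C * sqrt2 R).
Lemma sqrt2_neq0 : sqrt2 R != 0.
Proof. by rewrite (inj_eq (@complexI R)) gt_eqF // sqrtr_gt0. Qed.
Lemma mscale_neq0 k : (mode_scale K k)%:C * sqrt2 R != 0.
Proof. by rewrite mulf_neq0 ?sqrt2_neq0 // (inj_eq (@complexI R)) gt_eqF // mode_scale_gt0. Qed.

Lemma expi_pihalf : (expi (pi / 2 : R) : C) = 'i.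
Proof. by rewrite /= cos_pihalf sin_pihalf. Qed.
Lemma expi_Npihalf : (expi (- (pi / 2 : R)) : C) = - 'i.
Proof.
rewrite -expi_conj expi_pihalf; apply/eqP; rewrite eq_complex /=.
by rewrite oppr0 !eqxx.
Qed.

(** The generator of a real mode mixes raising and lowering. The relations for the phases [0] and
    [pi / 2], combined with coefficients [1] and [- i] or [i], separate the two; solving for a
    single entry divides by [wcoef]. *)
Lemma weyl_matrix (T : Fock R -> Fock R) (ga : nat -> R -> R) (k : R) :
  hlinear T -> 0 <= k -> (forall v, hnorm (T v) <= k * hnorm v) ->
  (forall j th (t : R) u, rho (uscale t (mode j th)) (T u) =
     (expi (t * ga j th) : C) *: T (rho (uscale t (mode j th)) u)) ->
  weylrel (fun j => ('i * (ga j 0)%:C + (ga j (pi / 2))%:C) / wcoef j)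
          (fun j => ('i * (ga j 0)%:C - (ga j (pi / 2))%:C) / wcoef j) (fmat T).
Proof.
move=> lT k0 bT cT.
have rel j th (be al : midx) : (mode_scale K j)%:C * sqrt2 R *
    ((al j)%:R * (expi (- th) : C) * fmat T be (decr j al) - (expi th : C) * fmat T be (incr j al)
     + ((be j)%:R * (expi th : C) * fmat T (decr j be) al - (expi (- th) : C) * fmat T (incr j be) al))
    + 'i * (ga j th)%:C * fmat T be al = 0.
  have h := comm_rel lT k0 bT (cT j th) (bv_finsup R al) (bv_finsup R be)
    (mode_vecE j th al) (mode_vecE j th be).
  rewrite -[RHS]h /fmat /mode_vec svecr // svecl {h}.
  have -> : ((mode_scale K j)%:C * sqrt2 R)^* = (mode_scale K j)%:C * sqrt2 R.
    by rewrite conjM_real conjc_real.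
  have -> : ((be j)%:R * (expi (- th) : C))^* = (be j)%:R * (expi th : C).
    have cM (n : nat) (z : C) : (n%:R * z)^* = n%:R * z^* by rewrite rmorphM rmorph_nat.
    by rewrite cM expi_conj opprK.
  by rewrite expi_conj [in LHS]mulrDr.
split=> j be al; have e0 := rel j 0 be al; have e1 := rel j (pi / 2) be al;
  move: e0 e1; rewrite oppr0 expi0 expi_pihalf expi_Npihalf /wcoef;
  move: (mscale_neq0 j); move: (_ * sqrt2 R) => s s0;
  move: (fmat T be al) (fmat T be (decr j al)) (fmat T be (incr j al))
    (fmat T (decr j be) al) (fmat T (incr j be) al) => m a b c d;
  move: ((ga j 0)%:C) ((ga j (pi / 2))%:C) ((al j)%:R : C) ((be j)%:R : C) => x y p q e0 e1;
  apply: (mulfI s0); apply: (@mulfI _ 2) => //.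
- have h : s * (2 * q * c - 2 * b) + ('i * x + y) * m = 0.
    rewrite -[RHS](subrr 0) -{1}e0 -(mulr0 'i) -{1}e1.
    have i2 : 'i * 'i = -1 :> C by rewrite -expr2 sqr_i.
    have -> : 'i * (s * (p * - 'i * a - 'i * b + (q * 'i * c - - 'i * d)) + 'i * y * m) =
       ('i * 'i) * (s * (- (p * a) - b + (q * c + d)) + y * m) by ring.
    rewrite i2 /=; ring.
  apply/eqP; rewrite -subr_eq0 -oppr_eq0 -h; apply/eqP; field.
  by rewrite s0.
- have h : s * (2 * p * a - 2 * d) + ('i * x - y) * m = 0.
    rewrite -[RHS](addr0 0) -{1}e0 -(mulr0 'i) -{1}e1.
    have i2 : 'i * 'i = -1 :> C by rewrite -expr2 sqr_i.
    have -> : 'i * (s * (p * - 'i * a - 'i * b + (q * 'i * c - - 'i * d)) + 'i * y * m) =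
       ('i * 'i) * (s * (- (p * a) - b + (q * c + d)) + y * m) by ring.
    rewrite i2 /=; ring.
  apply/eqP; rewrite -subr_eq0 -oppr_eq0 -h; apply/eqP; field.
  by rewrite s0.
Qed.

Lemma fmat_inj (T T' : Fock R -> Fock R) (k : R) : hlinear T -> hlinear T' -> 0 <= k ->
  (forall v, hnorm (T v) <= k * hnorm v) -> (forall v, hnorm (T' v) <= k * hnorm v) ->
  (forall be al, fmat T be al = fmat T' be al) -> T =1 T'.
Proof.
move=> lT lT' k0 bT bT' h; apply: (eq_on_total (@bv_total R) k0) => // al.
apply/eqP; rewrite -subr_eq0; apply/eqP/bv_total => be.
by rewrite hdotBr -/(fmat T be al) h subrr.
Qed.

Lemma weyl_prop (a b : nat -> C) (T T' : Fock R -> Fock R) : hlinear T -> hlinear T' ->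
  (forall v, hnorm (T v) <= hnorm v) -> (forall v, hnorm (T' v) <= hnorm v) ->
  weylrel a b (fmat T) -> weylrel a b (fmat T') ->
  forall v, fmat T' midx0 midx0 *: T v = fmat T midx0 midx0 *: T' v.
Proof.
move=> lT lT' bT bT' wT wT'.
set x := fmat T' _ _; set y := fmat T _ _.
apply: (@fmat_inj (fun v => x *: T v) (fun v => y *: T' v) (cabs x + cabs y)).
- by move=> c u v; rewrite lT scalerDr !scalerA mulrC.
- by move=> c u v; rewrite lT' scalerDr !scalerA mulrC.
- by rewrite addr_ge0 ?cabs_ge0.
- move=> v; rewrite hnormZ; apply: ler_pM; rewrite ?cabs_ge0 ?hnorm_ge0 //.
  by rewrite lerDl cabs_ge0.
- move=> v; rewrite hnormZ; apply: ler_pM; rewrite ?cabs_ge0 ?hnorm_ge0 //.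
  by rewrite lerDr cabs_ge0.
- by move=> be al; rewrite /fmat !hdotZr; exact: (weylrel_prop wT wT').
Qed.

(** [T] and the identity satisfy the same relations, those with zero phases, so they are
    proportional, and the scalar is the vacuum expectation of [T]. *)
Lemma fock_schur (T : Fock R -> Fock R) : hlinear T -> (forall v, hnorm (T v) <= hnorm v) ->
  (forall f v, T (rho f v) = rho f (T v)) -> exists c : C, forall v, T v = c *: v.
Proof.
move=> lT bT cT.
have w (S : Fock R -> Fock R) : hlinear S -> (forall v, hnorm (S v) <= hnorm v) ->
    (forall f v, S (rho f v) = rho f (S v)) ->
    weylrel (fun j => ('i * (0%:C) + 0%:C) / wcoef j) (fun j => ('i * (0%:C) - 0%:C) / wcoef j) (fmat S).
  move=> lS bS cS; apply: (@weyl_matrix S (fun _ _ => 0) 1) => //.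
    by move=> v; rewrite mul1r.
  by move=> j th t u; rewrite mulr0 expi0 scale1r cS.
have lid : hlinear (id : Fock R -> Fock R) by [].
have bid (v : Fock R) : hnorm v <= hnorm v by [].
exists (fmat T midx0 midx0) => v.
rewrite -(weyl_prop lT lid bT bid (w T lT bT cT) (w id lid bid (fun _ _ => erefl))).
by rewrite /fmat bv0_neq scale1r.
Qed.

Lemma fock_neq0 : exists v : Fock R, v <> 0.
Proof.
exists (bv R midx0) => h; have := bv0_neq R; rewrite h hdot0r => /eqP.
by rewrite eq_sym oner_eq0.
Qed.

End fock_intertwiners.

(** * Covariance of the Fock representation under rotation *)

Section fock_rotation.
Variables (R : realType) (K : level R) (rho : fock_rep K).
Local Notation C := R[i].
Implicit Types (f g : loopU R) (u v : Fock R).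

Definition energy (al : midx) : nat := msum S al.
Lemma energy_incr k al : energy (incr k al) = (energy al + k.+1)%N.
Proof. exact: msum_incr. Qed.
Definition rotm (phi : R) (al : midx) : C := expi ((energy al)%:R * phi).
Lemma rotm1 phi al : cabs (rotm phi al) = 1. Proof. exact: cabs_circ. Qed.
Definition rotF (phi : R) (v : Fock R) : Fock R := mult rotm1 phi v.
Lemma rotFE phi v al : lfun (rotF phi v) al = rotm phi al * lfun v al.
Proof. exact: multE. Qed.
Lemma rotF_lin phi : hlinear (rotF phi). Proof. exact: mult_lin. Qed.
Lemma rotF_norm phi v : hnorm (rotF phi v) = hnorm v. Proof. exact: mult_norm. Qed.
Lemma rotF_bv phi al : rotF phi (bv R al) = rotm phi al *: bv R al.
Proof.
apply: l2_eq => be; rewrite rotFE lfunZ bvE; case: eqP => [->//|_].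
by rewrite !mulr0.
Qed.
Lemma rotmD phi psi al : rotm (phi + psi) al = rotm phi al * rotm psi al.
Proof. by rewrite /rotm mulrDr expiCD. Qed.
Lemma rotm0 al : rotm 0 al = 1. Proof. by rewrite /rotm mulr0 expi0. Qed.
Lemma rotFD phi psi v : rotF (phi + psi) v = rotF phi (rotF psi v).
Proof. by apply: l2_eq => al; rewrite !rotFE rotmD mulrA. Qed.
Lemma rotF0 v : rotF 0 v = v.
Proof. by apply: l2_eq => al; rewrite rotFE rotm0 mul1r. Qed.
Lemma rotFK phi v : rotF (- phi) (rotF phi v) = v.
Proof. by rewrite -rotFD addNr rotF0. Qed.

(** Raising mode k changes the energy by k + 1, so conjugation by the rotation multiplies the
    coefficients by the corresponding phases; by [wa_rot] and [wb_rot] these are the coefficients of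
    the rotated loop. *)
Lemma weylrel_rot phi (a b : nat -> C) (m : midx -> midx -> C) : weylrel a b m ->
  weylrel (fun k => (expi (- (k.+1%:R * phi)) : C) * a k) (fun k => (expi (k.+1%:R * phi) : C) * b k)
    (fun be al => rotm phi be * rotm (- phi) al * m be al).
Proof.
have ri (p : R) k al : rotm p (incr k al) = rotm p al * (expi (k.+1%:R * p) : C).
  by rewrite /rotm energy_incr natrD mulrDl expiCD.
have rd (p : R) k (al : midx) : (al k)%:R * rotm p al = (al k)%:R * (rotm p (decr k al) * (expi (k.+1%:R * p) : C)).
  have [->|h] := eqVneq (al k) 0%N; first by rewrite !mul0r.
  by rewrite -ri decrK.
have e1 k : (expi (k.+1%:R * phi) : C) * (expi (k.+1%:R * - phi) : C) = 1.
  by rewrite expiCD mulrN addrN expi0.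
move=> [h1 h2]; split=> k be al; rewrite ri ?h1 ?h2.
  have h := rd phi k be; rewrite -mulrN mulrDr [X in X + _ = _](_ : _ =
    (be k)%:R * rotm phi be * (rotm (- phi) al * (expi (k.+1%:R * - phi) : C) * m (decr k be) al)); last by ring.
  rewrite h [X in X + _ = _](_ : _ = (be k)%:R * rotm phi (decr k be) * rotm (- phi) al *
    m (decr k be) al * ((expi (k.+1%:R * phi) : C) * (expi (k.+1%:R * - phi) : C))); last by ring.
  by rewrite e1 mulr1; ring.
have h := rd (- phi) k al; rewrite mulrDr [X in X + _ = _](_ : _ =
  (al k)%:R * rotm (- phi) al * (rotm phi be * (expi (k.+1%:R * phi) : C) * m be (decr k al))); last by ring.
rewrite h [X in X + _ = _](_ : _ = (al k)%:R * rotm phi be * rotm (- phi) (decr k al) *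
  m be (decr k al) * ((expi (k.+1%:R * phi) : C) * (expi (k.+1%:R * - phi) : C))); last by ring.
by rewrite e1 mulr1; ring.
Qed.

Definition cg g f : R := omega K g f - omega K f g.
Lemma cg_lin (a b : R) g g' f : cg (ulin a b g g') f = a * cg g f + b * cg g' f.
Proof.
rewrite /cg omegaDl omegaDr.
by move: (omega _ _ _) (omega _ _ _) (omega _ _ _) (omega _ _ _) => x y z t; ring.
Qed.
Lemma rho_cg f g (t : R) u : rho (uscale t g) (rho f u) =
  (expi (t * cg g f) : C) *: rho f (rho (uscale t g) u).
Proof.
by rewrite rho_comm -/(cg _ f) /uscale cg_lin mul0r addr0.
Qed.
Lemma cg_rot phi g f : cg (urot phi g) (urot phi f) = cg g f.
Proof. by rewrite /cg !omega_rot. Qed.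
Definition cgam f (k : nat) (th : R) : R := cg (mode k th) f.
Lemma cgam_lin f k th : cgam f k th = cos th * cgam f k 0 + sin th * cgam f k (pi / 2).
Proof. by rewrite -cg_lin -mode_lin. Qed.
Lemma cgam_rot phi f k th : cgam (urot phi f) k th = cgam f k (th - k.+1%:R * phi).
Proof.
rewrite /cgam; have -> : mode k th = urot phi (mode k (th - k.+1%:R * phi)).
  by rewrite mode_rot subrK.
exact: cg_rot.
Qed.

Definition wa f k : C := ('i * (cgam f k 0)%:C + (cgam f k (pi / 2))%:C) / wcoef K k.
Definition wb f k : C := ('i * (cgam f k 0)%:C - (cgam f k (pi / 2))%:C) / wcoef K k.
Lemma rho_weyl f : weylrel (wa f) (wb f) (fmat (rho f)).
Proof.
apply: (@weyl_matrix R K rho (rho f) (cgam f) 1) => //.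
- exact: (ract_lin (frep rho) f).
- by move=> v; rewrite rho_norm mul1r.
- by move=> j th t u; exact: rho_cg.
Qed.

Lemma wa_rot phi f k : wa (urot phi f) k = (expi (- (k.+1%:R * phi)) : C) * wa f k.
Proof.
rewrite /wa !cgam_rot add0r [cgam f k (- _)]cgam_lin [cgam f k (pi / 2 - _)]cgam_lin.
rewrite cosN sinN cosB sinB cos_pihalf sin_pihalf mulrA; congr (_ / _).
move: (cgam f k 0) (cgam f k (pi / 2)) (k.+1%:R * phi) => x y s.
by apply/eqP; rewrite eq_complex /= cosN sinN; apply/andP; split; apply/eqP; ring.
Qed.
Lemma wb_rot phi f k : wb (urot phi f) k = (expi (k.+1%:R * phi) : C) * wb f k.
Proof.
rewrite /wb !cgam_rot add0r [cgam f k (- _)]cgam_lin [cgam f k (pi / 2 - _)]cgam_lin.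
rewrite cosN sinN cosB sinB cos_pihalf sin_pihalf mulrA; congr (_ / _).
move: (cgam f k 0) (cgam f k (pi / 2)) (k.+1%:R * phi) => x y s.
by apply/eqP; rewrite eq_complex /=; apply/andP; split; apply/eqP; ring.
Qed.

Definition rotT phi f (u : Fock R) : Fock R := rotF phi (rho f (rotF (- phi) u)).
Lemma rotT_lin phi f : hlinear (rotT phi f).
Proof. by move=> a u v; rewrite /rotT rotF_lin (ract_lin (frep rho)) rotF_lin. Qed.
Lemma rotT_norm phi f v : hnorm (rotT phi f v) = hnorm v.
Proof. by rewrite /rotT rotF_norm rho_norm rotF_norm. Qed.
Lemma rotT_mat phi f be al :
  fmat (rotT phi f) be al = rotm phi be * rotm (- phi) al * fmat (rho f) be al.
Proof.
rewrite /fmat /rotT rotF_bv (hlinearZ (ract_lin (frep rho) f)) (hlinearZ (rotF_lin phi)).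
rewrite hdotZr ![hdot (bv R be) _]hdot_deltal rotFE; ring.
Qed.
Lemma rotT_weyl phi f : weylrel (wa (urot phi f)) (wb (urot phi f)) (fmat (rotT phi f)).
Proof.
have h := weylrel_rot phi (rho_weyl f).
have e1 : wa (urot phi f) = (fun k => (expi (- (k.+1%:R * phi)) : C) * wa f k).
  by apply/funext => k; exact: wa_rot.
have e2 : wb (urot phi f) = (fun k => (expi (k.+1%:R * phi) : C) * wb f k).
  by apply/funext => k; exact: wb_rot.
have e3 : fmat (rotT phi f) = (fun be al => rotm phi be * rotm (- phi) al * fmat (rho f) be al).
  by apply/funext => be; apply/funext => al; exact: rotT_mat.
by rewrite e1 e2 e3.
Qed.

(** The conjugated operator and [rho] of the rotated loop satisfy the same Weyl relations, hence are
    proportional. The vacuum entry of the latter cannot vanish, since its whole matrix would, and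
    unitarity gives the factor modulus one. *)
Lemma rot_phase phi f : exists c : circ R, forall u,
  rotT phi f u = (c : C) *: rho (urot phi f) u.
Proof.
set f' := urot phi f.
have lr := ract_lin (frep rho) f'.
have nr v : hnorm (rho f' v) <= hnorm v by rewrite rho_norm.
have nT v : hnorm (rotT phi f v) <= hnorm v by rewrite rotT_norm.
have h := weyl_prop (rotT_lin phi f) lr nT nr (rotT_weyl phi f) (rho_weyl f').
set x := fmat (rho f') midx0 midx0 in h; set y := fmat (rotT phi f) midx0 midx0 in h.
have x0 : x != 0.
  apply/eqP => x0; have [v v0] := fock_neq0 R; apply: v0; apply: (@rho_inj R K rho f').
  have z0 := weylrel0 (rho_weyl f') x0.
  rewrite (hlinear0 lr).
  have l0 : hlinear (fun _ : Fock R => 0 : Fock R) by move=> a u w; rewrite scaler0 addr0.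
  apply: (@fmat_inj R (rho f') (fun=> 0) 1) => //.
    by move=> u; rewrite mul1r; exact: nr.
    by move=> u; rewrite hnorm0 mul1r hnorm_ge0.
  by move=> be al; rewrite z0 /fmat hdot0r.
have [v v0] := fock_neq0 R.
have nv : 0 < hnorm v.
  by rewrite lt_neqAle hnorm_ge0 andbT eq_sym; apply/eqP => /hnorm_eq0.
have c1 : `|y / x| == 1.
  apply/eqP; rewrite cabsE; congr (_%:C); rewrite cabsM cabsV.
  have E : cabs x = cabs y.
    apply: (@mulIf _ (hnorm v)); first by rewrite gt_eqF.
    by have := congr1 (@hnorm _ _) (h v); rewrite !hnormZ rotT_norm rho_norm.
  by rewrite -E divff // gt_eqF // cabs_gt0.
exists (Circ c1) => u /=.
by rewrite mulrC -scalerA -h scalerA mulVf // scale1r.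
Qed.

Definition vac f : C := fmat (rho f) midx0 midx0.
(** The generator sends the vacuum to vectors of degree one, which are orthogonal to it, so the
    vacuum expectation has no first order term. *)
Lemma vac_deriv f (e : R) : 0 < e -> exists2 d : R, 0 < d & forall t : R, t != 0 -> `|t| < d ->
  cabs (vac (uscale t f) - 1) < e * `|t|.
Proof.
move=> e0; have [D eD hD] := frep_gen rho f (bv_finsup R midx0).
have [d d0 hd] := hD _ e0; exists d => // t t0 td.
have D0 : hdot (bv R midx0) D = 0.
  rewrite [LHS]hdot_deltal -[lfun D midx0]/(fock_fun D midx0) eD /drho fsum0 ?mulr0 // => k.
  have -> := drho_zb_bv R k midx0 midx0; have -> := drho_z_bv R k midx0 midx0.
  by rewrite midx0E eq_sym (negPf (incr_neq0 _ _)) !(mulr0, mul0r) addr0.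
have -> : vac (uscale t f) - 1 = t%:C * hdot (bv R midx0)
    (t^-1%:C *: (rho (uscale t f) (bv R midx0) - bv R midx0) - D).
  rewrite hdotBr D0 subr0 hdotZr mulrA -rmorphM mulfV // mul1r hdotBr bv0_neq.
  by [].
rewrite cabsM cabs_real mulrC ltr_pM2r ?normr_gt0 //.
apply: le_lt_trans (cauchy_schwarz _ _) _.
have -> : hnorm (bv R midx0) = 1 by rewrite /hnorm /dnorm bv0_neq /= sqrtr1.
by rewrite mul1r hd.
Qed.

Lemma circ_pow_dist (c : circ R) n : cabs ((c : C) ^+ n - 1) <= n%:R * cabs ((c : C) - 1).
Proof.
elim: n => [|n IH]; first by rewrite expr0 subrr cabs0 mul0r.
have -> : (c : C) ^+ n.+1 - 1 = (c : C) * ((c : C) ^+ n - 1) + ((c : C) - 1) by rewrite exprS; ring.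
apply: (le_trans (cabsD _ _)); rewrite cabsM cabs_circ mul1r -[n.+1]addn1 natrD mulrDl mul1r.
by rewrite lerD2r.
Qed.

(* The phase is multiplicative in f, and its derivative along t f is read off the vacuum
   expectations, which are 1 + o(t). *)
Lemma rot_rho phi f u : rotF phi (rho f u) = rho (urot phi f) (rotF phi u).
Proof.
have /choice[c hc] := rot_phase phi.
(* Both sides arise from the product rule of [rho], applied before or after conjugation by the
   rotation; [omega] is rotation invariant, so the twists agree and the phase is a homomorphism. *)
have cD g g' : c (uadd g g') = cmul (c g) (c g').
  have [v v0] := fock_neq0 R.
  have e1 : rotT phi g (rotT phi g' v) = ((c g : C) * c g' * (expi (omega K g g') : C)) *:
      rho (uadd (urot phi g) (urot phi g')) v.
    by rewrite !hc (hlinearZ (ract_lin (frep rho) _)) rhoM omega_rot !scalerA.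
  have e2 : rotT phi g (rotT phi g' v) = ((c (uadd g g') : C) * (expi (omega K g g') : C)) *:
      rho (uadd (urot phi g) (urot phi g')) v.
    rewrite /rotT rotFK rhoM (hlinearZ (rotF_lin phi)) -/(rotT phi _ v) hc scalerA urotD.
    by congr (_ *: _); exact: mulrC.
  apply: circ_eq; apply: (mulIf (circ_neq0 (expi (omega K g g')))) => /=.
  apply/eqP; rewrite -subr_eq0; apply/eqP; apply: contrapT => /eqP nz.
  apply: v0; apply: (@rho_inj R K rho (uadd (urot phi g) (urot phi g'))).
  rewrite (hlinear0 (ract_lin (frep rho) _)); apply/eqP.
  have := etrans (esym e2) e1; move/eqP; rewrite -subr_eq0 -scalerBl scaler_eq0.
  by rewrite (negPf nz).
have cn n g : c (uscale n%:R g) = cpow (c g) n.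
  elim: n => [|n IH].
    have -> : uscale 0%:R g = uzero by apply/loopU_eq/funext => x /=; ring.
    rewrite cpow0; have := cD uzero uzero; rewrite uaddf0 -{1}[c uzero]cmul1r => /cmul_inj.
    by move=> ->.
  have -> : uscale n.+1%:R g = uadd (uscale n%:R g) g.
    by apply/loopU_eq/funext => x /=; rewrite -[n.+1]addn1 natrD; ring.
  by rewrite cD IH -[n.+1]addn1 PoszD cpowD; congr (cmul _ _); apply: circ_eq.
have vc g : vac g = (c g : C) * vac (urot phi g).
  have := hc g (bv R midx0) => /(congr1 (hdot (bv R midx0))).
  rewrite hdotZr -/(vac _) => <-; rewrite -[hdot _ _]/(fmat (rotT phi g) midx0 midx0) rotT_mat.
  by rewrite /rotm /energy msum0 !mul0r expi0 !mul1r.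
(* [c g] is the power of exponent [N + 1] of [c (g / (N + 1))], which lies within [e / (N + 1)] of 1
   because both vacuum expectations are that close to 1. *)
have c1 g : c g = cone.
  apply: circ_eq; apply/eqP; rewrite -subr_eq0; apply/eqP/cabs_le_eq0 => e e0.
  have e4 : 0 < e / 4 by rewrite divr_gt0.
  have [d1 d10 h1] := vac_deriv g e4; have [d2 d20 h2] := vac_deriv (urot phi g) e4.
  have d0 : 0 < Num.min d1 d2 by rewrite lt_min d10.
  have [N _ hN] := near_infty_natSinv_lt (PosNum d0).
  pose t : R := N.+1%:R^-1; have tp : 0 < t by rewrite invr_gt0 ltr0n.
  have tn : t != 0 by rewrite gt_eqF.
  have : `|t| < Num.min d1 d2 by rewrite ger0_norm ?(ltW tp) //; exact: (hN N (leqnn N)).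
  rewrite lt_min => /andP[/(h1 t tn) k1 /(h2 t tn) k2].
  have k3 : cabs ((c (uscale t g) : C) - 1) < e * t.
    rewrite -urotZ in k2; have := vc (uscale t g).
    move: (vac _) (vac _) k1 k2 => y x k1 k2 exy.
    have -> : (c (uscale t g) : C) - 1 = (x - 1) - (c (uscale t g) : C) * (y - 1) by rewrite exy; ring.
    apply: (le_lt_trans (cabsD _ _)); rewrite cabsN cabsM cabs_circ mul1r.
    move: k1 k2; rewrite ger0_norm ?(ltW tp) // => k1 k2.
    have := mulr_gt0 e0 tp; lra.
  have -> : g = uscale N.+1%:R (uscale t g).
    apply/loopU_eq/funext => x /=; rewrite !mul0r !addr0 mulrA mulfV ?mul1r //.
  rewrite cn; have := circ_pow_dist (c (uscale t g)) N.+1 => /le_lt_trans; apply.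
  have -> : e = N.+1%:R * (e * t) by rewrite /t mulrCA mulfV ?mulr1 // pnatr_eq0.
  by rewrite ltr_pM2l ?ltr0n.
have := hc f (rotF phi u); rewrite c1 scale1r /rotT => <-.
by rewrite rotFK.
Qed.
End fock_rotation.

(** * Representations induced from the torus *)

Section continuity_on_total.
Variables (R : realType) (H : hilbert R) (T : topologicalType) (I : Type) (S : I -> H).
Variable op : T -> H -> H.
Hypotheses (tS : total S) (lop : forall t, hlinear (op t)) (iop : forall t, hisometric (op t)).

Lemma cont_total (t : T) :
  (forall i (e : R), 0 < e -> \forall s \near t, hnorm (op s (S i) - op t (S i)) < e) ->
  forall v (e : R), 0 < e -> \forall s \near t, hnorm (op s v - op t v) < e.
Proof.
move=> h v e e0; have e4 : 0 < e / 4 by rewrite divr_gt0.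
have [c hc] := total_dense tS v e4.
have hl : \forall s \near t, hnorm (op s (lcomb S c) - op t (lcomb S c)) < e / 4.
  move: (e / 4) e4; rewrite /lcomb; elim: (c) => [|p c' IH] d d0.
    by near=> s; rewrite !big_nil !(hlinear0 (lop _)) subrr hnorm0.
  have d2 : 0 < d / 2 by rewrite divr_gt0.
  have n1 : 0 < cabs p.1 + 1 by rewrite ltr_wpDl ?cabs_ge0.
  have h1 := h p.2 _ (divr_gt0 d2 n1); have h2 := IH _ d2.
  apply: filter_app2 h1 h2; near=> s => h1 h2.
  rewrite !big_cons !lop opprD addrACA -scalerBr.
  apply: (le_lt_trans (hnormD _ _)); rewrite (splitr d) ltrD // hnormZ.
  move: h1; rewrite ltr_pdivlMr // => h1; apply: le_lt_trans h1.
  by rewrite mulrC ler_wpM2l ?hnorm_ge0 // lerDl.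
apply: filterS hl => s hs.
have -> : op s v - op t v = op s (v - lcomb S c) - op t (v - lcomb S c) +
    (op s (lcomb S c) - op t (lcomb S c)).
  by rewrite !(hlinearB (lop _)); exact: subr_decomp.
apply: (le_lt_trans (hnormD _ _)).
have h1 : hnorm (op s (v - lcomb S c) - op t (v - lcomb S c)) <= e / 4 + e / 4.
  apply: (le_trans (hnormD _ _)); rewrite hnormN !(hiso_norm _ (iop _)) lerD //.
    by rewrite hnormBC ltW.
  by rewrite hnormBC ltW.
lra.
Unshelve. all: by end_near.
Qed.
End continuity_on_total.

(** * Sums over the integers of copies of a representation of [loopU] *)

Section induced.
Variables (R : realType) (K : level R) (mu0 : int) (J : choiceType) (wJ : J -> R).
Hypothesis J0 : forall j, 0 < wJ j.
Local Notation C := R[i].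
Local Notation X := (int * J)%type.

Definition wX (x : X) : R := wJ x.2.
Fact wX_gt0 x : 0 < wX x. Proof. exact: J0. Qed.
Definition ind : hilbert R := l2hilbert wX_gt0.
Local Notation H := (l2hilbert J0).

Let one_gt0 (i : int) : 0 < (fun=> 1 : R) i. Proof. exact: ltr01. Qed.
Let pK (x : X) : (x.1, x.2) = x. Proof. by case: x. Qed.
Let pI (i : int) (j : J) : (i, j).1 = i. Proof. by []. Qed.
Let pJ (i : int) (j : J) : (i, j).2 = j. Proof. by []. Qed.
Let pw (i : int) (j : J) : wX (i, j) = (fun=> 1 : R) i * wJ j. Proof. by rewrite mul1r. Qed.

Definition ifib (m : int) (v : ind) : H := fib one_gt0 J0 pJ pw m v.
Lemma ifibE m v j : lfun (ifib m v) j = lfun v (m, j). Proof. exact: fibE. Qed.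
Lemma ifib_lin m : hlinear (ifib m). Proof. exact: fib_lin. Qed.
Lemma ifib_inj u v : (forall m, ifib m u = ifib m v) -> u = v.
Proof. exact: (fib_inj pK). Qed.

Lemma ifib_glue (g : int -> H) (M : R) :
  (forall F : {fset int}, \sum_(i <- F) hnorm (g i) ^+ 2 <= M) -> exists f : ind, forall i, ifib i f = g i.
Proof.
move=> h; apply: (fib_glue wX_gt0 one_gt0 pK pI pJ pw (M := M)) => F.
by under eq_bigr do rewrite mul1r; exact: h.
Qed.

Lemma ifib_sum (v : ind) (F : {fset int}) : \sum_(i <- F) hnorm (ifib i v) ^+ 2 <= hnorm v ^+ 2.
Proof.
have := fib_sum one_gt0 J0 pI pJ pw v F.
by under eq_bigr do rewrite mul1r.
Qed.

Lemma ifib_le (f : ind) (M : R) :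
  (forall F : {fset int}, \sum_(i <- F) hnorm (ifib i f) ^+ 2 <= M) -> hnorm f ^+ 2 <= M.
Proof.
move=> h; apply: (fib_le pK (I0 := one_gt0) (J0 := J0) (eJ := pJ) (we := pw)) => F.
by under eq_bigr do rewrite mul1r; exact: h.
Qed.

Fact iinc_subproof (m : int) (u : H) : exists f : ind, forall i, ifib i f = if i == m then u else 0.
Proof.
apply: (@ifib_glue _ (hnorm u ^+ 2)) => F.
have [mF|mF] := boolP (m \in F).
  rewrite (big_fsetD1 m mF) /= eqxx big_seq big1 ?addr0 // => i.
  by rewrite !inE => /andP[/negPf -> _]; rewrite hnorm0 expr0n.
rewrite big_seq big1 ?sqr_ge0 // => i iF; case: eqP => [e|_]; last by rewrite hnorm0 expr0n.
by move: mF; rewrite -e iF.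
Qed.
Definition iinc m u : ind := sval (cid (iinc_subproof m u)).
Lemma ifib_inc m u i : ifib i (iinc m u) = if i == m then u else 0.
Proof. exact: (svalP (cid (iinc_subproof m u))). Qed.
Lemma iinc_fun m u x : lfun (iinc m u) x = if x.1 == m then lfun u x.2 else 0.
Proof. by case: x => i j; rewrite -ifibE ifib_inc; case: ifP. Qed.
Lemma iinc_lin m : hlinear (iinc m).
Proof.
move=> a u v; apply: ifib_inj => i; rewrite ifib_lin !ifib_inc; case: ifP => // _.
by rewrite scaler0 addr0.
Qed.
Definition ibas (x : X) : ind := iinc x.1 (delta J0 x.2).
Lemma ibasE x : ibas x = delta wX_gt0 x.
Proof.
apply: l2_eq => y; rewrite iinc_fun !deltaE; case: x y => [m j] [m' j'] /=.
by rewrite xpair_eqE; case: eqP.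
Qed.
Lemma ibas_total : total ibas.
Proof. by move=> v h; apply: (@delta_total _ _ _ wX_gt0) => x; rewrite -ibasE. Qed.
(** Isometry and orthogonality of the inclusions both follow from this adjunction. The unordered sum
    is computed by restricting finite index sets to the fibre over [m]. *)
Lemma hdot_inc m u v : hdot (iinc m u) v = hdot u (ifib m v).
Proof.
pose P (u : H) := hdot (iinc m u) v = hdot u (ifib m v).
suff : P u by []. 
have key u' : hdot v (iinc m u') = hdot (ifib m v) u'.
  apply: (@usumE _ _) => e e0.
  have [A hA] := l2dotP J0 (ifib m v) u' e0.
  exists [fset (m, j) | j in A]%fset => B hB.
  have [D hD] : exists D : {fset J}, forall j, (j \in D) = ((m, j) \in B).
    exists [fset x.2 | x in B & x.1 == m]%fset => j; apply/imfsetP/idP => /=.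
      by move=> [[m' j'] /=]; rewrite !inE /= => /andP[h /eqP <-] ->.
    by move=> h; exists (m, j); rewrite ?inE /= ?h ?eqxx.
  have AD : (A `<=` D)%fset.
    apply/fsubsetP => j jA; rewrite hD; apply: (fsubsetP hB).
    by apply/imfsetP; exists j.
  rewrite (_ : \sum_(i <- B) _ = \sum_(j <- D) (wJ j)%:C * ((l2fun (ifib m v) j)^* * l2fun u' j)).
    exact: hA.
  transitivity (\sum_(x <- [fset (m, j) | j in D]%fset) (wX x)%:C * ((l2fun v x)^* * l2fun (iinc m u') x)).
    apply/esym/big_fset_incl.
      by apply/fsubsetP => x /imfsetP[j /=]; rewrite hD => h ->.
    move=> [m' j]; have [->|ne] := eqVneq m' m => xB; last first.
      by rewrite -[l2fun (iinc m u') _]/(lfun _ _) iinc_fun /= (negPf ne) !mulr0.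
    by case/imfsetP; exists j => //=; rewrite hD xB.
  rewrite big_imfset /=; last by move=> j j' _ _ [].
  apply: eq_bigr => j _; rewrite -[l2fun (iinc m u') _]/(lfun _ _) iinc_fun /= eqxx.
  by rewrite -[l2fun (ifib m v) j]/(lfun _ _) ifibE.
by rewrite /P hdotC key -hdotC.
Qed.
Lemma iinc_iso m : hisometric (iinc m).
Proof. by move=> u v; rewrite hdot_inc ifib_inc eqxx. Qed.
Lemma iinc_orth m n u v : m != n -> hdot (iinc m u) (iinc n v) = 0.
Proof. by move=> mn; rewrite hdot_inc ifib_inc (negPf mn) hdot0r. Qed.
Lemma iinc_total v : (forall m u, hdot (iinc m u) v = 0) -> v = 0.
Proof. by move=> h; apply: ibas_total => x; exact: h. Qed.

Variable r : loopU R -> H -> H.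
Hypotheses (r_lin : forall f, hlinear (r f)) (r_iso : forall f, hisometric (r f))
  (r_surj : forall f v, exists u, r f u = v)
  (r_cont : forall v f (e : R), 0 < e -> \forall g \near f, hnorm (r g v - r f v) < e).

Definition iwt (m : int) : int := mu0 + m * kappa K.

Fact iop_subproof (t : circ R) (n : int) (f : loopU R) (v : ind) :
  exists v' : ind, (forall m, ifib m v' = (cpow t (iwt m) : C) *: r f (ifib (m + n) v)) /\ hnorm v' = hnorm v.
Proof.
apply: (fib_op one_gt0 pK pI pJ pw (s := fun m => m + n) (t := fun m => m - n)
  (A := fun m u => (cpow t (iwt m) : C) *: r f u)) => //.
- by move=> m; rewrite addrK.
- by move=> m; rewrite subrK.
- by move=> m u; rewrite hnormZ cabs_circ mul1r (hiso_norm _ (r_iso f)).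
Qed.
(** Fibre [m + n] moves to fibre [m]. With this direction of the shift, composing two operators
    produces exactly the factor kap n s of the cocycle, see [iop_comp]. *)
Definition iop t n f v : ind := sval (cid (iop_subproof t n f v)).
Lemma iopE t n f v m : ifib m (iop t n f v) = (cpow t (iwt m) : C) *: r f (ifib (m + n) v).
Proof. by case: (svalP (cid (iop_subproof t n f v))). Qed.
Lemma iop_norm t n f v : hnorm (iop t n f v) = hnorm v.
Proof. by case: (svalP (cid (iop_subproof t n f v))). Qed.
Lemma iop_lin t n f : hlinear (iop t n f).
Proof.
move=> a u v; apply: ifib_inj => m; rewrite ifib_lin !iopE ifib_lin r_lin scalerDr !scalerA.
by rewrite mulrC.
Qed.
Lemma iop_iso t n f : hisometric (iop t n f).
Proof. by apply: hiso_polar; [exact: iop_lin | exact: iop_norm]. Qed.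
Lemma iop_inc t n f m u : iop t n f (iinc m u) = (cpow t (iwt (m - n)) : C) *: iinc (m - n) (r f u).
Proof.
apply: ifib_inj => i; rewrite (hlinearZ (ifib_lin i)) iopE !ifib_inc.
have -> : (i + n == m) = (i == m - n) by lia.
by case: eqP => [->//|_]; rewrite (hlinear0 (r_lin f)) !scaler0.
Qed.
Lemma iop_comp t n f s n' g (c : C) h v : (forall u, r f (r g u) = c *: r h u) ->
  iop t n f (iop s n' g v) = ((cpow s (n * kappa K) : C) * c) *: iop (cmul t s) (n + n') h v.
Proof.
move=> hr; apply: ifib_inj => m; rewrite (hlinearZ (ifib_lin m)) !iopE.
rewrite (hlinearZ (r_lin f)) hr !scalerA addrA; congr (_ *: _).
have -> : iwt (m + n) = iwt m + n * kappa K by rewrite /iwt mulrDl addrA.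
by rewrite cpowD cpowM /=; ring.
Qed.
Lemma iop_surj t n f v : exists u, iop t n f u = v.
Proof.
have /choice[r' hr'] := r_surj f.
have nr' u : hnorm (r' u) = hnorm u by rewrite -(hiso_norm (r' u) (r_iso f)) hr'.
pose g m := r' ((cpow t (- iwt (m - n)) : C) *: ifib (m - n) v).
have [u hu] : exists u, forall m, ifib m u = g m.
  apply: (@ifib_glue _ (hnorm v ^+ 2)) => F.
  apply: le_trans (ifib_sum v [fset i - n | i in F]%fset).
  rewrite big_imfset /=; last by move=> i j _ _; exact: addIr.
  by apply: ler_sum => i _; rewrite /g nr' hnormZ cabs_circ mul1r.
exists u; apply: ifib_inj => m; rewrite iopE hu /g hr' addrK scalerA.
have -> : (cpow t (iwt m) : C) * (cpow t (- iwt m) : C) = 1.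
  by rewrite -[_ * _]/(cmul (cpow _ _) (cpow _ _) : C) -cpowD subrr cpow0.
by rewrite scale1r.
Qed.
Lemma iop_cont (T : topologicalType) (a : T -> circ R) (b : T -> int) (c : T -> loopU R) :
  continuous a -> continuous b -> continuous c ->
  forall v t (e : R), 0 < e -> \forall s \near t,
    hnorm (iop (a s) (b s) (c s) v - iop (a t) (b t) (c t) v) < e.
Proof.
move=> ca cb cc v t.
apply: (@cont_total _ _ _ _ ibas (fun s => iop (a s) (b s) (c s)) ibas_total
  (fun s => @iop_lin (a s) (b s) (c s)) (fun s => @iop_iso (a s) (b s) (c s))).
move=> [m j] e e0; have e2 : 0 < e / 2 by rewrite divr_gt0.
have n1 : 0 < hnorm (delta J0 j) + 1 by rewrite ltr_wpDl ?hnorm_ge0.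
have h1 : \forall s \near t, b s = b t by move/int_contP: cb; exact.
have /ccontP/(_ _ (divr_gt0 e2 n1)) h2 :=
  circ_cval_cont (@cpow_cont _ _ a (iwt (m - b t)) ca) (x := t).
have h3 : \forall s \near t, hnorm (r (c s) (delta J0 j) - r (c t) (delta J0 j)) < e / 2.
  have := r_cont (delta J0 j) (c t) e2; exact: (cc t).
near=> s; have k1 : b s = b t by near: s.
have k2 : cabs ((cpow (a s) (iwt (m - b t)) : C) - (cpow (a t) (iwt (m - b t)) : C)) <
  e / 2 / (hnorm (delta J0 j) + 1) by near: s.
have k3 : hnorm (r (c s) (delta J0 j) - r (c t) (delta J0 j)) < e / 2 by near: s.
rewrite /ibas !iop_inc /= k1.
rewrite -!(hlinearZ (iinc_lin _)) -(hlinearB (iinc_lin _)) (hiso_norm _ (iinc_iso _)).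
set x := r (c s) _; set y := r (c t) _; set p : C := (a s : C) ^ _; set q : C := (a t : C) ^ _.
have -> : p *: x - q *: y = p *: (x - y) + (p - q) *: y.
  by rewrite scalerBr scalerBl addrA subrK.
apply: (le_lt_trans (hnormD _ _)); rewrite !hnormZ [cabs p](cabs_circ (cpow (a s) _)) mul1r (splitr e) ltrD //.
rewrite (hiso_norm _ (r_iso _)); move: k2; rewrite ltr_pdivlMr //; apply: le_lt_trans.
by rewrite ler_wpM2l ?cabs_ge0 // lerDl.
Unshelve. all: by end_near.
Qed.

Hypothesis r0 : forall v, r uzero v = v.

(* The commutant is scalar: the torus separates the fibres, the fibres are irreducible and
   the shifts permute them. *)
Lemma iop_schur (T : ind -> ind) : (exists u : H, u <> 0) ->
  (forall S : H -> H, hlinear S -> (forall v, hnorm (S v) <= hnorm v) ->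
     (forall f v, S (r f v) = r f (S v)) -> exists c : C, forall v, S v = c *: v) ->
  hlinear T -> (forall v, hnorm (T v) <= hnorm v) ->
  (forall t n f v, T (iop t n f v) = iop t n f (T v)) -> exists c : C, forall v, T v = c *: v.
Proof.
move=> [u0 u0N] sch lT bT cT.
have off m u i : i != m -> ifib i (T (iinc m u)) = 0.
  move=> im; apply: contrapT => nz; move/eqP: im; apply.
  suff : iwt i = iwt m.
    by rewrite /iwt => /addrI /mulIf; apply; rewrite gt_eqF // kappa_gt0.
  apply: (@cpow_inj R) => t; apply: circ_eq.
  have := cT t 0 uzero (iinc m u); rewrite iop_inc subr0 r0 (hlinearZ lT) => /(congr1 (ifib i)).
  rewrite (hlinearZ (ifib_lin i)) iopE addr0 r0 => /eqP.
  rewrite -subr_eq0 -scalerBl scaler_eq0 subr_eq0 => /orP[/eqP -> //|/eqP //].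
pose S m u := ifib m (T (iinc m u)).
have TS m u : T (iinc m u) = iinc m (S m u).
  by apply: ifib_inj => i; rewrite ifib_inc; case: eqP => [->//|/eqP/off].
have nS m u : hnorm (S m u) <= hnorm u.
  by rewrite -(hiso_norm (S m u) (iinc_iso m)) -TS; apply: (le_trans (bT _)); rewrite (hiso_norm _ (iinc_iso m)).
have hS m : exists c : C, forall u, S m u = c *: u.
  apply: sch => // [a u v|f u].
    by rewrite /S iinc_lin lT ifib_lin.
  have := cT cone 0 f (iinc m u); rewrite iop_inc subr0 cpow1 scale1r TS => /(congr1 (ifib m)).
  by rewrite ifib_inc eqxx iopE addr0 cpow1 scale1r TS ifib_inc eqxx.
have [c hc] := hS 0.
(* The shift by [- m] carries fibre 0 to fibre [m] and commutes with [T], so all fibres share one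
   scalar. *)
have hcm m u : S m u = c *: u.
  have := cT cone (- m) uzero (iinc 0 u).
  rewrite iop_inc sub0r opprK cpow1 scale1r r0 TS TS hc iop_inc sub0r opprK cpow1 scale1r r0.
  by move=> /(congr1 (ifib m)); rewrite !ifib_inc eqxx.
exists c; apply: (@eq_on_total _ _ _ _ ibas T (fun v => c *: v) (1 + cabs c) ibas_total) => //.
- by rewrite addr_ge0 ?cabs_ge0.
- by move=> a u v; rewrite scalerDr !scalerA mulrC.
- move=> v; apply: (le_trans (bT v)); rewrite mulrDl mul1r lerDl mulr_ge0 ?cabs_ge0 ?hnorm_ge0 //.
- move=> v; rewrite hnormZ; rewrite mulrDl mul1r lerDr hnorm_ge0 //.
- by move=> [m j]; rewrite TS hcm (hlinearZ (iinc_lin m)).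
Qed.

End induced.

Section weight.
Variables (R : realType) (K : level R) (lam : central_char K).
Local Notation C := R[i].

Fact tweight_subproof : exists m : int, forall t, lam (t, cone) = cpow t m.
Proof.
apply: (@circ_char R (fun t => lam (t, cone))).
  apply: (@comp_cont _ _ _ (fun t : circ R => (t, cone) : ext (Tgrp K))); last exact: lam_cont.
  apply: (@pair_cont (circ R) (circ R) (circ R) id (fun=> cone)); first by move=> t; exact: cvg_id.
  exact: cst_continuous.
move=> s t; rewrite -lamM; congr (lam _).
by rewrite [RHS](@emul_T R K s cone t cone) cmul1.
Qed.
Definition tweight : int := sval (cid tweight_subproof).
Lemma tweightE t : lam (t, cone) = cpow t tweight.
Proof. exact: (svalP (cid tweight_subproof)). Qed.
Lemma lamE t z : lam (t, z) = cmul (cpow t tweight) z.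
Proof.
have -> : (t, z) = emul ((t, cone) : ext (Tgrp K)) (cone, z).
  by rewrite [RHS](@emul_T R K t cone cone z) cmul1 cmul1r.
by rewrite lamM tweightE lam_central.
Qed.
End weight.

(** * The sum of lines as a representation of the torus and its lattice *)

Section discrete_representation.
Variables (R : realType) (K : level R) (mu0 : int).
Local Notation C := R[i].

Definition w1 (_ : unit) : R := 1.
Fact w1_gt0 j : 0 < w1 j. Proof. exact: ltr01. Qed.
Definition line : hilbert R := l2hilbert w1_gt0.
(** A trivial action of loops on a line makes the induced construction applicable to the discrete
    part alone. *)
Definition rid (_ : loopU R) (v : line) : line := v.
Let rl f : hlinear (rid f). Proof. by []. Qed.
Let ri f : hisometric (rid f). Proof. by []. Qed.
Let rs f v : exists u, rid f u = v. Proof. by exists v. Qed.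
Let rc v f (e : R) : 0 < e -> \forall g \near f, hnorm (rid g v - rid f v) < e.
Proof. by move=> e0; near=> g; rewrite subrr hnorm0. Unshelve. all: by end_near. Qed.

Definition tpop (a : TPgrp K) (v : ind w1_gt0) : ind w1_gt0 := iop K mu0 ri a.1 a.2 uzero v.

Let tp_tw (g h : TPgrp K) v : tpop g (tpop h v) = (gtau g h : C) *: tpop (gmul g h) v.
Proof.
rewrite /tpop (@iop_comp R K mu0 unit w1 w1_gt0 rid rl ri g.1 g.2 uzero h.1 h.2 uzero 1 uzero).
  congr (_ *: _); change ((cpow h.1 (g.2 * kappa K) : C) * 1 =
    cmul (chi (K g.2) h.1) (expi (omega K uzero uzero))).
  by rewrite omega_self expi0 chiE cmul1r mulr1.
by move=> u; rewrite scale1r.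
Qed.
Let tp_cont v (g : TPgrp K) (e : R) : 0 < e -> \forall h \near g, hnorm (tpop h v - tpop g v) < e.
Proof.
apply: (@iop_cont R K mu0 unit w1 w1_gt0 rid rl ri rc (TPgrp K) fst snd (fun=> uzero)).
- by apply: fst_cont => t; exact: cvg_id.
- by apply: snd_cont => t; exact: cvg_id.
- by move=> t; exact: cvg_cst.
Qed.
(** The sum of the lines of weights [mu0 + m kappa]; for [mu0] the weight of [lam], its class is the
    index of [D_M]. *)
Definition tprep : twrep (TPgrp K) := TwRep (TwRepOn
  (fun g : TPgrp K => iop_lin K mu0 rl ri g.1 g.2 uzero) (fun g : TPgrp K => iop_iso K mu0 rl ri g.1 g.2 uzero)
  (fun g : TPgrp K => iop_surj K mu0 ri rs g.1 g.2 uzero) tp_tw tp_cont).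

Definition pt : line := delta w1_gt0 tt.
Lemma line_scale (v : line) : v = lfun v tt *: pt.
Proof. by apply: l2_eq => -[]; rewrite lfunZ deltaE mulr1. Qed.
Lemma hdot_pt : hdot pt pt = 1.
Proof. by rewrite hdot_delta eqxx. Qed.
Lemma pt_neq0 : pt <> 0.
Proof. by move=> h; have := hdot_pt; rewrite h hdot0r => /eqP; rewrite eq_sym oner_eq0. Qed.

Definition tpb (m : int) : tprep := iinc (J0 := w1_gt0) m pt.
Lemma tpb_dot m n : hdot (tpb m) (tpb n) = (m == n)%:R.
Proof.
have [->|mn] := eqVneq m n; first by rewrite [LHS](iinc_iso (J0 := w1_gt0) n pt pt) hdot_pt.
exact: iinc_orth.
Qed.
Lemma tpb_total : total tpb.
Proof.
move=> v h; apply: (@iinc_total R unit w1 w1_gt0) => m u.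
by rewrite (line_scale u) (hlinearZ (@iinc_lin _ _ _ w1_gt0 m)) hdotZl (h m) mulr0.
Qed.
Lemma tpb_act (t : circ R) n m : raction tprep (t, n) (tpb m) =
  (cpow t (iwt K mu0 (m - n)) : C) *: tpb (m - n).
Proof. exact: (@iop_inc R K mu0 unit w1 w1_gt0 rid rl ri t n uzero m pt). Qed.

Lemma tprep_irreducible : irreducible tprep.
Proof.
apply: schur_irreducible.
- move=> g; exists ((cpow (cinv g.1) (g.2 * kappa K) : C)^-1), (cinv g.1, - g.2) => v.
  rewrite (hlinearZ (ract_lin (raction tprep) g)).
  rewrite [raction tprep g _](@iop_comp R K mu0 unit w1 w1_gt0 rid rl ri g.1 g.2 uzero _ _ uzero 1 uzero).
    rewrite mulr1 scalerA mulVf ?circ_neq0 // scale1r /= subrr [cmul _ _]cmulC cmulV.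
    apply: ifib_inj => m; rewrite iopE cpow1 scale1r addr0 //.
  by move=> u; rewrite scale1r.
- by exists (tpb 0) => h; have := tpb_dot 0 0; rewrite h hdot0r => /eqP; rewrite eq_sym oner_eq0.
- move=> T lT bT cT; apply: (@iop_schur R K mu0 unit w1 w1_gt0 rid rl ri (fun=> erefl)) => //.
  + by exists pt; exact: pt_neq0.
  + move=> S lS _ _; exists (lfun (S pt) tt) => v.
    by rewrite [in LHS](line_scale v) (hlinearZ lS) [in LHS](line_scale (S pt)) [in RHS](line_scale v) !scalerA mulrC.
  + move=> t n f v; have := cT (t, n) v.
    have E u : iop K mu0 ri t n f u = iop K mu0 ri t n uzero u.
      by apply: ifib_inj => m; rewrite !iopE.
    by rewrite !E.
Qed.
End discrete_representation.

(** * The standard representation: irreducibility and positive energy *)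

Section loop_group_representation.
Variables (R : realType) (K : level R) (rho : fock_rep K) (mu0 : int).
Local Notation C := R[i].
Local Notation mf := (@mfact_gt0 R).

Definition lrho (f : loopU R) (v : l2hilbert mf) : l2hilbert mf := rho f v.
Definition rho_lin f : hlinear (lrho f) := ract_lin (frep rho) f.
Definition rho_iso f : hisometric (lrho f) := ract_iso (frep rho) f.
Let rho_surj f v : exists u, lrho f u = v := ract_surj (frep rho) f v.
Let rho_cont v f (e : R) (h : 0 < e) : \forall g \near f, hnorm (lrho g v - lrho f v) < e :=
  ract_cont (frep rho) v f h.

Definition lop (a : LT K) (v : ind mf) : ind mf := iop K mu0 rho_iso a.1.1 a.1.2 a.2 v.
Let lop_tw (g h : LT K) v : lop g (lop h v) = (gtau g h : C) *: lop (gmul g h) v.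
Proof.
rewrite /lop (@iop_comp R K mu0 _ _ mf lrho rho_lin rho_iso g.1.1 g.1.2 g.2 h.1.1 h.1.2 h.2
  (expi (omega K g.2 h.2) : C) (uadd g.2 h.2)); last by move=> u; exact: rhoM.
congr (_ *: _); change ((cpow h.1.1 (g.1.2 * kappa K) : C) * (expi (omega K g.2 h.2) : C) =
  cmul (chi (K g.1.2) h.1.1) (expi (omega K g.2 h.2))).
by rewrite chiE.
Qed.
Let lop_cont v (g : LT K) (e : R) : 0 < e -> \forall h \near g, hnorm (lop h v - lop g v) < e.
Proof.
apply: (@iop_cont R K mu0 _ _ mf lrho rho_lin rho_iso rho_cont (LT K) (fun a => a.1.1) (fun a => a.1.2) snd).
- by apply: fst_cont; apply: fst_cont => t; exact: cvg_id.
- by apply: snd_cont; apply: fst_cont => t; exact: cvg_id.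
- by apply: snd_cont => t; exact: cvg_id.
Qed.
Definition per : twrep (LT K) := TwRep (TwRepOn
  (fun g : LT K => iop_lin K mu0 rho_lin rho_iso g.1.1 g.1.2 g.2)
  (fun g : LT K => iop_iso K mu0 rho_lin rho_iso g.1.1 g.1.2 g.2)
  (fun g : LT K => iop_surj K mu0 rho_iso rho_surj g.1.1 g.1.2 g.2) lop_tw lop_cont).

Definition pinc (m : int) (u : Fock R) : per := iinc (J0 := mf) m u.
Lemma pinc_act (t : circ R) n f m u : raction per (t, n, f) (pinc m u) =
  (cpow t (iwt K mu0 (m - n)) : C) *: pinc (m - n) (rho f u).
Proof. exact: (@iop_inc R K mu0 _ _ mf lrho rho_lin rho_iso t n f m u). Qed.

Lemma per_irreducible : irreducible per.
Proof.
apply: schur_irreducible.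
- move=> g; exists ((cpow (cinv g.1.1) (g.1.2 * kappa K) : C)^-1), (cinv g.1.1, - g.1.2, uopp g.2) => v.
  rewrite (hlinearZ (ract_lin (raction per) g)).
  rewrite [raction per g _](@iop_comp R K mu0 _ _ mf lrho rho_lin rho_iso g.1.1 g.1.2 g.2 _ _ (uopp g.2) 1 uzero).
    rewrite mulr1 scalerA mulVf ?circ_neq0 // scale1r /= subrr [cmul _ _]cmulC cmulV.
    by apply: ifib_inj => m; rewrite iopE cpow1 scale1r addr0 [LHS]rho0.
  by move=> u; rewrite scale1r [RHS]rho0 [LHS]rhoV.
- exists (pinc 0 (bv R midx0)) => h.
  have := @iinc_iso R _ _ mf 0 (bv R midx0) (bv R midx0); rewrite -/(pinc 0 _) h hdot0r.
  by rewrite bv0_neq => /eqP; rewrite eq_sym oner_eq0.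
- move=> T lT bT cT; apply: (@iop_schur R K mu0 _ _ mf lrho rho_lin rho_iso (rho0 rho)) => //.
  + exact: fock_neq0.
  + exact: (@fock_schur R K rho).
  + by move=> t n f v; exact: (cT (t, n, f) v).
Qed.

Fact tri_subproof (m : int) : exists k : int, 2 * k = m * (m - 1).
Proof.
have [k [->|->]] : exists k : int, m = 2 * k \/ m = 2 * k + 1.
  by exists (m %/ 2)%Z; have := divz_eq m 2; lia.
- by exists (k * (2 * k - 1)); ring.
- by exists (k * (2 * k + 1)); ring.
Qed.
(** The binomial coefficient [m (m - 1) / 2]: an integral quadratic function whose polarisation is
    [m n], available for every integer [m]. *)
Definition tri (m : int) : int := sval (cid (tri_subproof m)).
Lemma triE m : 2 * tri m = m * (m - 1). Proof. exact: (svalP (cid (tri_subproof m))). Qed.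
Lemma tri_add m n : tri (m + n) = tri m + tri n + m * n.
Proof.
apply: (@mulfI _ (2 : int)) => //; rewrite !mulrDr !triE; ring.
Qed.

(* The quadratic term compensates the change of the cocycle under rotation. *)
Definition qlift (n : int) : int := - (kappa K * tri n).
(** Up to an additive constant, the only solution of the recursion [fiber_energyD], which is what
    covariance under rotation demands. It grows like [kappa m^2 / 2]. *)
Definition fiber_energy (m : int) : int := mu0 * m + kappa K * tri m.
Lemma fiber_energyD m n : fiber_energy (m + n) = fiber_energy m + n * iwt K mu0 m - qlift n.
Proof. by rewrite /fiber_energy /qlift /iwt tri_add; ring. Qed.

Definition tot_energy (x : int * midx) : int := fiber_energy x.1 + (energy x.2)%:Z.
Definition rotm_per (phi : R) (x : int * midx) : C := expi ((tot_energy x)%:~R * phi).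
Lemma rotm_per1 phi x : cabs (rotm_per phi x) = 1. Proof. exact: cabs_circ. Qed.
Definition rotP (phi : R) (v : per) : per := mult (w0 := @wX_gt0 R midx _ mf) rotm_per1 phi v.
Lemma rotP_fib phi v m : ifib m (rotP phi v) =
  (expi ((fiber_energy m)%:~R * phi) : C) *: rotF phi (ifib m v).
Proof.
apply: l2_eq => al; rewrite lfunZ rotFE !ifibE [LHS]multE mulrA; congr (_ * _).
by rewrite /rotm_per /rotm expiCD -mulrDl /tot_energy rmorphD.
Qed.

Lemma rotP_act phi (a b : LT K) v : rotates phi a b ->
  rotP phi (raction per a v) = (expi ((qlift a.1.2)%:~R * phi) : C) *: raction per b (rotP phi v).
Proof.
move=> /rotatesP ->; case: a => [[t n] f]; apply: ifib_inj => m.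
rewrite (hlinearZ (ifib_lin m)) rotP_fib !iopE rotP_fib; cbn [fst snd].
rewrite (hlinearZ (rotF_lin phi)) (hlinearZ (rho_lin _)) [rotF phi (lrho f _)]rot_rho !scalerA.
congr (_ *: _); have -> : (cpow (cmul t (expi (- n%:~R * phi))) (iwt K mu0 m) : C) =
    (cpow t (iwt K mu0 m) : C) * (expi (- (n * iwt K mu0 m)%:~R * phi) : C).
  rewrite cpowM -expiM.
  by congr (cmul _ (expi _) : C); rewrite rmorphM /=; ring.
have -> : (expi ((fiber_energy m)%:~R * phi) : C) = (expi ((qlift n)%:~R * phi) : C) *
    (expi (- (n * iwt K mu0 m)%:~R * phi) : C) * (expi ((fiber_energy (m + n))%:~R * phi) : C).
  have e : (fiber_energy m)%:~R = (qlift n)%:~R + - (n * iwt K mu0 m)%:~R + (fiber_energy (m + n))%:~R :> R.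
    by rewrite -rmorphN -!rmorphD fiber_energyD; congr (_%:~R); ring.
  by rewrite !expiCD -!mulrDl -e.
move: (cpow _ _ : C) (expi _ : C) (expi _ : C) (expi _ : C) => x y z w; ring.
Qed.

Lemma rotation_lift_per : @rotation_lift R K qlift.
Proof.
move=> phi a b a' b' /rotatesP -> /rotatesP ->.
case: a b => [[t n] f] [[s n'] g].
change (cmul (cmul (expi ((qlift n)%:~R * phi)) (expi ((qlift n')%:~R * phi)))
    (cmul (chi (K n) (cmul s (expi (- n'%:~R * phi)))) (expi (omega K (urot phi f) (urot phi g)))) =
  cmul (cmul (chi (K n) s) (expi (omega K f g))) (expi ((qlift (n + n'))%:~R * phi))).
rewrite omega_rot chiM; have -> : chi (K n) (expi (- n'%:~R * phi)) = expi (- (n * n' * kappa K)%:~R * phi).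
  by rewrite chiE -expiM !rmorphM /=; congr expi; ring.
have -> : expi ((qlift (n + n'))%:~R * phi) = cmul (cmul (expi ((qlift n)%:~R * phi))
   (expi ((qlift n')%:~R * phi))) (expi (- (n * n' * kappa K)%:~R * phi)).
  rewrite -!expiD -!mulrDl /qlift tri_add; congr (expi (_ * phi)).
  by rewrite -!rmorphN -!rmorphD /=; congr (_%:~R); ring.
apply: circ_eq => /=; ring.
Qed.

Lemma energy_ge k (al : midx) : (k.+1 * al k <= energy al)%N.
Proof. exact: msum_ge. Qed.
(** Every nonzero multi-index is [incr k] of one of smaller energy, where [k] is bounded by the
    energy; this gives a finite covering by induction. *)
Lemma energy_finite d : finite_set [set al : midx | (energy al <= d)%N].
Proof.
elim: d => [|d IH].
  apply: (@sub_finite_set _ _ [set midx0]); last exact: finite_set1.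
  move=> al /= h; apply: midx_eq0 => k; have := energy_ge k al; move: h; case: (al k) => // n; lia.
pose A := [set midx0] `|` \bigcup_(k in `I_d.+1) (incr k @` [set al : midx | (energy al <= d)%N]).
apply: (@sub_finite_set _ _ A); last first.
  rewrite finite_setU; split; first exact: finite_set1.
  by apply: bigcup_finite => // k _; exact: finite_image.
move=> al /= h; have [->|/midx_neq0[k hk]] := eqVneq al midx0; first by left.
right; have e : energy al = (energy (decr k al) + k.+1)%N by rewrite -{1}(decrK hk) energy_incr.
exists k; first by rewrite /=; have := energy_ge k al; move: hk h; case: (al k) => // n; lia.
exists (decr k al); last exact: decrK.
by rewrite /=; lia.
Qed.

Lemma int_finite (B : nat) : finite_set [set m : int | `|m| <= B%:Z].
Proof.
apply: (@sub_finite_set _ _ ((fun k : nat => k%:Z - B%:Z) @` `I_(B + B).+1)).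
  move=> m /= h; exists (absz (m + B%:Z)) => /=; lia.
exact: finite_image.
Qed.

(** Positivity of the level enters here: [kappa >= 1] and [tri m >= 0], so the quadratic term
    outgrows [mu0 m]. *)
Lemma fiber_energy_large (E m : int) : 2 * `|mu0| + 2 * `|E| + 2 < `|m| -> E < fiber_energy m.
Proof.
move=> h; have k0 := kappa_gt0 K; have t2 := triE m.
have tpos : 0 <= tri m by nia.
have : mu0 * m + tri m <= fiber_energy m by rewrite /fiber_energy; nia.
apply: lt_le_trans; have := ler_norm E; have := ler_norm (- E); have := ler_norm mu0; have := ler_norm (- mu0).
rewrite !normrN; move: (`|mu0|) (`|E|) h => x y h h1 h2 h3 h4; nia.
Qed.

Lemma per_energy : positive_energy per.
Proof.
(* An eigenvector of weight [E] is supported on basis vectors of total energy [E], as distinct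
   integers give distinct characters of the circle. *)
have xw (E : int) v : (forall phi, rotP phi v = (expi (E%:~R * phi) : C) *: v) ->
    forall x, lfun v x != 0 -> tot_energy x = E.
  move=> h x vx; apply: (@cpow_inj R) => t; have [y ->] := expi_surj t.
  have := congr1 (fun u : per => lfun u x) (h y); rewrite -!expiM [LHS]multE lfunZ.
  by move=> /(mulIf vx) e; apply: circ_eq.
exists qlift, rotP; split; first exact: rotation_lift_per.
split.
  split.
  - by move=> phi; exact: mult_lin.
  - by move=> phi; exact: mult_iso.
  - move=> phi psi v; apply: l2_eq => x; rewrite ![lfun (rotP _ _) x]multE mulrA; congr (_ * _).
    by rewrite /rotm_per mulrDr expiCD.
  - move=> v; apply: l2_eq => x; rewrite [LHS]multE /rotm_per expi_2piM; exact: mul1r.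
  - move=> v phi e e0; apply: mult_cont => // x; apply: circ_cval_cont; apply: expi_comp_cont.
    by move=> y; apply: cvgM; [exact: cvg_cst | exact: cvg_id].
split; first by move=> phi a b v; exact: rotP_act.
pose M : nat := absz (2 * `|mu0| + 2).
split=> [E|].
  have [A hA] : exists A : {fset int * midx}, forall x, tot_energy x = E -> x \in A.
    pose S1 := [set m : int | `|m| <= (M + 2 * absz E)%N%:Z].
    have f1 : finite_set S1 by exact: int_finite.
    pose S2 m := [set al : midx | (energy al <= absz (E - fiber_energy m))%N].
    have f3 : finite_set (\bigcup_(m in S1) (pair m @` S2 m)).
      by apply: bigcup_finite => // m _; apply: finite_image; exact: energy_finite.
    exists (fset_set (\bigcup_(m in S1) (pair m @` S2 m))) => -[m al] h.
    rewrite in_fset_set // inE; exists m; last first.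
      by exists al => //=; rewrite /S2 /=; move: h; rewrite /tot_energy /=; lia.
    rewrite /S1 /= leNgt; apply/negP => hm.
    have : E < fiber_energy m by apply: fiber_energy_large; move: hm; rewrite /M; lia.
    by move: h; rewrite /tot_energy /=; lia.
  pose x0 : int * midx := (0, midx0).
  exists (size (A : seq _)), (fun i => delta (@wX_gt0 R midx _ mf) (nth x0 (A : seq _) i)) => v hv.
  exists (fun i => lfun v (nth x0 (A : seq _) i)); apply: l2_eq => x.
  rewrite lfun_sum.
  transitivity (\sum_(i < size (A : seq _)) lfun v (nth x0 (A : seq _) i) * (x == nth x0 (A : seq _) i)%:R); last first.
    by apply: eq_bigr => i _; rewrite lfunZ deltaE.
  rewrite -(big_mkord xpredT (fun i => lfun v (nth x0 (A : seq _) i) * (x == nth x0 (A : seq _) i)%:R)).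
  rewrite -(big_nth x0 xpredT (fun y => lfun v y * (x == y)%:R)).
  have [xA|xA] := boolP (x \in A).
    rewrite (big_fsetD1 x xA) /= eqxx mulr1 big_seq big1 ?addr0 // => y.
    by rewrite !inE eq_sym => /andP[/negPf -> _]; rewrite mulr0.
  rewrite big_seq big1; last first.
    by move=> y yA; case: eqP => [e|_]; [move: xA; rewrite e yA | rewrite mulr0].
  apply/eqP; apply: contraNT xA => vx; apply: hA; exact: (xw E v hv x vx).
have [E0 hE0] : exists E0 : int, forall m, E0 <= fiber_energy m.
  (* A generous bound: completing the square, [mu0 m + tri m] is never below
     [- (2 mu0 - 1)^2 / 8]. *)
  exists (- ((1 + 2 * `|mu0|) ^+ 2)) => m.
  have k0 := kappa_gt0 K; have t2 := triE m.
  have tpos : 0 <= tri m by nia.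
  have : mu0 * m + tri m <= fiber_energy m by rewrite /fiber_energy; nia.
  apply: le_trans; have := ler_norm mu0; have := ler_norm (- mu0).
  rewrite normrN; move: (`|mu0|) => x h1 h2.
  have h3 : 0 <= (1 + 2 * x - (2 * mu0 - 1)) * (1 + 2 * x + (2 * mu0 - 1)) by apply: mulr_ge0; lia.
  have h4 := sqr_ge0 (m + (2 * mu0 - 1)); have h5 := sqr_ge0 m; nia.
exists E0 => E EE0 v hv; apply: l2_eq => x; rewrite lfun0; apply/eqP/negPn/negP => vx.
have h1 : fiber_energy x.1 + (energy x.2)%:Z = E := xw E v hv x vx.
have := hE0 x.1; move: (fiber_energy _) (energy _) h1 => a b; lia.
Qed.

Lemma per_standard (lam : central_char K) : mu0 = tweight lam -> corresponds_to lam rho per.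
Proof.
move=> mE; have lamT t : lam (t, cone) = cpow t mu0 by rewrite tweightE mE.
split.
  exists (GRing.mull_fun mu0 idfun : {additive int -> int}), 0 => t.
  by rewrite lamT /chi kapE mul0r cpow0 cmul1r /= mulr1.
move=> mu [n0 hmu]; have mu1 : mu 1 = mu0 - n0 * kappa K.
  apply: (@cpow_inj R) => t; have := hmu t; rewrite lamT chiE => e.
  by rewrite cpowD e -cmulA -cpowD addrN cpow0 cmul1r.
(* Another representative [mu] of the coset has weight [mu0 - n0 kappa], so the same space serves
   with its summands relabelled by [n0]. *)
exists (fun m => pinc (m - n0)); split.
- move=> m; exact: iinc_lin.
- move=> m; exact: iinc_iso.
- by move=> n m u v nm; apply: iinc_orth; apply: contra nm => /eqP/addIr ->.
- move=> v h; apply: (@iinc_total R _ _ mf) => m u.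
  by have := h (m + n0) u; rewrite addrK.
- move=> t n m f u; apply: (etrans (pinc_act t n f (m - n0) u)).
  have -> : m - n0 - n = m - n - n0 by ring.
  congr (_ *: _).
  change ((cpow t (iwt K mu0 (m - n - n0)) : C) = cmul (chi mu t) (chi (K (m - n)) t)).
  rewrite chiE /chi mu1 -cpowD; congr (cpow t _ : C).
  by rewrite /iwt; ring.
Qed.
End loop_group_representation.

(** * The Dirac operator *)

Section conjugation.
Variable R : realType.
Implicit Types (a b : R[i]).
Lemma cjM a b : (a * b)^* = a^* * b^*. Proof. exact: rmorphM. Qed.
Lemma cjN a : (- a)^* = - a^*. Proof. exact: rmorphN. Qed.
Lemma cjn (n : nat) : (n%:R : R[i])^* = n%:R. Proof. exact: rmorph_nat. Qed.
Lemma cj_sum (I : Type) (r : seq I) (F : I -> R[i]) : (\sum_(i <- r) F i)^* = \sum_(i <- r) (F i)^*.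
Proof. exact: rmorph_sum. Qed.
Lemma cji : ('i : R[i])^* = - 'i.
Proof. by apply/eqP; rewrite eq_complex /= oppr0 !eqxx. Qed.
End conjugation.

Section matrix_operators.
Variables (R : realType) (Y : choiceType).
Local Notation C := R[i].
Implicit Types (c d : Y -> C).

Definition unitf (x : Y) : Y -> C := fun y => (y == x)%:R.
Definition op_lin (D : (Y -> C) -> Y -> C) :=
  forall (a : C) c d y, D (fun x => a * c x + d x) y = a * D c y + D d y.

Lemma op_lin0 D : op_lin D -> forall y, D (fun=> 0) y = 0.
Proof.
move=> lD y; have := lD 1 (fun=> 0) (fun=> 0) y; rewrite mulr0 addr0 mul1r => h.
by apply: (addrI (D (fun=> 0) y)); rewrite addr0 -h.
Qed.
Lemma op_linZ D : op_lin D -> forall a c y, D (fun x => a * c x) y = a * D c y.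
Proof.
move=> lD a c y; have := lD a c (fun=> 0) y; rewrite op_lin0 // addr0 => <-.
by congr D; apply/funext => x; rewrite addr0.
Qed.
Lemma op_expand D (A : {fset Y}) c : op_lin D -> (forall x, x \notin A -> c x = 0) ->
  forall y, D c y = \sum_(x <- A) c x * D (unitf x) y.
Proof.
move=> lD hA y.
have -> : c = fun y => \sum_(x <- A) c x * unitf x y.
  apply/funext => z; have [zA|zA] := boolP (z \in A).
    rewrite (big_fsetD1 z zA) /= /unitf eqxx mulr1 big_seq big1 ?addr0 // => x.
    by rewrite !inE eq_sym => /andP[/negPf -> _]; rewrite mulr0.
  rewrite (hA z zA) big_seq big1 // => x xA; rewrite /unitf.
  by case: eqP => [e|_]; [move: zA; rewrite e xA | rewrite mulr0].
have -> : \sum_(x <- A) (\sum_(z <- A) c z * unitf z x) * D (unitf x) y = \sum_(x <- A) c x * D (unitf x) y.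
  rewrite big_seq [RHS]big_seq; apply: eq_bigr => x xA; congr (_ * _).
  rewrite (big_fsetD1 x xA) /= /unitf eqxx mulr1 big_seq big1 ?addr0 // => z.
  by rewrite !inE eq_sym => /andP[/negPf -> _]; rewrite mulr0.
elim: (A : seq Y) => [|x r IH].
  rewrite big_nil -[RHS](op_lin0 lD y); congr D; apply/funext => z; exact: big_nil.
rewrite big_cons -IH -lD; congr D; apply/funext => z; exact: big_cons.
Qed.

Lemma l2dot_fin (w : Y -> R) c d (A : {fset Y}) : (forall x, x \notin A -> d x = 0) ->
  l2dot w c d = \sum_(x <- A) (w x)%:C * ((c x)^* * d x).
Proof. by move=> hA; apply: usumE; apply: is_usum_fin => x /hA ->; rewrite !mulr0. Qed.

Lemma matrix_sym (w : Y -> R) D : op_lin D -> (forall c, finsup c -> finsup (D c)) ->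
  (forall x y, (w y)%:C * (D (unitf x) y)^* = (w x)%:C * D (unitf y) x) ->
  forall c d, finsup c -> finsup d -> l2dot w (D c) d = l2dot w c (D d).
Proof.
move=> lD fD sD c d fc fd.
have [A1 h1] := fset_suppP fc; have [A2 h2] := fset_suppP fd.
have [A3 h3] := fset_suppP (fD d fd).
pose A := (A1 `|` A2 `|` A3)%fset.
have hc x : x \notin A -> c x = 0 by rewrite !inE !negb_or -!andbA => /and3P[/h1].
have hd x : x \notin A -> d x = 0 by rewrite !inE !negb_or -!andbA => /and3P[_ /h2].
have hDd x : x \notin A -> D d x = 0 by rewrite !inE !negb_or -!andbA => /and3P[_ _ /h3].
rewrite (l2dot_fin w (D c) hd) (l2dot_fin w c hDd).
transitivity (\sum_(y <- A) \sum_(x <- A) (w x)%:C * ((c x)^* * (d y * D (unitf y) x))).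
  apply: eq_bigr => y _; rewrite (op_expand lD hc) cj_sum mulr_suml mulr_sumr.
  apply: eq_bigr => x _; rewrite cjM.
  have := sD x y; move: (D (unitf x) y) (D (unitf y) x) ((w y)%:C) ((w x)%:C) => p q a b e.
  have -> : b * ((c x)^* * (d y * q)) = (b * q) * ((c x)^* * d y) by ring.
  by rewrite -e; ring.
rewrite exchange_big; apply: eq_bigr => x _ /=.
by rewrite (op_expand lD hd) mulr_sumr mulr_sumr.
Qed.
End matrix_operators.

Section signs.
Variable R : realType.
Local Notation C := R[i].
Implicit Types (k l : nat) (s : {fset nat}).

(** Exterior multiplication and contraction by mode k both toggle k in the basis set, so a single
    family of operators covers them. *)
Definition flip k s : {fset nat} := if k \in s then (s `\ k)%fset else (k |` s)%fset.
Lemma flip_in k l s : (l \in flip k s) = if l == k then k \notin s else l \in s.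
Proof.
rewrite /flip; case: (boolP (k \in s)) => ks; rewrite !inE; have [->|lk] //= := eqVneq l k.
Qed.
Lemma flipK k s : flip k (flip k s) = s.
Proof.
by apply/fsetP => l; rewrite !flip_in eqxx; have [->|] //= := eqVneq l k; rewrite negbK.
Qed.
Lemma flipC k l s : flip k (flip l s) = flip l (flip k s).
Proof.
apply/fsetP => j; rewrite !flip_in.
have [ejk|jk] := eqVneq j k; have [ejl|jl] := eqVneq j l; subst; rewrite ?eqxx ?(negPf jl) ?(negPf jk) //.
Qed.
Lemma fsign_sqr k s : fsign R k s * fsign R k s = 1.
Proof. by rewrite /fsign -exprD addnn -mul2n exprM sqrrN expr1n expr1n. Qed.
Lemma fsign_conj k s : (fsign R k s)^* = fsign R k s.
Proof. by rewrite /fsign rmorphXn rmorphN rmorph1. Qed.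
Lemma fsign_ext k s t : (forall j, (j < k)%N -> (j \in s) = (j \in t)) -> fsign R k s = fsign R k t.
Proof.
move=> h; rewrite /fsign; congr (_ ^+ #|` _|); apply/fsetP => j; rewrite !inE /=.
by case: (boolP (j < k)%N) => [/h ->|] //; rewrite !andbF.
Qed.
(** The sign depends only on the elements below k, so toggling l matters exactly when [l < k]. For
    two distinct modes this happens in one of the two orders, whence anticommutation. *)
Lemma fsign_flip k l s : k != l -> fsign R k (flip l s) = (if (l < k)%N then -1 else 1) * fsign R k s.
Proof.
move=> kl; case: ifP => lk; last first.
  rewrite mul1r; apply: fsign_ext => j jk; rewrite flip_in.
  by case: eqP => // e; move: jk; rewrite e lk.
have add t : l \notin t -> fsign R k (l |` t)%fset = - fsign R k t.
  move=> lt; rewrite /fsign.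
  have -> : [fset j in (l |` t)%fset | (j < k)%N]%fset = (l |` [fset j in t | (j < k)%N])%fset.
    by apply/fsetP => j; rewrite !inE /=; have [->|] //= := eqVneq j l.
  by rewrite cardfsU1 !inE /= (negPf lt) /= exprS mulN1r.
rewrite mulN1r /flip; case: ifPn => ls; last exact: add.
have := add (s `\ l)%fset; rewrite !inE eqxx /= fsetD1K // => -> //.
by rewrite opprK.
Qed.
End signs.

(** * The fibre operator: finite form, square and symmetry *)

Section partial_algebra.
Variable R : realType.
Local Notation C := R[i].
Implicit Types (k l : nat) (x y : idx) (u v : idx -> C).

Definition tauk k x : idx :=
  ((if k \in x.2 then incr k x.1.1 else decr k x.1.1, x.1.2), flip k x.2).
Definition coefk k x : C := if k \in x.2 then 1 else - (x.1.1 k)%:R.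
(** The contribution of mode k to [partial], divided by [2 i sqrt (k + 1)]. At each index one of the
    two summands of [partial] vanishes: the wedge term when k is outside the set, the contraction
    term when it is inside. The minus sign of [coefk] comes from the dual representation. *)
Definition Bk k u : idx -> C := fun x => fsign R k x.2 * coefk k x * u (tauk k x).
Definition ck k : C := (Num.sqrt k.+1%:R : R)%:C.
(** Modes outside this finite set annihilate the value at [x]: there is nothing to contract in the
    set and the multi-index has exponent zero. The infinite sums of [partial] thus become finite
    ones. *)
Definition modes x : {fset nat} := (x.2 `|` finsupp x.1.1)%fset.

Lemma mono_bv (al : midx) : mono R al = lfun (bv R al).
Proof. by apply/funext => be; rewrite bvE. Qed.
Lemma sqrt2_sqr : sqrt2 R * sqrt2 R = 2.
Proof. by rewrite /sqrt2 -rmorphM -expr2 sqr_sqrtr ?ler0n // rmorph_nat. Qed.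

Lemma drhoD_zE k (phi : midx -> C) al : drhoD_z k phi al = sqrt2 R * phi (incr k al).
Proof.
rewrite /drhoD_z /pairing (@fsum1 _ _ _ (incr k al)) => [|be /negPf be0].
  by rewrite mono_bv drho_z_bv eqxx mulr1 mulrN opprK mulrC.
by rewrite mono_bv drho_z_bv be0 !mulr0.
Qed.
Lemma drhoD_zbE k (phi : midx -> C) al : drhoD_zb k phi al = - sqrt2 R * ((al k)%:R * phi (decr k al)).
Proof.
rewrite /drhoD_zb /pairing (@fsum1 _ _ _ (decr k al)) => [|be /negPf be0].
  by rewrite mono_bv drho_zb_bv eqxx mulr1 mulNr; congr (- _); ring.
by rewrite mono_bv drho_zb_bv be0 !mulr0.
Qed.

Lemma partialE u x (F : {fset nat}) : (modes x `<=` F)%fset ->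
  partial u x = 2 * 'i * \sum_(k <- F) ck k * Bk k u x.
Proof.
move=> sF; case: x sF => [[al be] s] sF.
have inF k : k \notin F -> k \notin s /\ al k = 0%N.
  move=> kF; have : k \notin modes (al, be, s) by apply: contra kF; exact: (fsubsetP sF).
  by rewrite /modes inE negb_or memNfinsupp => /andP[-> /eqP ->].
rewrite /partial (@fsum_fset _ _ _ F) => [|k /inF[/negPf ks ak]]; last first.
  by rewrite /on_dual drhoD_zE /on_spinor /gam_zb /wedge ks !mulr0.
rewrite (@fsum_fset _ _ _ F) => [|k /inF[ks ak]]; last first.
  by rewrite /on_dual drhoD_zbE ak mul0r !mulr0.
rewrite -mulrDr -big_split [2 * 'i]mulrC -mulrA; congr (_ * _); rewrite mulr_sumr; apply: eq_bigr => k _ /=.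
rewrite /on_dual drhoD_zE drhoD_zbE /on_spinor /gam_zb /gam_z /wedge /Defs.contract /Bk /coefk /tauk /flip /=.
rewrite -/(ck k); have := sqrt2_sqr; move: (sqrt2 R) => r hr; case: ifP => ks.
  rewrite !mulr0 addr0 mulr1 [r * (r * _)]mulrA hr; ring.
rewrite !mulr0 add0r; have -> : - r * ((al k)%:R * (r * (fsign R k s * u (decr k al, be, (k |` s)%fset)))) =
   - (r * r) * ((al k)%:R * (fsign R k s * u (decr k al, be, (k |` s)%fset))) by ring.
rewrite hr; ring.
Qed.

Lemma partial_lin : op_lin (@partial R).
Proof.
move=> a u v x; rewrite !(@partialE _ x (modes x)) ?fsubset_refl //.
rewrite mulrCA -mulrDr; congr (_ * _); rewrite mulr_sumr -big_split; apply: eq_bigr => k _ /=.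
by rewrite /Bk; ring.
Qed.

Lemma tauk_modes k x : k \in modes x -> (modes (tauk k x) `<=` modes x)%fset.
Proof.
move=> kx; apply/fsubsetP => j; have [->//|jk] := eqVneq j k.
rewrite /modes /tauk !inE /= flip_in (negPf jk) => /orP[->//|].
by rewrite !mem_finsupp; case: ifP => _; rewrite ?incrE ?decrE (negPf jk) => ->; rewrite orbT.
Qed.

Lemma coefk_tauk k l x : l != k -> coefk l (tauk k x) = coefk l x.
Proof.
move=> lk; rewrite /coefk /tauk /= flip_in (negPf lk).
by case: ifP => _ //; case: ifP => _; rewrite ?incrE ?decrE (negPf lk).
Qed.
Lemma decrC j k (al : midx) : decr j (decr k al) = decr k (decr j al).
Proof.
apply/fsfunP => i; rewrite !decrE; have [->//|jk] := eqVneq j k.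
by have [->|ij] := eqVneq i j; rewrite ?(negPf jk).
Qed.
Lemma incr_decrC j k (al : midx) : j != k -> incr j (decr k al) = decr k (incr j al).
Proof.
move=> jk; apply/fsfunP => i; rewrite !(incrE, decrE) (negPf jk) [k == j]eq_sym (negPf jk).
by have [->|ij] := eqVneq i j; rewrite ?(negPf jk).
Qed.
Lemma tauk_comm k l x : l != k -> tauk k (tauk l x) = tauk l (tauk k x).
Proof.
move=> lk; rewrite /tauk /= !flip_in (negPf lk) [k == l]eq_sym (negPf lk).
apply: pair_eq; last exact: flipC.
apply: pair_eq => //; case: ifP => _; case: ifP => _.
- exact: incrC.
- by rewrite incr_decrC // eq_sym.
- by rewrite incr_decrC.
- exact: decrC.
Qed.
(** The index maps of distinct modes commute and leave each other's coefficients unchanged; only the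
    signs differ, by [fsign_flip]. *)
Lemma Bk_anti k l u x : k != l -> Bk k (Bk l u) x = - Bk l (Bk k u) x.
Proof.
move=> kl; have lk : l != k by rewrite eq_sym.
rewrite /Bk !coefk_tauk // tauk_comm //= !fsign_flip // /tauk /=.
have e : (if (k < l)%N then -1 else 1 : C) = - (if (l < k)%N then -1 else 1).
  by case: (ltngtP k l) kl => // _ _; rewrite opprK.
rewrite e; move: (if _ then _ else _ : C) => z; ring.
Qed.
Lemma Bk_sqr k u x : Bk k (Bk k u) x = - ((x.1.1 k)%:R + (k \in x.2)%:R) * u x.
Proof.
case: x => [[al be] s]; rewrite /Bk /=.
have -> : fsign R k (flip k s) = fsign R k s.
  by apply: fsign_ext => j jk; rewrite flip_in (ltn_eqF jk).
rewrite /coefk /tauk /= flip_in eqxx flipK; have := fsign_sqr R k s; move: (fsign _ _ _) => e ee.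
case: ifP => ks /=.
  rewrite incrK incr_k mulr1n; have -> : e * 1 * (e * - (al k).+1%:R * u (al, be, s)) =
     (e * e) * - (al k).+1%:R * u (al, be, s) by ring.
  by rewrite ee mul1r -[(al k).+1]addn1 natrD.
rewrite mulr0n addr0; have [a0|a0] := eqVneq (al k) 0%N; first by rewrite a0 /=; ring.
rewrite decrK //; have -> : e * - (al k)%:R * (e * 1 * u (al, be, s)) =
     (e * e) * - (al k)%:R * u (al, be, s) by ring.
by rewrite ee mul1r.
Qed.

Definition number x : nat := (\sum_(k <- modes x) k.+1 * (x.1.1 k + (k \in x.2)))%N.
Lemma number_eq0 x : number x = 0%N -> x.1.1 = midx0 /\ x.2 = fset0.
Proof.
move=> h; have hk k : (x.1.1 k + (k \in x.2) = 0)%N.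
  apply/eqP/negPn/negP => nz.
  have kx : k \in modes x.
    by move: nz; rewrite /modes inE mem_finsupp addn_eq0 negb_and eqb0 negbK orbC.
  by move: h; rewrite /number (big_fsetD1 k kx) /= => /eqP; rewrite addn_eq0 muln_eq0 (negPf nz).
split; first by apply: midx_eq0 => k; have /eqP := hk k; rewrite addn_eq0 => /andP[/eqP].
apply/fsetP => k; have /eqP := hk k; rewrite addn_eq0 inE => /andP[_].
by case: (k \in x.2).
Qed.

(** The off-diagonal products of the [Bk] cancel in pairs, and each square is minus the bosonic plus
    fermionic occupation of its mode. With the factors [sqrt (k + 1)] squared, the total energy
    remains. *)
Lemma partial_sqr u x : partial (partial u) x = 4 * (number x)%:R * u x.
Proof.
set F := modes x.
pose X k l := ck k * ck l * Bk k (Bk l u) x.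
have E : partial (partial u) x = - 4 * \sum_(k <- F) \sum_(l <- F) X k l.
  rewrite (@partialE _ x F) //.
  have -> : \sum_(k <- F) ck k * Bk k (partial u) x = 2 * 'i * \sum_(k <- F) \sum_(l <- F) X k l.
    rewrite mulr_sumr big_seq [RHS]big_seq; apply: eq_bigr => k kF.
    rewrite /Bk (@partialE u (tauk k x) F); last exact: tauk_modes.
    rewrite !mulr_sumr; apply: eq_bigr => l _; rewrite /X /Bk; ring.
  rewrite mulrA; congr (_ * _).
  have -> : 2 * 'i * (2 * 'i) = 4 * ('i * 'i) :> C by ring.
  by rewrite -expr2 sqr_i mulrN1.
(* Doubling the sum pairs the term (k, l) with (l, k), so that anticommutation removes all but the
   diagonal. *)
have S2 : 2 * (\sum_(k <- F) \sum_(l <- F) X k l) = 2 * \sum_(k <- F) X k k.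
  have -> : 2 * (\sum_(k <- F) \sum_(l <- F) X k l) = \sum_(k <- F) \sum_(l <- F) (X k l + X l k).
    have -> : \sum_(k <- F) \sum_(l <- F) (X k l + X l k) =
       \sum_(k <- F) \sum_(l <- F) X k l + \sum_(k <- F) \sum_(l <- F) X l k.
      by rewrite -big_split; apply: eq_bigr => k _; rewrite -big_split.
    by rewrite [X in _ + X]exchange_big /=; ring.
  rewrite mulr_sumr big_seq [RHS]big_seq; apply: eq_bigr => k kF.
  rewrite (big_fsetD1 k kF) /= big_seq big1 ?addr0 => [|l]; first by ring.
  by rewrite !inE => /andP[lk _]; rewrite /X (@Bk_anti l k) //; ring.
rewrite E; have -> : \sum_(k <- F) \sum_(l <- F) X k l = \sum_(k <- F) X k k by apply: (mulfI _ S2).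
have -> : \sum_(k <- F) X k k = - ((number x)%:R * u x).
  rewrite /number natr_sum mulr_suml -sumrN; apply: eq_bigr => k _.
  rewrite /X Bk_sqr /ck -rmorphM -expr2 sqr_sqrtr ?ler0n // rmorph_nat natrM natrD; ring.
ring.
Qed.

Lemma partial_finsup u : finsup u -> finsup (partial u).
Proof.
move=> /fset_suppP[A hA].
apply: (@finsupP _ _ _ (\bigcup_(y <- A) [fset (tauk k y : idx) | k in modes y])%fset) => x xD.
rewrite (@partialE u x (modes x)) // big_seq big1 ?mulr0 // => k kx.
rewrite /Bk; have [->|c0] := eqVneq (coefk k x) 0; first by rewrite !(mulr0, mul0r).
have tt : tauk k (tauk k x) = x.
  case: (x) c0 => [[al be] s]; rewrite /coefk /tauk /= flip_in eqxx flipK.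
  case: ifP => ks /=; first by rewrite incrK.
  by rewrite oppr_eq0 pnatr_eq0 => h; rewrite decrK.
have [yA|yA] := boolP (tauk k x \in A); last by rewrite (hA _ yA) !mulr0.
case/negP: xD; apply/bigfcupP; exists (tauk k x); first by rewrite yA.
apply/imfsetP; exists k => //=.
rewrite /modes /tauk inE /= flip_in eqxx mem_finsupp; case: (boolP (k \in x.2)) => ks //=.
by rewrite incr_k.
Qed.

Lemma idxw_tauk k x : k \in x.2 -> (idxw R (tauk k x) * (x.1.1 k).+1%:R) = idxw R x.
Proof.
move=> ks; rewrite /idxw /tauk ks /= mfact_incr invfM.
have h : (x.1.1 k).+1%:R != 0 :> R by rewrite pnatr_eq0.
have alg (a b c : R) : a != 0 -> b != 0 -> a^-1 / b * c * a = b^-1 * c.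
  by move=> a0 b0; field; rewrite a0 b0.
by apply: alg => //; rewrite gt_eqF // mfact_gt0.
Qed.

(** Raising the dual exponent divides the weight by the new exponent, which is the coefficient of
    the lowering map; the remaining sign makes [Bk] skew-adjoint. The factor [2 i] of [partial]
    turns this into symmetry. *)
Lemma Bk_sym_aux k x y : k \in y.2 ->
  (idxw R y)%:C * Bk k (@unitf R idx x) y = - (idxw R x)%:C * Bk k (unitf R y) x.
Proof.
move=> ky; rewrite /Bk /unitf.
have [e|ne] := eqVneq (tauk k y) x; last first.
  rewrite /= mulr0 mulr0; have [e2|_] := eqVneq (tauk k x) y; last by rewrite !mulr0.
  have kx : k \notin x.2 by move: ky; rewrite -e2 /tauk /= flip_in eqxx.
  rewrite /coefk (negPf kx); have [a0|a0] := eqVneq (x.1.1 k) 0%N; first by rewrite a0 oppr0 !(mulr0, mul0r).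
  case/eqP: ne; rewrite -e2; case: (x) kx a0 => [[al be] s] /= /negPf kx a0.
  by rewrite /tauk /= kx /= flip_in eqxx kx /= flipK decrK.
have e2 : tauk k x = y.
  by rewrite -e; case: (y) ky => [[al be] s] /= ky; rewrite /tauk /= ky /= flip_in eqxx ky /= flipK incrK.
have kx : k \notin x.2 by rewrite -e /tauk /= flip_in eqxx ky.
rewrite e2 eqxx -(idxw_tauk ky) e {1}/coefk ky /coefk (negPf kx).
have -> : x.1.1 k = (y.1.1 k).+1 by rewrite -e /tauk ky /= incr_k.
have -> : fsign R k x.2 = fsign R k y.2.
  by rewrite -e /tauk /=; apply: fsign_ext => j jk; rewrite flip_in (ltn_eqF jk).
rewrite rmorphM rmorph_nat /= mulr1n; ring.
Qed.
Lemma Bk_sym k x y :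
  (idxw R y)%:C * Bk k (@unitf R idx x) y = - (idxw R x)%:C * Bk k (unitf R y) x.
Proof.
have [ky|ky] := boolP (k \in y.2); first exact: Bk_sym_aux.
have [kx|kx] := boolP (k \in x.2).
  by have e := Bk_sym_aux y kx; rewrite mulNr e mulNr opprK.
have z (a b : idx) : k \notin a.2 -> k \notin b.2 -> (tauk k a == b) = false.
  by move=> ka kb; apply/eqP => e; move: kb; rewrite -e /tauk /= flip_in eqxx ka.
by rewrite /Bk /unitf !z // !mulr0.
Qed.
Lemma Bk_unitf_conj k x y : (Bk k (@unitf R idx x) y)^* = Bk k (unitf R x) y.
Proof.
rewrite /Bk !cjM fsign_conj /unitf cjn; congr (_ * _ * _).
by rewrite /coefk; case: ifP => _; rewrite ?(cjn R 1) // cjN cjn.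
Qed.

Lemma partial_unitf_sym (x y : idx) :
  (idxw R y)%:C * (partial (unitf R x) y)^* = (idxw R x)%:C * partial (unitf R y) x.
Proof.
pose F := (modes x `|` modes y)%fset.
rewrite (@partialE _ y F) ?fsubsetUr // (@partialE _ x F) ?fsubsetUl //.
have ci : (2 * 'i : C)^* = - (2 * 'i) by rewrite cjM cjn cji mulrN.
rewrite cjM ci cj_sum; set S1 := \sum_(k <- F) _^*; set S2 := \sum_(k <- F) _.
have key : (idxw R y)%:C * S1 = - ((idxw R x)%:C * S2).
  rewrite /S1 /S2 !mulr_sumr -sumrN; apply: eq_bigr => k _.
  rewrite cjM Bk_unitf_conj [(ck k)^*](conjc_real (Num.sqrt k.+1%:R)) -/(ck k).
  have := Bk_sym k x y; move: (Bk k _ y) (Bk k _ x) ((idxw R y)%:C) ((idxw R x)%:C) (ck k) => p q a b c e.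
  have -> : a * (c * p) = c * (a * p) by ring.
  by rewrite e; ring.
move: key; move: S1 S2 (2 * 'i) ((idxw R y)%:C) ((idxw R x)%:C) => p q z a b e.
have -> : a * (- z * p) = - z * (a * p) by ring.
by rewrite e; ring.
Qed.

Lemma partial_sym u v : finsup u -> finsup v ->
  l2dot (@idxw R) (partial u) v = l2dot (@idxw R) u (partial v).
Proof.
apply: matrix_sym; [exact: partial_lin | exact: partial_finsup | exact: partial_unitf_sym].
Qed.

End partial_algebra.

(** * The kernel of the fibre operator *)

Section kernel.
Variables (R : realType) (K : level R) (rho : fock_rep K).
Local Notation C := R[i].
Local Notation H := (WZWS R).

Definition ifst (x : idx) : (midx * {fset nat})%type := (x.1.1, x.2).
Definition isnd (x : idx) : midx := x.1.2.
Definition imk (i : midx * {fset nat}) (be : midx) : idx := (i.1, be, i.2).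
Definition iw (i : midx * {fset nat}) : R := (mfact R i.1)^-1.
Fact iw_gt0 i : 0 < iw i. Proof. by rewrite invr_gt0 mfact_gt0. Qed.
Let mK x : imk (ifst x) (isnd x) = x. Proof. by case: x => [[al be] s]. Qed.
Let m1 i be : ifst (imk i be) = i. Proof. by case: i. Qed.
Let m2 i be : isnd (imk i be) = be. Proof. by []. Qed.
Let mw i be : idxw R (imk i be) = iw i * mfact R be. Proof. by []. Qed.

Definition wfib (i : midx * {fset nat}) (u : H) : Fock R := fib iw_gt0 (@mfact_gt0 R) m2 mw i u.
Lemma wfibE i u be : lfun (wfib i u) be = lfun u (imk i be). Proof. exact: fibE. Qed.
Lemma wfib_lin i : hlinear (wfib i). Proof. exact: fib_lin. Qed.
Lemma wfib_inj u v : (forall i, wfib i u = wfib i v) -> u = v.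
Proof. exact: (fib_inj mK). Qed.

Definition vac_idx : (midx * {fset nat})%type := (midx0, fset0).
Lemma iw_vac : iw vac_idx = 1. Proof. by rewrite /iw mfact0 invr1. Qed.

Fact vinc_subproof (v : Fock R) : exists u : H,
  forall i, wfib i u = if i == vac_idx then v else 0.
Proof.
apply: (fib_glue (@idxw_gt0 R) iw_gt0 mK m1 m2 mw (M := hnorm v ^+ 2)) => F.
have [iF|iF] := boolP (vac_idx \in F).
  rewrite (big_fsetD1 _ iF) /= eqxx iw_vac mul1r big_seq big1 ?addr0 // => i.
  by rewrite !inE => /andP[/negPf -> _]; rewrite hnorm0 expr0n mulr0.
rewrite big_seq big1 ?sqr_ge0 // => i hi; case: eqP => [e|_]; last by rewrite hnorm0 expr0n mulr0.
by move: iF; rewrite -e hi.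
Qed.
Definition vinc v : H := sval (cid (vinc_subproof v)).
Lemma wfib_vinc v i : wfib i (vinc v) = if i == vac_idx then v else 0.
Proof. exact: (svalP (cid (vinc_subproof v))). Qed.
Lemma vinc_lin : hlinear vinc.
Proof.
move=> a u v; apply: wfib_inj => i; rewrite wfib_lin !wfib_vinc; case: ifP => // _.
by rewrite scaler0 addr0.
Qed.
Lemma supp_norm (u : H) : (forall i, i != vac_idx -> wfib i u = 0) -> hnorm u = hnorm (wfib vac_idx u).
Proof.
move=> hu; apply/eqP; rewrite -(@eqrXn2 _ 2%N) ?hnorm_ge0 // eq_le; apply/andP; split.
  apply: (fib_le (I0 := iw_gt0) (J0 := @mfact_gt0 R) mK (eJ := m2) (we := mw)) => F.
  have [iF|iF] := boolP (vac_idx \in F).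
    rewrite (big_fsetD1 _ iF) /= iw_vac mul1r big_seq big1 ?addr0 // => i.
    by rewrite !inE => /andP[hi _]; rewrite -/(wfib i u) hu // hnorm0 expr0n mulr0.
  rewrite big_seq big1 ?sqr_ge0 // => i hi; rewrite -/(wfib i u) hu ?hnorm0 ?expr0n ?mulr0 //.
  by apply/eqP => e; move: iF; rewrite -e hi.
have := fib_sum iw_gt0 (@mfact_gt0 R) m1 m2 mw u [fset vac_idx]%fset.
by rewrite big_seq_fset1 iw_vac mul1r.
Qed.
Lemma vinc_iso : hisometric vinc.
Proof.
apply: hiso_polar; first exact: vinc_lin.
move=> v; rewrite supp_norm; first by rewrite wfib_vinc eqxx.
by move=> i /negPf hi; rewrite wfib_vinc hi.
Qed.

(** A spectral gap: the squared norm of [v = partial u] is the pairing of [u] with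
    [partial (partial u)], a sum of nonnegative terms in which the one at [x] has a factor at least
    4. *)
Lemma partial_norm (u v : H) x : finsup (lfun u) -> lfun v =1 partial (lfun u) -> number x != 0%N ->
  Num.sqrt (idxw R x) * cabs (lfun u x) <= hnorm v.
Proof.
move=> fu hv nx.
have vE : lfun v = partial (lfun u) by apply/funext.
have e1 : hdot v v = l2dot (@idxw R) (lfun u) (fun y => 4 * (number y)%:R * lfun u y).
  rewrite [hdot _ _](_ : _ = l2dot (@idxw R) (lfun v) (lfun v)) // vE partial_sym //; last first.
    exact: partial_finsup.
  by congr l2dot; apply/funext => y; rewrite partial_sqr.
have [A hA] := fset_suppP fu.
pose A' := (x |` A)%fset.
have hA' y : y \notin A' -> lfun u y = 0 by rewrite inE negb_or => /andP[_ /hA].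
have e2 : hnorm v ^+ 2 = \sum_(y <- A') 4 * (number y)%:R * (idxw R y * sqc (lfun u y)).
  apply: (@complexI R); rewrite -hdot_self e1 (@l2dot_fin _ _ _ _ _ A'); last first.
    by move=> y /hA' ->; rewrite mulr0.
  rewrite rmorph_sum; apply: eq_bigr => y _; rewrite !rmorphM /= -cabs_sqc -conj_mul !rmorph_nat.
  by move: ((idxw R y)%:C) => w; ring.
rewrite -(@ler_pXn2r _ 2%N) ?nnegrE ?mulr_ge0 ?hnorm_ge0 ?cabs_ge0 ?sqrtr_ge0 //.
rewrite exprMn sqr_sqrtr ?(ltW (idxw_gt0 R x)) // cabs_sqc e2 (big_fsetD1 x (fset1U1 _ _)) /= -/A'.
have n1 : 1 <= (number x)%:R :> R by rewrite ler1n lt0n.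
have p0 := wsqc_ge0 (@idxw_gt0 R) (lfun u) x.
have : 0 <= \sum_(y <- (A' `\ x)%fset) 4 * (number y)%:R * (idxw R y * sqc (lfun u y)).
  by apply: sumr_ge0 => y _; rewrite mulr_ge0 // wsqc_ge0 //; exact: idxw_gt0.
have := ler_wpM2r p0 n1; move: (\sum_(y <- _) _) => S; lra.
Qed.

(** The gap survives the closure: a coordinate of [u] is bounded by the coordinate of [u - u'] and,
    through [partial_norm], by the norm of [v']. *)
Lemma ker_supp b (u : H) : @ker_partial R b u -> forall x, number x != 0%N -> lfun u x = 0.
Proof.
move=> [ku _] x nx; apply: cabs_eq0; apply/eqP; rewrite eq_le cabs_ge0 andbT.
have w0 : 0 < Num.sqrt (idxw R x) by rewrite sqrtr_gt0 idxw_gt0.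
rewrite -(pmulr_rle0 _ w0); apply: (@le_small _ _ 2) => e e0.
have [u' [v' [fu' hv' h1 h2]]] := ku _ e0.
have h3 := @partial_norm u' v' x fu' hv' nx.
have h4 := l2_coord (u - u') x; rewrite lfunB in h4.
have h5 := cabsD (lfun u x - lfun u' x) (lfun u' x); rewrite subrK in h5.
have h6 := ler_wpM2l (ltW w0) h5; rewrite mulrDr in h6.
lra.
Qed.

Lemma ker_vinc u : @ker_partial R false u <-> exists v, vinc v = u.
Proof.
split=> [ku|[v <-]].
  exists (wfib vac_idx u); apply: wfib_inj => i; rewrite wfib_vinc; case: eqP => [->//|/eqP hi].
  apply/esym/l2_eq => be; rewrite wfibE lfun0; apply: (ker_supp ku).
  apply/eqP => /number_eq0; rewrite /imk /= => -[h1 h2].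
  by case/eqP: hi; case: (i) h1 h2 => al s /= -> ->.
have sv x : lfun (vinc v) x != 0 -> x.1.1 = midx0 /\ x.2 = fset0.
  rewrite -{1}(mK x) -wfibE wfib_vinc; case: (ifst x =P vac_idx) => [e _|_ h]; last by move: h; rewrite lfun0 eqxx.
  by case: (x) e => [[al be] s] [-> ->].
split; last by move=> x /sv[_ ->]; rewrite cardfs0.
move=> e e0; have [A /(_ A (fsubset_refl A)) hA] := trunc_cvg (vinc v) e0.
(* A truncation stays on the vacuum of the dual bosonic and spinor variables, which [partial]
   annihilates, so its image is exactly zero. *)
exists (trunc A (vinc v)), 0; split.
- exact: trunc_finsup.
- move=> x; rewrite [LHS](@lfun0 R idx (@idxw R) (@idxw_gt0 R) x) (@partialE _ _ x (modes x)) // big1 ?mulr0 // => k _.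
  rewrite /Bk; have [->|nz] := eqVneq (wfun (trunc A (vinc v)) (tauk k x)) 0; first by rewrite !mulr0.
  have [|h1 h2] := sv (tauk k x).
    by move: nz; rewrite [wfun _ _]truncE; case: ifP => // _; rewrite eqxx.
  have kx : k \in x.2.
    by move/fsetP: h2 => /(_ k); rewrite /tauk /= flip_in eqxx inE => /negbFE.
  by move: h1; rewrite /tauk kx /= => /eqP; rewrite (negPf (incr_neq0 _ _)).
- exact: hA.
- by rewrite hnorm0.
Qed.

Lemma ker_odd u : @ker_partial R true u -> u = 0.
Proof.
move=> ku; apply: l2_eq => x; rewrite lfun0; have [nx|nx] := eqVneq (number x) 0%N; last exact: ker_supp ku x nx.
apply/eqP/negPn/negP => /(ku.2 x); have [_ ->] := number_eq0 nx.
by rewrite cardfs0.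
Qed.

Lemma acts_vinc f v : acts_by_rho rho f (wfun (vinc v)) (wfun (vinc (rho f v))).
Proof.
move=> al s; exists (wfib (al, s) (vinc v)) => be; first exact: wfibE.
rewrite -[wfun _ _]/(lfun (vinc (rho f v)) (imk (al, s) be)) -wfibE !wfib_vinc.
case: eqP => _ //; rewrite [LHS]lfun0.
by rewrite (hlinear0 (ract_lin (frep rho) f)).
Qed.

Lemma fock_even_kernel : subrep_on rho (@ker_partial R false) (fock_twrep rho).
Proof.
exists vinc; split.
- exact: vinc_lin.
- exact: vinc_iso.
- exact: ker_vinc.
- exact: acts_vinc.
Qed.

Lemma even_kernel_iso (W : twrep (Ugrp K)) : subrep_on rho (@ker_partial R false) W ->
  tw_iso W (fock_twrep rho).
Proof.
move=> [j [lj ij kj aj]].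
have sj w i : i != vac_idx -> wfib i (j w) = 0.
  have /ker_vinc[v <-] : ker_partial false (j w) by apply/kj; exists w.
  by move=> /negPf hi; rewrite wfib_vinc hi.
exists (fun w => wfib vac_idx (j w)); split.
- by move=> a x y; rewrite lj wfib_lin.
- apply: hiso_polar => [a x y|w]; first by rewrite lj wfib_lin.
  by rewrite -supp_norm ?hiso_norm // => i; exact: sj.
- move=> v; have /kj[w hw] : ker_partial false (vinc v) by apply/ker_vinc; exists v.
  by exists w; rewrite hw wfib_vinc eqxx.
- move=> f w; have [v hv hv'] := aj f w midx0 fset0.
  have -> : wfib vac_idx (j w) = v by apply: l2_eq => be; rewrite wfibE; exact: esym (hv be).
  by apply: l2_eq => be; rewrite wfibE; exact: hv' be.
Qed.

Lemma odd_kernel_zero (W : twrep (Ugrp K)) : subrep_on rho (@ker_partial R true) W -> forall w : W, w = 0.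
Proof.
move=> [j [lj ij kj _]] w; apply: (hiso_inj lj ij); rewrite (hlinear0 lj).
by apply: ker_odd; apply/kj; exists w.
Qed.

Section zero_rep.
Variable G : twgroup R.
Definition wvoid (x : void) : R := 1.
Fact wvoid_gt0 x : 0 < wvoid x. Proof. by case: x. Qed.
Definition zspace : hilbert R := l2hilbert wvoid_gt0.
Lemma zspace0 (v w : zspace) : v = w. Proof. by apply: l2_eq => -[]. Qed.
Let zc (v : zspace) (g : G) (e : R) : 0 < e -> \forall h \near g, hnorm (v - v) < e.
Proof. by move=> e0; near=> h; rewrite subrr hnorm0. Unshelve. all: by end_near. Qed.
(** The zero representation, realised over the empty index type; it carries the odd kernel. *)
Definition zrep : twrep G := TwRep (@TwRepOn R G zspace (fun _ v => v) (fun _ _ _ _ => erefl)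
  (fun _ _ _ => erefl) (fun _ v => ex_intro _ v erefl) (fun _ _ _ => zspace0 _ _) zc).
End zero_rep.

Lemma zero_odd_kernel : subrep_on rho (@ker_partial R true) (zrep (Ugrp K)).
Proof.
exists (fun=> 0); split.
- by move=> a x y; rewrite scaler0 addr0.
- by move=> x y; rewrite hdot0r (zspace0 y 0) hdot0r.
- move=> u; split=> [/ker_odd ->|[_ <-]]; first by exists 0.
  split=> [e e0|x]; last by rewrite -[wfun _ x]/(lfun (0 : H) x) lfun0 eqxx.
  exists 0, 0; split; rewrite ?subrr ?hnorm0 //.
    by apply: (@finsupP _ _ _ fset0) => x _.
  have -> : wfun (0 : H) = fun=> 0 by apply/funext => y; exact: (@lfun0 R idx (@idxw R) (@idxw_gt0 R) y).
  by move=> x; rewrite (op_lin0 (@partial_lin R)).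
- move=> f w al s; exists 0 => be //.
  by rewrite (hlinear0 (ract_lin (frep rho) f)).
Qed.

End kernel.

(** * Equivariant sections in terms of their values at base points *)

Section extension_TP.
Variables (R : realType) (K : level R) (lam : central_char K).
Local Notation C := R[i].
Local Notation TE := (ext (TPgrp K)).
Implicit Types (x y z : TE) (h : ext (Tgrp K)).

Lemma tp_emulE x y : emul x y = ((cmul x.1.1 y.1.1, x.1.2 + y.1.2),
  cmul (cmul x.2 y.2) (chi (K x.1.2) y.1.1)).
Proof.
apply: pair_eq => //; congr (cmul _ _).
change (cmul (chi (K x.1.2) y.1.1) (expi (omega K uzero uzero)) = chi (K x.1.2) y.1.1).
by rewrite omega_self expi0 cmul1r.
Qed.
Lemma tp_emulA x y z : emul (emul x y) z = emul x (emul y z).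
Proof.
case: x y z => [[t n] z1] [[s m] z2] [[r k] z3].
rewrite !tp_emulE; cbn [fst snd]; rewrite chiD chiM; apply: pair_eq; first by rewrite cmulA addrA.
by apply: circ_eq; move: (chi _ _) (chi _ _) (chi _ _) => a b c /=; ring.
Qed.

(** The value of [lam] on the torus element that takes the base point over the same lattice point to
    [x]; an equivariant section is divided by it along the fibre. *)
Definition phase x : circ R := lam (x.1.1, cmul x.2 (cinv (chi (K x.1.2) x.1.1))).
Lemma phase_base n : phase (basept K n) = cone.
Proof.
rewrite /phase /basept; cbn [fst snd]; rewrite chi1 lamE cpow1 cmul1.
by rewrite [cmul _ _]cmulC cmulV.
Qed.
Lemma phase_emul x h : phase (emul x (eincTP h)) = cmul (phase x) (lam h).
Proof.
case: x h => [[t n] z] [s y]; rewrite tp_emulE /phase /eincTP; cbn [fst snd].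
rewrite addr0 !lamE cpowM chiM cinvM.
apply: circ_eq; have a0 := circ_neq0 (chi (K n) s); have b0 := circ_neq0 (chi (K n) t).
move: (chi _ _) (chi _ _) (cpow _ _) (cpow _ _) a0 b0 => a b c d a0 b0 /=.
by field; rewrite ?a0 ?b0.
Qed.
Lemma base_emul x : exists h, x = emul (basept K x.1.2) (eincTP h) /\ lam h = phase x.
Proof.
case: x => [[t n] z]; exists (t, cmul z (cinv (chi (K n) t))); split; last by [].
rewrite tp_emulE /basept /eincTP; cbn [fst snd]; rewrite addr0 !cmul1 -cmulA cmulV cmul1r.
by [].
Qed.

Variable I : Type.
Implicit Types (s : TE -> I -> C).
Lemma sec_phase s : equivariant lam s -> forall x j, s x j = (phase x : C)^-1 * s (basept K x.1.2) j.
Proof. by move=> es x j; have [h [ex hx]] := base_emul x; rewrite [in LHS]ex es hx. Qed.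

Definition secof (c : int -> I -> C) : TE -> I -> C := fun x j => (phase x : C)^-1 * c x.1.2 j.
Lemma secof_equiv c : equivariant lam (secof c).
Proof.
move=> g h j; rewrite /secof phase_emul.
have -> : (emul g (eincTP h)).1.2 = g.1.2 by rewrite tp_emulE; cbn [fst snd eincTP]; rewrite addr0.
by rewrite /= invfM mulrCA mulrA.
Qed.
Lemma secof_base c n j : secof c (basept K n) j = c n j.
Proof. by rewrite /secof phase_base invr1 mul1r. Qed.

Lemma translate_equiv g s : equivariant lam s -> equivariant lam (translate g s).
Proof. by move=> es x h j; rewrite /translate -tp_emulA es. Qed.

Definition tphase (g : TPgrp K) (m : int) : C := (phase (emul (einv (g, cone)) (basept K m)) : C)^-1.
Lemma tphase1 g m : cabs (tphase g m) = 1.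
Proof. by rewrite /tphase cabsV cabs_circ invr1. Qed.
Lemma translate_base g s m j : equivariant lam s ->
  translate g s (basept K m) j = tphase g m * s (basept K (m - g.2)) j.
Proof.
move=> es; rewrite /translate sec_phase //; congr (_ * s (basept K _) j).
by rewrite tp_emulE; cbn [fst snd]; rewrite addrC.
Qed.
Lemma translateE g s x j : equivariant lam s ->
  translate g s x j = (phase x : C)^-1 * (tphase g x.1.2 * s (basept K (x.1.2 - g.2)) j).
Proof. by move=> es; rewrite (sec_phase (translate_equiv g es)) translate_base. Qed.
End extension_TP.

(** * The Dirac operator on sections and its equivariance *)

Section dirac_facts.
Variables (R : realType) (K : level R) (rho : fock_rep K) (lam : central_char K).
Local Notation C := R[i].
Local Notation Z := (int * idx)%type.
Implicit Types (s t : ext (TPgrp K) -> idx -> C).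

Fact secw_gt0 (z : Z) : 0 < secw R z. Proof. exact: idxw_gt0. Qed.
Definition LS : hilbert R := l2hilbert secw_gt0.

Definition dirz (c : Z -> C) : Z -> C := fun z => partial (fun y => c (z.1, y)) z.2.
Lemma dirz_lin : op_lin dirz.
Proof. by move=> a c d z; exact: partial_lin. Qed.
Lemma dirz_finsup c : finsup c -> finsup (dirz c).
Proof.
move=> fc; pose N := [set z.1 | z in [set z | c z != 0]].
apply: (@sub_finite_set _ _ (\bigcup_(n in N) (pair n @` [set x | partial (fun y => c (n, y)) x != 0]))).
  move=> [n x] /= h; have [nN|nN] := pselect (N n); first by exists n => //; exists x.
  case/eqP: h; rewrite /dirz /= (_ : (fun y => c (n, y)) = fun=> 0).
    exact: (op_lin0 (@partial_lin R)).
  apply/funext => y; apply/eqP/negPn/negP => h; apply: nN; by exists (n, y).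
apply: bigcup_finite; first exact: finite_image.
move=> n _; apply: finite_image; apply: partial_finsup.
have [A hA] := fset_suppP fc.
apply: (@finsupP _ _ _ [fset z.2 | z in A]%fset) => y hy; apply: hA.
by apply: contra hy => h; apply/imfsetP; exists (n, y).
Qed.
Lemma dirz_sym c d : finsup c -> finsup d -> l2dot (@secw R) (dirz c) d = l2dot (@secw R) c (dirz d).
Proof.
apply: matrix_sym; [exact: dirz_lin | exact: dirz_finsup |].
move=> [n x] [m y]; rewrite /dirz /secw /=.
have E (p q : int) (a b : idx) : partial (fun y => unitf R (p, a) (q, y)) b =
    if q == p then partial (unitf R a) b else 0.
  have [->|qp] := eqVneq q p.
    by apply: (congr1 (fun u => partial u b)); apply/funext => z; rewrite /unitf xpair_eqE eqxx.
  rewrite (_ : (fun y => _) = fun=> 0); first exact: (op_lin0 (@partial_lin R)).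
  by apply/funext => z; rewrite /unitf xpair_eqE (negPf qp).
rewrite !E [n == m]eq_sym; case: eqP => _; last by rewrite conjc0 !mulr0.
exact: partial_unitf_sym.
Qed.

Lemma diracE s x : Defs.dirac s x = partial (s x).
Proof. by apply/funext => j; rewrite /Defs.dirac /dirac_M add0r. Qed.
Lemma coords_dirac s : coords (Defs.dirac s) = dirz (coords s).
Proof. by apply/funext => z; rewrite /coords diracE. Qed.
Lemma dirac_equivariant s : equivariant lam s -> equivariant lam (Defs.dirac s).
Proof.
move=> es g h j; rewrite !diracE -(op_linZ (@partial_lin R)).
by apply: (congr1 (fun u => partial u j)); apply/funext => y; exact: es.
Qed.
Lemma coords_l2 s (F : LS) : coords s = lfun F -> coords s \in l2pred (@secw R).
Proof. by move=> ->; exact: l2P. Qed.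
Lemma l2_coords s : L2sec lam s -> exists F : LS, coords s = lfun F.
Proof. by move=> [_ h]; exists (L2 h). Qed.
Lemma core_l2 s : core lam s -> exists F : LS, coords s = lfun F.
Proof. by move=> [_ /(finsup_ex secw_gt0)[F hF]]; exists F; apply/funext => z; rewrite hF. Qed.
Lemma coords_secof (c : Z -> C) : coords (secof lam (fun n j => c (n, j))) = c.
Proof. by apply/funext => -[n j]; exact: secof_base. Qed.
Lemma sec_normE s (F : LS) : coords s = lfun F -> sec_norm s = hnorm F.
Proof. by move=> h; rewrite /sec_norm /dnorm /sec_dot h. Qed.
Lemma coords_sub s t (F G : LS) : coords s = lfun F -> coords t = lfun G ->
  coords (sec_sub s t) = lfun (F - G).
Proof.
move=> hs ht; apply/funext => z; rewrite lfunB -hs -ht.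
by [].
Qed.

(** All coordinates except the second multi-index: those on which the Dirac operator acts or which
    label the component. The fibres over [zI] are copies of the Fock space on which [rho] acts. *)
Definition zI : choiceType := (int * (midx * {fset nat}))%type.
Definition zmk (i : zI) (be : midx) : Z := (i.1, imk i.2 be).
Definition zfst (z : Z) : zI := (z.1, ifst z.2).
Definition zsnd (z : Z) : midx := isnd z.2.
Definition zw (i : zI) : R := iw R i.2.
Fact zw_gt0 i : 0 < zw i. Proof. exact: iw_gt0. Qed.
Let zK z : zmk (zfst z) (zsnd z) = z. Proof. by case: z => n [[al be] s]. Qed.
Let z1 i be : zfst (zmk i be) = i. Proof. by case: i => n [al s]. Qed.
Let z2 i be : zsnd (zmk i be) = be. Proof. by []. Qed.
Let zwE i be : secw R (zmk i be) = zw i * mfact R be. Proof. by []. Qed.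
Definition zfib (i : zI) (F : LS) : Fock R := fib zw_gt0 (@mfact_gt0 R) z2 zwE i F.
Lemma zfibE i F be : lfun (zfib i F) be = lfun F (zmk i be). Proof. exact: fibE. Qed.
Lemma zfib_inj F G : (forall i, zfib i F = zfib i G) -> F = G. Proof. exact: (fib_inj zK). Qed.
Lemma zfib_lin i : hlinear (zfib i). Proof. exact: fib_lin. Qed.

Definition zshift (a : LT K) (i : zI) : zI := (i.1 - a.1.2, i.2).
Fact zact_subproof (a : LT K) (F : LS) : exists F' : LS,
  (forall i, zfib i F' = tphase lam a.1 i.1 *: rho a.2 (zfib (zshift a i) F)) /\ hnorm F' = hnorm F.
Proof.
apply: (fib_op zw_gt0 zK z1 z2 zwE (s := zshift a) (t := fun i => (i.1 + a.1.2, i.2))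
  (A := fun i v => tphase lam a.1 i.1 *: rho a.2 v)).
- by move=> [n i]; rewrite /zshift /= subrK.
- by move=> [n i]; rewrite /zshift /= addrK.
- by [].
- by move=> i v; rewrite hnormZ tphase1 mul1r rho_norm.
Qed.
Definition zact a F : LS := sval (cid (zact_subproof a F)).
Lemma zactE a F i : zfib i (zact a F) = tphase lam a.1 i.1 *: rho a.2 (zfib (zshift a i) F).
Proof. by case: (svalP (cid (zact_subproof a F))). Qed.
Lemma zact_norm a F : hnorm (zact a F) = hnorm F.
Proof. by case: (svalP (cid (zact_subproof a F))). Qed.
Lemma zact_lin a : hlinear (zact a).
Proof.
move=> c F G; apply: zfib_inj => i; rewrite zfib_lin !zactE zfib_lin (ract_lin (frep rho)).
by rewrite scalerDr !scalerA mulrC.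
Qed.

Definition zsec (F : LS) : ext (TPgrp K) -> idx -> C := secof lam (fun n j => lfun F (n, j)).
Lemma coords_zsec F : coords (zsec F) = lfun F.
Proof. exact: coords_secof. Qed.
Lemma zsec_L2 F : L2sec lam (zsec F).
Proof. by split; [exact: secof_equiv | rewrite coords_zsec; exact: l2P]. Qed.

Lemma sec_act_zact a s F : equivariant lam s -> coords s = lfun F -> sec_act rho a s (zsec (zact a F)).
Proof.
move=> es hs x al sp.
pose i : zI := (x.1.2, (al, sp)).
exists ((phase lam x : C)^-1 *: (tphase lam a.1 x.1.2 *: zfib (zshift a i) F)) => be.
  rewrite (@translateE R K lam idx a.1 s x (al, be, sp) es) -[fock_fun _ _]/(lfun _ be) !lfunZ zfibE.
  by rewrite -hs.
rewrite /zsec /secof -[fock_fun _ _]/(lfun _ be) !(hlinearZ (ract_lin (frep rho) a.2)) lfunZ -(zactE a F i).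
by rewrite zfibE.
Qed.

Lemma sec_act_uniq a s s1 s2 : sec_act rho a s s1 -> sec_act rho a s s2 -> s1 = s2.
Proof.
move=> h1 h2; apply/funext => x; apply/funext => -[[al be] sp].
have [v1 e1 ->] := h1 x al sp; have [v2 e2 ->] := h2 x al sp.
by congr (fock_fun (rho _ _) _); apply: l2_eq => b; rewrite -[RHS]/(fock_fun v2 b) e2 -e1.
Qed.

(** On fibres over [zI] the operator is a finite linear combination with coefficients independent of
    the Fock coordinate and of the component n, so it commutes with [rho] fibrewise and with the
    shift and phase of the lattice action. No finiteness of support is involved, since the sum at
    each index is finite. *)
Lemma dirz_zact a (F G : LS) : lfun G = dirz (lfun F) -> lfun (zact a G) = dirz (lfun (zact a F)).
Proof.
move=> hG; apply/funext => -[n [[al be] sp]].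
pose i : zI := (n, (al, sp)); pose x : idx := (al, be, sp).
pose cf k : C := ck R k * (fsign R k sp * coefk R k (al, midx0, sp)).
pose nx k : midx * {fset nat} := ifst (tauk k (al, midx0, sp)).
have E (f : LS) m b : dirz (lfun f) (m, (al, b, sp)) =
    2 * 'i * \sum_(k <- modes (al, midx0, sp)) cf k * lfun (zfib (m, nx k) f) b.
  rewrite /dirz (@partialE _ _ (al, b, sp) (modes (al, midx0, sp))) //; congr (_ * _).
  by apply: eq_bigr => k _; rewrite zfibE /Bk mulrA.
have zG m : zfib (m, (al, sp)) G = (2 * 'i) *: \sum_(k <- modes (al, midx0, sp)) cf k *: zfib (m, nx k) F.
  apply: l2_eq => b; rewrite zfibE lfunZ lfun_sum hG E; congr (_ * _).
rewrite E -[LHS](zfibE i) zactE /zshift zG.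
rewrite (hlinearZ (ract_lin (frep rho) a.2)) lfunZ lfunZ.
have -> : rho a.2 (\sum_(k <- modes (al, midx0, sp)) cf k *: zfib (n - a.1.2, nx k) F) =
    \sum_(k <- modes (al, midx0, sp)) cf k *: rho a.2 (zfib (n - a.1.2, nx k) F).
  elim: (modes (al, midx0, sp) : seq nat) => [|k r IH].
    by rewrite !big_nil (hlinear0 (ract_lin (frep rho) a.2)).
  by rewrite !big_cons (ract_lin (frep rho) a.2) IH.
rewrite lfun_sum mulrCA; congr (_ * _); rewrite mulr_sumr; apply: eq_bigr => k _.
rewrite zactE !lfunZ mulrCA //.
Qed.

Definition box (FI : {fset zI}) (FB : {fset midx}) : {fset Z} := [fset zmk i be | i in FI, be in FB]%fset.
Lemma in_box FI FB z : (z \in box FI FB) = (zfst z \in FI) && (zsnd z \in FB).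
Proof.
apply/imfset2P/andP => [[i iF [be bF ->]]|[h1 h2]]; first by rewrite z1.
by exists (zfst z) => //; exists (zsnd z).
Qed.

(** Cutting in the Fock coordinate, which [dirz] leaves alone, commutes with it; the support
    hypotheses make the cut in the other coordinates vacuous. This recovers core sections after
    [rho] has produced possibly infinite supports. *)
Lemma dirz_box (f g : LS) FI FB : lfun g = dirz (lfun f) ->
  (forall z, zfst z \notin FI -> lfun f z = 0) -> (forall z, zfst z \notin FI -> lfun g z = 0) ->
  lfun (trunc (box FI FB) g) = dirz (lfun (trunc (box FI FB) f)).
Proof.
move=> hg fI gI.
have tr (h : LS) z : (forall z, zfst z \notin FI -> lfun h z = 0) ->
    lfun (trunc (box FI FB) h) z = if zsnd z \in FB then lfun h z else 0.
  move=> hI; rewrite truncE in_box; case: (boolP (zfst z \in FI)) => //= hz.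
  by rewrite hI // if_same.
apply/funext => -[n x]; rewrite tr // hg /dirz /= !(@partialE _ _ x (modes x)) //.
case: ifP => hb.
  by congr (_ * _); apply: eq_bigr => k _; rewrite /Bk tr // /zsnd /isnd /tauk /= -[x.1.2]/(zsnd (n, x)) hb.
rewrite big1 ?mulr0 // => k _.
by rewrite /Bk tr // /zsnd /isnd /tauk /= -[x.1.2]/(zsnd (n, x)) hb !mulr0.
Qed.

Lemma zact_supp a (F : LS) : finsup (lfun F) -> exists FI : {fset zI}, forall z, zfst z \notin FI -> lfun (zact a F) z = 0.
Proof.
move=> /fset_suppP[A hA]; pose g (z : Z) : zI := ((zfst z).1 + a.1.2, (zfst z).2).
exists [fset g z | z in A]%fset => z hz.
rewrite -(zK z) -zfibE zactE lfunZ.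
rewrite (_ : zfib _ F = 0) ?(hlinear0 (ract_lin (frep rho) a.2)) ?lfun0 ?mulr0 //.
apply: l2_eq => be; rewrite zfibE lfun0; apply: hA; apply: contra hz => h.
apply/imfsetP; exists (zmk (zshift a (zfst z)) be) => //=.
by rewrite /g z1 /zshift subrK; case: (zfst z).
Qed.

Lemma dirac_operator_holds : dirac_operator rho lam.
Proof.
have dom s : core lam s -> L2sec lam s.
  by move=> cs; have [F hF] := core_l2 cs; split; [case: cs | exact: coords_l2 hF].
have stab s : core lam s -> core lam (Defs.dirac s).
  move=> [es fs]; split; first exact: dirac_equivariant.
  by rewrite coords_dirac; exact: dirz_finsup.
split => //.
- move=> s Ls e e0; have [F hF] := l2_coords Ls.
  have [A /(_ A (fsubset_refl A)) hA] := trunc_cvg F e0.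
  exists (zsec (trunc A F)).
    by split; [exact: secof_equiv | rewrite coords_zsec; exact: trunc_finsup].
  by rewrite (sec_normE (coords_sub hF (coords_zsec _))).
- move=> s t [_ fs] [_ ft]; rewrite /sec_dot !coords_dirac; exact: dirz_sym.
- move=> a s Ls; have [F hF] := l2_coords Ls; exists (zsec (zact a F)); first exact: zsec_L2.
  by apply: sec_act_zact => //; case: Ls.
move=> a s t s' t' [Ls Lt hst] as' at'.
have [F hF] := l2_coords Ls; have [G hG] := l2_coords Lt.
have -> : s' = zsec (zact a F).
  by apply: (sec_act_uniq as'); apply: sec_act_zact => //; case: Ls.
have -> : t' = zsec (zact a G).
  by apply: (sec_act_uniq at'); apply: sec_act_zact => //; case: Lt.
split; [exact: zsec_L2 | exact: zsec_L2 |] => e e0.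
have e2 : 0 < e / 2 by rewrite divr_gt0.
have [s1 [cs1 h1 h2]] := hst _ e2.
have [F1 hF1] := core_l2 cs1; have [G1 hG1] := core_l2 (stab _ cs1).
rewrite (sec_normE (coords_sub hF hF1)) in h1; rewrite (sec_normE (coords_sub hG hG1)) in h2.
have dG : lfun G1 = dirz (lfun F1) by rewrite -hG1 coords_dirac hF1.
have dU := dirz_zact a dG.
have [FI1 hI1] : exists FI : {fset zI}, forall z, zfst z \notin FI -> lfun (zact a F1) z = 0.
  by apply: zact_supp; rewrite -hF1; case: cs1.
have [FI2 hI2] : exists FI : {fset zI}, forall z, zfst z \notin FI -> lfun (zact a G1) z = 0.
  by apply: zact_supp; rewrite -hG1; case: (stab _ cs1).
have [A1 hA1] := trunc_cvg (zact a F1) e2; have [A2 hA2] := trunc_cvg (zact a G1) e2.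
(* [FI] contains the [zI]-supports of both vectors, so that [dirz_box] applies, and the box contains
   both truncation sets, so that a single cut approximates the section and its image. *)
pose FI := (FI1 `|` FI2 `|` [fset zfst z | z in A1] `|` [fset zfst z | z in A2])%fset.
pose FB := ([fset zsnd z | z in A1] `|` [fset zsnd z | z in A2])%fset.
have sA1 : (A1 `<=` box FI FB)%fset.
  apply/fsubsetP => z zA; rewrite in_box !inE.
  by rewrite !(in_imfset _ zfst zA) !(in_imfset _ zsnd zA) !orbT.
have sA2 : (A2 `<=` box FI FB)%fset.
  apply/fsubsetP => z zA; rewrite in_box !inE.
  by rewrite !(in_imfset _ zfst zA) !(in_imfset _ zsnd zA) !orbT.
have hB := dirz_box (FI := FI) FB dU.
pose W := trunc (box FI FB) (zact a F1).
have hW : coords (Defs.dirac (zsec W)) = lfun (trunc (box FI FB) (zact a G1)).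
  rewrite coords_dirac coords_zsec hB //.
  - by move=> z; rewrite !inE !negb_or -!andbA => /and4P[/hI1].
  - by move=> z; rewrite !inE !negb_or -!andbA => /and4P[_ /hI2].
exists (zsec W); split.
- by split; [exact: secof_equiv | rewrite coords_zsec; exact: trunc_finsup].
- rewrite (sec_normE (coords_sub (coords_zsec _) (coords_zsec _))).
  apply: (le_lt_trans (hnormB_le _ (zact a F1) _)); rewrite (splitr e) ltrD //; last exact: hA1.
  by rewrite -(hlinearB (zact_lin a)) zact_norm.
- rewrite (sec_normE (coords_sub (coords_zsec _) hW)).
  apply: (le_lt_trans (hnormB_le _ (zact a G1) _)); rewrite (splitr e) ltrD //; last exact: hA2.
  by rewrite -(hlinearB (zact_lin a)) zact_norm.
Qed.

End dirac_facts.

(** * Haar integration and the twisted group algebra *)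

Section double_integrals.
Variable R : realType.
Implicit Types (F : R * R -> R) (f : R -> R).

(** Uniform continuity in the first variable, uniform in the second, from compactness of the unit
    square. *)
Lemma modulus F (e : R) : continuous F -> 0 < e -> exists2 d : R, 0 < d &
  forall x y x' : R, 0 <= x <= 1 -> 0 <= y <= 1 -> `|x' - x| < d -> `|F (x', y) - F (x, y)| < e.
Proof.
move=> cF e0; pose K : set (R * R) := `[0, 1] `*` `[0, 1].
have cK : compact K by apply: compact_setX; exact: segment_compact.
pose P (d : R) (z : R * R) := forall x', `|x' - z.1| < d -> `|F (x', z.2) - F z| < e.
have nP : \forall d \near 0^'+, K `<=` P d.
  move/compact_near_coveringP: cK; apply => z _.
  have e2 : 0 < e / 2 by rewrite divr_gt0.
  have /cvgrPdist_lt/(_ _ e2) := cF z; move=> /nbhs_ballP[r /= r0 hr].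
  have r2 : 0 < r / 2 by rewrite divr_gt0.
  exists (ball z (r / 2), [set d : R | d < r / 2]).
    split; first exact: nbhsx_ballx.
    exact: nbhs_right_lt.
  move=> [z' d] /= [[b1 b2] hd] x' hx'.
  have h1 : `|F z - F z'| < e / 2.
    apply: hr; split.
      by apply: lt_le_trans b1 _; rewrite ler_pdivrMr // ler_peMr ?(ltW r0) // ler1n.
    by apply: lt_le_trans b2 _; rewrite ler_pdivrMr // ler_peMr ?(ltW r0) // ler1n.
  have h2 : `|F z - F (x', z'.2)| < e / 2.
    apply: hr; split => /=; last first.
      by apply: lt_le_trans b2 _; rewrite ler_pdivrMr // ler_peMr ?(ltW r0) // ler1n.
    move: b1; rewrite /ball /= => b1.
    have -> : z.1 - x' = (z.1 - z'.1) - (x' - z'.1) by ring.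
    apply: (le_lt_trans (ler_normB _ _)); rewrite (splitr r) ltrD //.
    exact: lt_trans hx' hd.
  have -> : F (x', z'.2) - F z' = (F z - F z') - (F z - F (x', z'.2)) by ring.
  by apply: (le_lt_trans (ler_normB _ _)); rewrite (splitr e) ltrD.
have np : \forall d \near 0^'+, 0 < d :> R by exact: nbhs_right_gt.
have [d [hd d0]] : exists d : R, K `<=` P d /\ 0 < d.
  by apply: (@filter_ex _ _ (at_right_proper_filter (0 : R))); exact: filterI.
by exists d => // x y x' hx hy hxx'; apply: (hd (x, y)).
Qed.

(** Induction over the subintervals: on each one the integral is the value at an intermediate point
    times [1 / N], and that value is within [e] of the one at the left end. *)
Lemma riemann f (e d : R) N : continuous f ->
  (forall x x', 0 <= x <= 1 -> `|x' - x| < d -> `|f x' - f x| < e) -> (0 < N)%N -> N%:R^-1 < d ->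
  `|rint 0 1 f - N%:R^-1 * \sum_(j < N) f (j%:R / N%:R)| <= e.
Proof.
move=> cf hf N0 Nd; have NR : 0 < N%:R :> R by rewrite ltr0n.
have alg (I S a b n u v : R) : `|a - b| < u -> `|I - n * S| <= v -> 0 <= n ->
    `|I + a * n - n * (S + b)| <= v + n * u.
  move=> hc hI n0; have -> : I + a * n - n * (S + b) = (I - n * S) + n * (a - b) by ring.
  by apply: (le_trans (ler_normD _ _)); rewrite lerD // normrM ger0_norm // ler_wpM2l // ltW.
have hk k : (k <= N)%N -> `|rint 0 (k%:R / N%:R) f - N%:R^-1 * \sum_(j < k) f (j%:R / N%:R)| <= k%:R / N%:R * e.
  elim: k => [_|k IH kN].
    by rewrite big_ord0 mulr0 subr0 mul0r mul0r /rint set_itv1 Rintegral_set1 normr0.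
  rewrite big_ord_recr /=.
  have le1 : 0 <= k%:R / N%:R :> R by rewrite divr_ge0.
  have le2 : k%:R / N%:R <= k.+1%:R / N%:R :> R by rewrite ler_pM2r ?invr_gt0 // ler_nat.
  have le3 : k.+1%:R / N%:R <= 1 :> R by rewrite ler_pdivrMr // mul1r ler_nat.
  rewrite (rint_cat le1 le2 cf); have [c /andP[c1 c2] ->] := rint_mvt le2 cf.
  have w : k.+1%:R / N%:R - k%:R / N%:R = N%:R^-1 :> R by rewrite -mulrBl -natrB // subSnn mul1r.
  have hc : `|f c - f (k%:R / N%:R)| < e.
    apply: hf; first by rewrite le1 (le_trans le2 le3).
    rewrite ger0_norm ?subr_ge0 //.
    apply: (@le_lt_trans _ _ (k.+1%:R / N%:R - k%:R / N%:R)); first by rewrite lerD2r.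
    by rewrite w.
  have := IH (ltnW kN); rewrite w.
  have -> : k.+1%:R / N%:R = k%:R / N%:R + N%:R^-1 :> R by rewrite -[k.+1]addn1 natrD mulrDl mul1r.
  by move=> hI; rewrite mulrDl; apply: alg => //; rewrite invr_ge0 ltW.
by have := hk N (leqnn N); rewrite mulfV ?gt_eqF // mul1r.
Qed.

Lemma rint_dist f g (M : R) : continuous f -> continuous g ->
  (forall x, 0 <= x <= 1 -> `|f x - g x| <= M) -> `|rint 0 1 f - rint 0 1 g| <= M.
Proof.
move=> cf cg hM; have cN : continuous (fun x => - g x) by move=> x; apply: cvgN; exact: cg.
have cfg : continuous (fun x => f x - g x) by move=> x; apply: cvgB; [exact: cf | exact: cg].
have -> : rint 0 1 f - rint 0 1 g = rint 0 1 (fun x => f x - g x) by rewrite rintD // rintN.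
have [|c hc ->] := @rint_mvt R _ 0 1 _ cfg; first exact: ler01.
by rewrite subr0 mulr1 hM.
Qed.

Lemma rint_param_cont (T : topologicalType) (F : T * R -> R) : continuous F ->
  continuous (fun t => rint 0 1 (fun x => F (t, x))).
Proof.
move=> cF t0; have cx t : continuous (fun x => F (t, x)).
  apply: (@comp_cont _ _ _ (fun x : R => (t, x)) F) => //.
  by apply: pair_cont; [exact: cst_continuous | move=> x; exact: cvg_id].
apply/cvgrPdist_lt => e e0; have e2 : 0 < e / 2 by rewrite divr_gt0.
have e4 : 0 < e / 4 by rewrite divr_gt0.
have h : \forall t \near t0, `[0, 1] `<=` (fun x : R => `|F (t, x) - F (t0, x)| < e / 2).
  have /compact_near_coveringP := @segment_compact R 0 1; apply => x _.
  have /cvgrPdist_lt/(_ _ e4)[[U V] /= [hU hV] hUV] := cF (t0, x).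
  exists (V, U) => // -[x' t] /= [Vx Ut].
  have h1 := hUV (t, x') (conj Ut Vx).
  have h2 := hUV (t0, x') (conj (nbhs_singleton hU) Vx).
  rewrite /= in h1 h2.
  have -> : F (t, x') - F (t0, x') = (F (t0, x) - F (t0, x')) - (F (t0, x) - F (t, x')) by ring.
  apply: (le_lt_trans (ler_normB _ _)); lra.
apply: filterS h => t ht.
apply: (@le_lt_trans _ _ (e / 2)); last by rewrite gtr_pMr // invf_lt1 ?ltr1n.
by apply: rint_dist => // x hx; rewrite distrC ltW //; apply: ht; rewrite /= in_itv.
Qed.

Lemma rint_sum (N : nat) (G : nat -> R -> R) : (forall j, continuous (G j)) ->
  continuous (fun x => \sum_(j < N) G j x) /\ rint 0 1 (fun x => \sum_(j < N) G j x) = \sum_(j < N) rint 0 1 (G j).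
Proof.
move=> cG; elim: N => [|N [IH1 IH2]].
  have -> : (fun x => \sum_(j < 0) G j x) = fun=> 0 by apply/funext => x; rewrite big_ord0.
  by split; [exact: cst_continuous | rewrite big_ord0 rint_cst ?ler01 // mul0r].
have -> : (fun x => \sum_(j < N.+1) G j x) = fun x => \sum_(j < N) G j x + G N x.
  by apply/funext => x; rewrite big_ord_recr.
split; first by move=> x; apply: cvgD; [exact: IH1 | exact: cG].
by rewrite rintD // IH2 big_ord_recr.
Qed.

(* Both iterated integrals are limits of the same Riemann sums. *)
Lemma rint_fubini F : continuous F ->
  rint 0 1 (fun x => rint 0 1 (fun y => F (x, y))) = rint 0 1 (fun y => rint 0 1 (fun x => F (x, y))).
Proof.
move=> cF.
have cy x : continuous (fun y => F (x, y)).
  apply: (@comp_cont _ _ _ (fun y : R => (x, y)) F) => //.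
  by apply: pair_cont; [exact: cst_continuous | move=> y; exact: cvg_id].
have cx y : continuous (fun x => F (x, y)).
  apply: (@comp_cont _ _ _ (fun x : R => (x, y)) F) => //.
  by apply: pair_cont; [move=> x; exact: cvg_id | exact: cst_continuous].
pose G x := rint 0 1 (fun y => F (x, y)); pose H y := rint 0 1 (fun x => F (x, y)).
have cG : continuous G by exact: rint_param_cont.
have cH : continuous H.
  apply: (@rint_param_cont _ (fun z : R * R => F (z.2, z.1))).
  apply: (@comp_cont _ _ _ (fun z : R * R => (z.2, z.1)) F) => //.
  by apply: pair_cont; [apply: snd_cont => z; exact: cvg_id | apply: fst_cont => z; exact: cvg_id].
apply/eqP; rewrite -subr_eq0 -normr_eq0 eq_le normr_ge0 andbT; apply: (@le_small _ _ 3) => e e0.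
have [d d0 hd] := modulus cF e0.
have [N _ hN] := near_infty_natSinv_lt (PosNum d0); have Nd := hN N (leqnn N).
have hG x x' : 0 <= x <= 1 -> `|x' - x| < d -> `|G x' - G x| <= e.
  by move=> hx hxx'; apply: rint_dist => // y hy; rewrite ltW // hd.
pose S y := N.+1%:R^-1 * \sum_(j < N.+1) F (j%:R / N.+1%:R, y).
have [cS iS] := @rint_sum N.+1 (fun j y => F (j%:R / N.+1%:R, y)) (fun j => cy _).
have cS' : continuous S by move=> y; apply: cvgM; [exact: cvg_cst | exact: cS].
have SG : rint 0 1 S = N.+1%:R^-1 * \sum_(j < N.+1) G (j%:R / N.+1%:R) by rewrite rintZ // iS.
have h1 : `|rint 0 1 H - rint 0 1 S| <= e.
  apply: rint_dist => // y hy.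
  apply: (@riemann (fun x => F (x, y)) e d) => // x x' hx hxx'; exact: hd.
have h2 : `|rint 0 1 G - rint 0 1 S| <= 2 * e.
  rewrite SG; apply: (@riemann G (2 * e) d) => // x x' hx hxx'.
  by apply: (le_lt_trans (hG _ _ hx hxx')); rewrite ltr_pMl // ltr1n.
change (`|rint 0 1 G - rint 0 1 H| <= 3 * e).
have three (a b c : R) : `|a - c| <= 2 * e -> `|b - c| <= e -> `|a - b| <= 3 * e.
  move=> ac bc; have -> : a - b = (a - c) - (b - c) by ring.
  by apply: (le_trans (ler_normB _ _)); lra.
exact: three h2 h1.
Qed.
End double_integrals.

Section complex_continuity.
Variables (R : realType) (T : topologicalType).
Local Notation C := R[i].
Implicit Types f g : T -> C.
Lemma ccontD f g : continuous (f : T -> C^o) -> continuous (g : T -> C^o) -> continuous ((fun t => f t + g t) : T -> C^o).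
Proof. by move=> cf cg t; apply: (@cvgD C C^o _ _ _ f); [exact: cf | exact: cg]. Qed.
Lemma ccontM f g : continuous (f : T -> C^o) -> continuous (g : T -> C^o) -> continuous ((fun t => f t * g t) : T -> C^o).
Proof. by move=> cf cg t; apply: (@cvgM C _ _ _ f); [exact: cf | exact: cg]. Qed.
Lemma ccontZ (a : C) f : continuous (f : T -> C^o) -> continuous ((fun t => a * f t) : T -> C^o).
Proof.
move=> cf; have ca : continuous ((fun=> a) : T -> C^o) by exact: cst_continuous.
exact: (ccontM ca cf).
Qed.
End complex_continuity.

(** * Integration over the circle *)

Section circle_integral.
Variable R : realType.
Local Notation C := R[i].
Implicit Types (f g : circ R -> C).
Notation tcont f := (continuous ((f : circ R -> C) : circ R -> C^o)).

Definition tint f : C := cintegral 0 1 (fun x => f (expi (2 * pi * x))).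
Let rp f (x : R) : R := complex.Re (f (expi (2 * pi * x))).
Let ip f (x : R) : R := complex.Im (f (expi (2 * pi * x))).
Let tintE f : tint f = rint 0 1 (rp f) +i* rint 0 1 (ip f). Proof. by []. Qed.

Lemma wrap_cont : continuous (fun x : R => expi (2 * pi * x) : circ R).
Proof.
apply: expi_comp_cont => x; apply: cvgM; [exact: cvg_cst | exact: cvg_id].
Qed.
Let fw_cont f : tcont f -> continuous (fun x : R => f (expi (2 * pi * x)) : C^o).
Proof. by move=> cf; exact: (comp_cont wrap_cont cf). Qed.
Let rp_cont f : tcont f -> continuous (rp f).
Proof. by move=> /fw_cont; exact: Re_cont. Qed.
Let ip_cont f : tcont f -> continuous (ip f).
Proof. by move=> /fw_cont; exact: Im_cont. Qed.
Lemma wrap_per (x : R) : expi (2 * pi * (x + 1)) = expi (2 * pi * x) :> circ R.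
Proof. by rewrite mulrDr mulr1 expiD expi_2pi; exact: cmul1r. Qed.

Lemma tint_eq f g : (forall t, f t = g t) -> tint f = tint g.
Proof. by move=> h; congr tint; apply/funext. Qed.
Lemma tintD f g : tcont f -> tcont g -> tint (fun t => f t + g t) = tint f + tint g.
Proof.
move=> cf cg; rewrite !tintE; apply/eqP; rewrite eq_complex /=.
rewrite -(rintD _ _ (rp_cont cf) (rp_cont cg)) -(rintD _ _ (ip_cont cf) (ip_cont cg)).
by apply/andP; split; apply/eqP/rint_eq => x _; rewrite /rp /ip; case: (f _) (g _) => [a b] [c d].
Qed.
Lemma tintZ (a : C) f : tcont f -> tint (fun t => a * f t) = a * tint f.
Proof.
move=> cf; have cr := rp_cont cf; have ci := ip_cont cf; case: a => p q.
have cM (k : R) F : continuous F -> continuous (fun x : R => k * F x).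
  by move=> cF x; apply: cvgM; [exact: cvg_cst | exact: cF].
rewrite !tintE; apply/eqP; rewrite eq_complex /= -mulNr -!rintZ // -!rintD //; try exact: cM.
by apply/andP; split; apply/eqP/rint_eq => x _; rewrite /rp /ip; case: (f _) => [a b] /=; ring.
Qed.
Lemma tint_cst (c : C) : tint (fun=> c) = c.
Proof. by rewrite tintE /rp /ip !rint_cst ?ler01 // subr0 !mulr1; case: c. Qed.
Lemma tint0 : tint (fun=> 0) = 0. Proof. exact: tint_cst. Qed.
Lemma tint_conj f : tcont f -> tint (fun t => (f t)^*) = (tint f)^*.
Proof.
move=> cf; rewrite !tintE; apply/eqP; rewrite eq_complex /= -(rintN _ _ (ip_cont cf)).
by apply/andP; split; apply/eqP/rint_eq => x _; rewrite /rp /ip; case: (f _).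
Qed.
Lemma cabs_ReIm_le (z : C) : cabs z <= `|complex.Re z| + `|complex.Im z|.
Proof.
have -> : z = (complex.Re z)%:C + 'i * (complex.Im z)%:C.
  by apply/eqP; rewrite eq_complex /=; apply/andP; split; apply/eqP; ring.
apply: (le_trans (cabsD _ _)); rewrite cabsM !cabs_real.
rewrite (_ : cabs 'i = 1) ?mul1r; last by rewrite /cabs normc_def /= expr0n expr1n add0r sqrtr1.
by case: z => a b /=; rewrite !(mul0r, mul1r, mulr0, addr0, subr0, add0r).
Qed.
(** Real and imaginary parts are bounded separately, whence the factor 2; only the finiteness of the
    bound and its dependence on [M] matter later. *)
Lemma tint_bound f (M : R) : tcont f -> (forall t, cabs (f t) <= M) -> cabs (tint f) <= M + M.
Proof.
move=> cf hM; apply: (le_trans (cabs_ReIm_le _)); rewrite tintE /=.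
have b F : continuous F -> (forall x, `|F x| <= M) -> `|rint 0 1 F| <= M.
  move=> cF hF; have [|c _ ->] := @rint_mvt R F 0 1 _ cF; first exact: ler01.
  by rewrite subr0 mulr1.
apply: lerD; apply: b; [exact: rp_cont| |exact: ip_cont|] => x.
  exact: le_trans (cabs_ReIm _).1 (hM _).
exact: le_trans (cabs_ReIm _).2 (hM _).
Qed.
Lemma tcont_bdd f : tcont f -> exists2 M : R, 0 < M & forall t, cabs (f t) <= M.
Proof.
move=> cf; have [M1 M10 h1] := bounded_itv ler01 (rp_cont cf).
have [M2 M20 h2] := bounded_itv ler01 (ip_cont cf).
exists (M1 + M2); first exact: addr_gt0.
have key x : 0 <= x <= 1 -> cabs (f (expi (2 * pi * x))) <= M1 + M2.
  move=> hx; apply: (le_trans (cabs_ReIm_le _)); apply: lerD; [exact: h1 | exact: h2].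
move=> t; have [y ->] := expi_surj t; pose n := Num.floor (y / (2 * pi)).
have p0 : 0 < 2 * pi :> R by rewrite mulr_gt0 // pi_gt0.
have -> : expi y = expi (2 * pi * (y / (2 * pi) - n%:~R)) :> circ R.
  rewrite mulrBr mulrCA mulfV ?gt_eqF // mulr1 expiD -mulrN -[_ * - _]mulrC -mulrNz expi_2piM.
  by rewrite [RHS]cmul1r.
apply: key; rewrite subr_ge0 lerBlDl; apply/andP; split; first exact: floor_le.
by have := ltW (floorD1_gt (y / (2 * pi))); rewrite intrD.
Qed.
Lemma tint_shift f s : tcont f -> tint (fun t => f (cmul s t)) = tint f.
Proof.
move=> cf; have [y ->] := expi_surj s.
have p0 : 2 * pi != 0 :> R by rewrite gt_eqF // mulr_gt0 // pi_gt0.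
have E x : cmul (expi y) (expi (2 * pi * x)) = expi (2 * pi * (x + y / (2 * pi))) :> circ R.
  rewrite -[LHS]expiD; congr expi; move: pi p0 => p p0; by field; move: p0; rewrite mulf_eq0 negb_or => /andP[].
rewrite !tintE; congr (_ +i* _).
  transitivity (rint 0 1 (fun x => rp f (x + y / (2 * pi)))).
    by apply: rint_eq => x _; rewrite /rp E.
  by apply: rint_rot; [exact: ler01 | exact: rp_cont | move=> x; rewrite /rp wrap_per].
transitivity (rint 0 1 (fun x => ip f (x + y / (2 * pi)))).
  by apply: rint_eq => x _; rewrite /ip E.
by apply: rint_rot; [exact: ler01 | exact: ip_cont | move=> x; rewrite /ip wrap_per].
Qed.
Lemma tint_inv f : tcont f -> tint (fun t => f (cinv t)) = tint f.
Proof.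
move=> cf; have E x : cinv (expi (2 * pi * x)) = expi (2 * pi * - x) :> circ R.
  by rewrite -expiN mulrN.
rewrite !tintE; congr (_ +i* _).
  transitivity (rint 0 1 (fun x => rp f (- x))); first by apply: rint_eq => x _; rewrite /rp E.
  by apply: rint_refl; [exact: ler01 | exact: rp_cont | move=> x; rewrite /rp wrap_per].
transitivity (rint 0 1 (fun x => ip f (- x))); first by apply: rint_eq => x _; rewrite /ip E.
by apply: rint_refl; [exact: ler01 | exact: ip_cont | move=> x; rewrite /ip wrap_per].
Qed.
Lemma tint_param_cont (T : topologicalType) (F : T * circ R -> C) :
  continuous (F : _ -> C^o) -> continuous ((fun t => tint (fun s => F (t, s))) : T -> C^o).
Proof.
move=> cF.
have cw : continuous (fun p : T * R => (p.1, expi (2 * pi * p.2)) : T * circ R).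
  apply: pair_cont; first by apply: fst_cont => p; exact: cvg_id.
  by apply: expi_comp_cont => p; apply: cvgM; [exact: cvg_cst | apply: (@snd_cont _ _ _ id) => q; exact: cvg_id].
have cFw := comp_cont cw cF.
apply: ccont_ReIm; rewrite /tint /cintegral /=.
  exact: (@rint_param_cont R T (fun p => complex.Re (F (p.1, expi (2 * pi * p.2)))) (Re_cont cFw)).
exact: (@rint_param_cont R T (fun p => complex.Im (F (p.1, expi (2 * pi * p.2)))) (Im_cont cFw)).
Qed.
Lemma tint_fubini (F : circ R * circ R -> C) : continuous (F : _ -> C^o) ->
  tint (fun s => tint (fun t => F (s, t))) = tint (fun t => tint (fun s => F (s, t))).
Proof.
move=> cF.
have cw : continuous (fun p : R * R => (expi (2 * pi * p.1), expi (2 * pi * p.2)) : circ R * circ R).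
  apply: pair_cont.
    by apply: expi_comp_cont => p; apply: cvgM; [exact: cvg_cst | apply: (@fst_cont _ _ _ id) => q; exact: cvg_id].
  by apply: expi_comp_cont => p; apply: cvgM; [exact: cvg_cst | apply: (@snd_cont _ _ _ id) => q; exact: cvg_id].
have cFw := comp_cont cw cF.
have cpx (a b c d : R) : a = c -> b = d -> a +i* b = c +i* d by move=> -> ->.
exact: (cpx _ _ _ _ (rint_fubini (Re_cont cFw)) (rint_fubini (Im_cont cFw))).
Qed.
Lemma tint_sum (I : Type) (r : seq I) (F : I -> circ R -> C) : (forall i, tcont (F i)) ->
  tcont (fun t => \sum_(i <- r) F i t) /\ tint (fun t => \sum_(i <- r) F i t) = \sum_(i <- r) tint (F i).
Proof.
move=> cF; elim: r => [|i r [IH1 IH2]].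
  have -> : (fun t => \sum_(i <- [::]) F i t) = fun=> 0 by apply/funext => t; rewrite big_nil.
  by split; [exact: cst_continuous | rewrite big_nil tint0].
have -> : (fun t => \sum_(j <- i :: r) F j t) = fun t => F i t + \sum_(j <- r) F j t.
  by apply/funext => t; rewrite big_cons.
split; first by apply: ccontD; [exact: cF | exact: IH1].
by rewrite big_cons -IH2; exact: (tintD (cF i) IH1).
Qed.
End circle_integral.

(** * Haar measure on the torus times the lattice *)

Section haar_integral.
Variables (R : realType) (K : level R).
Local Notation C := R[i].
Local Notation G := (TPgrp K).
Implicit Types (b c f : G -> C) (A : {fset int}).
Notation cts f := (forall n : int, continuous ((fun t : circ R => f (t, n)) : circ R -> C^o)).

Lemma gtauE (g h : G) : gtau g h = chi (K g.2) h.1.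
Proof.
change (cmul (chi (K g.2) h.1) (expi (omega K uzero uzero)) = chi (K g.2) h.1).
by rewrite omega_self expi0 cmul1r.
Qed.

Definition vanishes b A := forall n, n \notin A -> forall t, b (t, n) = 0.
Lemma Cc_supp b : Cc b -> exists A, vanishes b A.
Proof.
move=> [_ /finite_fsetP[A hA]]; exists A => n nA t; apply/eqP/negPn/negP => h.
by case/negP: nA; have : [set n | exists t, b (t, n) != 0] n by [exists t]; rewrite hA.
Qed.
Lemma Cc_intro b A : cts b -> vanishes b A -> Cc b.
Proof.
move=> cb hb; split => //; apply: (@sub_finite_set _ _ [set` A]); last exact: finite_fset.
by move=> n /= [t h]; apply/negPn/negP => nA; rewrite hb ?eqxx in h.
Qed.
Lemma haar_fset b A : vanishes b A -> haar b = \sum_(n <- A) tint (fun t => b (t, n)).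
Proof.
move=> hb; rewrite -(@fsum_fset R int (fun n => tint (fun t => b (t, n))) A) // => n nA.
by rewrite (@tint_eq R _ (fun=> 0)) ?tint0 // => t; exact: hb.
Qed.
Lemma haar_eq b c : (forall g, b g = c g) -> haar b = haar c.
Proof. by move=> h; congr haar; apply/funext. Qed.

Lemma CcM b f : Cc b -> cts f -> Cc (fun g => b g * f g).
Proof.
move=> hb cf; have [A hA] := Cc_supp hb; apply: (@Cc_intro _ A) => [n|n nA t].
  by apply: ccontM; [case: hb | exact: cf].
by rewrite hA // mul0r.
Qed.
Lemma CcL (a : C) b c : Cc b -> Cc c -> Cc (fun g => a * b g + c g).
Proof.
move=> hb hc; have [A hA] := Cc_supp hb; have [B hB] := Cc_supp hc.
apply: (@Cc_intro _ (A `|` B)%fset) => [n|n].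
  apply: ccontD; last by case: hc.
  exact: (ccontZ (hb.1 n)).
by rewrite inE negb_or => /andP[nA nB] t; rewrite hA // hB // mulr0 addr0.
Qed.
Lemma Cc_conj b : Cc b -> Cc (fun g => (b g)^*).
Proof.
move=> hb; have [A hA] := Cc_supp hb; apply: (@Cc_intro _ A) => [n|n nA t].
  by apply: conj_cont; case: hb.
by rewrite hA // conjc0.
Qed.
Lemma haarL (a : C) b c : Cc b -> Cc c -> haar (fun g => a * b g + c g) = a * haar b + haar c.
Proof.
move=> hb hc; have [A hA] := Cc_supp hb; have [B hB] := Cc_supp hc.
have hA' : vanishes b (A `|` B)%fset by move=> n; rewrite inE negb_or => /andP[/hA].
have hB' : vanishes c (A `|` B)%fset by move=> n; rewrite inE negb_or => /andP[_ /hB].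
rewrite (haar_fset hA') (haar_fset hB') (@haar_fset _ (A `|` B)%fset); last first.
  by move=> n nAB t; rewrite hA' // hB' // mulr0 addr0.
rewrite mulr_sumr -big_split /=; apply: eq_bigr => n _.
have cb : continuous ((fun t : circ R => b (t, n)) : circ R -> C^o) by case: hb.
have ca : continuous ((fun t : circ R => a * b (t, n)) : circ R -> C^o).
  exact: (ccontZ cb).
by rewrite -(tintZ a cb); exact: (tintD ca (hc.1 n)).
Qed.
Lemma haarZ (a : C) b : Cc b -> haar (fun g => a * b g) = a * haar b.
Proof.
have C0 : Cc (fun _ : G => 0 : C).
  by apply: (@Cc_intro _ fset0) => // n; exact: cst_continuous.
have h0 : haar (fun _ : G => 0 : C) = 0 by rewrite (@haar_fset _ fset0) ?big_seq_fset0.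
move=> hb; rewrite -[RHS]addr0 -h0 -haarL //.
by apply: haar_eq => g; rewrite addr0.
Qed.
Lemma haar_conj b : Cc b -> haar (fun g => (b g)^*) = (haar b)^*.
Proof.
move=> hb; have [A hA] := Cc_supp hb; rewrite (haar_fset hA) (@haar_fset _ A); last first.
  by move=> n nA t; rewrite hA // conjc0.
rewrite cj_sum; apply: eq_bigr => n _; apply: tint_conj; by case: hb.
Qed.

Lemma CcT b (h : G) : Cc b -> Cc (fun g => b (gmul h g)).
Proof.
move=> hb; have [A hA] := Cc_supp hb.
pose f (n : int) := n - h.2.
apply: (@Cc_intro _ [fset f n | n in A]%fset) => [n|n nA t].
  have ch : continuous (fun t : circ R => cmul h.1 t).
    by apply: cmul_cont => //; [exact: cst_continuous | move=> t; exact: cvg_id].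
  exact: (comp_cont ch (hb.1 (h.2 + n))).
apply: hA; apply: contra nA => nA; apply/imfsetP; exists (h.2 + n) => //=.
by rewrite /f addrC addKr.
Qed.
Lemma haar_translate b (h : G) : Cc b -> haar (fun g => b (gmul h g)) = haar b.
Proof.
move=> hb; have [A hA] := Cc_supp hb.
pose f (n : int) := n - h.2; pose B := [fset f n | n in A]%fset.
have hB : vanishes (fun g => b (gmul h g)) B.
  move=> n nA t; apply: hA; apply: contra nA => nA; apply/imfsetP; exists (h.2 + n) => //=.
  by rewrite /f addrC addKr.
rewrite (haar_fset hA) (haar_fset hB) big_imfset /=; last by move=> x y _ _; exact: addIr.
apply: eq_bigr => n _.
transitivity (tint (fun t => b (cmul h.1 t, n))).
  by apply: tint_eq => t; rewrite /f /= addrC subrK.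
by apply: tint_shift; case: hb.
Qed.
Lemma CcV b : Cc b -> Cc (fun g => b (ginv g)).
Proof.
move=> hb; have [A hA] := Cc_supp hb.
apply: (@Cc_intro _ [fset - n | n in A]%fset) => [n|n nA t].
  have ch : continuous (fun t : circ R => cinv t) by apply: cinv_cont => t; exact: cvg_id.
  exact: (comp_cont ch (hb.1 (- n))).
by apply: hA; apply: contra nA => nA; apply/imfsetP; exists (- n) => //=; rewrite opprK.
Qed.
Lemma haar_inv b : Cc b -> haar (fun g => b (ginv g)) = haar b.
Proof.
move=> hb; have [A hA] := Cc_supp hb; pose B := [fset - n | n in A]%fset.
have hB : vanishes (fun g => b (ginv g)) B.
  by move=> n nA t; apply: hA; apply: contra nA => nA; apply/imfsetP; exists (- n) => //=; rewrite opprK.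
rewrite (haar_fset hA) (haar_fset hB) big_imfset /=; last by move=> x y _ _; exact: oppr_inj.
apply: eq_bigr => n _; rewrite /= opprK.
by apply: (@tint_inv R (fun t => b (t, n))); case: hb.
Qed.
Lemma haar_bound b : Cc b -> exists2 k : R, 0 <= k & forall f (M : R), cts f -> (forall g, cabs (f g) <= M) ->
  cabs (haar (fun g => b g * f g)) <= k * M.
Proof.
move=> hb; have [A hA] := Cc_supp hb.
have /choice[k hk] : forall n, exists k : R, 0 < k /\ forall t, cabs (b (t, n)) <= k.
  move=> n; have [M M0 hM] := @tcont_bdd R (fun t => b (t, n)) (hb.1 n); by exists M.
exists (\sum_(n <- A) (k n + k n)).
  by apply: sumr_ge0 => n _; rewrite addr_ge0 // ltW // (hk n).1.
move=> f M cf hM; rewrite (@haar_fset _ A); last by move=> n nA t; rewrite hA // mul0r.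
apply: (le_trans (cabs_sum _ _ _)); rewrite mulr_suml; apply: ler_sum => n _.
rewrite mulrDl; apply: tint_bound.
  by apply: ccontM; [case: hb | exact: cf].
by move=> t; rewrite cabsM ler_pM ?cabs_ge0 // (hk n).2.
Qed.

Definition cts2 (F : G -> G -> C) := forall m n,
  continuous ((fun p : circ R * circ R => F (p.1, m) (p.2, n)) : _ -> C^o).
Lemma haar_param (F : G -> G -> C) B : cts2 F -> (forall g, vanishes (F g) B) ->
  cts (fun g => haar (F g)).
Proof.
move=> cF hB n.
have -> : (fun t : circ R => haar (F (t, n))) = fun t => \sum_(m <- B) tint (fun s => F (t, n) (s, m)).
  by apply/funext => t; exact: haar_fset.
have cm m : continuous ((fun t : circ R => tint (fun s => F (t, n) (s, m))) : _ -> C^o).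
  exact: (tint_param_cont (cF n m)).
by case: (tint_sum B (F := fun m t => tint (fun s => F (t, n) (s, m))) cm).
Qed.
Lemma haar_fubini (F : G -> G -> C) A B : cts2 F ->
  (forall g, g.2 \notin A -> forall h, F g h = 0) -> (forall g, vanishes (F g) B) ->
  haar (fun g => haar (F g)) = haar (fun h => haar (fun g => F g h)).
Proof.
move=> cF hA hB.
have h0 (b : G -> C) : (forall g, b g = 0) -> haar b = 0.
  by move=> h; rewrite (@haar_fset _ fset0) ?big_seq_fset0 // => n _ t.
rewrite (@haar_fset _ A); last by move=> n nA t; apply: h0 => h; exact: hA.
rewrite (@haar_fset _ B); last by move=> n nB t; apply: h0 => h; exact: hB.
have E n : tint (fun t => haar (F (t, n))) = \sum_(m <- B) tint (fun t => tint (fun s => F (t, n) (s, m))).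
  rewrite -(proj2 (@tint_sum R _ B (fun m t => tint (fun s => F (t, n) (s, m)))
    (fun m => tint_param_cont (cF n m)))).
  by apply: tint_eq => t; exact: haar_fset.
have sw n m : continuous ((fun p : circ R * circ R => F (p.2, n) (p.1, m)) : _ -> C^o).
  have cs : continuous (fun p : circ R * circ R => (p.2, p.1)).
    by apply: pair_cont; [apply: snd_cont | apply: fst_cont] => p; exact: cvg_id.
  exact: (comp_cont cs (cF n m)).
have E' m : tint (fun s => haar (fun g => F g (s, m))) = \sum_(n <- A) tint (fun s => tint (fun t => F (t, n) (s, m))).
  rewrite -(proj2 (@tint_sum R _ A (fun n s => tint (fun t => F (t, n) (s, m)))
    (fun n => tint_param_cont (sw n m)))).
  by apply: tint_eq => s; apply: haar_fset => n nA t; exact: hA.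
under eq_bigr do rewrite E; under [RHS]eq_bigr do rewrite E'.
rewrite exchange_big /=; apply: eq_bigr => m _; apply: eq_bigr => n _.
exact: (tint_fubini (cF n m)).
Qed.
End haar_integral.

Lemma cont_eq (T S : topologicalType) (f g : T -> S) : (forall t, f t = g t) -> continuous f -> continuous g.
Proof. by move=> /funext ->. Qed.

(** * Integrated representations on compactly supported functions *)

Section coefficients.
Variables (R : realType) (K : level R) (V : twrep (TPgrp K)).
Local Notation C := R[i].
Local Notation G := (TPgrp K).
Implicit Types (b c : G -> C) (v w : V) (g h k : G).
Notation cts f := (forall n : int, continuous ((fun t : circ R => f (t, n)) : circ R -> C^o)).

Definition coef v w g : C := hdot v (raction V g w).
Lemma coef_cont (T : topologicalType) (phi : T -> circ R * int) v w : continuous phi ->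
  continuous ((fun t => coef v w (phi t)) : T -> C^o).
Proof.
move=> cphi t; apply/ccontP => e e0.
have d0 : 0 < e / (hnorm v + 1) by rewrite divr_gt0 // ltr_wpDl ?hnorm_ge0.
have h : \forall s \near t, hnorm (raction V (phi s) w - raction V (phi t) w) < e / (hnorm v + 1).
  exact: (cphi t _ (ract_cont (raction V) w (phi t) d0)).
apply: filterS h => s hs.
rewrite /coef -hdotBr; apply: (le_lt_trans (cauchy_schwarz _ _)).
apply: (@le_lt_trans _ _ ((hnorm v + 1) * hnorm (raction V (phi s) w - raction V (phi t) w))).
  by rewrite ler_wpM2r ?hnorm_ge0 // lerDl.
by rewrite mulrC -ltr_pdivlMr // ltr_wpDl ?hnorm_ge0.
Qed.
Lemma coef_cts v w : cts (coef v w).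
Proof.
move=> n; have cp : continuous (fun t : circ R => (t, n)).
  by apply: (@pair_cont _ _ _ id (fun=> n)); [move=> t; exact: cvg_id | exact: cst_continuous].
exact: (@coef_cont _ _ v w cp).
Qed.
Lemma ract_norm g v : hnorm (raction V g v) = hnorm v.
Proof. exact: hiso_norm (ract_iso (raction V) g). Qed.
Lemma coef_le v w g : cabs (coef v w g) <= hnorm v * hnorm w.
Proof. by apply: (le_trans (cauchy_schwarz _ _)); rewrite ract_norm. Qed.
Lemma coef_linr v g : forall a x y, coef v (a *: x + y) g = a * coef v x g + coef v y g.
Proof. by move=> a x y; rewrite /coef (ract_lin (raction V)) hdotDr hdotZr. Qed.
Lemma coef_linl w g : forall a x y, coef (a *: x + y) w g = a^* * coef x w g + coef y w g.
Proof. by move=> a x y; rewrite /coef hdotDl hdotZl. Qed.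

Lemma Cc_coef b v w : Cc b -> Cc (fun g => b g * hdot v (raction V g w)).
Proof. by move=> hb; exact: (CcM hb (@coef_cts v w)). Qed.

Lemma integrated_bound b : Cc b -> exists2 k : R, 0 <= k & forall v w,
  cabs (integrated b v w) <= k * (hnorm v * hnorm w).
Proof.
move=> hb; have [k k0 hk] := haar_bound hb; exists k => // v w.
by apply: hk; [exact: coef_cts | exact: coef_le].
Qed.
Lemma integratedLl b : Cc b -> forall a x y w, integrated b (a *: x + y) w = a^* * integrated b x w + integrated b y w.
Proof.
move=> hb a x y w; rewrite -haarL; [|exact: Cc_coef..].
by apply: haar_eq => g; rewrite -!/(coef _ _ _) coef_linl; ring.
Qed.
Lemma integratedLr b : Cc b -> forall a v x y, integrated b v (a *: x + y) = a * integrated b v x + integrated b v y.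
Proof.
move=> hb a v x y; rewrite -haarL; [|exact: Cc_coef..].
by apply: haar_eq => g; rewrite -!/(coef _ _ _) coef_linr; ring.
Qed.
Lemma integratedL a b c v w : Cc b -> Cc c ->
  integrated (fun g => a * b g + c g) v w = a * integrated b v w + integrated c v w.
Proof.
move=> hb hc; rewrite -haarL; [|exact: Cc_coef..].
by apply: haar_eq => g; ring.
Qed.

(** The condition on [b] is placed inside so that [cpi] is total; outside [Cc] the identity is a
    placeholder. *)
Fact cpi_subproof b : exists T : V -> V, Cc b -> forall v w, integrated b v w = hdot v (T w).
Proof.
have [hb|nb] := pselect (Cc b); last by exists id => /nb.
have [k k0 hk] := integrated_bound hb.
by have [T hT] := riesz_op (integratedLl hb) hk; exists T.
Qed.
Definition cpi b : V -> V := sval (cid (cpi_subproof b)).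
Lemma cpiE b v w : Cc b -> hdot v (cpi b w) = integrated b v w.
Proof. by move=> hb; rewrite (svalP (cid (cpi_subproof b)) hb). Qed.

Lemma tp_mulK h g : gmul h (gmul (ginv h) g) = g :> G.
Proof. by case: g h => [t n] [s m]; congr pair; [rewrite /= cmulA cmulVr cmul1 | rewrite /= addrA subrr add0r]. Qed.

Lemma ract1 v : raction V (cone, 0) v = v.
Proof.
have [u <-] := ract_surj (raction V) (cone, 0) v.
rewrite (ract_tw (raction V)) gtauE chi1 scale1r.
by congr (raction V _ u); rewrite /= cmul1 addr0.
Qed.

Lemma tau_cont (m : int) (T : topologicalType) (f : T -> circ R) : continuous f ->
  continuous ((fun t => (chi (K m) (f t) : C)) : T -> C^o).
Proof. by move=> cf; apply: circ_cval_cont; exact: chi_cont. Qed.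

Lemma conv_ker_cont b c : Cc b -> Cc c -> cts2 (fun g h : G => b h * c (gmul (ginv h) g) * (gtau h (gmul (ginv h) g) : C)).
Proof.
move=> hb hc m n; have c2 : continuous (fun p : circ R * circ R => p.2) by apply: snd_cont => p; exact: cvg_id.
have cd : continuous (fun p : circ R * circ R => cmul (cinv p.2) p.1).
  by apply: cmul_cont; [exact: cinv_cont | apply: fst_cont => p; exact: cvg_id].
apply: ccontM; last first.
  by apply: cont_eq (@tau_cont n _ _ cd) => p; rewrite gtauE.
by apply: ccontM; [exact: (comp_cont c2 (hb.1 n)) | exact: (comp_cont cd (hc.1 (- n + m)))].
Qed.

Lemma conv_supp b c (A B : {fset int}) : vanishes b A -> vanishes c B ->
  exists D : {fset int}, forall g : G, g.2 \notin D -> forall h, b h * c (gmul (ginv h) g) = 0.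
Proof.
move=> hA hB; pose f (m n : int) := m + n.
exists [fset f m n | m in A, n in B]%fset => g gD h.
have [hn|hn] := boolP (h.2 \in A); last by case: h hn => s n hn; rewrite hA ?mul0r.
rewrite [c _](_ : _ = 0) ?mulr0 //; case: g gD => t n gD /=.
apply: hB; apply: contra gD => hm; apply/imfset2P; exists h.2 => //; exists (- h.2 + n) => //.
by rewrite /f addrA subrr add0r.
Qed.

Lemma Cc_conv b c : Cc b -> Cc c -> Cc (Defs.conv b c).
Proof.
move=> hb hc; have [A hA] := Cc_supp hb; have [B hB] := Cc_supp hc.
have [D hD] := conv_supp hA hB; apply: (@Cc_intro _ _ _ D) => [|n nD t].
  by apply: (haar_param (conv_ker_cont hb hc) (B := A)) => g n nA t; rewrite hA // !mul0r.
rewrite /Defs.conv (@haar_fset _ _ _ fset0) ?big_seq_fset0 // => m _ s.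
by rewrite (hD (t, n)) // mul0r.
Qed.

(** After exchanging the integrals, the substitution [k = h^-1 g] turns the twist in the convolution
    into the composition of the two unitaries. *)
Lemma integrated_conv b c v w : Cc b -> Cc c -> integrated (Defs.conv b c) v w = integrated b v (cpi c w).
Proof.
move=> hb hc; have [A hA] := Cc_supp hb; have [B hB] := Cc_supp hc.
have [D hD] := conv_supp hA hB.
(* [vi h] is the preimage of [v] under the operator of [h]; taking it from surjectivity avoids the
   cocycle factor of an inverse. *)
have /choice[vi hvi] : forall h : G, exists v', raction V h v' = v by move=> h; exact: ract_surj.
pose F (g h : G) := (b h * c (gmul (ginv h) g) * (gtau h (gmul (ginv h) g) : C)) * coef v w g.
have ck : cts2 F.
  move=> m n; apply: ccontM; first exact: conv_ker_cont.
  have c1 : continuous (fun p : circ R * circ R => (p.1, m)).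
    apply: (@pair_cont _ _ _ (fun p : circ R * circ R => p.1) (fun=> m)); last exact: cst_continuous.
    by apply: fst_cont => p; exact: cvg_id.
  exact: (@coef_cont _ _ v w c1).
have cE h k : (gtau h k : C) * coef v w (gmul h k) = coef (vi h) w k.
  by rewrite /coef -hdotZr -(ract_tw (raction V)) -[X in hdot X _](hvi h) (ract_iso (raction V)).
have FE g h : F g h = b h * (c (gmul (ginv h) g) * coef (vi h) w (gmul (ginv h) g)).
  by rewrite /F -cE tp_mulK; ring.
have CF g : Cc (fun h => b h * c (gmul (ginv h) g) * (gtau h (gmul (ginv h) g) : C)).
  apply: (@Cc_intro _ _ _ A) => [m|m mA s]; last by rewrite hA // !mul0r.
  case: g => t n.
  have cp : continuous (fun s : circ R => (t, s)).
    by apply: (@pair_cont _ _ _ (fun=> t) id); [exact: cst_continuous | move=> s; exact: cvg_id].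
  exact: (comp_cont cp (@conv_ker_cont b c hb hc n m)).
transitivity (haar (fun g => haar (F g))).
  apply: haar_eq => g; rewrite -/(coef v w g) mulrC -haarZ //.
  by apply: haar_eq => h; rewrite /F mulrC.
rewrite (haar_fubini ck (A := D) (B := A)); last first.
- by move=> g n nA t; rewrite /F hA // !mul0r.
- by move=> g gD h; rewrite /F hD // !mul0r.
apply: haar_eq => h; pose ch k := c k * coef (vi h) w k.
have Cch : Cc ch by apply: CcM => //; exact: coef_cts.
transitivity (b h * haar (fun g => ch (gmul (ginv h) g))).
  rewrite -haarZ; last exact: CcT.
  by apply: haar_eq => g; rewrite FE.
congr (_ * _); rewrite haar_translate // -[LHS]/(integrated c (vi h) w) -cpiE //.
by rewrite -[in RHS](hvi h) (ract_iso (raction V)).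
Qed.

Lemma Cc_star b : Cc b -> Cc (star b).
Proof.
move=> hb; apply: Cc_conj; apply: CcM; first exact: CcV.
move=> n; have ci : continuous (fun t : circ R => t) by move=> t; exact: cvg_id.
by apply: cont_eq (@tau_cont (- n) _ _ ci) => t; rewrite gtauE.
Qed.
Lemma integrated_star b v w : Cc b -> integrated (star b) v w = (integrated b w v)^*.
Proof.
move=> hb; rewrite /integrated -(haar_inv (Cc_coef w v hb)) -haar_conj; last exact: (CcV (Cc_coef w v hb)).
apply: haar_eq => g.
have E : hdot v (raction V g w) = (gtau (ginv g) g : C) * hdot (raction V (ginv g) v) w.
  rewrite -[in LHS](ract_iso (raction V) (ginv g)) (ract_tw (raction V)) hdotZr.
  rewrite (_ : gmul (ginv g) g = (cone, 0)) ?ract1 //.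
  by congr pair; [rewrite /= cmulV | rewrite /= addNr].
rewrite /star E hdotC; move: (gtau (ginv g) g) => z.
rewrite !cjM -mulrA; congr (_ * _).
by rewrite mulrA conj_mul cabs_circ expr1n mul1r.
Qed.
End coefficients.

(** * Extending representations to the twisted group algebra *)

Section cstar_facts.
Variables (R : realType) (A : cstar R).
Local Notation C := R[i].
Implicit Types (x y z : A) (a : C).

Lemma cprod0l z : cprod 0 z = 0 :> A.
Proof.
by have := @cprodDl R A 1 0 0 z; rewrite !scale1r addr0 => /eqP; rewrite -subr_eq0 opprD addNKr oppr_eq0 => /eqP.
Qed.
Lemma cprodBl x y z : cprod (x - y) z = cprod x z - cprod y z.
Proof. by rewrite -scaleN1r addrC cprodDl scaleN1r addrC. Qed.
Lemma cprodBr x y z : cprod z (x - y) = cprod z x - cprod z y.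
Proof. by rewrite -scaleN1r addrC cprodDr scaleN1r addrC. Qed.
Lemma cadjB x y : cadj (x - y) = cadj x - cadj y.
Proof. have := cadjD (-1) y x; rewrite !scaleN1r ![- _ + _]addrC => ->.
by rewrite NconjE cjN (cjn _ 1) scaleN1r addrC. Qed.
Lemma cnorm00 : cnorm (0 : A) = 0.
Proof. by rewrite -(scale0r (0 : A)) cnormZ cabs0 mul0r. Qed.
Lemma cnormN x : cnorm (- x) = cnorm x.
Proof. by rewrite -scaleN1r cnormZ cabsN cabs1 mul1r. Qed.
Lemma cnorm_ge0 x : 0 <= cnorm x.
Proof. by have := cnormD x (- x); rewrite subrr cnorm00 cnormN; lra. Qed.
Lemma cnormBC x y : cnorm (x - y) = cnorm (y - x).
Proof. by rewrite -cnormN opprB. Qed.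
Lemma cnorm_dist x y : cnorm x <= cnorm y + cnorm (x - y).
Proof. by have := cnormD y (x - y); rewrite addrC subrK. Qed.
(** The C*-identity and submultiplicativity give [|y|^2 <= |y'| |y|] for the adjoint [y'];
    cancelling and exchanging the roles gives both inequalities. *)
Lemma cnorm_adj x : cnorm (cadj x) = cnorm x.
Proof.
have h y : cnorm y <= cnorm (cadj y).
  have [->|y0] := eqVneq (cnorm y) 0; first exact: cnorm_ge0.
  have p : 0 < cnorm y by rewrite lt_def y0 cnorm_ge0.
  by rewrite -(ler_pM2r p) -expr2 -cnorm_star cnormM.
by apply/eqP; rewrite eq_le h andbT -{2}(cadjK x) h.
Qed.
End cstar_facts.

Section extension_to_completion.
Variables (R : realType) (K : level R) (A : group_cstar K).
Local Notation C := R[i].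
Local Notation G := (TPgrp K).
Implicit Types (b c : G -> C) (x y : A).

Section one_representation.
Variable V : twrep G.
Implicit Types (u v w : V).

Lemma cpi_lin b : Cc b -> hlinear (cpi (V := V) b).
Proof.
by move=> hb a v w; apply: hdot_inj => u; rewrite hdotDr hdotZr !cpiE // integratedLr.
Qed.
Lemma cpiL a b c v : Cc b -> Cc c -> cpi (fun g => a * b g + c g) v = a *: cpi b v + cpi c v.
Proof.
move=> hb hc; apply: hdot_inj => u; rewrite hdotDr hdotZr !cpiE ?integratedL //; exact: CcL.
Qed.
Lemma cpiM b c v : Cc b -> Cc c -> cpi (Defs.conv b c) v = cpi b (cpi c v).
Proof.
move=> hb hc; apply: hdot_inj => u; rewrite !cpiE ?integrated_conv //; exact: Cc_conv.
Qed.

Lemma integrated_cnorm b v w : Cc b -> cabs (integrated b v w) <= cnorm (gcj A b) * (hnorm v * hnorm w).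
Proof.
move=> hb; have [k k0 hk] := haar_bound hb.
pose S := [set r : R | exists (V : twrep G) (v w : V),
           [/\ hnorm v <= 1, hnorm w <= 1 & r = cabs (integrated b v w)]].
(* The bound [k] depends on [b] alone and not on the representation, so the set is bounded and its
   supremum is a true upper bound. *)
have ubS r : S r -> r <= k * 1.
  move=> [V' [v' [w' [h1 h2 ->]]]]; apply: hk; first exact: coef_cts.
  by move=> g; apply: (le_trans (coef_le _ _ _)); rewrite mulr_ile1 ?hnorm_ge0.
have hS v' w' : hnorm v' <= 1 -> hnorm w' <= 1 -> cabs (integrated b v' w') <= cnorm (gcj A b).
  move=> h1 h2; have Sr : S (cabs (integrated b v' w')) by exists V, v', w'.
  rewrite gcj_norm //; apply: sup_upper_bound => //.
  by split; [exists (cabs (integrated b v' w')) | exists (k * 1)].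
have [z|vw0] := eqVneq (hnorm v * hnorm w) 0.
  have [k' k'0 /(_ v w)] := integrated_bound V hb; rewrite z !mulr0 //.
have v0 : 0 < hnorm v by rewrite lt_def hnorm_ge0 andbT; apply: contraNneq vw0 => ->; rewrite mul0r.
have w0 : 0 < hnorm w by rewrite lt_def hnorm_ge0 andbT; apply: contraNneq vw0 => ->; rewrite mulr0.
have n1 (u : V) : 0 < hnorm u -> hnorm ((hnorm u)^-1%:C *: u) <= 1.
  by move=> u0; rewrite hnormZ cabs_real ger0_norm ?invr_ge0 ?hnorm_ge0 // mulVf // gt_eqF.
have := hS _ _ (n1 _ v0) (n1 _ w0).
rewrite -cpiE // (hlinearZ (cpi_lin hb)) hdotZl hdotZr cpiE // !cabsM cabsJ !cabs_real.
rewrite !ger0_norm ?invr_ge0 ?hnorm_ge0 // mulrA -invfM mulrC ler_pdivrMr //.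
by rewrite mulr_gt0.
Qed.
(** The sesquilinear bound is tested on the vector [cpi b w] itself. *)
Lemma cpi_norm b w : Cc b -> hnorm (cpi b w) <= cnorm (gcj A b) * hnorm w.
Proof.
move=> hb; set u := cpi b w.
have [->|u0] := eqVneq (hnorm u) 0; first by rewrite mulr_ge0 ?cnorm_ge0 ?hnorm_ge0.
have p : 0 < hnorm u by rewrite lt_def u0 hnorm_ge0.
rewrite -(ler_pM2l p) mulrCA -expr2; have := integrated_cnorm u w hb.
by rewrite -cpiE // -/u hdot_self cabs_real ger0_norm ?sqr_ge0.
Qed.
Lemma cpi_dist b c w : Cc b -> Cc c -> hnorm (cpi b w - cpi c w) <= cnorm (gcj A b - gcj A c) * hnorm w.
Proof.
move=> hb hc; have := cpi_norm w (CcL (-1) hc hb).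
by rewrite cpiL // gcj_lin // !scaleN1r ![- _ + _]addrC.
Qed.

(* u is the limit of cpi b v as gcj b tends to x. *)
Fact gpi_subproof x v : exists u, forall b, Cc b -> hnorm (u - cpi b v) <= cnorm (x - gcj A b) * hnorm v.
Proof.
have /choice[b hb] : forall n : nat, exists b, Cc b /\ cnorm (x - gcj A b) < n.+1%:R^-1.
  by move=> n; have [|b hb h] := @gcj_dense R K A x (n.+1%:R^-1); [rewrite invr_gt0 ltr0n | exists b].
have near0 (e : R) : 0 < e -> exists N, forall n, (N <= n)%N -> cnorm (x - gcj A (b n)) * hnorm v < e.
  move=> e0; have d0 : 0 < e / (hnorm v + 1) by rewrite divr_gt0 // ltr_wpDl ?hnorm_ge0.
  have [N _ hN] := near_infty_natSinv_lt (PosNum d0); exists N => n Nn.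
  have h : cnorm (x - gcj A (b n)) < e / (hnorm v + 1) by apply: lt_trans (hb n).2 _; exact: hN.
  apply: (@le_lt_trans _ _ (cnorm (x - gcj A (b n)) * (hnorm v + 1))).
    by rewrite ler_wpM2l ?cnorm_ge0 // lerDl.
  by rewrite -ltr_pdivlMr // ltr_wpDl ?hnorm_ge0.
have tri n c : Cc c -> hnorm (cpi (b n) v - cpi c v) <= cnorm (x - gcj A (b n)) * hnorm v + cnorm (x - gcj A c) * hnorm v.
  move=> hc; apply: (le_trans (cpi_dist v (hb n).1 hc)); rewrite -mulrDl ler_wpM2r ?hnorm_ge0 //.
  rewrite [cnorm (x - gcj A (b n))]cnormBC.
  by have := cnormD (gcj A (b n) - x) (x - gcj A c); rewrite addrA subrK.
have [|u hu] := @hcomplete R V (fun n => cpi (b n) v).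
  move=> e e0; have e2 : 0 < e / 2 by rewrite divr_gt0.
  have [N hN] := near0 _ e2; exists N => m n hm hn.
  apply: (le_lt_trans (tri m (b n) (hb n).1)); rewrite (splitr e); apply: ltrD; exact: hN.
exists u => c hc; apply/ler_addgt0Pl => e e0.
have e2 : 0 < e / 2 by rewrite divr_gt0.
have [N1 h1] := near0 _ e2; have [N2 h2] := hu _ e2.
have := h1 (maxn N1 N2) (leq_maxl _ _); have := h2 (maxn N1 N2) (leq_maxr _ _).
set n := maxn N1 N2; rewrite -/(hnorm (cpi (b n) v - u)) hnormBC => a1 a2.
apply: (le_trans (hnormB_le _ (cpi (b n) v) _)); have := tri n c hc; lra.
Qed.
Definition gpi x v : V := sval (cid (gpi_subproof x v)).
Lemma gpi_dist x v b : Cc b -> hnorm (gpi x v - cpi b v) <= cnorm (x - gcj A b) * hnorm v.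
Proof. exact: (svalP (cid (gpi_subproof x v)) b). Qed.

(** Identifies a limit from any approximation with linear error; linearity and multiplicativity of
    [gpi] are obtained through it. Restricting to [e <= 1] lets a factor such as the norm of an
    approximant be bounded by a constant. *)
Lemma gpi_char x v u (k1 k2 : R) : 0 <= k1 -> 0 <= k2 -> (forall e : R, 0 < e -> e <= 1 -> exists b, [/\ Cc b,
  cnorm (x - gcj A b) <= k1 * e & hnorm (u - cpi b v) <= k2 * e]) -> gpi x v = u.
Proof.
move=> k10 k20 h; apply/eqP; rewrite -subr_eq0; apply/eqP/hnorm_le0.
have key (e : R) : 0 < e -> e <= 1 -> hnorm (gpi x v - u) <= (k1 * hnorm v + k2) * e.
  move=> e0 e1; have [b [hb h1 h2]] := h e e0 e1.
  apply: (le_trans (hnormB_le _ (cpi b v) _)); rewrite mulrDl lerD //; last by rewrite hnormBC.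
  by apply: (le_trans (gpi_dist x v hb)); rewrite mulrAC ler_wpM2r ?hnorm_ge0.
have K0 : 0 <= k1 * hnorm v + k2 by rewrite addr_ge0 // mulr_ge0 ?hnorm_ge0.
apply: (@le_small _ _ (k1 * hnorm v + k2)) => e e0; have [e1|e1] := leP e 1; first exact: key.
apply: (le_trans (key 1 ltr01 (lexx _))); rewrite ler_wpM2l // ltW //.
Qed.
Lemma approx x (e : R) : 0 < e -> exists2 b, Cc b & cnorm (x - gcj A b) <= e.
Proof. by move=> e0; have [b hb h] := gcj_dense x e0; exists b => //; exact: ltW. Qed.

Lemma gpi_gcj b v : Cc b -> gpi (gcj A b) v = cpi b v.
Proof.
move=> hb; apply: (@gpi_char _ _ _ 0 0) => // e _ _; exists b.
by rewrite !subrr cnorm00 hnorm0 !mul0r.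
Qed.
Lemma gpi_linl a x y v : gpi (a *: x + y) v = a *: gpi x v + gpi y v.
Proof.
have k0 : 0 <= cabs a + 1 by rewrite addr_ge0 ?cabs_ge0.
apply: (@gpi_char _ _ _ (cabs a + 1) ((cabs a + 1) * hnorm v)) => // [|e e0 _].
  by rewrite mulr_ge0 ?hnorm_ge0.
have [b hb h1] := approx x e0; have [c hc h2] := approx y e0.
exists (fun g => a * b g + c g); split; first exact: CcL.
  rewrite gcj_lin // opprD addrACA -scalerBr.
  by apply: (le_trans (cnormD _ _)); rewrite cnormZ mulrDl mul1r lerD // ler_wpM2l ?cabs_ge0.
rewrite cpiL // opprD addrACA -scalerBr; apply: (le_trans (hnormD _ _)).
rewrite hnormZ -mulrA mulrDl mul1r lerD //.
  rewrite ler_wpM2l ?cabs_ge0 //; apply: (le_trans (gpi_dist x v hb)).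
  by rewrite mulrC ler_wpM2l ?hnorm_ge0.
by apply: (le_trans (gpi_dist y v hc)); rewrite mulrC ler_wpM2l ?hnorm_ge0.
Qed.
Lemma gpiD x y v : gpi (x + y) v = gpi x v + gpi y v.
Proof. by have := gpi_linl 1 x y v; rewrite !scale1r. Qed.
Lemma gpi_lin x : hlinear (gpi x).
Proof.
move=> a v w; have k0 : 0 <= cabs a * hnorm v + hnorm w by rewrite addr_ge0 ?mulr_ge0 ?cabs_ge0 ?hnorm_ge0.
apply: (@gpi_char _ _ _ 1 (cabs a * hnorm v + hnorm w)) => // e e0 _.
have [b hb h1] := approx x e0; exists b; split => //; first by rewrite mul1r.
rewrite (cpi_lin hb) opprD addrACA -scalerBr; apply: (le_trans (hnormD _ _)).
rewrite hnormZ mulrDl lerD // -?mulrA ?ler_wpM2l ?cabs_ge0 //.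
  by apply: (le_trans (gpi_dist x v hb)); rewrite mulrC ler_wpM2l ?hnorm_ge0.
by apply: (le_trans (gpi_dist x w hb)); rewrite mulrC ler_wpM2l ?hnorm_ge0.
Qed.
Lemma gpi_norm x v : hnorm (gpi x v) <= cnorm x * hnorm v.
Proof.
rewrite -subr_le0; apply: (@le_small _ _ (2 * hnorm v)) => e e0.
have [b hb h] := approx x e0.
have h1 := hnormB_le (gpi x v) (cpi b v) 0; rewrite !subr0 in h1.
have h2 := gpi_dist x v hb; have h3 := cpi_norm v hb.
have h4 : cnorm (gcj A b) <= cnorm x + e.
  by apply: (le_trans (cnorm_dist _ x)); rewrite lerD2l cnormBC.
have v0 := hnorm_ge0 v; have h5 := ler_wpM2r v0 h4; have h6 := ler_wpM2r v0 h.
lra.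
Qed.
Lemma gpiM x y v : gpi (cprod x y) v = gpi x (gpi y v).
Proof.
have x1 : 0 <= cnorm x + 1 by rewrite addr_ge0 ?cnorm_ge0.
apply: (@gpi_char _ _ _ (cnorm y + (cnorm x + 1)) (hnorm (gpi y v) + (cnorm x + 1) * hnorm v)).
- by rewrite addr_ge0 ?cnorm_ge0.
- by rewrite addr_ge0 ?mulr_ge0 ?hnorm_ge0.
move=> e e0 e1; have [b hb h1] := approx x e0; have [c hc h2] := approx y e0.
have b1 : cnorm (gcj A b) <= cnorm x + 1.
  by apply: (le_trans (cnorm_dist _ x)); rewrite lerD2l cnormBC (le_trans h1).
exists (Defs.conv b c); split; first exact: Cc_conv.
  rewrite gcj_mul //.
  have -> : cprod x y - cprod (gcj A b) (gcj A c) = cprod (x - gcj A b) y + cprod (gcj A b) (y - gcj A c).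
    by rewrite cprodBl cprodBr addrA subrK.
  apply: (le_trans (cnormD _ _)); rewrite mulrDl lerD //.
    by apply: (le_trans (cnormM _ _)); rewrite mulrC ler_wpM2l ?cnorm_ge0.
  by apply: (le_trans (cnormM _ _)); rewrite ler_pM ?cnorm_ge0.
rewrite cpiM //; apply: (le_trans (hnormB_le _ (cpi b (gpi y v)) _)); rewrite mulrDl lerD //.
  by apply: (le_trans (gpi_dist x _ hb)); rewrite mulrC ler_wpM2l ?hnorm_ge0.
rewrite -(hlinearB (cpi_lin hb)); apply: (le_trans (cpi_norm _ hb)); rewrite -mulrA.
apply: ler_pM; rewrite ?cnorm_ge0 ?hnorm_ge0 //.
by apply: (le_trans (gpi_dist y v hc)); rewrite mulrC ler_wpM2l ?hnorm_ge0.
Qed.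
Lemma gpi_adj x v w : hdot (gpi (cadj x) v) w = hdot v (gpi x w).
Proof.
apply/eqP; rewrite -subr_eq0; apply/eqP/cabs_eq0/eqP; rewrite eq_le cabs_ge0 andbT.
apply: (@le_small _ _ (2 * (hnorm v * hnorm w))) => e e0.
have [b hb h] := approx x e0.
have E : hdot (cpi (star b) v) w = hdot v (cpi b w).
  by rewrite hdotC cpiE ?integrated_star ?conjcK ?cpiE //; exact: Cc_star.
have -> : hdot (gpi (cadj x) v) w - hdot v (gpi x w) =
    hdot (gpi (cadj x) v - cpi (star b) v) w - hdot v (gpi x w - cpi b w).
  by rewrite hdotBl hdotBr E; ring.
have h1 := gpi_dist (cadj x) v (Cc_star hb); rewrite gcj_star // -cadjB cnorm_adj in h1.
have h2 := gpi_dist x w hb.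
rewrite -cabsN opprB; apply: (le_trans (cabsD _ _)); rewrite cabsN.
have c1 := cauchy_schwarz (gpi (cadj x) v - cpi (star b) v) w.
have c2 := cauchy_schwarz v (gpi x w - cpi b w).
have v0 := hnorm_ge0 v; have w0 := hnorm_ge0 w.
have g1 := ler_wpM2r w0 (le_trans h1 (ler_wpM2r v0 h)).
have g2 := ler_wpM2l v0 (le_trans h2 (ler_wpM2r w0 h)).
lra.
Qed.
Lemma gpi_adjr x v w : hdot v (gpi (cadj x) w) = hdot (gpi x v) w.
Proof. by rewrite -gpi_adj cadjK. Qed.
Lemma gpi_extends : extends_rep gpi.
Proof.
split; [exact: (fun v a x y => gpi_linl a x y v) | exact: gpi_lin | exact: gpiM | exact: gpi_adj |].
by move=> b hb v w; rewrite gpi_gcj // cpiE.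
Qed.
End one_representation.

(** The norm of [gcj b] is a supremum over representations by definition; density of these elements
    and the continuity of [gpi] extend the resulting estimate to the whole algebra. *)
Lemma cnorm_le_reps x (k : R) : 0 <= k ->
  (forall (V : twrep G) (v w : V), cabs (hdot v (gpi x w)) <= k * (hnorm v * hnorm w)) -> cnorm x <= k.
Proof.
move=> k0 h; rewrite -subr_le0; apply: (@le_small _ _ 2) => e e0.
have [b hb hx] := approx x e0.
have hs : cnorm (gcj A b) <= k + e.
  rewrite gcj_norm //; apply: ge_sup.
    (* The zero representation shows that the set under the supremum is nonempty. *)
    by exists (cabs (integrated b (0 : zrep G) 0)), (zrep G), 0, 0; rewrite hnorm0 ler01.
  move=> r [V [v [w [v1 w1 ->]]]]; rewrite -cpiE //.
  have -> : hdot v (cpi b w) = hdot v (gpi x w) - hdot v (gpi x w - cpi b w) by rewrite hdotBr; ring.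
  have vw : hnorm v * hnorm w <= 1 by rewrite mulr_ile1 ?hnorm_ge0.
  apply: (le_trans (cabsD _ _)); rewrite cabsN lerD //.
    by apply: (le_trans (h V v w)); rewrite ler_piMr.
  apply: (le_trans (cauchy_schwarz _ _)).
  have d := le_trans (gpi_dist x w hb) (ler_wpM2r (hnorm_ge0 w) hx).
  apply: (le_trans (ler_wpM2l (hnorm_ge0 v) d)); rewrite mulrCA ler_piMr //; exact: ltW.
have := cnorm_dist x (gcj A b); lra.
Qed.

(* Positivity of y^* y is only available in representations, where cnorm is computed. *)
Lemma cnorm_sum_squares x y : cnorm (cprod (cadj x) x) <= cnorm (cprod (cadj x) x + cprod (cadj y) y).
Proof.
set k := cnorm (_ + _).
have sq (V : twrep G) (v : V) : hnorm (gpi x v) ^+ 2 <= k * hnorm v ^+ 2.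
  have E z : hdot v (gpi (cprod (cadj z) z) v) = (hnorm (gpi z v) ^+ 2)%:C.
    by rewrite gpiM gpi_adjr hdot_self.
  have h : (hnorm (gpi x v) ^+ 2 + hnorm (gpi y v) ^+ 2)%:C = hdot v (gpi (cprod (cadj x) x + cprod (cadj y) y) v).
    by rewrite gpiD hdotDr !E -rmorphD.
  have := cauchy_schwarz v (gpi (cprod (cadj x) x + cprod (cadj y) y) v).
  rewrite -h cabs_real ger0_norm ?addr_ge0 ?sqr_ge0 // => h1.
  have := ler_wpM2l (hnorm_ge0 v) (gpi_norm (cprod (cadj x) x + cprod (cadj y) y) v).
  rewrite -/k; have := sqr_ge0 (hnorm (gpi y v)); rewrite [hnorm v ^+ 2]expr2; lra.
apply: cnorm_le_reps; first exact: cnorm_ge0.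
move=> V v w; rewrite gpiM gpi_adjr.
apply: (le_trans (cauchy_schwarz _ _)).
have p1 := hnorm_ge0 (gpi x v); have p2 := hnorm_ge0 (gpi x w).
have k0 : 0 <= k by exact: cnorm_ge0.
rewrite -(@ler_pXn2r _ 2%N) ?nnegrE ?mulr_ge0 ?hnorm_ge0 //.
rewrite !exprMn [k ^+ 2]expr2.
have -> : k * k * (hnorm v ^+ 2 * hnorm w ^+ 2) = (k * hnorm v ^+ 2) * (k * hnorm w ^+ 2) by ring.
by apply: ler_pM; rewrite ?sqr_ge0.
Qed.
End extension_to_completion.

(** * Kasparov's module and the index *)

Section generator.
Variables (R : realType) (K : level R) (lam : central_char K).
Local Notation C := R[i].
Local Notation G := (TPgrp K).
Local Notation mu := (tweight lam).
Local Notation ka := (kappa K).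
Implicit Types (s : sect K) (g : G) (b : G -> C).

(** Moving [t] past the base point over [m] costs kap m t, which shifts the weight of that fibre
    from [mu] to [mu - m kappa]. *)
Lemma tphaseE (t : circ R) (n m : int) : tphase lam (t, n) m = (cpow t (mu - m * ka) : C).
Proof.
have pE : phase lam (emul (einv ((t, n) : G, cone)) (basept K m)) = cpow t (- (mu - m * ka)).
  rewrite tp_emulE /phase /basept /einv; cbn [fst snd].
  rewrite gtauE; cbn [fst snd ginv gmul TPgrp].
  rewrite chi1 !cmul1r !cmul1 lamE !chiE.
  have pw k : cpow (cinv t) k = cpow t (- k).
    by rewrite -mulN1r cpowMz cpowN; congr (cpow (cinv _) k); apply: circ_eq; rewrite /= expr1z.
  rewrite !pw -!cpowN -!cpowD; congr cpow; ring.
by rewrite /tphase pE cpowN /= invrK.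
Qed.

Definition dsec : sect K := secof lam (fun n (_ : unit) => (n == 0)%:R).
Lemma dsec_base n j : dsec (basept K n) j = (n == 0)%:R.
Proof. exact: secof_base. Qed.
Lemma dsec_Csec : Csec lam dsec.
Proof.
split; first exact: secof_equiv.
apply: (@sub_finite_set _ _ [set 0 : int]); last exact: finite_set1.
by move=> n /=; rewrite dsec_base; have [->|_] := eqVneq n 0; rewrite // eqxx.
Qed.

Definition dip s : G -> C := fun g => (cpow g.1 (mu - g.2 * ka) : C)^* * s (basept K g.2) tt.
Lemma sect_ip_dsec s : Csec lam s -> sect_ip s dsec = dip s.
Proof.
move=> [es _]; apply/funext => -[t n]; rewrite /sect_ip.
have E m : translate (t, n) dsec (basept K m) tt = (cpow t (mu - m * ka) : C) * (m - n == 0)%:R.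
  by rewrite (@translate_base R K lam) ?dsec_base ?tphaseE //; exact: secof_equiv.
rewrite (@fsum1 _ _ _ n) => [|m mn]; first by rewrite E subrr eqxx mulr1.
by rewrite NconjE E subr_eq0 (negPf mn) mulr0 conjc0 mul0r.
Qed.
Lemma dip_Cc s : Csec lam s -> Cc (dip s).
Proof.
move=> [_ /finite_fsetP[A hA]]; apply: (@Cc_intro _ _ _ A) => [n|n nA t].
  apply: (@ccontM _ _ _ (fun=> s (basept K n) tt)); last exact: cst_continuous.
  apply: conj_cont; apply: circ_cval_cont; cbn [fst snd].
  by apply: (@cpow_cont _ _ id) => t; exact: cvg_id.
rewrite /dip [s _ _](_ : _ = 0) ?mulr0 //=; apply/eqP/negPn/negP => h.
by case/negP: nA; have : [set n | s (basept K n) tt != 0] n by []; rewrite hA.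
Qed.
Lemma sect_act_dip s : Csec lam s -> sect_act (dip s) dsec = s.
Proof.
move=> [es fs]; apply/funext => x; apply/funext => -[]; rewrite /sect_act.
have E g : translate g dsec x tt = (phase lam x : C)^-1 * ((cpow g.1 (mu - x.1.2 * ka) : C) * (x.1.2 - g.2 == 0)%:R).
  by case: g => t n; rewrite (@translateE R K lam) ?dsec_base ?tphaseE //; exact: secof_equiv.
rewrite (@haar_fset _ _ _ [fset x.1.2]%fset) => [|n nx t]; last first.
  by rewrite E subr_eq0; move: nx; rewrite inE eq_sym => /negPf ->; rewrite !mulr0.
(* Only the lattice component of [x] contributes; there the two characters are conjugate, so the
   integrand is constant and the circle has mass one. *)
rewrite big_seq_fset1 [RHS](sec_phase es) -[RHS]tint_cst; apply: tint_eq => t.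
rewrite E subrr eqxx mulr1 /dip; cbn [fst snd]; move: (cpow t _) => c.
have cc : (c : C)^* * c = 1 by rewrite conj_mul cabs_circ expr1n.
have al (a b d e : C) : a * d = 1 -> a * b * (e * d) = e * b by move=> h; rewrite -[RHS]mulr1 -h; ring.
exact: al.
Qed.

Lemma integrated_dsec (V : twrep G) (v w : V) :
  integrated (dip dsec) v w = tint (fun t => (cpow t mu : C)^* * hdot v (raction V (t, 0) w)).
Proof.
rewrite /integrated (@haar_fset _ _ _ [fset 0]%fset) => [|n n0 t]; last first.
  by rewrite /dip dsec_base; move: n0; rewrite inE => /negPf ->; rewrite mulr0 mul0r.
rewrite big_seq_fset1; apply: tint_eq => t.
by rewrite /dip dsec_base eqxx mulr1; cbn [fst snd]; rewrite mul0r subr0.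
Qed.

Definition weight_vector (V : twrep G) (w : V) : Prop :=
  forall t : circ R, raction V (t, 0) w = (cpow t mu : C) *: w.
Lemma TP_mul (V : twrep G) (s t : circ R) (w : V) : raction V (s, 0) (raction V (t, 0) w) = raction V (cmul s t, 0) w.
Proof.
by rewrite (ract_tw (raction V)) gtauE chiE mul0r cpow0 scale1r.
Qed.
(** [T] averages the torus action against the conjugate of the character of [lam]. It fixes vectors
    of that weight because the integrand becomes constant, and translation invariance gives every
    fixed vector that weight. *)
Lemma integrated_weight (V : twrep G) (T : V -> V) :
  (forall v w, hdot v (T w) = integrated (dip dsec) v w) -> forall w, weight_vector w <-> T w = w.
Proof.
move=> hT w; split => [hw|<- s].
  apply: hdot_inj => v; rewrite hT integrated_dsec -[RHS]tint_cst; apply: tint_eq => t.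
  by rewrite hw hdotZr mulrA conj_mul cabs_circ expr1n mul1r.
apply: hdot_inj => v; have [v' <-] := ract_surj (raction V) (s, 0) v.
rewrite (ract_iso (raction V)) hdotZr !hT !integrated_dsec.
pose f t := (cpow t mu : C)^* * coef (raction V (s, 0) v') w (t, 0).
have cf : continuous (f : circ R -> C^o).
  apply: ccontM; last exact: coef_cts.
  by apply: conj_cont; apply: circ_cval_cont; apply: cpow_cont => t; exact: cvg_id.
rewrite -[X in _ = _ * X](tint_shift s cf) -tintZ; last first.
  have cs : continuous (fun t : circ R => cmul s t).
    by apply: cmul_cont => //; [exact: cst_continuous | move=> t; exact: cvg_id].
  exact: (comp_cont cs cf).
apply: tint_eq => t; rewrite /f /coef -TP_mul (ract_iso (raction V)) cpowM.
move: (cpow s mu) (cpow t mu) (hdot _ _) => a b d.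
have cc : (a : C) * (a : C)^* = 1 by rewrite mulrC conj_mul cabs_circ expr1n.
by rewrite cjM !mulrA cc mul1r.
Qed.
End generator.

(** * Structure of the Hilbert module *)

Section hilbert_module.
Variables (R : realType) (A : cstar R) (E : hmodule A).
Local Notation C := R[i].
Implicit Types (x y z : E).
Lemma mip0l y : mip 0 y = 0 :> A.
Proof.
by have := @mipDl R A E 1 0 0 y; rewrite !scale1r addr0 => /eqP; rewrite -subr_eq0 opprD addNKr oppr_eq0 => /eqP.
Qed.
Lemma mipBl x y z : mip (x - y) z = mip x z - mip y z.
Proof. by rewrite -scaleN1r addrC mipDl scaleN1r addrC. Qed.
Lemma mip_addl x y z : mip (x + y) z = mip x z + mip y z.
Proof. by have := mipDl 1 x y z; rewrite !scale1r. Qed.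
Lemma cadj_add (a b : A) : cadj (a + b) = cadj a + cadj b.
Proof. by have := cadjD 1 a b; rewrite NconjE (cjn _ 1) !scale1r. Qed.
Lemma cadj00 : cadj (0 : A) = 0.
Proof. by have := cadj_add 0 0; rewrite addr0 => /eqP; rewrite -subr_eq0 opprD addNKr oppr_eq0 => /eqP. Qed.
Lemma mip_addr x y z : mip z (x + y) = mip z x + mip z y.
Proof. by rewrite -[LHS]mipJ mip_addl cadj_add !mipJ. Qed.
Lemma mactBl (a b : A) z : mact (a - b) z = mact a z - mact b z.
Proof. by rewrite -scaleN1r addrC mactDl scaleN1r addrC. Qed.
Lemma mipMr a x y : mip x (mact a y) = cprod (mip x y) (cadj a).
Proof. by rewrite -[LHS]mipJ mipM cadjM mipJ. Qed.
Lemma mnorm_eq0 x : (forall e : R, 0 < e -> mnorm x < e) -> x = 0.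
Proof.
move=> h; apply: mip_eq0; apply: cnorm0; apply/eqP; rewrite eq_le cnorm_ge0 andbT.
rewrite -sqrtr_eq0 eq_le sqrtr_ge0 andbT; apply/ler_addgt0Pl => e e0; rewrite addr0; exact: ltW (h e e0).
Qed.
End hilbert_module.

Section module_structure.
Variables (R : realType) (K : level R) (lam : central_char K) (A : group_cstar K) (E : kasparov_module lam A).
Local Notation C := R[i].
Local Notation G := (TPgrp K).
Notation EE := (kmE E).
Notation AA := (gcA A).

Definition gen : EE := kmi E (dsec lam).
Lemma kmi_gen s : Csec lam s -> mact (mip (kmi E s) gen) gen = kmi E s.
Proof.
move=> cs; rewrite kmi_ip ?sect_ip_dsec //; last exact: dsec_Csec.
by rewrite -kmi_act ?sect_act_dip //; [exact: dip_Cc | exact: dsec_Csec].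
Qed.
Definition defect (x : EE) : EE := x - mact (mip x gen) gen.
Lemma defectB x y : defect (x - y) = defect x - defect y.
Proof. by rewrite /defect mipBl mactBl !opprD !opprK addrACA.
Qed.
Lemma mact_gen : mact (mip gen gen) gen = gen.
Proof. by rewrite kmi_gen //; exact: dsec_Csec. Qed.
Lemma mip_genM x : cprod (mip x gen) (mip gen gen) = mip x gen :> AA.
Proof. by rewrite -[in RHS]mact_gen mipMr mipJ. Qed.
Lemma defect_gen x : mip (defect x) gen = 0 :> AA.
Proof. by rewrite /defect mipBl mipM mip_genM subrr. Qed.
(** The defect is orthogonal to [gen], so the algebra-valued inner product of [x] is the sum of
    those of its two parts; [cnorm_sum_squares] then supplies monotonicity of the norm. This bound
    is what carries the spanning property from sections to their limits. *)
Lemma defect_norm x : mnorm (defect x) <= mnorm x.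
Proof.
set r := defect x; set y := mact (mip x gen) gen.
have xE : x = r + y by rewrite subrK.
have ry : mip r y = 0 :> AA by rewrite mipMr defect_gen cprod0l.
have Exx : mip x x = mip r r + mip y y :> AA.
  have yr : mip y r = 0 :> AA by rewrite -[LHS]mipJ ry cadj00.
  have alg (p q : EE) : mip p q = 0 :> AA -> mip q p = 0 :> AA -> mip (p + q) (p + q) = mip p p + mip q q :> AA.
    by move=> h1 h2; rewrite mip_addl !mip_addr h1 h2 addr0 add0r.
  by rewrite (_ : mip x x = mip (r + y) (r + y)); [exact: alg | rewrite -xE].
rewrite /mnorm Exx ler_sqrt; last exact: cnorm_ge0.
have [a ->] := mip_ge0 r; have [b ->] := mip_ge0 y; exact: cnorm_sum_squares.
Qed.
Lemma gen_spans x : mact (mip x gen) gen = x.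
Proof.
suff : defect x = 0 by move/eqP; rewrite subr_eq0 => /eqP.
apply: mnorm_eq0 => e e0; have [s cs hs] := kmi_dense x e0.
have -> : defect x = defect (x - kmi E s).
  by rewrite defectB [defect (kmi E s)]/defect kmi_gen // subrr subr0.
exact: le_lt_trans (defect_norm _) hs.
Qed.
Lemma mip_factor x y : mip x y = cprod (mip x gen) (cadj (mip y gen)) :> AA.
Proof. by rewrite -[in LHS](gen_spans x) mipM mipJ. Qed.
Lemma compact_id_holds : compact_id EE.
Proof.
(* The identity is itself a rank one operator, so the error is zero for every [e]. *)
move=> e e0; exists 1%N, (fun=> gen), (fun=> gen) => x.
rewrite big_ord1 gen_spans subrr /mnorm mip0l cnorm00 sqrtr0.
by rewrite mulr_ge0 ?sqrtr_ge0 // ltW.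
Qed.

Section dimension.
Variables (V : twrep G) (pi : AA -> V -> V).
Hypothesis hpi : extends_rep pi.
Let pilin x : hlinear (pi x). Proof. by case: hpi => _ h _ _ _; exact: h. Qed.
Let piM x y v : pi (cprod x y) v = pi x (pi y v). Proof. by case: hpi => _ _ h _ _; exact: h. Qed.
Let pi_adj x v w : hdot (pi (cadj x) v) w = hdot v (pi x w). Proof. by case: hpi => _ _ _ h _; exact: h. Qed.
Let pi_gen v w : hdot v (pi (mip gen gen) w) = integrated (dip lam (dsec lam)) v w.
Proof.
case: hpi => _ _ _ _ h; have cd := dsec_Csec lam.
by rewrite kmi_ip // sect_ip_dsec // h //; exact: dip_Cc.
Qed.
(* e (x) v |-> <gen, e> v, the isometry of the localisation onto the weight space. *)
Definition loc (x : seq (EE * V)) : V := \sum_(p <- x) pi (cadj (mip p.1 gen)) p.2.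
Lemma loc_formE x y : loc_form pi x y = hdot (loc x) (loc y).
Proof.
rewrite /loc hdot_suml; apply: eq_bigr => p _; rewrite hdot_sumr; apply: eq_bigr => q _.
by rewrite mip_factor piM pi_adj.
Qed.
Lemma loc_weight x : weight_vector lam (loc x).
Proof.
apply/(integrated_weight pi_gen); elim: x => [|p x IH]; first by rewrite /loc big_nil (hlinear0 (pilin _)).
rewrite /loc big_cons -/(loc x) (hlinearD (pilin _)) IH -piM; congr (pi _ _ + _).
by rewrite -[in LHS](mipJ gen gen) -cadjM mip_genM.
Qed.
Lemma loc_onto v : weight_vector lam v -> loc [:: (gen, v)] = v.
Proof. by move/(integrated_weight pi_gen) => h; rewrite /loc big_seq1 mipJ. Qed.

Lemma loc_dim0 : (forall v : V, weight_vector lam v -> v = 0) -> forall d, loc_dim EE pi d <-> d = 0%N.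
Proof.
move=> h d; have l0 x : loc x = 0 by apply: h; exact: loc_weight.
split=> [[x [h1 _]]|->].
  case: d x h1 => // d x /(_ ord0 ord0); rewrite loc_formE l0 hdot0r eqxx => /eqP.
  by rewrite eq_sym oner_eq0.
exists (fun _ => [::]); split; first by case.
by move=> y; rewrite big_ord0 loc_formE l0 hdot0r.
Qed.
Lemma loc_dim1 (u : V) : weight_vector lam u -> hdot u u = 1 ->
  (forall v : V, weight_vector lam v -> exists c : C, v = c *: u) -> forall d, loc_dim EE pi d <-> d = 1%N.
Proof.
move=> wu u1 h d.
have lE x : exists c : C, loc x = c *: u by apply: h; exact: loc_weight.
split=> [[x [h1 h2]]|->].
  (* Dimension zero contradicts Parseval's identity at the image of [u], and two orthonormal vectors
     cannot lie on one line. *)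
  case: d x h1 h2 => [|[|d]] x h1 h2 //.
    have := h2 [:: (gen, u)]; rewrite big_ord0 loc_formE loc_onto // u1 => /eqP.
    by rewrite oner_eq0.
  have := h1 ord0 (lift ord0 ord0); have := h1 ord0 ord0; have := h1 (lift ord0 ord0) (lift ord0 ord0).
  rewrite !loc_formE; have [a ->] := lE (x ord0); have [b ->] := lE (x (lift ord0 ord0)).
  rewrite !hdotZl !hdotZr u1 !mulr1 !eqxx /= => hb ha /eqP; rewrite mulf_eq0 => /orP[|] /eqP z.
    by move: ha; rewrite z mul0r => /eqP; rewrite eq_sym oner_eq0.
  by move: hb; rewrite z mulr0 => /eqP; rewrite eq_sym oner_eq0.
exists (fun _ => [:: (gen, u)]); split.
  by move=> i j; rewrite !ord1 eqxx loc_formE loc_onto.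
move=> y; rewrite big_ord1 !loc_formE loc_onto //; have [c ->] := lE y.
rewrite hdotZl !hdotZr u1 !mulr1 conj_mul cabsE; by rewrite rmorphXn.
Qed.
End dimension.
End module_structure.

(** * Irreducible representations that contain the weight of [lam] *)

Section weight_vectors.
Variables (R : realType) (K : level R) (lam : central_char K) (V : twrep (TPgrp K)).
Local Notation C := R[i].
Local Notation mu := (tweight lam).
Implicit Types (v w : V).

(** The minus sign gives this translate the weight [mu + m kappa], in step with the basis [tpb]. *)
Definition wshift w (m : int) : V := raction V (cone, - m) w.
Lemma wshift0 w : wshift w 0 = w.
Proof. by rewrite /wshift oppr0 ract1. Qed.
Lemma wshift_act w (t : circ R) (n m : int) : weight_vector lam w ->
  raction V (t, n) (wshift w m) = (cpow t (iwt K mu (m - n)) : C) *: wshift w (m - n).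
Proof.
move=> hw; rewrite /wshift (ract_tw (raction V)) gtauE; cbn [fst snd]; rewrite chi1 scale1r.
have -> : gmul ((t, n) : TPgrp K) (cone, - m) = (t, - (m - n)).
  by congr pair; [exact: cmul1r | rewrite /= opprB addrC].
have := ract_tw (raction V) (cone, - (m - n)) (t, 0) w; rewrite hw (hlinearZ (ract_lin (raction V) _)) gtauE.
have -> : gmul ((cone, - (m - n)) : TPgrp K) (t, 0) = (t, - (m - n)).
  by congr pair; [exact: cmul1 | rewrite /= addr0].
rewrite chiE mulNr cpowN /iwt cpowD; cbn [fst snd].
move: (raction V (cone, _) w) (raction V (t, _) w) => x y; have c0 := circ_neq0 (cpow t ((m - n) * kappa K)).
move: (cpow t _) (cpow t _) c0 => a b c0 h.
have -> : y = (b : C) *: ((cinv b : C) *: y) by rewrite scalerA /= mulfV // scale1r.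
by rewrite -h scalerA /= mulrC.
Qed.
Lemma wshift_dot w m n : weight_vector lam w -> hdot w w = 1 -> hdot (wshift w m) (wshift w n) = (m == n)%:R.
Proof.
move=> hw w1; have [->|mn] := eqVneq m n; first by rewrite (ract_iso (raction V)).
apply/eqP/negPn/negP => h; case/eqP: mn; suff : mu + m * kappa K = mu + n * kappa K.
  by move/addrI/mulIf => -> //; rewrite gt_eqF // kappa_gt0.
apply: (@cpow_inj R) => t; have := ract_iso (raction V) (t, 0) (wshift w m) (wshift w n).
rewrite !wshift_act // !subr0 hdotZl hdotZr mulrA -[RHS]mul1r => /(mulIf h) e.
apply: circ_eq; move: e; rewrite -/(iwt K mu m) -/(iwt K mu n) circ_conj => e.
by rewrite -[RHS](mulVKf (circ_neq0 (cpow t (iwt K mu m)))) e mulr1.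
Qed.
(** The common orthogonal complement of the translates is closed and invariant; it omits [w], so
    irreducibility makes it zero. *)
Lemma wshift_total w : irreducible V -> weight_vector lam w -> hdot w w = 1 -> total (wshift w).
Proof.
move=> [_ irr] hw w1; case: (irr (fun v => forall m, hdot (wshift w m) v = 0)) => [|//|h].
  split=> [m|a x y hx hy m|[t n] v hv m|v hv m].
  - by rewrite hdot0r.
  - by rewrite hdotDr hdotZr hx hy mulr0 addr0.
  - have := hv (m + n); rewrite -(ract_iso (raction V) (t, n)) wshift_act // addrK hdotZl.
    by move/eqP; rewrite mulf_eq0 conjc_eq0 (negPf (circ_neq0 _)) => /eqP.
  - apply/cabs_eq0/eqP; rewrite eq_le cabs_ge0 andbT.
    apply: (@le_small _ _ (hnorm (wshift w m))) => e e0; have [u hu huv] := hv e e0.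
    rewrite -[v](subKr u) hdotBr hu sub0r cabsN.
    by apply: (le_trans (cauchy_schwarz _ _)); rewrite ler_wpM2l ?hnorm_ge0 // ltW.
by have := h w 0; rewrite wshift0 w1 => /eqP; rewrite oner_eq0.
Qed.
Lemma weight_iso w : irreducible V -> weight_vector lam w -> hdot w w = 1 -> tw_iso V (tprep K mu).
Proof.
move=> irr hw w1; have [|g m|u [? ? ? ? _]] := @tw_iso_total R _ int V (tprep K mu) (wshift w) (@tpb R K mu)
  (wshift_total irr hw w1) (@tpb_total R K mu).
- by move=> m n; rewrite wshift_dot // tpb_dot.
- case: g => t n; exists (cpow t (iwt K mu (m - n))), (m - n).
  by split; [exact: wshift_act | exact: tpb_act].
by exists u.
Qed.
(** The difference is orthogonal to every translate of [w]: to those with [m] nonzero because their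
    weights differ from [mu], and to [w] by the choice of the coefficient. *)
Lemma weight_line w v : irreducible V -> weight_vector lam w -> hdot w w = 1 -> weight_vector lam v ->
  v = hdot w v *: w.
Proof.
move=> irr hw w1 hv; apply/eqP; rewrite -subr_eq0; apply/eqP/(wshift_total irr hw w1) => m.
have wd := wshift_dot m 0 hw w1; rewrite wshift0 in wd; rewrite hdotBr hdotZr wd.
have [->|m0] := eqVneq m 0; first by rewrite wshift0 mulr1 subrr.
rewrite mulr0 subr0; apply/eqP/negPn/negP => h; case/eqP: m0.
suff : mu + m * kappa K = mu by move/eqP; rewrite -subr_eq0 addrC addKr mulf_eq0 (gt_eqF (kappa_gt0 K)) orbF => /eqP.
apply: (@cpow_inj R) => t; have := ract_iso (raction V) (t, 0) (wshift w m) v.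
rewrite wshift_act // hv subr0 hdotZl hdotZr mulrA -[RHS]mul1r => /(mulIf h) e.
apply: circ_eq; move: e; rewrite -/(iwt K mu m) circ_conj => e.
by rewrite -[RHS](mulVKf (circ_neq0 (cpow t (iwt K mu m)))) e mulr1.
Qed.
Lemma unit_weight v : weight_vector lam v -> v <> 0 -> exists w, weight_vector lam w /\ hdot w w = 1.
Proof.
move=> hv v0; have n0 : hnorm v != 0 by apply/eqP => /hnorm_eq0.
exists ((hnorm v)^-1%:C *: v); split.
  by move=> t; rewrite (hlinearZ (ract_lin (raction V) _)) hv !scalerA mulrC.
rewrite hdot_self hnormZ cabs_real ger0_norm ?invr_ge0 ?hnorm_ge0 // mulVf // expr1n.
by [].
Qed.
Lemma iso_weight : tw_iso (tprep K mu) V -> exists w, weight_vector lam w /\ hdot w w = 1.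
Proof.
move=> [u [lu iu _ cu]]; exists (u (tpb K mu 0)); split; last by rewrite iu tpb_dot eqxx.
by move=> t; rewrite -cu tpb_act (hlinearZ lu) /iwt subr0 mul0r addr0.
Qed.
End weight_vectors.

Section index.
Variables (R : realType) (K : level R) (lam : central_char K) (A : group_cstar K) (E : kasparov_module lam A).
Local Notation C := R[i].
Local Notation G := (TPgrp K).
Local Notation W := (tprep K (tweight lam)).

Lemma index_dim (V : twrep G) (pi : gcA A -> V -> V) d : irreducible V -> extends_rep pi ->
  loc_dim (kmE E) pi d <-> d%:Z = fclass W V.
Proof.
move=> irr hpi; rewrite /fclass; case: asboolP => [iso|niso].
  have [w [hw w1]] := iso_weight iso.
  rewrite (loc_dim1 E hpi hw w1); first by split => [->|[]].
  by move=> v hv; exists (hdot w v); exact: weight_line.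
rewrite (loc_dim0 E hpi); first by split => [->|[]].
move=> v hv; apply: contrapT => v0; have [w [hw w1]] := unit_weight hv v0.
by apply: niso; apply: tw_iso_sym; exact: weight_iso hw w1.
Qed.

(** Localisation fixes the value of [m] at irreducible representations. At all others both sides
    vanish, because [free_on] admits only classes of irreducibles and irreducibility is invariant
    under isomorphism. *)
Lemma index_M_iff m : index_M E m <-> (forall V, m V = fclass W V).
Proof.
have nirr (V : twrep G) : ~ irreducible V -> forall U, irreducible U -> fclass U V = 0.
  move=> nV U irrU; rewrite /fclass; case: asboolP => // iso.
  by case: nV; exact: irreducible_iso iso irrU.
split=> [[_ [n [c [U [irrU mE]]]] h] V|h].
  have [irr|nV] := pselect (irreducible V).
    have [pi [d [hpi hd ->]]] := h V irr.
    by apply/(index_dim d irr hpi).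
  rewrite mE (nirr V nV _ (tprep_irreducible K _)) big1 // => i _.
  by rewrite nirr // mulr0.
split; first exact: compact_id_holds.
  exists 1%N, (fun=> 1), (fun=> W); split; first by move=> _; exact: tprep_irreducible.
  by move=> V; rewrite big_ord1 mul1r h.
move=> V irr; exists (@gpi R K A V).
have [d hd] : exists d : nat, d%:Z = fclass W V.
  by rewrite /fclass; case: asboolP => _; [exists 1%N | exists 0%N].
by exists d; split; [exact: gpi_extends | apply/(index_dim d irr (gpi_extends A V)) | rewrite h hd].
Qed.
End index.

(** * Tensor products and their classes *)

Section tensor_products.
Variables (R : realType) (K : level R).
Local Notation C := R[i].

(** The simple tensors are the two total families; their Gram matrices are products and so agree
    under unitary equivalences of the factors. *)
Lemma tensor_unique (V V' : twrep (TPgrp K)) (W W' : twrep (Ugrp K)) (X X' : twrep (LT K)) :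
  tensor_rep V W X -> tensor_rep V' W' X' -> tw_iso V V' -> tw_iso W W' -> tw_iso X X'.
Proof.
move=> [b [_ _ bd bt bg]] [b' [_ _ bd' bt' bg']] [u [_ ui us ug]] [s [_ si ss sg]].
have [||p q|g p|t [? ? ? ? _]] := @tw_iso_total R _ (V * W)%type X X' (fun p => b p.1 p.2) (fun p => b' (u p.1) (s p.2)).
- by move=> x h; apply: bt => v w; exact: (h (v, w)).
- move=> x h; apply: bt' => v' w'; have [v <-] := us v'; have [w <-] := ss w'.
  exact: (h (v, w)).
- by rewrite bd bd' ui si.
- exists 1, (raction V g.1 p.1, raction W g.2 p.2); rewrite !scale1r; split; first exact: bg.
  exact: (etrans (bg' g _ _) (f_equal2 b' (esym (ug _ _)) (esym (sg _ _)))).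
by exists t.
Qed.

(** With two distinct summands, the orthogonal complement of one would be a closed invariant
    subspace that is neither zero nor everything. So there is at most one summand, and at least one
    as the space is nonzero. *)
Lemma has_class_irreducible (P : twrep (LT K) -> Prop) (X : twrep (LT K)) (y : formal (LT K)) :
  (forall Z, P Z -> irreducible Z) -> irreducible X -> has_class P X y -> forall Z, y Z = fclass X Z.
Proof.
move=> hP [[x0 x00] irr] [n [W [PW [inc [il ii ig io ix]] yE]]] Z.
have W0 i : exists w : W i, w <> 0 by have [] := hP _ (PW i).
have only (i j : 'I_n) : i = j.
  apply/eqP/negPn/negP => ij.
  case: (irr (fun x => forall w, hdot (inc j w) x = 0)) => [|h|h].
  - split=> [w|a x z hx hz w|g x hx w|x hx w].
    + by rewrite hdot0r.
    + by rewrite hdotDr hdotZr hx hz mulr0 addr0.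
    + have [w' <-] := ract_surj (raction (W j)) g w.
      by rewrite ig (ract_iso (raction X)).
    + apply/cabs_eq0/eqP; rewrite eq_le cabs_ge0 andbT.
      apply: (@le_small _ _ (hnorm (inc j w))) => e e0; have [u hu hux] := hx e e0.
      rewrite -[x](subKr u) hdotBr hu sub0r cabsN.
      by apply: (le_trans (cauchy_schwarz _ _)); rewrite ler_wpM2l ?hnorm_ge0 // ltW.
  - have [w w0] := W0 i; apply: w0; have z : inc i w = 0.
      by apply: h => w'; apply: io; rewrite eq_sym.
    by apply: hdot_eq0; rewrite -(ii i) z hdot0r.
  - have [w w0] := W0 j; apply: w0; apply: hdot_eq0; rewrite -(ii j).
    exact: h.
have [w x0E] := ix x0.
case: n W PW inc il ii ig io ix yE W0 only w x0E => [|n] W PW inc il ii ig io ix yE W0 only w x0E.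
  by case: x00; rewrite x0E big_ord0.
rewrite yE big_ord_recl big1 => [|i _]; last by have := only (lift ord0 i) ord0 => /eqP.
rewrite addr0; apply: fclass_iso; exists (inc ord0); split => //.
move=> x; have [w' ->] := ix x; exists (w' ord0); rewrite big_ord_recl big1 ?addr0 // => i _.
by have := only (lift ord0 i) ord0 => /eqP.
Qed.
Lemma has_class_zero (P : twrep (LT K) -> Prop) (X : twrep (LT K)) (y : formal (LT K)) :
  (forall Z, P Z -> irreducible Z) -> (forall x : X, x = 0) -> has_class P X y -> forall Z, y Z = 0.
Proof.
move=> hP X0 [n [W [PW [inc [il ii ig io ix]] yE]]] Z; rewrite yE big1 // => i _.
have [[w w0] _] := hP _ (PW i); case: w0; apply: hdot_eq0.
by rewrite -(ii i) (X0 (inc i w)) hdot0r.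
Qed.
Lemma tensor_zero (V : twrep (TPgrp K)) (W : twrep (Ugrp K)) (X : twrep (LT K)) :
  tensor_rep V W X -> (forall w : W, w = 0) -> forall x : X, x = 0.
Proof.
move=> [b [_ _ bd bt _]] W0 x; apply: bt => v w.
have ww : hdot w w = 0 by rewrite (W0 w); exact: hdot0r.
have bz : b v w = 0 := hdot_eq0 (etrans (bd v w v w) (etrans (congr1 (fun t => _ * t) ww) (mulr0 _))).
exact: (etrans (congr1 (fun t => hdot t x) bz) (hdot0l x)).
Qed.
Lemma tensor_zrep (V : twrep (TPgrp K)) : tensor_rep V (zrep (Ugrp K)) (zrep (LT K)).
Proof.
exists (fun _ _ => 0); split.
- by move=> w a x y; exact: zspace0.
- by move=> w a x y; exact: zspace0.
- move=> v w v' w'; have ww : hdot w w' = 0 by rewrite (zspace0 w' 0); exact: hdot0r.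
  exact: (etrans (hdot0r _) (esym (etrans (congr1 (fun t => hdot v v' * t) ww) (mulr0 _)))).
- by move=> x _; exact: zspace0.
- by move=> a v w; exact: zspace0.
Qed.
End tensor_products.

Section standard_tensor.
Variables (R : realType) (K : level R) (rho : fock_rep K) (mu0 : int).
Local Notation C := R[i].
Local Notation mf := (@mfact_gt0 R).
Local Notation W := (tprep K mu0).
Local Notation X := (per rho mu0).
Implicit Types (v : W) (w : Fock R).

Definition tco v (m : int) : C := lfun v (m, tt).
Lemma tco_lin a u v m : tco (a *: u + v) m = a * tco u m + tco v m.
Proof. by rewrite /tco lfunD lfunZ. Qed.
Lemma tco_tpb m n : tco (tpb K mu0 m) n = (n == m)%:R.
Proof. by rewrite /tco iinc_fun /= deltaE; case: eqP. Qed.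
Lemma tco_act (t : circ R) n v m : tco (raction W (t, n) v) m = (cpow t (iwt K mu0 m) : C) * tco v (m + n).
Proof. by rewrite /tco -(ifibE (J0 := @w1_gt0 R)) iopE lfunZ ifibE. Qed.
Lemma tco_dot v m : hdot v (tpb K mu0 m) = (tco v m)^*.
Proof.
rewrite hdotC; congr (_^*); rewrite [LHS]hdot_inc hdot_deltal ifibE mul1r.
by [].
Qed.

Fact tens_subproof v w : exists x : X, (forall m, ifib m x = tco v m *: w) /\ hnorm x <= hnorm v * hnorm w.
Proof.
have h (F : {fset int}) : \sum_(m <- F) hnorm (tco v m *: w) ^+ 2 <= (hnorm v * hnorm w) ^+ 2.
  have := @ifib_sum _ _ _ (@w1_gt0 R) v F => hF.
  rewrite exprMn; apply: le_trans (ler_wpM2r (sqr_ge0 (hnorm w)) hF).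
  rewrite mulr_suml; apply: ler_sum => m _; rewrite hnormZ exprMn ler_wpM2r ?sqr_ge0 //.
  by rewrite (line_scale (ifib m v)) hnormZ exprMn hnorm_sqr hdot_pt mulr1 ifibE.
have [x hx] := ifib_glue h; exists x; split => //.
rewrite -(@ler_pXn2r _ 2%N) ?nnegrE ?mulr_ge0 ?hnorm_ge0 //.
apply: ifib_le => F; by under eq_bigr do rewrite hx.
Qed.
Definition tens v w : X := sval (cid (tens_subproof v w)).
Lemma tens_fib v w m : ifib m (tens v w) = tco v m *: w.
Proof. by case: (svalP (cid (tens_subproof v w))). Qed.
Lemma tens_norm v w : hnorm (tens v w) <= hnorm v * hnorm w.
Proof. by case: (svalP (cid (tens_subproof v w))). Qed.
Lemma tens_linl w : hlinear (fun v => tens v w).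
Proof. by move=> a u v; apply: ifib_inj => m; rewrite ifib_lin !tens_fib tco_lin scalerDl scalerA. Qed.
Lemma tens_linr v : hlinear (tens v).
Proof. by move=> a x y; apply: ifib_inj => m; rewrite ifib_lin !tens_fib scalerDr !scalerA mulrC. Qed.
Lemma tens_tpb m w : tens (tpb K mu0 m) w = pinc rho mu0 m w.
Proof.
apply: ifib_inj => n; rewrite tens_fib tco_tpb ifib_inc.
by case: eqP => _; rewrite ?scale1r ?scale0r.
Qed.
(** In [v'] the difference of the two sides is a bounded linear functional, represented by some [u];
    it vanishes on the basis [tpb], hence so does [u]. The norm bound of [tens] is what makes the
    functional bounded. *)
Lemma tens_dot v w v' w' : hdot (tens v w) (tens v' w') = hdot v v' * hdot w w'.
Proof.
pose psi u := hdot (tens v w) (tens u w') - hdot w w' * hdot v u.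
have [||u hu] := @riesz R W psi (hnorm (tens v w) * hnorm w' + cabs (hdot w w') * hnorm v).
- move=> a x y.
  have e1 : hdot (tens v w) (tens (a *: x + y) w') =
      a * hdot (tens v w) (tens x w') + hdot (tens v w) (tens y w').
    by rewrite (tens_linl w' a x y) hdotDr hdotZr.
  have e2 : hdot v (a *: x + y) = a * hdot v x + hdot v y by rewrite hdotDr hdotZr.
  rewrite /psi e1 e2; move: (hdot w w') (hdot (tens v w) _) (hdot (tens v w) _) (hdot v x) (hdot v y).
  by move=> p q r s t; ring.
- move=> x; rewrite /psi mulrDl; apply: (le_trans (cabsD _ _)); rewrite cabsN lerD //.
    apply: (le_trans (cauchy_schwarz _ _)); rewrite -mulrA ler_wpM2l ?hnorm_ge0 // mulrC.
    exact: tens_norm.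
  by rewrite cabsM -mulrA ler_wpM2l ?cabs_ge0 // cauchy_schwarz.
have u0 : u = 0.
  apply: (@tpb_total R K mu0) => m; rewrite hdotC -hu /psi tens_tpb tco_dot.
  rewrite (hdotC (pinc rho mu0 m w') (tens v w)) [hdot (pinc _ _ _ _) _]hdot_inc tens_fib hdotZr cjM.
  by rewrite -hdotC [_ * (tco v m)^*]mulrC subrr conjc0.
by have := hu v'; rewrite u0 hdot0l /psi => /eqP; rewrite subr_eq0 mulrC => /eqP.
Qed.
Lemma standard_tensor : tensor_rep W (fock_twrep rho) X.
Proof.
exists tens; split; [exact: tens_linl | exact: tens_linr | exact: tens_dot | |].
  move=> x h; apply: (@iinc_total R midx _ mf) => m u.
  by rewrite -[iinc m u]/(pinc rho mu0 m u) -tens_tpb; exact: h.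
move=> [[t n] f] v w; apply: ifib_inj => m; rewrite tens_fib tco_act [LHS]iopE; cbn [fst snd].
by rewrite tens_fib (hlinearZ (rho_lin rho _)) scalerA.
Qed.
End standard_tensor.

(** * The index of the Dirac operator *)

Section dirac_index.
Variables (R : realType) (K : level R) (rho : fock_rep K) (lam : central_char K)
  (A : group_cstar K) (E : kasparov_module lam A).
Local Notation mu := (tweight lam).

Lemma per_irrPER (mu0 : int) : irrPER (per rho mu0).
Proof. by split; [exact: per_irreducible | exact: per_energy]. Qed.

Lemma dirac_index_iff (x : formal (LT K)) :
  dirac_index rho E x <-> (forall Z, x Z = fclass (per rho mu) Z).
Proof.
have irP Z : irrPER (K := K) Z -> irreducible Z by case.
split=> [[m [W0 [W1 [/index_M_iff hm s0 s1 [n [c [V [X0 [X1 [y0 [y1 [hV Vinj mE hX xE]]]]]]]]]]]]|hx].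
  have diag i j : fclass (V i) (V j) = (i == j)%:R.
    rewrite /fclass; have [->|ij] := eqVneq i j.
      by case: asboolP => // h; case: h; exact: tw_iso_refl.
    by case: asboolP => // /Vinj /eqP; rewrite (negPf ij).
  have mV j : m (V j) = c j.
    rewrite mE (bigD1 j) //= diag eqxx mulr1 big1 ?addr0 // => i ij.
    by rewrite diag (negPf ij) mulr0.
  (* The coefficient of [V j] is the value there of a function with values 0 and 1; being nonzero,
     it is 1, and [V j] is isomorphic to the sum of lines. *)
  have isoV j : tw_iso (tprep K mu) (V j) /\ c j = 1.
    have [_ cj] := hV j; move: cj; rewrite -mV hm /fclass; case: asboolP => //.
  (* An empty expansion would give [m] the value 0 at the sum of lines, where it is 1. With pairwise
     non-isomorphic terms, exactly one term remains. *)
  have [j _] : exists j : 'I_n, True.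
    case: n c V X0 X1 y0 y1 hV Vinj mE hX xE diag mV isoV => [|n] c V X0 X1 y0 y1 hV Vinj mE hX xE diag mV isoV; last by exists ord0.
    have := hm (tprep K mu); rewrite mE big_ord0 /fclass; case: asboolP => // h; case: h.
    exact: tw_iso_refl.
  have only i : i = j.
    by apply: Vinj; apply: tw_iso_trans (isoV j).1; apply: tw_iso_sym; exact: (isoV i).1.
  have sumE (F : 'I_n -> int) : \sum_(i < n) F i = F j.
    by rewrite (bigD1 j) // big1 => [|i /eqP[]]; [exact: addr0 | exact: only].
  move=> Z; rewrite xE sumE.
  have [iso ->] := isoV j; rewrite mul1r; have [t0 k0 t1 k1] := hX j.
  have z1 := tensor_zero t1 (odd_kernel_zero s1).
  rewrite (has_class_zero irP z1 k1) subr0.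
  have isoX : tw_iso (per rho mu) (X0 j).
    apply: (tensor_unique (standard_tensor rho mu) t0 iso); apply: tw_iso_sym; exact: even_kernel_iso.
  rewrite (has_class_irreducible irP (irreducible_iso isoX (per_irreducible rho mu)) k0).
  by symmetry; exact: fclass_iso.
have one0 (F : int) : F = \sum_(i < 1) F by rewrite big_ord1.
have one1 (F : int) : F = \sum_(i < 1) 1 * F by rewrite big_ord1 mul1r.
have one2 (F : int) : F = \sum_(i < 1) 1 * (F - 0) by rewrite big_ord1 mul1r subr0.
exists (fclass (tprep K mu)), (fock_twrep rho), (zrep (Ugrp K)); split.
- exact: (proj2 (index_M_iff E (fclass (tprep K mu))) (fun Z => erefl)).
- exact: fock_even_kernel.
- exact: zero_odd_kernel.
exists 1%N, (fun=> 1), (fun=> tprep K mu), (fun=> per rho mu), (fun=> zrep (LT K)),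
  (fun=> fclass (per rho mu)), (fun=> fun=> 0); split.
- by move=> _; split; [exact: tprep_irreducible | exact: oner_neq0].
- by move=> i j _; rewrite !ord1.
- by move=> Z; exact: one1.
- move=> _; split; [exact: standard_tensor | | exact: tensor_zrep |].
    exists 1%N, (fun=> per rho mu); split.
    + by move=> _; exact: per_irrPER.
    + exists (fun _ v => v); split => //.
        by move=> i j; rewrite !ord1.
      by move=> v; exists (fun=> v); rewrite big_ord1.
    + by move=> Z; exact: one0.
  (* The zero space is the empty direct sum, so the odd kernel contributes the zero class. *)
  exists 0%N, (fun=> zrep (LT K)); split.
  + by case.
  + exists (fun _ v => v); split => //; try by case.
    by move=> v; exists (fun=> v); rewrite big_ord0; exact: zspace0.
  + by move=> Z; rewrite big_ord0.
by move=> Z; rewrite hx; exact: one2.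
Qed.
End dirac_index.

Theorem theorem7p1 (R : realType) (K : level R) (rho : fock_rep K)
    (lam : central_char K) (A : group_cstar K) (E : kasparov_module lam A) :
  bundle_is_equivariant lam /\
  dirac_operator rho lam /\
  exists V : twrep (LT K),
    [/\ irrPER V,
        corresponds_to lam rho V &
        forall x : formal (LT K),
          dirac_index rho E x <-> (forall W, x W = fclass V W)].
Proof.
split; first exact: bundle_equivariant.
split; first exact: dirac_operator_holds.
exists (per rho (tweight lam)); split.
- exact: per_irrPER.
- exact: per_standard.
- exact: dirac_index_iff.
Qed.
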